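(* Consider the partially linear varying coefficient model $Y_i = w_i'\gamma + x_i'\beta(z_i) + u_i$, $i=1,\dots,n$, with $E(u_i\mid w_i,x_i,z_i)=0$, and the series estimator $\hat\gamma$ defined in the context. Let $\mathcal S$ denote the support of $(x_1,z_1)$. Assume: (1) (i) $(Y_i,w_i,x_i,z_i)_{i=1}^n$ are independent and identically distributed, and the support of $(w_1,x_1,z_1)$ is a compact subset of $\mathbb R^{q+d+r}$; (ii) $\theta(x_1,z_1)=E[w_1\mid x_1,z_1]$ and $\operatorname{var}[Y_1\mid w_1,x_1,z_1]$ are bounded functions on the support of $(w_1,x_1,z_1)$. (2) (i) For every $K$ there is a nonsingular matrix $B$ such that, for $P^K(x,z)=Bp^K(x,z)$, the smallest eigenvalue of $E[P^K(x_i,z_i)P^K(x_i,z_i)']$ is bounded away from zero uniformly in $K$; (ii) there is a sequence of constants $\zeta_0(K)$ satisfying $\sup_{(x,z)\in\mathcal S}\|P^K(x,z)\|\le\zeta_0(K)$, and $K=K_n$ is such that $\zeta_0(K)^2K/n\to0$ as $n\to\infty$. (3) (i) For $f(x,z)=\sum_{l=1}^d x_l\beta_l(z)$ and for $f(x,z)=m_j(x,z)$ ($j=1,\dots,q$), there exist $\delta_l>0$ ($l=1,\dots,d$) and $\alpha_f=\alpha_{fK}\in\mathbb R^K$ such that $\sup_{(x,z)\in\mathcal S}|f(x,z)-P^K(x,z)'\alpha_f|=O\big(\sum_{l=1}^d k_l^{-\delta_l}\big)$; (ii) as $n\to\infty$, $\min\{k_1,\dots,k_d\}\to\infty$ and $\sqrt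 n\sum_{l=1}^d k_l^{-2\delta_l}\to0$. Let $\varepsilon_i=w_i-m(x_i,z_i)$ and assume $\Phi=E[\varepsilon_i\varepsilon_i']$ is positive definite. Assume further conditional homoskedasticity: $E[u_i^2\mid w_i,x_i,z_i]=E(u_i^2)=\sigma^2$ with $\sigma^2>0$. Then $\hat\gamma$ is semiparametrically efficient: the asymptotic variance $\Sigma$ of $\sqrt n(\hat\gamma-\gamma)$ (i.e. the matrix such that $\sqrt n(\hat\gamma-\gamma)\to N(0,\Sigma)$ in distribution) satisfies $\Sigma=\sigma^2\Phi^{-1}$ and $\Sigma^{-1}=J_0$, where $$J_0=\inf_{g\in\mathcal G}E\big[(w_i-g(x_i,z_i))(\operatorname{var}[u_i\mid w_i,x_i,z_i])^{-1}(w_i-g(x_i,z_i))'\big]$$ is the semiparametric efficiency bound for the inverse of the asymptotic variance of an estimator of $\gamma$.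
   Context: Prime denotes transpose. For a matrix $A$, $\|A\|=[\operatorname{tr}(A'A)]^{1/2}$. Model: $w_i$ is a $q\times1$ random vector, $\gamma\in\mathbb R^q$ an unknown parameter, $x_i=(x_{i1},\dots,x_{id})'$ a $d\times1$ random vector, $z_i$ an $r$-dimensional random vector, $\beta(\cdot)=(\beta_1(\cdot),\dots,\beta_d(\cdot))'$ a vector of unknown functions, $u_i$ a scalar error. Series: for $l=1,\dots,d$, $p_l^{k_l}(z)=[p_{l1}(z),\dots,p_{lk_l}(z)]'$ is a $k_l\times1$ vector of base functions, where $k_l$ may depend on $n$. Put $K=\sum_{l=1}^d k_l$ and $p^K(x,z)=(x_1p_1^{k_1}(z)',\dots,x_dp_d^{k_d}(z)')'$ (a $K\times1$ vector), where $x_l$ is the $l$th component of $x$. Matrices: $Y=(Y_1,\dots,Y_n)'$, $W=(w_1,\dots,w_n)'$, $P=(p^K(x_1,z_1),\dots,p^K(x_n,z_n))'$. Let $M=P(P'P)^-P'$, with $(\cdot)^-$ a symmetric generalized inverse, and for a matrix $A$ with $n$ rows write $\widetilde A=MA$. Estimator: $\hat\gamma=[(W-\widetilde W)'(W-\widetilde W)]^-(W-\widetilde W)'(Y-\widetilde Y)$ (the coefficient of $W$ in the least squares regression of $Y$ on $(W,P)$). Varying coefficient class: $\mathcal G$ is the set of functions $g(x,z)=\sum_{l=1}^d x_lh_l(z)$ with $h_l$ continuous and $\sum_{l=1}^dE[x_{il}^2h_l(z_i)^2]<\infty$; for $\mathbb R^q$-valued $g$, ''$g\in\mathcal G$'' means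 every component is in $\mathcal G$. For a function $f(x,z)$, $E_{\mathcal G}[f(x,z)]$ denotes the projection (in $L_2$, componentwise for vector-valued $f$) of $f$ onto $\mathcal G$: it is the element of $\mathcal G$ for which $E\{(f-E_{\mathcal G}f)(f-E_{\mathcal G}f)'\}\le E\{(f-g)(f-g)'\}$ for all $g\in\mathcal G$. Here $A\le B$ means $A-B$ is negative semidefinite, and infima of matrices are taken with respect to this order. Define $\theta(x,z)=E[w\mid x,z]$ and $m(x,z)=(m_1(x,z),\dots,m_q(x,z))'=E_{\mathcal G}[\theta(x,z)]$ (also written $E_{\mathcal G}(w)$). The matrix $J_0$ is the efficiency bound for this model given by Chamberlain (1992); for the purposes of this statement the bound is $J_0$ by definition. *)

(* Defs.v *)
From HB Require Import structures.
From mathcomp Require Export all_boot all_order all_algebra.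
From mathcomp Require Export all_classical all_reals all_analysis.

Set Implicit Arguments.
Unset Strict Implicit.
Unset Printing Implicit Defensive.

Import Order.TTheory GRing.Theory Num.Theory.
Export numFieldNormedType.Exports.

Local Open Scope classical_set_scope.
Local Open Scope ring_scope.

Definition fnorm (R : realType) (a b : nat) (A : 'M[R]_(a, b)) : R :=
  Num.sqrt (\tr (A^T *m A)).

Definition negsemidef (R : realType) (m : nat) (A : 'M[R]_m) : Prop :=
  A^T = A /\ forall v : 'cV[R]_m, (v^T *m A *m v) 0 0 <= 0.

Definition posdef (R : realType) (m : nat) (A : 'M[R]_m) : Prop :=
  A^T = A /\ forall v : 'cV[R]_m, v != 0 -> 0 < (v^T *m A *m v) 0 0.

Definition loewner_le (R : realType) (m : nat) (A B : 'M[R]_m) : Prop :=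
  negsemidef (A - B).

(* Greatest lower bound for the Loewner order; since [negsemidef] includes
   symmetry, [loewner_le] is antisymmetric and [J] is unique. *)
Definition is_loewner_inf (R : realType) (m : nat) (S : set 'M[R]_m)
    (J : 'M[R]_m) : Prop :=
  (forall A, S A -> loewner_le J A) /\
  (forall L, (forall A, S A -> loewner_le L A) -> loewner_le L J).

Definition is_sym_ginv (R : realType) (ginv : forall m, 'M[R]_m -> 'M[R]_m) :=
  forall m (A : 'M[R]_m), A^T = A ->
    A *m ginv m A *m A = A /\ (ginv m A)^T = ginv m A.

Notation borel_cV R m := (g_sigma_algebraType (@open 'cV[R]_m)).

Definition borel_set (R : realType) (m : nat) (A : set 'cV[R]_m) : Prop :=
  measurable (A : set (borel_cV R m)).

Definition borel_fun (R : realType) (m : nat) (f : 'cV[R]_m -> R) : Prop :=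
  measurable_fun setT (f : borel_cV R m -> R).

Section random_vectors.
Context d (T : measurableType d) (R : realType) (Pr : probability T R).

Definition random_vector (m : nat) (X : T -> 'cV[R]_m) : Prop :=
  measurable_fun setT (X : T -> borel_cV R m).

Definition identically_distributed (m : nat) (V : nat -> T -> 'cV[R]_m) :=
  forall i j A, borel_set A -> Pr (V i @^-1` A) = Pr (V j @^-1` A).

Definition mutually_independent (m : nat) (V : nat -> T -> 'cV[R]_m) :=
  forall (s : seq nat) (A : nat -> set 'cV[R]_m), uniq s ->
    (forall i, borel_set (A i)) ->
    Pr (\bigcap_(i in [set` s]) (V i @^-1` A i)) =
      (\prod_(i <- s) Pr (V i @^-1` A i))%E.

Definition support (m : nat) (X : T -> 'cV[R]_m) : set 'cV[R]_m :=
  [set v | forall U : set 'cV[R]_m, open U -> U v -> (0 < Pr (X @^-1` U))%E].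

Definition expectation_mx (a b : nat) (A : T -> 'M[R]_(a, b)) : 'M[R]_(a, b) :=
  \matrix_(i, j) fine ('E_Pr[fun t => A t i j])%E.

(* [g] is a version of the regression function v |-> E[X | V = v]. *)
Definition is_cond_exp (m : nat) (X : T -> R) (V : T -> 'cV[R]_m)
    (g : 'cV[R]_m -> R) : Prop :=
  [/\ borel_fun g,
      Pr.-integrable setT (EFin \o X),
      Pr.-integrable setT (EFin \o (g \o V)) &
      forall A, borel_set A ->
        (\int[Pr]_(t in V @^-1` A) (X t)%:E =
         \int[Pr]_(t in V @^-1` A) (g (V t))%:E)%E].

Definition is_cond_var (m : nat) (X : T -> R) (V : T -> 'cV[R]_m)
    (v : 'cV[R]_m -> R) : Prop :=
  exists2 g, is_cond_exp X V g &
    is_cond_exp (fun t => (X t - g (V t)) ^+ 2) V v.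

End random_vectors.

(* [normal_prob] takes the standard deviation, and is not the Dirac mass
   when that is 0. *)
Definition centered_normal (R : realType) (s2 : R) (A : set R) : \bar R :=
  if s2 == 0 then \d_(0 : R) A else normal_prob 0 (Num.sqrt s2) A.

(* N(0, Sigma): the law under which every t'Z is N(0, t' Sigma t). *)
Definition is_mvnormal (R : realType) (q : nat)
    (mu : probability (borel_cV R q) R) (Sigma : 'M[R]_q) : Prop :=
  negsemidef (- Sigma) /\
  forall (t : 'cV[R]_q) (A : set R), measurable A ->
    mu [set v | A ((t^T *m v) 0 0)] =
      centered_normal ((t^T *m Sigma *m t) 0 0) A.

Definition cvg_in_distribution d (T : measurableType d) (R : realType)
    (Pr : probability T R) (q : nat) (X : nat -> T -> 'cV[R]_q)
    (mu : probability (borel_cV R q) R) : Prop :=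
  forall f : 'cV[R]_q -> R, continuous f -> (exists C, forall v, `|f v| <= C) ->
    (fun n => ('E_Pr[f \o X n])%E) @ \oo --> (\int[mu]_v (f v)%:E)%E.

Definition asymptotically_normal d (T : measurableType d) (R : realType)
    (Pr : probability T R) (q : nat) (X : nat -> T -> 'cV[R]_q)
    (Sigma : 'M[R]_q) : Prop :=
  exists2 mu : probability (borel_cV R q) R,
    is_mvnormal mu Sigma & cvg_in_distribution Pr X mu.

Section varying_coefficients.
Context disp (T : measurableType disp) (R : realType) (Pr : probability T R).
Variables (d r : nat) (x : T -> 'cV[R]_d) (z : T -> 'cV[R]_r).

Definition in_G (g : 'cV[R]_d -> 'cV[R]_r -> R) : Prop :=
  exists h : 'I_d -> 'cV[R]_r -> R,
    [/\ forall l, continuous (h l),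
        forall xx zz, g xx zz = \sum_(l < d) xx l 0 * h l zz &
        (\sum_(l < d) 'E_Pr[fun t => ((x t l 0) ^+ 2 * (h l (z t)) ^+ 2)%R]
           < +oo)%E].

Definition in_Gq (q : nat) (g : 'cV[R]_d -> 'cV[R]_r -> 'cV[R]_q) : Prop :=
  forall j, in_G (fun xx zz => g xx zz j 0).

Definition is_G_projection (q : nat)
    (f m : 'cV[R]_d -> 'cV[R]_r -> 'cV[R]_q) : Prop :=
  let msd g := expectation_mx Pr (fun t =>
    (f (x t) (z t) - g (x t) (z t)) *m (f (x t) (z t) - g (x t) (z t))^T) in
  in_Gq m /\ forall g, in_Gq g -> loewner_le (msd m) (msd g).

(* The set whose Loewner infimum is the efficiency bound; [v] is the
   conditional variance of the error given (w, x, z). *)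
Definition efficiency_bound_set (q : nat) (w : T -> 'cV[R]_q)
    (v : 'cV[R]_(q + (d + r)) -> R) : set 'M[R]_q :=
  [set A | exists2 g : 'cV[R]_d -> 'cV[R]_r -> 'cV[R]_q, in_Gq g &
    A = expectation_mx Pr (fun t =>
      (v (col_mx (w t) (col_mx (x t) (z t))))^-1 *:
      ((w t - g (x t) (z t)) *m (w t - g (x t) (z t))^T))].

End varying_coefficients.

Section series.
Variables (R : realType) (d r : nat) (p : 'I_d -> nat -> 'cV[R]_r -> R).

Definition series_dim (k : 'I_d -> nat) : nat := \sum_(l < d) k l.

(* [p l j] is the (j+1)-st base function of the l-th coefficient. *)
Definition series_basis (k : 'I_d -> nat) (xx : 'cV[R]_d) (zz : 'cV[R]_r) :
    'cV[R]_(series_dim k) :=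
  \mxcol_(l < d) (xx l 0 *: \col_(j < k l) p l j zz).

End series.

Section estimator.
Variables (R : realType) (ginv : forall m, 'M[R]_m -> 'M[R]_m).

Definition series_proj (n K : nat) (P : 'M[R]_(n, K)) : 'M[R]_n :=
  P *m ginv (P^T *m P) *m P^T.

Definition partialled_ols (n q K : nat) (Y : 'cV[R]_n) (W : 'M[R]_(n, q))
    (P : 'M[R]_(n, K)) : 'cV[R]_q :=
  let M := series_proj P in
  ginv ((W - M *m W)^T *m (W - M *m W)) *m (W - M *m W)^T *m (Y - M *m Y).

Definition gamma_hat (T : Type) (q d r : nat) (Y : nat -> T -> R)
    (w : nat -> T -> 'cV[R]_q) (x : nat -> T -> 'cV[R]_d)
    (z : nat -> T -> 'cV[R]_r) (p : 'I_d -> nat -> 'cV[R]_r -> R)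
    (k : nat -> 'I_d -> nat) (n : nat) (t : T) : 'cV[R]_q :=
  partialled_ols (\col_(i < n) Y i t) (\matrix_(i < n, j < q) w i t j 0)
    (\matrix_(i < n, j < series_dim (k n))
       series_basis p (k n) (x i t) (z i t) j 0).

End estimator.

(* |f - P^K' alpha_K| = O(sum_l k_l ^ (- delta_l)) uniformly over S, along
   K = K_n. *)
Definition series_approximable (R : realType) (d r : nat)
    (S : set 'cV[R]_(d + r)) (k : nat -> 'I_d -> nat)
    (PK : forall n, 'cV[R]_d -> 'cV[R]_r -> 'cV[R]_(series_dim (k n)))
    (delta : 'I_d -> R) (f : 'cV[R]_d -> 'cV[R]_r -> R) : Prop :=
  exists (alpha : forall n, 'cV[R]_(series_dim (k n))) (C : R),
    \forall n \near \oo, forall xx zz, S (col_mx xx zz) ->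
      `|f xx zz - ((PK n xx zz)^T *m alpha n) 0 0|
        <= C * \sum_(l < d) (k n l)%:R `^ (- delta l).

(* Main.v *)
(* Normalise the series basis by the Cholesky factor of its second moment matrix. As
   zeta_0(K)^2 K / n -> 0, its empirical Gram matrix is within n/2 of n times the identity with
   high probability, and on that event the projection M satisfies |M v|^2 <= (2/n) |P' v|^2 for
   the normalised P, whatever generalized inverse is used. Hence |M eps_j|^2 and |M u|^2 are of
   order K = o(sqrt n). The approximation errors of m and of x'beta also have squared length
   o(sqrt n), and they are uncorrelated with eps and u: the minimality of the projection onto G
   makes w - m orthogonal to x_l h(z) for continuous h, thus for Borel h. It follows that
   (W - M W)'(W - M W) / n -> Phi in probability and
   sqrt n (gamma_hat - gamma) = Phi^-1 n^(-1/2) sum_i eps_i u_i + o_p(1),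
   which is asymptotically N(0, sigma^2 Phi^-1). The central limit theorem is obtained from
   characteristic functions, written as pairs (E cos, E sin), and weak convergence from them by
   trigonometric approximation of bounded continuous functions on cubes.
   Finally var[u | w, x, z] = sigma^2 almost surely and, by the same orthogonality,
   E(w - g)(w - g)' = Phi + E(m - g)(m - g)', so the infimum defining J_0 is attained at g = m. *)
From HB Require Import structures.
Require Import Defs.
From mathcomp Require Import ring lra measurable_realfun lebesgue_measure.

Import Order.TTheory GRing.Theory Num.Theory.
Set Implicit Arguments.
Unset Strict Implicit.
Unset Printing Implicit Defensive.
Local Open Scope classical_set_scope.
Local Open Scope ring_scope.

(** * Expectations *)

(** Approximation errors are never met alone: they are paired with each other or with projected
    noise, all of squared length o(sqrt n), or with the noise itself, where the mean is zero and the
    variance vanishes. This is why the squared rates k_l^(-2 delta_l) need only be o(1 / sqrt n).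
    Two obstacles shape the details. First, [beta] is an arbitrary function: x'beta(z) is Borel and
    uncorrelated with w - m only as a uniform limit, on the support, of series combinations. Second,
    the hypotheses give bounds only on a support or almost surely, while the moment estimates use
    functions that are Borel and bounded everywhere. So each function is cut off outside a set of
    probability one, and u is rewritten as a function of the observation (Y, w, x, z), since it is
    the observations that are i.i.d. The base functions are merely Borel, hence the orthogonality
    beyond continuous coefficients. W and Y go through the same estimates, indexed by [option 'I_q]:
    [Some j] for the j-th column of W, [None] for Y. *)

Definition Ex d (T : measurableType d) (R : realType) (Pr : probability T R)
  (X : T -> R) : R := fine ('E_Pr[X])%E.

Definition intg d (T : measurableType d) (R : realType) (Pr : probability T R)
  (X : T -> R) : Prop := Pr.-integrable setT (EFin \o X).

Section expectation_toolkit.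
Context d (T : measurableType d) (R : realType) (Pr : probability T R).
Implicit Types X Y : T -> R.
Local Notation intg := (intg Pr).
Local Notation Ex := (Ex Pr).

Lemma ExE X : Ex X = fine (\int[Pr]_t (X t)%:E)%E.
Proof. by rewrite /Ex unlock. Qed.

Lemma intg_fin_num X : intg X -> (\int[Pr]_t (X t)%:E)%E \is a fin_num.
Proof. by move=> iX; exact: integrable_fin_num. Qed.

Lemma ExEE X : intg X -> (\int[Pr]_t (X t)%:E)%E = (Ex X)%:E.
Proof. by move=> iX; rewrite ExE fineK// intg_fin_num. Qed.

Lemma intg_meas X : intg X -> measurable_fun setT X.
Proof. by move=> /measurable_int /measurable_EFinP. Qed.

Lemma eq_intg X Y : X =1 Y -> intg X -> intg Y.
Proof. by move=> /funext ->. Qed.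

Lemma eq_Ex X Y : X =1 Y -> Ex X = Ex Y.
Proof. by move=> /funext ->. Qed.

Lemma intgD X Y : intg X -> intg Y -> intg (fun t => X t + Y t).
Proof.
move=> iX iY; have := integrableD measurableT iX iY.
by apply: eq_integrable.
Qed.

Lemma intgZ a X : intg X -> intg (fun t => a * X t).
Proof.
move=> iX; have := integrableZl measurableT a iX.
by apply: eq_integrable.
Qed.

Lemma intgN X : intg X -> intg (fun t => - X t).
Proof. by move=> /(intgZ (-1)); apply: eq_intg => t; rewrite mulN1r. Qed.

Lemma intgB X Y : intg X -> intg Y -> intg (fun t => X t - Y t).
Proof. by move=> iX iY; apply: intgD => //; exact: intgN. Qed.

Lemma intg_cst a : intg (fun=> a).
Proof. exact: finite_measure_integrable_cst. Qed.

Lemma intg_sum I (s : seq I) (P : pred I) (F : I -> T -> R) :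
  (forall i, P i -> intg (F i)) -> intg (fun t => \sum_(i <- s | P i) F i t).
Proof.
move=> iF; elim: s => [|i s ih].
  by apply: eq_intg (intg_cst 0) => t; rewrite big_nil.
have [Pi|Pi] := boolP (P i).
- by apply: eq_intg (intgD (iF _ Pi) ih) => t; rewrite big_cons Pi.
- by apply: eq_intg ih => t; rewrite big_cons (negbTE Pi).
Qed.

Lemma ExD X Y : intg X -> intg Y -> Ex (fun t => X t + Y t) = Ex X + Ex Y.
Proof.
move=> iX iY; rewrite !ExE.
under eq_integral do rewrite EFinD.
by rewrite integralD//= fineD ?intg_fin_num.
Qed.

Lemma ExZ a X : intg X -> Ex (fun t => a * X t) = a * Ex X.
Proof.
move=> iX; rewrite !ExE.
under eq_integral do rewrite EFinM.
by rewrite integralZl//= fineM ?intg_fin_num.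
Qed.

Lemma ExN X : intg X -> Ex (fun t => - X t) = - Ex X.
Proof.
by move=> iX; rewrite -mulN1r -ExZ//; apply: eq_Ex => t; rewrite mulN1r.
Qed.

Lemma ExB X Y : intg X -> intg Y -> Ex (fun t => X t - Y t) = Ex X - Ex Y.
Proof. by move=> iX iY; rewrite ExD ?ExN//; exact: intgN. Qed.

Lemma Ex_cst a : Ex (fun=> a) = a.
Proof. by rewrite /Ex expectation_cst. Qed.

Lemma Ex_sum I (s : seq I) (P : pred I) (F : I -> T -> R) :
  (forall i, P i -> intg (F i)) ->
  Ex (fun t => \sum_(i <- s | P i) F i t) = \sum_(i <- s | P i) Ex (F i).
Proof.
move=> iF; elim: s => [|i s ih].
  by rewrite big_nil -[RHS]Ex_cst; apply: eq_Ex => t; rewrite big_nil.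
rewrite big_cons -ih; case: ifPn => Pi.
- rewrite -ExD; [|exact: iF|exact: intg_sum].
  by apply: eq_Ex => t; rewrite big_cons Pi.
- by apply: eq_Ex => t; rewrite big_cons (negbTE Pi).
Qed.

Lemma Ex_ge0 X : (forall t, 0 <= X t) -> 0 <= Ex X.
Proof. by move=> X0; rewrite fine_ge0// expectation_ge0. Qed.

Lemma le_Ex X Y : intg X -> intg Y -> (forall t, X t <= Y t) -> Ex X <= Ex Y.
Proof.
move=> iX iY XY; rewrite -subr_ge0 -ExB//; apply: Ex_ge0 => t.
by rewrite subr_ge0.
Qed.

Lemma intg_norm X : intg X -> intg (fun t => `|X t|).
Proof. exact: integrable_norm. Qed.

Lemma le_intg X Y : measurable_fun setT X -> intg Y ->
  (forall t, `|X t| <= Y t) -> intg X.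
Proof.
move=> mX iY XY; apply: (le_integrable measurableT _ _ iY).
  exact/measurable_EFinP.
by move=> t _ /=; rewrite lee_fin (le_trans (XY t))// ler_norm.
Qed.

Lemma norm_Ex X : intg X -> `|Ex X| <= Ex (fun t => `|X t|).
Proof.
move=> iX; rewrite ler_norml -ExN; last exact: intg_norm.
apply/andP; split; apply: le_Ex => //; try exact: intg_norm.
- by apply: intgN; exact: intg_norm.
- by move=> t; rewrite lerNl -normrN ler_norm.
- by move=> t; rewrite ler_norm.
Qed.

Lemma bounded_intg X C : measurable_fun setT X -> (forall t, `|X t| <= C) ->
  intg X.
Proof. by move=> mX XC; exact: le_intg (intg_cst C) XC. Qed.

Lemma Ex_le_bound X C : intg X -> (forall t, `|X t| <= C) -> `|Ex X| <= C.
Proof.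
move=> iX XC; rewrite (le_trans (norm_Ex iX))// -[leRHS]Ex_cst.
by apply: le_Ex => //; [exact: intg_norm|exact: intg_cst].
Qed.

Lemma ae_eq_intg X Y : measurable_fun setT Y ->
  {ae Pr, forall t, X t = Y t} -> intg X -> intg Y.
Proof.
move=> mY XY iX; apply/integrableP; split; first exact/measurable_EFinP.
move/integrableP : (iX) => [mX]; congr (_ < _)%E.
apply: ae_eq_integral => //.
- by apply: measurableT_comp.
- by apply: measurableT_comp => //; apply/measurable_EFinP.
- by apply: filterS XY => t /= -> _.
Qed.

Lemma ae_eq_Ex X Y : measurable_fun setT X -> measurable_fun setT Y ->
  {ae Pr, forall t, X t = Y t} -> Ex X = Ex Y.
Proof.
move=> mX mY XY; rewrite !ExE; congr fine.
apply: ae_eq_integral => //; try exact/measurable_EFinP.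
by apply: filterS XY => t /= -> _.
Qed.

Lemma ae_bounded_intg X C : measurable_fun setT X ->
  {ae Pr, forall t, `|X t| <= C} -> intg X.
Proof.
move=> mX XC.
(* The clamp of X to [-C, C] equals X almost surely and is bounded everywhere; the bound is |C|
   because no sign of C is known. *)
pose Z t := Num.max (- C) (Num.min C (X t)).
have mZ : measurable_fun setT Z.
  by apply: measurable_maxr => //; apply: measurable_minr.
have ZX : {ae Pr, forall t, Z t = X t}.
  apply: filterS XC => t; rewrite ler_norml /Z => /andP[C1 C2].
  by rewrite (min_idPr C2) (max_idPr C1).
apply: (ae_eq_intg mX ZX); apply: (@bounded_intg _ `|C|) => // t.
rewrite /Z ler_norml; have := ler_norm C; have := ler_norm (- C).
rewrite normrN => h1 h2; rewrite le_max ge_max ge_min h2 !andbT.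
by apply/andP; split; [apply/orP; left; lra|lra].
Qed.

Lemma measurable_ge_set X a : measurable_fun setT X ->
  measurable [set t | (a <= X t)%R].
Proof.
move=> mX; rewrite -[X in measurable X]setTI.
have h := measurable_fun_ler (measurable_cst a) mX.
exact: (h measurableT [set true]).
Qed.

Lemma measurable_le_set X a : measurable_fun setT X ->
  measurable [set t | (X t <= a)%R].
Proof.
move=> mX; rewrite -[X in measurable X]setTI.
have h := measurable_fun_ler mX (measurable_cst a).
exact: (h measurableT [set true]).
Qed.

Lemma Ex_indic (A : set T) : measurable A -> (Ex (\1_A))%:E = Pr A.
Proof.
move=> mA; rewrite /Ex expectation_indic// fineK// fin_num_measure//.
Qed.

Lemma intg_indic (A : set T) : measurable A -> intg (\1_A).
Proof.
move=> mA; apply: (@bounded_intg _ 1) => // t.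
by rewrite indicE; case: (_ \in _); rewrite ?normr1 ?normr0.
Qed.

Lemma markov_Ex X a : intg X -> (forall t, 0 <= X t) -> 0 < a ->
  (Pr [set t | (a <= X t)%R] <= (Ex X / a)%:E)%E.
Proof.
move=> iX X0 a0; have mA := measurable_ge_set a (intg_meas iX).
rewrite -Ex_indic// lee_fin ler_pdivlMr// mulrC -ExZ; last exact: intg_indic.
apply: le_Ex => //; first by apply: intgZ; exact: intg_indic.
move=> t; rewrite indicE; have [|_] := boolP (t \in _); last by rewrite mulr0.
by rewrite inE mulr1.
Qed.

Definition sqintg X := measurable_fun setT X /\ intg (fun t => X t ^+ 2).

Lemma sqintgM X Y : sqintg X -> sqintg Y -> intg (fun t => X t * Y t).
Proof.
move=> [mX iX] [mY iY]; apply: (le_intg _ (intgD iX iY)).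
  exact: measurable_funM.
by move=> t; rewrite normrM; have := sqr_ge0 (`|X t| - `|Y t|);
  rewrite -(real_normK (num_real (X t))) -(real_normK (num_real (Y t))); nra.
Qed.

Lemma sqintg_intg X : sqintg X -> intg X.
Proof.
move=> [mX iX]; apply: (le_intg mX (intgD iX (intg_cst 1))) => t.
by rewrite -(real_normK (num_real (X t))); have := sqr_ge0 (`|X t| - 1); nra.
Qed.

Lemma sqintgD X Y : sqintg X -> sqintg Y -> sqintg (fun t => X t + Y t).
Proof.
move=> sX sY; split; first by apply: measurable_funD; [apply: sX.1|apply: sY.1].
apply: eq_intg (intgD (intgD sX.2 (intgZ 2 (sqintgM sX sY))) sY.2) => t.
ring.
Qed.

Lemma sqintgZ a X : sqintg X -> sqintg (fun t => a * X t).
Proof.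
move=> [mX iX]; split; first exact: measurable_funM.
by apply: eq_intg (intgZ (a ^+ 2) iX) => t; rewrite exprMn.
Qed.

Lemma bounded_sqintg X C : measurable_fun setT X ->
  (forall t, `|X t| <= C) -> sqintg X.
Proof.
move=> mX XC; split=> //; apply: (@bounded_intg _ (C ^+ 2)).
  exact: measurable_funX.
by move=> t; rewrite normrX lerXn2r ?nnegrE ?normr_ge0// (le_trans _ (XC t)).
Qed.

Lemma sqintg_sum I (s : seq I) (P : pred I) (F : I -> T -> R) :
  (forall i, P i -> sqintg (F i)) ->
  sqintg (fun t => \sum_(i <- s | P i) F i t).
Proof.
move=> iF; elim: s => [|i s ih].
  by under eq_fun do rewrite big_nil; apply: (@bounded_sqintg _ 0) => // t;
    rewrite normr0.
have [Pi|Pi] := boolP (P i).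
- by under eq_fun do rewrite big_cons Pi; apply: sqintgD => //; exact: iF.
- by under eq_fun do rewrite big_cons (negbTE Pi).
Qed.

Lemma bounded_intgM X Y C : measurable_fun setT X ->
  (forall t, `|X t| <= C) -> intg Y -> intg (fun t => X t * Y t).
Proof.
move=> mX XC iY; apply: (le_intg _ (intgZ C (intg_norm iY))).
  by apply: measurable_funM => //; exact: intg_meas.
by move=> t; rewrite normrM ler_wpM2r.
Qed.

Lemma bounded_sqintgM X Y C : measurable_fun setT X ->
  (forall t, `|X t| <= C) -> sqintg Y -> sqintg (fun t => X t * Y t).
Proof.
move=> mX XC [mY iY]; split; first exact: measurable_funM.
under eq_fun do rewrite exprMn.
apply: (@bounded_intgM _ _ (C ^+ 2)) => //; first exact: measurable_funX.
by move=> t; rewrite normrX lerXn2r ?nnegrE ?normr_ge0// (le_trans _ (XC t)).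
Qed.

Lemma intg_dominated_cvg (f : nat -> T -> R) (g h : T -> R) :
  (forall n, measurable_fun setT (f n)) -> measurable_fun setT g ->
  (forall t, f ^~ t @ \oo --> g t) ->
  intg h -> (forall n t, `|f n t| <= h t) ->
  (fun n => Ex (f n)) @ \oo --> Ex g.
Proof.
move=> mf mg fg ih fh.
have mf' n := iffRL (measurable_EFinP setT _) (mf n).
have mg' := iffRL (measurable_EFinP setT _) mg.
have fg' : {ae Pr, forall t, setT t -> (fun n => (f n t)%:E) @ \oo --> (g t)%:E}.
  by apply: aeW => t _; apply: cvg_EFin; [exact: nearW|exact: fg].
have fh' : {ae Pr, forall t n, setT t -> (`|(f n t)%:E| <= (h t)%:E)%E}.
  by apply: aeW => t n _; rewrite lee_fin.
have [ig _ cvg] := dominated_convergence measurableT mf' mg' fg' ih fh'.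
under eq_fun do rewrite ExE.
apply: fine_cvg; rewrite -ExEE//; exact: cvg.
Qed.

End expectation_toolkit.

(** * Borel sets and supports *)

Section borel_cV.
Variable R : realType.

Lemma coord_norm_le m n (A : 'M[R]_(m, n)) i j : `|A i j| <= `|A|.
Proof.
rewrite [leRHS](mx_normrE A); apply/bigmax_geP; right.
by exists (i, j).
Qed.

Lemma norm_mx_le m n (A : 'M[R]_(m, n)) e : 0 <= e ->
  (forall i j, `|A i j| <= e) -> `|A| <= e.
Proof.
by move=> e0 H; rewrite [leLHS](mx_normrE A); apply/bigmax_leP; split.
Qed.

Lemma open_cVP m (U : set 'cV[R]_m) v : open U -> U v ->
  exists2 e : R, 0 < e & forall y : 'cV[R]_m, (forall i, `|v i 0 - y i 0| < e) -> U y.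
Proof.
move=> oU Uv; have := open_nbhs_nbhs (conj oU Uv).
move=> /nbhs_ballP[e /= e0 eU]; exists e => // y H; apply: eU; split=> // i j.
by rewrite ord1; exact: H.
Qed.

Lemma continuous_coord m (i : 'I_m) : continuous (fun v : 'cV[R]_m => v i 0).
Proof. exact: coord_continuous. Qed.

(** A countable base of the topology. It reduces Borel measurability of a random vector to its
    coordinates, and the complement of a support to countably many null boxes. *)
Definition rat_box m (cn : 'cV[rat]_m * nat) : set 'cV[R]_m :=
  [set v | forall i, `|v i 0 - ratr (cn.1 i 0)| < cn.2.+1%:R^-1].

Lemma rat_box_in m (U : set 'cV[R]_m) v : open U -> U v ->
  exists cn, rat_box cn v /\ rat_box cn `<=` U.
Proof.
move=> oU Uv; have [e e0 eU] := open_cVP oU Uv.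
(* With radius below e / 2, every point of a box containing v is within e of v. *)
have [n _ ne] : exists2 n : nat, True & n.+1%:R^-1 < e / 2.
  have e2 : (0 < e / 2)%R by rewrite divr_gt0.
  have [n _ /(_ n (leqnn n)) ?] := near_infty_natSinv_lt (PosNum e2).
  by exists n.
have n0 : 0 < n.+1%:R^-1 :> R by rewrite invr_gt0.
have H i : exists q : rat, ratr q \in `](v i 0 - n.+1%:R^-1), (v i 0 + n.+1%:R^-1)[.
  by apply: rat_in_itvoo; rewrite ltrBlDr -addrA ltrDl addr_gt0.
pose c : 'cV[rat]_m := \col_i projT1 (cid (H i)).
have cE i : `|v i 0 - ratr (c i 0)| < n.+1%:R^-1.
  rewrite mxE; case: cid => /= x; rewrite in_itv/= ltr_norml => /andP[h1 h2].
  apply/andP; split; move: n0 h1 h2; set a := _^-1; lra.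
exists (c, n); split=> // y yc; apply: eU => i.
rewrite (_ : _ - _ = (v i 0 - ratr (c i 0)) - (y i 0 - ratr (c i 0))); last by ring.
by rewrite (le_lt_trans (ler_normB _ _))//; move: ne (cE i) (yc i); rewrite /=; set a := n.+1%:R^-1; lra.
Qed.

Lemma open_rat_box m (U : set 'cV[R]_m) : open U ->
  U = \bigcup_(cn in [set cn | rat_box cn `<=` U]) rat_box cn.
Proof.
move=> oU; apply/seteqP; split=> [v Uv|v [cn /= cnU /cnU//]].
by have [cn [? ?]] := rat_box_in oU Uv; exists cn.
Qed.

Lemma measurable_cV d (T : measurableType d) m (X : T -> 'cV[R]_m) :
  (forall i, measurable_fun setT (fun t => X t i 0)) -> random_vector X.
Proof.
move=> mX; apply: (@measurability _ _ T (borel_cV R m) setT X (@open 'cV[R]_m) erefl).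
move=> _ [U oU <-]; rewrite setTI (open_rat_box oU) preimage_bigcup bigcup_mkcond.
apply: countable_bigcupT_measurable => [|cn]; first exact: countableP.
case: ifPn => // _.
rewrite (_ : _ @^-1` _ =
  \bigcap_(i in [set: 'I_m]) [set t | `|X t i 0 - ratr (cn.1 i 0)| < cn.2.+1%:R^-1]).
  apply: fin_bigcap_measurable => // i _.
  rewrite -[X in measurable X]setTI.
  have h : measurable_fun setT (fun t => `|X t i 0 - ratr (cn.1 i 0)| < cn.2.+1%:R^-1).
    apply: measurable_fun_ltr => //; apply: measurableT_comp => //.
    exact: measurable_funB.
  exact: (h measurableT [set true]).
by apply/seteqP; split => t /= H i; [move=> _; exact: H|exact: (H i)].
Qed.

Lemma open_borel m (U : set 'cV[R]_m) : open U -> borel_set U.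
Proof. by move=> oU; apply: sub_sigma_algebra. Qed.

Lemma closed_borel m (U : set 'cV[R]_m) : closed U -> borel_set U.
Proof.
move=> cU; rewrite -(setCK U); apply: (@measurableC _ (borel_cV R m)).
by apply: open_borel; rewrite openC.
Qed.

Lemma continuous_borel m (f : 'cV[R]_m -> R) : continuous f -> borel_fun f.
Proof.
move=> cf; rewrite /borel_fun.
refine (@measurability _ _ (borel_cV R m) (measurableTypeR R) setT f (@RGenOpens.G R) _ _).
  by rewrite RGenOpens.measurableE.
move=> _ [U oU <-]; rewrite setTI; apply: open_borel.
move: oU => [a [b ->]].
by move/continuousP : cf; apply.
Qed.

Lemma borel_coord m (i : 'I_m) : borel_fun (fun v : 'cV[R]_m => v i 0).
Proof. by apply: continuous_borel; exact: continuous_coord. Qed.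

(** Products of segments are compact for row vectors; transposition is continuous and carries this
    to columns. *)
Lemma compact_cube m (L : R) : compact [set v : 'cV[R]_m | forall i, `|v i 0| <= L].
Proof.
have cr := @rV_compact R m (fun=> `[(- L), L]%classic) (fun=> @segment_compact R (- L) L).
have ct : {within [set v : 'rV[R]_m | forall i, `[(- L), L]%classic (v ord0 i)],
    continuous (fun v : 'rV[R]_m => v^T)}.
  apply: continuous_subspaceT => v A /nbhs_ballP[e /= e0 eA].
  apply/nbhs_ballP; exists e => //= w [_ vw]; apply: eA; split=> // i j.
  by rewrite !mxE; exact: vw.
have := continuous_compact ct cr; congr compact.
apply/seteqP; split=> [_ [v H <-] i|v H].
  by rewrite mxE ler_norml; have := H i; rewrite /= in_itv.
exists v^T; last by rewrite trmxK.
by move=> i; rewrite /= in_itv/= mxE -ler_norml.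
Qed.

Lemma near_coord m (f : 'cV[R]_m -> R) (x : 'cV[R]_m) (e : R) :
  {for x, continuous f} -> 0 < e ->
  exists2 h : R, 0 < h & forall y : 'cV[R]_m,
    (forall i, `|x i 0 - y i 0| < h) -> `|f x - f y| < e.
Proof.
move=> cf e0; have /cvgrPdist_lt/(_ e e0) := cf.
move=> /nbhs_ballP[h /= h0 hA]; exists h => // y xy; apply: hA; split=> // i j.
by rewrite ord1; exact: xy.
Qed.

(** Only x is confined to K; y may lie anywhere near it. Around each point of K half of the radius
    of continuity is kept in reserve for y, and compactness, in the form of near coverings, makes
    the radius uniform. *)
Lemma compact_unif_continuous m (f : 'cV[R]_m -> R) (K : set 'cV[R]_m) (e : R) :
  continuous f -> compact K -> 0 < e ->
  exists2 h : R, 0 < h & forall x y : 'cV[R]_m, K x ->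
    (forall i, `|x i 0 - y i 0| < h) -> `|f x - f y| < e.
Proof.
move=> cf cK e0.
pose P (h : R) (x : 'cV[R]_m) := forall y : 'cV[R]_m,
  (forall i, `|x i 0 - y i 0| < h) -> `|f x - f y| < e.
have : \forall h \near (0 : R)^'+, K `<=` P h.
  apply: (iffLR (compact_near_coveringP K) cK R (0^'+)) => x Kx.
  have e2 : 0 < e / 2 by rewrite divr_gt0.
  have [h h0 H] := near_coord (cf x) e2.
  have h2 : 0 < h / 2 by rewrite divr_gt0.
  exists (ball x (h / 2), [set k | k < h / 2]); first split=> /=.
  - exact: nbhsx_ballx.
  - exact: nbhs_right_lt.
  move=> [x' k] /= [[_ xx'] kh] y x'y.
  have h1 : `|f x - f x'| < e / 2.
    by apply: H => i; rewrite (lt_trans (xx' i 0))// ltr_pdivrMr// ltr_pMr// ltr1n.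
  have h3 : `|f x - f y| < e / 2.
    apply: H => i; rewrite (_ : _ - _ = (x i 0 - x' i 0) + (x' i 0 - y i 0)); last by ring.
    rewrite (le_lt_trans (ler_normD _ _))//.
    have := xx' i 0; rewrite /ball/= => b1; have b2 := x'y i.
    rewrite -(@divfK _ 2 _ h)// mulr_natr mulr2n ltrD// (lt_trans b2)//.
  rewrite (_ : _ - _ = (f x - f y) - (f x - f x')); last by ring.
  rewrite (le_lt_trans (ler_normB _ _))//; lra.
move=> [d /= d0 dP].
have d2 : 0 < d / 2 by rewrite divr_gt0.
exists (d / 2) => // x y Kx xy; apply: (dP (d / 2)) => //=.
by rewrite sub0r normrN gtr0_norm// ltr_pdivrMr// ltr_pMr// ltr1n.
Qed.

Lemma compact_norm_bounded m (f : 'cV[R]_m -> R) (K : set 'cV[R]_m) :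
  continuous f -> compact K -> exists C, forall x, K x -> `|f x| <= C.
Proof.
move=> cf cK.
have cf' : {within K, continuous f} by exact: continuous_subspaceT.
have [M [Mr MP]] := @compact_bounded R R^o _ (continuous_compact cf' cK).
by exists (M + 1) => x Kx; apply: (MP (M + 1)); [rewrite ltrDl|exists x].
Qed.

End borel_cV.

Section random_vectors.
Context d (T : measurableType d) (R : realType) (Pr : probability T R).

Lemma borel_comp m (X : T -> 'cV[R]_m) (f : 'cV[R]_m -> R) :
  random_vector X -> borel_fun f -> measurable_fun setT (fun t => f (X t)).
Proof. by move=> mX mf; exact: (measurableT_comp mf mX). Qed.

Lemma random_vector_coord m (X : T -> 'cV[R]_m) i :
  random_vector X -> measurable_fun setT (fun t => X t i 0).
Proof. by move=> mX; exact: (@borel_comp _ X (fun v => v i 0) mX (borel_coord i)). Qed.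

Lemma random_vector_preimage m (X : T -> 'cV[R]_m) (A : set 'cV[R]_m) :
  random_vector X -> borel_set A -> measurable (X @^-1` A).
Proof. by move=> mX mA; rewrite -[X in measurable X]setTI; exact: mX. Qed.

Lemma closed_support m (X : T -> 'cV[R]_m) : closed (support Pr X).
Proof.
rewrite -openC openE => v; rewrite /support /= => /existsNP[U].
move=> /not_implyP[oU /not_implyP[Uv U0]].
apply: filterS (open_nbhs_nbhs (conj oU Uv)) => w Uw /(_ U oU Uw).
exact: U0.
Qed.

Lemma borel_support m (X : T -> 'cV[R]_m) : borel_set (support Pr X).
Proof. by apply: closed_borel; exact: closed_support. Qed.

Lemma ae_countable (I : countType) (P : I -> T -> Prop) :
  (forall i, {ae Pr, forall t, P i t}) -> {ae Pr, forall t i, P i t}.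
Proof.
move=> H.
pose Q n t := if @unpickle I n is Some i then P i t else True.
have Qn n : {ae Pr, forall t, Q n t}.
  rewrite /Q; case: (unpickle n) => [i|]; first exact: H.
  exact: aeW.
have := negligible_bigcup Qn.
apply: negligibleS => t /= /existsNP[i nP]; exists (pickle i) => //=.
by rewrite /Q pickleK.
Qed.

(** A point outside the support lies in a rational box of probability zero, and there are only
    countably many such boxes. *)
Lemma ae_support m (X : T -> 'cV[R]_m) : random_vector X ->
  {ae Pr, forall t, support Pr X (X t)}.
Proof.
move=> mX.
pose P (cn : 'cV[rat]_m * nat) t :=
  Pr.-negligible (X @^-1` @rat_box R m cn) -> ~ @rat_box R m cn (X t).
have : {ae Pr, forall t cn, P cn t}.
  apply: ae_countable => cn; have [nb|nb] := pselect (Pr.-negligible (X @^-1` @rat_box R m cn)).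
    by apply: negligibleS nb => t /= /not_implyP[_ /contrapT].
  by apply: aeW => t /nb.
apply: filterS => t H U oU Uv.
rewrite lt_neqAle measure_ge0 andbT; apply/eqP => U0.
have [cn [cnv cnU]] := rat_box_in oU Uv.
apply: (H cn) cnv; apply: (@negligibleS _ _ _ _ (X @^-1` U)).
  by move=> s; exact: cnU.
by apply/negligibleP => //; apply: random_vector_preimage => //; exact: open_borel.
Qed.

End random_vectors.

(** * Conditional expectation and independence *)

Lemma norm_indic_le1 (R : realType) (U : Type) (A : set U) t : `|\1_A t : R| <= 1.
Proof. by rewrite indicE; case: (_ \in _); rewrite ?normr1 ?normr0. Qed.

Section conditioning.
Import HBSimple HBNNSimple.
Context d (T : measurableType d) (R : realType) (Pr : probability T R).
Context d' (T' : measurableType d').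
Local Notation intg := (intg Pr).
Local Notation Ex := (Ex Pr).

Lemma set_integral_Ex (X : T -> R) (A : set T) : measurable A -> intg X ->
  (\int[Pr]_(t in A) (X t)%:E = (Ex (fun t => \1_A t * X t))%:E)%E.
Proof.
move=> mA iX; rewrite -ExEE; last first.
  apply: (@bounded_intgM _ _ _ _ _ _ 1) => //.
  by move=> t; rewrite indicE; case: (_ \in _); rewrite ?normr1 ?normr0.
rewrite integral_mkcond; apply: eq_integral => t _.
rewrite patchE indicE; case: ifPn => _; first by rewrite mul1r.
by rewrite mul0r.
Qed.

Section orthogonality.
Variables (V : T -> T') (X : T -> R).
Hypotheses (mV : measurable_fun setT V) (iX : intg X).
Hypothesis X0 : forall A, measurable A -> Ex (fun t => \1_A (V t) * X t) = 0.

Let intg_indicV A : measurable A -> intg (fun t => \1_A (V t) * X t).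
Proof.
move=> mA; apply: (@bounded_intgM _ _ _ _ _ _ 1) => //.
- by apply: measurableT_comp.
- by move=> t; exact: norm_indic_le1.
Qed.

Let ortho_nnsfun (s : {nnsfun T' >-> R}) : Ex (fun t => s (V t) * X t) = 0.
Proof.
under eq_fun do rewrite fimfunEord mulr_suml.
rewrite Ex_sum => [|i _].
  rewrite big1// => i _; under eq_fun do rewrite -mulrA.
  by rewrite ExZ ?X0 ?mulr0//; exact: intg_indicV.
by under eq_fun do rewrite -mulrA; apply: intgZ; exact: intg_indicV.
Qed.

Let ortho_ge0 (psi : T' -> R) : measurable_fun setT psi ->
  (forall v, 0 <= psi v) -> intg (fun t => psi (V t) * X t) ->
  Ex (fun t => psi (V t) * X t) = 0.
Proof.
move=> mpsi psi0 ipsi.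
have mpsi' : measurable_fun setT (EFin \o psi) by exact/measurable_EFinP.
have psi0' v : setT v -> (0 <= (EFin \o psi) v)%E by rewrite lee_fin.
pose s n := nnsfun_approx measurableT mpsi' n.
have sle n v : s n v <= psi v.
  have := @le_approx _ _ _ setT (EFin \o psi) n v psi0' I.
  by rewrite lee_fin /s nnsfun_approxE.
have scvg v : s ^~ v @ \oo --> psi v.
  exact: (fine_cvg (cvg_nnsfun_approx measurableT mpsi' psi0' I)).
have c : (fun n => Ex (fun t => s n (V t) * X t)) @ \oo -->
    Ex (fun t => psi (V t) * X t).
  apply: (intg_dominated_cvg (h := fun t => `|psi (V t) * X t|)).
  - move=> n; apply: measurable_funM; last exact: intg_meas iX.
    exact: measurableT_comp.
  - exact: intg_meas ipsi.
  - by move=> t; apply: cvgMl; exact: scvg.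
  - exact: intg_norm.
  - move=> n t; rewrite !normrM ler_wpM2r// ger0_norm// ger0_norm//.
have c0 : (fun n => Ex (fun t => s n (V t) * X t)) = cst 0.
  by apply/funext => n; exact: ortho_nnsfun.
rewrite c0 in c; have := cvg_unique _ c (@cvg_cst _ _ _ _ _).
by apply; exact: norm_hausdorff.
Qed.

(** Linearity gives the case of simple psi, dominated convergence with majorant |psi(V) X| the
    nonnegative case, and positive and negative parts the rest. It serves twice: for conditional
    expectations, with X replaced by X - g(V), and for independence, with X centred. *)
Lemma cond_ortho (psi : T' -> R) : measurable_fun setT psi ->
  intg (fun t => psi (V t) * X t) -> Ex (fun t => psi (V t) * X t) = 0.
Proof.
move=> mpsi ipsi.
have mX := intg_meas iX.
pose p v := Num.max (psi v) 0; pose n v := Num.max (- psi v) 0.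
have mp : measurable_fun setT p by exact: measurable_maxr.
have mn : measurable_fun setT n by apply: measurable_maxr => //; exact: measurableT_comp.
have ip : intg (fun t => p (V t) * X t).
  apply: (le_intg _ (intg_norm ipsi)).
    by apply: measurable_funM => //; exact: measurableT_comp.
  move=> t; rewrite !normrM ler_wpM2r// /p; case: (leP (psi (V t)) 0) => // _.
  by rewrite normr0.
have in_ : intg (fun t => n (V t) * X t).
  apply: (le_intg _ (intg_norm ipsi)).
    by apply: measurable_funM => //; exact: measurableT_comp.
  move=> t; rewrite !normrM ler_wpM2r// /n; case: (leP (- psi (V t)) 0) => // _.
  by rewrite normr0.
  by rewrite normrN.
have E t : psi (V t) * X t = p (V t) * X t - n (V t) * X t.
  rewrite -mulrBl; congr (_ * _); rewrite /p /n.
  by case: (leP (psi (V t)) 0); case: (leP (- psi (V t)) 0); lra.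
rewrite (eq_Ex _ E) ExB// !ortho_ge0 ?subrr// => v.
- by rewrite le_max lexx orbT.
- by rewrite le_max lexx orbT.
Qed.

End orthogonality.

End conditioning.

Section conditional_expectation.
Import HBSimple HBNNSimple.
Context d (T : measurableType d) (R : realType) (Pr : probability T R).
Local Notation intg := (intg Pr).
Local Notation Ex := (Ex Pr).
Context m (V : T -> 'cV[R]_m).
Hypothesis mV : random_vector V.

Lemma cond_exp_indic (X : T -> R) g A : is_cond_exp Pr X V g -> borel_set A ->
  Ex (fun t => \1_A (V t) * X t) = Ex (fun t => \1_A (V t) * g (V t)).
Proof.
move=> [mg iX ig H] mA; have := H A mA.
have mVA := random_vector_preimage mV mA.
by rewrite (set_integral_Ex mVA iX) (set_integral_Ex mVA ig) => -[].
Qed.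

Lemma intg_indic_comp (X : T -> R) (A : set 'cV[R]_m) : borel_set A -> intg X ->
  intg (fun t => \1_A (V t) * X t).
Proof.
move=> mA iX; apply: (@bounded_intgM _ _ _ _ _ _ 1) => //.
- apply: (@borel_comp _ _ _ _ V (\1_A) mV).
  exact: (@measurable_indic _ (borel_cV R m) R setT A mA).
- by move=> t; rewrite indicE; case: (_ \in _); rewrite ?normr1 ?normr0.
Qed.

Lemma cond_exp_pullout (X : T -> R) g psi : is_cond_exp Pr X V g -> borel_fun psi ->
  intg (fun t => psi (V t) * X t) -> intg (fun t => psi (V t) * g (V t)) ->
  Ex (fun t => psi (V t) * X t) = Ex (fun t => psi (V t) * g (V t)).
Proof.
move=> cX mpsi i1 i2; have [mg iX ig _] := cX.
apply/eqP; rewrite -subr_eq0 -ExB//; apply/eqP.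
rewrite (eq_Ex _ (fun t => esym (mulrBr (psi (V t)) (X t) (g (V t))))).
apply: (@cond_ortho _ T R Pr _ (borel_cV R m)) => //.
- exact: intgB.
- move=> A mA; under eq_fun do rewrite mulrBr.
  by rewrite ExB ?(cond_exp_indic cX)// ?subrr//; exact: intg_indic_comp.
- by apply: eq_intg (intgB i1 i2) => t; rewrite mulrBr.
Qed.

Lemma Ex_norm0_ae (Z : T -> R) : intg Z -> Ex (fun t => `|Z t|) = 0 ->
  {ae Pr, forall t, Z t = 0}.
Proof.
move=> iZ Z0.
have mZ : measurable_fun setT (EFin \o Z) by apply/measurable_EFinP; exact: intg_meas iZ.
have : ae_eq Pr setT (EFin \o Z) (cst 0%E).
  apply/ae_eq_integral_abs => //.
  transitivity ((Ex (fun t => `|Z t|))%:E); last by rewrite Z0.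
  by rewrite -(ExEE (intg_norm iZ)); apply: eq_integral.
by apply: filterS => t /= /(_ Logic.I) [].
Qed.

Lemma cond_exp_unique (X : T -> R) g g' :
  is_cond_exp Pr X V g -> is_cond_exp Pr X V g' ->
  {ae Pr, forall t, g (V t) = g' (V t)}.
Proof.
move=> cg cg'; have [mg iX ig _] := cg; have [mg' _ ig' _] := cg'.
pose h v := g v - g' v.
have mh : borel_fun h by exact: measurable_funB.
(* The sign of h, so that psi h = |h|; testing both versions against it gives E|h(V)| = 0. *)
pose psi v : R := \1_[set v | 0 <= h v] v - \1_[set v | h v <= 0] v.
have mpsi : borel_fun psi.
  apply: (@measurable_funB _ (borel_cV R m)); apply: measurable_indic.
  - exact: (@measurable_ge_set _ (borel_cV R m) R h 0).
  - exact: (@measurable_le_set _ (borel_cV R m) R h 0).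
have psiE v : psi v * h v = `|h v|.
  rewrite /psi !indicE.
  have -> : (v \in [set v | 0 <= h v]) = (0 <= h v) by apply/idP/idP; rewrite inE.
  have -> : (v \in [set v | h v <= 0]) = (h v <= 0) by apply/idP/idP; rewrite inE.
  by case: (ltgtP (h v) 0) => hv; rewrite /= ?subrr ?sub0r ?subr0 ?mul0r ?mul1r ?mulN1r
    ?(ltr0_norm hv) ?(gtr0_norm hv)// hv normr0.
have psi1 v : `|psi v| <= 1.
  rewrite /psi !indicE; case: (_ \in _); case: (_ \in _);
  by rewrite /= ?subrr ?sub0r ?subr0 ?normrN ?normr1 ?normr0.
have mpsiV := borel_comp mV mpsi.
have bd (Z : T -> R) : intg Z -> intg (fun t => psi (V t) * Z t).
  by apply: (@bounded_intgM _ _ _ _ _ _ 1).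
have E1 := cond_exp_pullout cg mpsi (bd _ iX) (bd _ ig).
have E2 := cond_exp_pullout cg' mpsi (bd _ iX) (bd _ ig').
have ihV : intg (fun t => h (V t)) by exact: intgB.
have : {ae Pr, forall t, h (V t) = 0}.
  apply: Ex_norm0_ae => //; transitivity (Ex (fun t => psi (V t) * g (V t) - psi (V t) * g' (V t))).
    by apply: eq_Ex => t; rewrite -psiE mulrBr.
  rewrite ExB; [|exact: (bd _ ig)|exact: (bd _ ig')].
  by rewrite -E1 E2 subrr.
by apply: filterS => t /eqP; rewrite subr_eq0 => /eqP.
Qed.

End conditional_expectation.

Section iid.
Import HBSimple HBNNSimple.
Context d (T : measurableType d) (R : realType) (Pr : probability T R).
Local Notation intg := (intg Pr).
Local Notation Ex := (Ex Pr).
Context m (V : nat -> T -> 'cV[R]_m).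
Hypothesis mV : forall i, random_vector (V i).

Let mpsiV i (psi : 'cV[R]_m -> R) : borel_fun psi ->
  measurable_fun setT (fun t => psi (V i t)).
Proof. exact: borel_comp. Qed.

Let bindic (A : set 'cV[R]_m) : borel_set A -> borel_fun (\1_A : 'cV[R]_m -> R).
Proof. by move=> mA; exact: (@measurable_indic _ (borel_cV R m) R setT A mA). Qed.

Section identical.
Hypothesis idV : identically_distributed Pr V.

Lemma ident_intg_Ex i j (psi : 'cV[R]_m -> R) : borel_fun psi ->
  intg (fun t => psi (V i t)) ->
  intg (fun t => psi (V j t)) /\ Ex (fun t => psi (V j t)) = Ex (fun t => psi (V i t)).
Proof.
move=> mpsi ii.
pose mu k : {measure set (borel_cV R m) -> \bar R} :=
  measure_function_pushforward__canonical__measure_function_Measure Pr (mV k).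
have Epush k l (f : borel_cV R m -> \bar R) :
    (\int[mu k]_y f y = \int[mu l]_y f y)%E.
  by apply: eq_measure_integral => A mA _; exact: idV.
have mi : measurable_fun setT (fun v : borel_cV R m => (`|psi v|)%:E).
  by apply/measurable_EFinP; apply: measurableT_comp.
have mpE : measurable_fun setT (EFin \o (psi : borel_cV R m -> R)).
  exact/measurable_EFinP.
have p0 : {in [set: borel_cV R m], forall y : borel_cV R m, (0 <= (`|psi y|)%:E)%E}.
  by move=> y _; rewrite lee_fin.
have ei := ge0_integral_pushforward (mV i) Pr measurableT mi p0.
have ej := ge0_integral_pushforward (mV j) Pr measurableT mi p0.
have eij : (\int[Pr]_t (`|psi (V i t)|)%:E = \int[Pr]_t (`|psi (V j t)|)%:E)%E.
  by rewrite -[LHS]ei -[RHS]ej; exact: Epush.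
have ij : intg (fun t => psi (V j t)).
  apply/integrableP; split; first by apply/measurable_EFinP; exact: mpsiV.
  by rewrite /= -eij; move/integrableP : ii => [].
split=> //; rewrite !ExE; congr fine.
have ei' := @integral_pushforward _ _ _ _ _ _ (mV i) Pr setT _ mpE ii measurableT.
have ej' := @integral_pushforward _ _ _ _ _ _ (mV j) Pr setT _ mpE ij measurableT.
by rewrite -[LHS]ej' -[RHS]ei'; exact: Epush.
Qed.


End identical.

Section independent.
Hypothesis indV : mutually_independent Pr V.

Lemma indep_prod_indic (A : nat -> set 'cV[R]_m) (s : seq nat) : uniq s ->
  (forall i, borel_set (A i)) ->
  Ex (fun t => \prod_(i <- s) \1_(A i) (V i t)) =
  \prod_(i <- s) Ex (fun t => \1_(A i) (V i t)).
Proof.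
move=> us mA; have := indV us mA.
have mVA i : measurable (V i @^-1` A i) by exact: random_vector_preimage.
have mb : measurable (\bigcap_(i in [set` s]) V i @^-1` A i).
  by apply: fin_bigcap_measurable.
rewrite -(Ex_indic Pr mb).
rewrite (eq_bigr (fun i => (Ex (fun t => \1_(A i) (V i t)))%:E)); last first.
  by move=> i _; rewrite -(Ex_indic Pr (mVA i)).
rewrite prodEFin => -[<-]; apply: eq_Ex => t.
elim: s {us mb} => [|i s ih].
  by rewrite big_nil indicE mem_set//= => i; rewrite /= in_nil.
rewrite big_cons ih !indicE.
have -> : (t \in \bigcap_(i0 in [set` i :: s]) V i0 @^-1` A i0) =
    (V i t \in A i) && (t \in \bigcap_(i in [set` s]) V i @^-1` A i).
  apply/idP/andP => [/set_mem H|[/set_mem H1 /set_mem H2]].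
    split; apply/mem_set; first by apply: (H i); rewrite /= inE eqxx.
    by move=> k ks; apply: (H k); rewrite /= inE ks orbT.
  by apply/mem_set => k; rewrite /= inE => /orP[/eqP->//|ks]; exact: H2.
by case: (_ \in _); case: (_ \in _); rewrite /= ?mulr1 ?mul0r ?mulr0.
Qed.

Lemma measurable_prod_comp (psi : nat -> 'cV[R]_m -> R) (s : seq nat) :
  (forall i, borel_fun (psi i)) ->
  measurable_fun setT (fun t => \prod_(i <- s) psi i (V i t)).
Proof. by move=> mpsi; apply: measurable_prod => i _; exact: mpsiV. Qed.

Lemma norm_prod_le (psi : nat -> R) (C : R) (s : seq nat) :
  (forall i, `|psi i| <= C) -> `|\prod_(i <- s) psi i| <= C ^+ size s.
Proof.
move=> H; elim: s => [|i s ih]; first by rewrite big_nil normr1.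
by rewrite big_cons normrM exprS ler_pM.
Qed.

(** The statement mixes functions on [s1] with indicators on [s2] so that induction can turn one
    indicator into a function at a time: the rest of the product, minus its mean, is orthogonal to
    every indicator of V_i, hence to psi_i(V_i). *)
Lemma indep_prod_aux (A : nat -> set 'cV[R]_m) (psi : nat -> 'cV[R]_m -> R)
    (C : R) (s1 s2 : seq nat) :
  uniq (s1 ++ s2) -> (forall i, borel_set (A i)) -> (forall i, borel_fun (psi i)) ->
  (forall i v, `|psi i v| <= C) ->
  Ex (fun t => (\prod_(i <- s1) psi i (V i t)) * \prod_(i <- s2) \1_(A i) (V i t)) =
  (\prod_(i <- s1) Ex (fun t => psi i (V i t))) *
  \prod_(i <- s2) Ex (fun t => \1_(A i) (V i t)).
Proof.
move=> us mA mpsi psiC.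
elim: s1 s2 us A mA => [|i s1 ih] s2 us A mA.
  rewrite big_nil mul1r -indep_prod_indic//.
  by apply: eq_Ex => t; rewrite big_nil mul1r.
pose H t := (\prod_(i <- s1) psi i (V i t)) * \prod_(i <- s2) \1_(A i) (V i t) : R.
have us' : uniq (s1 ++ i :: s2) by rewrite -cat1s uniq_catCA cat1s.
have mH : measurable_fun setT H.
  apply: measurable_funM; first exact: measurable_prod_comp.
  by apply: (@measurable_prod_comp (fun i => \1_(A i))) => k; exact: bindic.
have HC t : `|H t| <= C ^+ size s1.
  rewrite normrM -[leRHS]mulr1 ler_pM//.
    exact: (@norm_prod_le (fun i => psi i (V i t))).
  rewrite (le_trans (@norm_prod_le (fun i => \1_(A i) (V i t)) 1 s2 _)) ?expr1n// => k.
  by rewrite indicE; case: (_ \in _); rewrite ?normr1 ?normr0.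
have iH : intg H by exact: bounded_intg HC.
have us2 : uniq (s1 ++ s2) by move: us => /= /andP[].
have iis2 : i \notin s2 by move: us => /= /andP[]; rewrite mem_cat negb_or => /andP[].
have h := ih s2 us2 A mA; rewrite -/H in h.
set hh := Ex H in h.
have i1 (X : T -> R) (f : 'cV[R]_m -> R) B : borel_fun f -> (forall v, `|f v| <= B) ->
    intg X -> intg (fun t => f (V i t) * X t).
  move=> mf fB iX; apply: (@bounded_intgM _ _ _ _ _ _ B) => //; exact: (mpsiV i mf).
have iHh : intg (fun t => H t - hh) by apply: intgB => //; exact: intg_cst.
have ipsi : intg (fun t => psi i (V i t)).
  apply: (@bounded_intg _ _ _ _ _ C); first exact: (mpsiV i (mpsi i)).
  by move=> t; exact: psiC.
have ind1 (B : set 'cV[R]_m) v : `|\1_B v : R| <= 1 by exact: norm_indic_le1.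
have := @cond_ortho _ T R Pr _ (borel_cV R m) (V i) (fun t => H t - hh)
  (mV i) iHh _ (psi i) (mpsi i) (i1 _ _ _ (mpsi i) (psiC i) iHh).
have -> : Ex (fun t => psi i (V i t) * (H t - hh)) =
   Ex (fun t => psi i (V i t) * H t) - hh * Ex (fun t => psi i (V i t)).
  rewrite -ExZ// -ExB; [|exact: i1 (psiC i) iH|exact: intgZ].
  by apply: eq_Ex => t; ring.
move=> E; transitivity (Ex (fun t => psi i (V i t) * H t)).
  by apply: eq_Ex => t; rewrite big_cons mulrA.
rewrite big_cons -mulrA -h mulrC; apply/eqP; rewrite -subr_eq0; apply/eqP.
apply: E => B mB.
have bB := bindic mB.
(* The induction hypothesis is applied with index i moved among the indicators and carrying B; since
   i is not in [s2], the other sets are unchanged. *)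
pose A' k := if k == i then B else A k.
have mA' k : borel_set (A' k) by rewrite /A'; case: ifP.
have A'i : A' i = B by rewrite /A' eqxx.
have A's2 (g : nat -> set 'cV[R]_m -> R) : \prod_(k <- s2) g k (A' k) = \prod_(k <- s2) g k (A k).
  apply: eq_big_seq => k ks; rewrite /A'; case: eqP => // ki.
  by move: iis2; rewrite -ki ks.
have := ih (i :: s2) us' A' mA'; rewrite big_cons A'i.
rewrite (A's2 (fun k B => Ex (fun t => \1_B (V k t)))).
rewrite mulrCA -h => E2.
rewrite (eq_Ex _ (fun t => mulrBr _ _ _)) ExB; last 2 first.
- exact: i1 bB (ind1 B) iH.
- by apply: i1 bB (ind1 B) _; exact: intg_cst.
rewrite (_ : Ex (fun t => \1_B (V i t) * hh) = Ex (fun t => \1_B (V i t)) * hh); last first.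
  rewrite mulrC -ExZ; first by apply: eq_Ex => t; rewrite mulrC.
  by apply: (@bounded_intg _ _ _ _ _ 1); [exact: (mpsiV i bB)|move=> t; exact: ind1].
rewrite -E2; apply/eqP; rewrite subr_eq0; apply/eqP/eq_Ex => t.
by rewrite /H big_cons A'i (A's2 (fun k B => \1_B (V k t))); ring.
Qed.

Lemma indep_prod (psi : nat -> 'cV[R]_m -> R) (C : R) (s : seq nat) :
  uniq s -> (forall i, borel_fun (psi i)) -> (forall i v, `|psi i v| <= C) ->
  Ex (fun t => \prod_(i <- s) psi i (V i t)) =
  \prod_(i <- s) Ex (fun t => psi i (V i t)).
Proof.
move=> us mpsi psiC.
have := @indep_prod_aux (fun=> setT) psi C s [::].
rewrite cats0 big_nil mulr1 => <- //; last by move=> i; exact: (@measurableT _ (borel_cV R m)).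
by apply: eq_Ex => t; rewrite big_nil mulr1.
Qed.

(** Here f and g may be unbounded. Orthogonality is used twice: first to pass from indicators of V_i
    to f while V_j still carries an indicator, then from indicators of V_j to g. *)
Lemma indep_pair i j (f g : 'cV[R]_m -> R) : i != j -> borel_fun f -> borel_fun g ->
  intg (fun t => f (V i t)) -> intg (fun t => g (V j t)) ->
  intg (fun t => f (V i t) * g (V j t)) ->
  Ex (fun t => f (V i t) * g (V j t)) =
  Ex (fun t => f (V i t)) * Ex (fun t => g (V j t)).
Proof.
move=> ij mf mg i_f i_g i_fg.
have ind1 (B : set 'cV[R]_m) v : `|\1_B v : R| <= 1 by exact: norm_indic_le1.
have iind B k : borel_set B -> intg (fun t => \1_B (V k t)).
  move=> mB; apply: (@bounded_intg _ _ _ _ _ 1); last by move=> t; exact: ind1.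
  exact: (mpsiV k (bindic mB)).
have indX B k X : borel_set B -> intg X -> intg (fun t => \1_B (V k t) * X t).
  move=> mB; apply: (@bounded_intgM _ _ _ _ _ _ 1); last by move=> t; exact: ind1.
  exact: (mpsiV k (bindic mB)).
have H1 A B : borel_set A -> borel_set B -> Ex (fun t => \1_A (V i t) * \1_B (V j t)) =
    Ex (fun t => \1_A (V i t)) * Ex (fun t => \1_B (V j t)).
  move=> mA mB; pose C k := if k == i then A else B.
  have mC k : borel_set (C k) by rewrite /C; case: ifP.
  have u : uniq [:: i; j] by rewrite /= inE ij.
  have := indep_prod_indic u mC; rewrite !big_cons big_nil mulr1 /C eqxx.
  rewrite eq_sym (negbTE ij) => <-; apply: eq_Ex => t.
  by rewrite !big_cons big_nil mulr1 eqxx eq_sym (negbTE ij).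
have H2 B : borel_set B -> Ex (fun t => f (V i t) * \1_B (V j t)) =
    Ex (fun t => f (V i t)) * Ex (fun t => \1_B (V j t)).
  move=> mB; set b := Ex (fun t => \1_B (V j t)).
  have iX : intg (fun t => \1_B (V j t) - b) by apply: intgB (iind _ _ mB) (intg_cst _ _).
  have ifB : intg (fun t => f (V i t) * \1_B (V j t)).
    by apply: eq_intg (indX _ j _ mB i_f) => t; rewrite mulrC.
  have ifb : intg (fun t => f (V i t) * b).
    by apply: eq_intg (intgZ b i_f) => t; rewrite mulrC.
  have := @cond_ortho _ T R Pr _ (borel_cV R m) (V i) (fun t => \1_B (V j t) - b)
    (mV i) iX _ f mf.
  rewrite (eq_Ex _ (fun t => mulrBr _ _ _)) ExB//.
  rewrite (_ : Ex (fun t => f (V i t) * b) = Ex (fun t => f (V i t)) * b); last first.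
    by rewrite mulrC -ExZ//; apply: eq_Ex => t; rewrite mulrC.
  move=> E; apply/eqP; rewrite -subr_eq0; apply/eqP; apply: E.
    move=> A mA; rewrite (eq_Ex _ (fun t => mulrBr _ _ _)) ExB.
    - rewrite H1// (_ : Ex (fun t => \1_A (V i t) * b) = Ex (fun t => \1_A (V i t)) * b) ?subrr//.
      by rewrite mulrC -ExZ; [apply: eq_Ex => t; rewrite mulrC|exact: iind].
    - by apply: indX => //; exact: iind.
    - by apply: indX => //; exact: intg_cst.
  by apply: eq_intg (intgB ifB ifb) => t; rewrite mulrBr.
set a := Ex (fun t => f (V i t)).
have iX : intg (fun t => f (V i t) - a) by apply: intgB i_f (intg_cst _ _).
have iga : intg (fun t => g (V j t) * a).
  by apply: eq_intg (intgZ a i_g) => t; rewrite mulrC.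
have igf : intg (fun t => g (V j t) * f (V i t)).
  by apply: eq_intg i_fg => t; rewrite mulrC.
have := @cond_ortho _ T R Pr _ (borel_cV R m) (V j) (fun t => f (V i t) - a)
    (mV j) iX _ g mg.
rewrite (eq_Ex _ (fun t => mulrBr _ _ _)) ExB//.
rewrite (_ : Ex (fun t => g (V j t) * a) = a * Ex (fun t => g (V j t))); last first.
  by rewrite -ExZ//; apply: eq_Ex => t; rewrite mulrC.
rewrite (_ : Ex (fun t => g (V j t) * f (V i t)) = Ex (fun t => f (V i t) * g (V j t))); last first.
  by apply: eq_Ex => t; rewrite mulrC.
move=> E; apply/eqP; rewrite -subr_eq0; apply/eqP; apply: E.
  move=> A mA; rewrite (eq_Ex _ (fun t => mulrBr _ _ _)) ExB.
  - rewrite (_ : Ex (fun t => \1_A (V j t) * a) = a * Ex (fun t => \1_A (V j t))); last first.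
      by rewrite -ExZ; [apply: eq_Ex => t; rewrite mulrC|exact: iind].
    rewrite -H2//; apply/eqP; rewrite subr_eq0; apply/eqP/eq_Ex => t.
    by rewrite mulrC.
  - exact: indX.
  - by apply: indX => //; exact: intg_cst.
by apply: eq_intg (intgB igf iga) => t; rewrite mulrBr.
Qed.


End independent.
End iid.

(** * A central limit theorem via characteristic functions *)

Section trig_bounds.
Variable R : realType.
Implicit Types x : R.

Lemma sin_MVT x : 0 <= x -> exists2 c, 0 <= c <= x & sin x = x * cos c.
Proof.
rewrite le_eqVlt => /predU1P[<-|x0]; first by exists 0; rewrite ?lexx// sin0 mul0r.
have ds y : y \in `]0, x[ -> is_derive y 1 (@sin R) (cos y) by move=> _; exact: is_derive_sin.
have cs : {within `[0, x], continuous (@sin R)}.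
  by apply: continuous_subspaceT; exact: continuous_sin.
have [c /itvP cx] := MVT x0 ds cs.
by rewrite sin0 !subr0 mulrC => E; exists c; rewrite ?cx.
Qed.

Lemma norm_sin_le x : `|sin x| <= `|x|.
Proof.
wlog x0 : x / 0 <= x => [H|].
  have [/H//|/ltW x0] := leP 0 x.
  by rewrite -normrN -sinN -(normrN x) H// oppr_ge0.
have [c _ ->] := sin_MVT x0.
by rewrite normrM -[leRHS]mulr1 ler_wpM2l// cos_max.
Qed.

Lemma onem_cosE x : 1 - cos x = 2 * sin (x / 2) ^+ 2.
Proof.
rewrite [in LHS](_ : x = (x / 2) *+ 2); last by rewrite -mulr_natr divfK.
by rewrite cos_mulr2n cos2sin2; ring.
Qed.

Lemma onem_cos_ge0 x : 0 <= 1 - cos x.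
Proof. by rewrite subr_ge0 cos_le1. Qed.

Lemma onem_cos_le x : 1 - cos x <= x ^+ 2 / 2.
Proof.
have h : `|sin (x / 2)| ^+ 2 <= `|x / 2| ^+ 2 by rewrite lerXn2r ?nnegrE// norm_sin_le.
rewrite !real_normK ?num_real// in h; rewrite onem_cosE.
by rewrite (_ : x ^+ 2 / 2 = 2 * (x / 2) ^+ 2); [lra|field].
Qed.

Lemma onem_cos_le_norm x : 1 - cos x <= `|x|.
Proof.
have h := norm_sin_le (x / 2); have h1 := sin_max (x / 2).
rewrite onem_cosE -(real_normK (num_real (sin _))).
rewrite normrM [`|2^-1|]ger0_norm// in h.
by rewrite (le_trans (y := 2 * `|sin (x / 2)|))//; have := normr_ge0 (sin (x / 2)); nra.
Qed.

(** The quadratic bound is the integrable majorant when n E sin(Z / sqrt n) is expanded; the cubic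
    bound gives the pointwise limit. *)
Lemma norm_sin_sub x : `|sin x - x| <= x ^+ 2 /\ `|sin x - x| <= `|x| ^+ 3.
Proof.
wlog x0 : x / 0 <= x => [H|].
  have [/H//|/ltW x0] := leP 0 x.
  have [] := H (- x); first by rewrite oppr_ge0.
  by rewrite sinN -opprD !normrN sqrrN.
rewrite (ger0_norm x0).
have [c /andP[c0 cx] ->] := sin_MVT x0.
rewrite -[X in _ - X]mulr1 -mulrBr normrM (ger0_norm x0) -normrN opprB.
rewrite ger0_norm ?onem_cos_ge0//; split.
  rewrite expr2 ler_wpM2l// (le_trans (onem_cos_le_norm c))//.
  by rewrite ger0_norm.
rewrite exprS ler_wpM2l// (le_trans (onem_cos_le c))//.
by rewrite ler_pdivrMr//; nra.
Qed.

Lemma norm_cos_sub x : `|cos x - 1 + x ^+ 2 / 2| <= `|x| ^+ 4.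
Proof.
have [_ h] := norm_sin_sub (x / 2); have h1 := norm_sin_le (x / 2).
(* Since 1 - cos x = 2 sin(x/2)^2, the left side is twice a difference of two squares. *)
have -> : cos x - 1 + x ^+ 2 / 2 = 2 * ((x / 2 - sin (x / 2)) * (x / 2 + sin (x / 2))).
  have -> : cos x = 1 - 2 * sin (x / 2) ^+ 2 by rewrite -onem_cosE; ring.
  by field.
rewrite normrM (ger0_norm (ler0n _ 2)) normrM distrC.
have h2 : `|x / 2 + sin (x / 2)| <= 2 * `|x / 2| by rewrite (le_trans (ler_normD _ _))//; lra.
have h3 := ler_pM (normr_ge0 _) (normr_ge0 _) h h2.
rewrite (le_trans (ler_wpM2l (ler0n _ 2) h3))//.
rewrite normrM [`|2^-1|]ger0_norm//.
have := exprn_ge0 4 (normr_ge0 x); set a := `|x|; lra.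
Qed.

Lemma norm_cosB x y : `|cos x - cos y| <= `|x - y|.
Proof.
wlog xy : x y / x < y => [H|].
  have [/H//|/H|->] := ltgtP x y; last by rewrite !subrr.
  by rewrite distrC [leRHS]distrC.
have ds z : z \in `]x, y[ -> is_derive z 1 (@cos R) (- sin z).
  by move=> _; exact: is_derive_cos.
have cs : {within `[x, y], continuous (@cos R)}.
  by apply: continuous_subspaceT; exact: continuous_cos.
have [c /itvP cx E] := MVT xy ds cs.
rewrite distrC E normrM normrN [leRHS]distrC -[leRHS]mul1r ler_wpM2r//.
exact: sin_max.
Qed.

End trig_bounds.

Section charfun.
Variable R : realType.

Lemma cvg_le0 (f g : nat -> R) (l : R) : (forall n, `|f n - l| <= g n) ->
  g @ \oo --> 0 -> f @ \oo --> l.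
Proof.
move=> fg /cvgrPdist_lt g0; apply/cvgrPdist_lt => e e0.
apply: filterS (g0 e e0) => n /=; rewrite sub0r normrN distrC => h.
by rewrite (le_lt_trans (fg n))// (le_lt_trans (ler_norm _)).
Qed.

Lemma invn_cvg0 : (fun n => n%:R^-1 : R) @ \oo --> 0.
Proof.
apply/cvgrPdist_lt => e e0.
have [N _ H] := near_infty_natSinv_lt (PosNum e0).
exists N.+1 => // -[//|n] /= Nn; rewrite sub0r normrN ger0_norm//.
exact: H.
Qed.

Lemma invsqrtn_cvg0 : (fun n => (Num.sqrt n%:R)^-1 : R) @ \oo --> 0.
Proof.
apply/cvgrPdist_lt => e e0.
have e2 : 0 < e ^+ 2 by rewrite exprn_gt0.
have /cvgrPdist_lt/(_ _ e2) := invn_cvg0; apply: filterS => n /=.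
rewrite !sub0r !normrN !ger0_norm ?invr_ge0 ?sqrtr_ge0// => H.
by rewrite -(ltr_pXn2r (n := 2)) ?nnegrE ?invr_ge0 ?sqrtr_ge0 ?(ltW e0)// exprVn sqr_sqrtr.
Qed.

Lemma sqrt_nat_sqr (n : nat) : Num.sqrt n%:R ^+ 2 = n%:R :> R.
Proof. by rewrite sqr_sqrtr. Qed.

Lemma natr_mul_sqrtV2 (n : nat) : n != 0%N ->
  n%:R * ((Num.sqrt n%:R)^-1 * (Num.sqrt n%:R)^-1) = 1 :> R.
Proof.
by move=> n0; rewrite -expr2 exprVn sqrt_nat_sqr divff// pnatr_eq0.
Qed.

Lemma n_sin_cvg (z : R) :
  (fun n : nat => n%:R * (sin (z / Num.sqrt n%:R) - z / Num.sqrt n%:R)) @ \oo --> 0.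
Proof.
apply: (cvg_le0 (g := fun n => `|z| ^+ 3 * (Num.sqrt n%:R)^-1)); last first.
  by rewrite -(mulr0 (`|z| ^+ 3)); apply: cvgMl_tmp; exact: invsqrtn_cvg0.
move=> n; rewrite subr0 normrM ger0_norm//.
have [_ h] := norm_sin_sub (z / Num.sqrt n%:R).
rewrite (le_trans (ler_wpM2l _ h))// normrM exprMn [`|_^-1|]ger0_norm ?invr_ge0 ?sqrtr_ge0//.
have [->|n0] := eqVneq n 0%N; first by rewrite mul0r mulr_ge0 ?invr_ge0 ?sqrtr_ge0.
set a := (Num.sqrt _)^-1; rewrite (_ : _ * _ = n%:R * (a * a) * (`|z| ^+ 3 * a)); last by ring.
by rewrite natr_mul_sqrtV2// mul1r.
Qed.

Lemma n_cos_cvg (z : R) :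
  (fun n : nat => n%:R * (cos (z / Num.sqrt n%:R) - 1)) @ \oo --> - (z ^+ 2 / 2).
Proof.
have : (fun n : nat => n%:R * (cos (z / Num.sqrt n%:R) - 1 + (z / Num.sqrt n%:R) ^+ 2 / 2)) @ \oo --> (0 : R).
  apply: (cvg_le0 (g := fun n => `|z| ^+ 4 * n%:R^-1)); last first.
    by rewrite -(mulr0 (`|z| ^+ 4)); apply: cvgMl_tmp; exact: invn_cvg0.
  move=> n; rewrite subr0 normrM ger0_norm//.
  rewrite (le_trans (ler_wpM2l _ (norm_cos_sub _)))// normrM exprMn [`|_^-1|]ger0_norm ?invr_ge0 ?sqrtr_ge0//.
  have [->|n0] := eqVneq n 0%N; first by rewrite mul0r mulr_ge0 ?invr_ge0.
  rewrite -{3}sqrt_nat_sqr -exprVn.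
  set a := (Num.sqrt _)^-1; rewrite (_ : _ * _ = n%:R * (a * a) * (`|z| ^+ 4 * a ^+ 2)); last by ring.
  by rewrite natr_mul_sqrtV2// mul1r.
move=> /cvgrPdist_lt H; apply/cvgrPdist_lt => e e0.
have [N _ HN] := H e e0; exists N.+1 => // -[//|n] /= Nn.
have := HN n.+1 (ltnW Nn).
rewrite (_ : (0 : R) - _ = - (z ^+ 2 / 2) - n.+1%:R * (cos (z / Num.sqrt n.+1%:R) - 1))//.
rewrite expr_div_n sqrt_nat_sqr; field.
by rewrite addrC natr1 pnatr_eq0.
Qed.

Context d (T : measurableType d) (Pr : probability T R).
Local Notation intg := (intg Pr).
Local Notation Ex := (Ex Pr).

Lemma measurable_cosX (X : T -> R) : measurable_fun setT X ->
  measurable_fun setT (fun t => cos (X t)).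
Proof.
by apply: measurableT_comp; apply: continuous_measurable_fun; exact: continuous_cos.
Qed.

Lemma measurable_sinX (X : T -> R) : measurable_fun setT X ->
  measurable_fun setT (fun t => sin (X t)).
Proof.
by apply: measurableT_comp; apply: continuous_measurable_fun; exact: continuous_sin.
Qed.

Lemma intg_cos (X : T -> R) : measurable_fun setT X -> intg (fun t => cos (X t)).
Proof.
by move=> mX; apply: (@bounded_intg _ _ _ _ _ 1); [exact: measurable_cosX|move=> t; exact: cos_max].
Qed.

Lemma intg_sin (X : T -> R) : measurable_fun setT X -> intg (fun t => sin (X t)).
Proof.
by move=> mX; apply: (@bounded_intg _ _ _ _ _ 1); [exact: measurable_sinX|move=> t; exact: sin_max].
Qed.

Section expansion.
Variable Z : T -> R.
Hypotheses (sZ : sqintg Pr Z).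

Let mZn n : measurable_fun setT (fun t => Z t / Num.sqrt n%:R).
Proof. by apply: measurable_funM => //; exact: sZ.1. Qed.

(** Z has only two moments, so higher Taylor remainders need not be integrable. Dominated
    convergence replaces them: n (1 - cos(Z / sqrt n)) is at most Z^2 and converges pointwise to Z^2
    / 2. *)
Lemma Ex_cos_expansion :
  (fun n : nat => n%:R * (Ex (fun t => cos (Z t / Num.sqrt n%:R)) - 1)) @ \oo -->
  - (Ex (fun t => Z t ^+ 2) / 2).
Proof.
have E n : n%:R * (Ex (fun t => cos (Z t / Num.sqrt n%:R)) - 1) =
    Ex (fun t => n%:R * (cos (Z t / Num.sqrt n%:R) - 1)).
  rewrite ExZ ?ExB ?Ex_cst//; first exact: intg_cos.
  - exact: intg_cst.
  - by apply: intgB; [exact: intg_cos|exact: intg_cst].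
rewrite (funext E).
have -> : - (Ex (fun t => Z t ^+ 2) / 2) = Ex (fun t => - (Z t ^+ 2 / 2)).
  rewrite mulrC -mulNr -ExZ ?sZ.2//; last exact: sZ.2.
  by apply: eq_Ex => t; rewrite mulNr mulrC.
apply: (intg_dominated_cvg (h := fun t => Z t ^+ 2)).
- move=> n; apply: measurable_funM => //; apply: measurable_funB => //.
  exact: measurable_cosX.
- apply: measurableT_comp => //; apply: measurable_funM => //.
  exact: measurable_funX sZ.1.
- by move=> t; exact: n_cos_cvg.
- exact: sZ.2.
move=> n t; rewrite normrM ger0_norm// -normrN opprB ger0_norm ?onem_cos_ge0//.
rewrite (le_trans (ler_wpM2l _ (onem_cos_le _)))//.
have [->|n0] := eqVneq n 0%N; first by rewrite mul0r sqr_ge0.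
set a := (Num.sqrt _)^-1; rewrite (_ : _ * _ = n%:R * (a * a) * (Z t ^+ 2 / 2)); last by field.
by rewrite natr_mul_sqrtV2// mul1r; have := sqr_ge0 (Z t); lra.
Qed.

Lemma Ex_sin_expansion : Ex Z = 0 ->
  (fun n : nat => n%:R * Ex (fun t => sin (Z t / Num.sqrt n%:R))) @ \oo --> 0.
Proof.
move=> Z0; have iZ := sqintg_intg sZ.
have iZn n : intg (fun t => Z t / Num.sqrt n%:R).
  by apply: eq_intg (intgZ (Num.sqrt n%:R)^-1 iZ) => t; rewrite mulrC.
have E n : n%:R * Ex (fun t => sin (Z t / Num.sqrt n%:R)) =
    Ex (fun t => n%:R * (sin (Z t / Num.sqrt n%:R) - Z t / Num.sqrt n%:R)).
  rewrite ExZ ?ExB//; [|exact: intg_sin|by apply: intgB => //; exact: intg_sin].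
  rewrite (_ : Ex (fun t => Z t / Num.sqrt n%:R) = 0) ?subr0//.
  rewrite -(mulr0 (Num.sqrt n%:R)^-1) -Z0 -ExZ//.
  by apply: eq_Ex => t; rewrite mulrC.
rewrite (funext E) -[X in _ --> X](Ex_cst Pr).
apply: (intg_dominated_cvg (h := fun t => Z t ^+ 2)).
- move=> n; apply: measurable_funM => //; apply: measurable_funB => //.
  exact: measurable_sinX.
- exact: measurable_cst.
- by move=> t; exact: n_sin_cvg.
- exact: sZ.2.
move=> n t; rewrite normrM ger0_norm//.
have [h _] := norm_sin_sub (Z t / Num.sqrt n%:R).
rewrite (le_trans (ler_wpM2l _ h))//.
have [->|n0] := eqVneq n 0%N; first by rewrite mul0r sqr_ge0.
set a := (Num.sqrt _)^-1; rewrite (_ : _ * _ = n%:R * (a * a) * (Z t ^+ 2)); last by ring.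
by rewrite natr_mul_sqrtV2// mul1r.
Qed.

End expansion.

(** From e^y >= 1 + y one gets e^(-y) <= 1 / (1 + y), and then e^(-y) - 1 + y <= y^2 / (1 + y). *)
Lemma expRN_bounds (y : R) : 0 <= y -> `|expR (- y) - 1 + y| <= y ^+ 2.
Proof.
move=> y0; have h1 := expR_ge1Dx (- y); have h2 := expR_ge1Dx y.
have h3 : expR (- y) * (1 + y) <= 1.
  rewrite expRN -[leRHS](@mulVf _ (expR y)) ?gt_eqF ?expR_gt0//.
  by rewrite ler_wpM2l// invr_ge0 expR_ge0.
rewrite ger0_norm; last lra.
have := expR_gt0 (- y); set e := expR (- y) in h1 h3 *; nra.
Qed.

Lemma expR_expansion (s2 : R) : 0 <= s2 ->
  (fun n : nat => n%:R * (expR (- (s2 / 2) / n%:R) - 1)) @ \oo --> - (s2 / 2).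
Proof.
move=> s20; have h0 : 0 <= s2 / 2 by rewrite divr_ge0.
have : (fun n : nat => n%:R * (expR (- (s2 / 2 / n%:R)) - 1 + s2 / 2 / n%:R)) @ \oo --> (0 : R).
  apply: (cvg_le0 (g := fun n => (s2 / 2) ^+ 2 * n%:R^-1)); last first.
    by rewrite -(mulr0 ((s2 / 2) ^+ 2)); apply: cvgMl_tmp; exact: invn_cvg0.
  move=> n; rewrite subr0 normrM ger0_norm//.
  rewrite (le_trans (ler_wpM2l _ (expRN_bounds _)))//; first by rewrite divr_ge0.
  have [->|n0] := eqVneq n 0%N; first by rewrite mul0r mulr_ge0 ?invr_ge0 ?sqr_ge0.
  rewrite expr_div_n [n%:R ^+ 2]expr2 invfM mulrCA ler_wpM2l ?sqr_ge0//.
  by rewrite mulrA divff ?pnatr_eq0// mul1r.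
move=> /cvgrPdist_lt H; apply/cvgrPdist_lt => e e0.
have [N _ HN] := H e e0; exists N.+1 => // -[//|n] /= Nn.
have := HN n.+1 (ltnW Nn).
rewrite (_ : (0 : R) - _ = - (s2 / 2) - n.+1%:R * (expR (- (s2 / 2) / n.+1%:R) - 1))//.
rewrite mulNr; field.
by rewrite addrC natr1 pnatr_eq0.
Qed.

Lemma pow_close (a rho : R) n : `|a| <= 1 -> `|rho| <= 1 ->
  `|a ^+ n - rho ^+ n| <= n%:R * `|a - rho|.
Proof.
move=> a1 r1; elim: n => [|n ih]; first by rewrite !expr0 subrr normr0 mul0r.
rewrite !exprS (_ : _ - _ = a * (a ^+ n - rho ^+ n) + (a - rho) * rho ^+ n); last by ring.
rewrite (le_trans (ler_normD _ _))// !normrM normrX mulrSr mulrDl mul1r lerD//.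
  by rewrite (le_trans _ ih)// ler_piMl.
by rewrite ler_piMr// exprn_ile1.
Qed.

End charfun.

(** * Characteristic functions of sums of i.i.d. terms and the limit theorem *)

Section clt.
Context d (T : measurableType d) (R : realType) (Pr : probability T R).
Local Notation intg := (intg Pr).
Local Notation Ex := (Ex Pr).
Context m (V : nat -> T -> 'cV[R]_m).
Hypothesis mV : forall i, random_vector (V i).
Hypothesis indV : mutually_independent Pr V.
Hypothesis idV : identically_distributed Pr V.

(** Real and imaginary parts of (c + i s)^k. *)
Fixpoint cos_sin_rec (c s : R) (k : nat) : R * R :=
  if k is k'.+1 then
    let p := cos_sin_rec c s k' in (p.1 * c - p.2 * s, p.2 * c + p.1 * s)
  else (1, 0).

Lemma borel_cos (f : 'cV[R]_m -> R) : borel_fun f -> borel_fun (fun v => cos (f v)).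
Proof. exact: (@measurable_cosX R _ (borel_cV R m)). Qed.

Lemma borel_sin (f : 'cV[R]_m -> R) : borel_fun f -> borel_fun (fun v => sin (f v)).
Proof. exact: (@measurable_sinX R _ (borel_cV R m)). Qed.

Section one.
Variable a : 'cV[R]_m -> R.
Hypothesis ma : borel_fun a.
Let c := Ex (fun t => cos (a (V 0%N t))).
Let s := Ex (fun t => sin (a (V 0%N t))).

Let mVt i (f : 'cV[R]_m -> R) (mf : borel_fun f) : measurable_fun setT (fun t => f (V i t)) :=
  borel_comp (mV i) mf.

Let Exc i : Ex (fun t => cos (a (V i t))) = c.
Proof.
by apply: (ident_intg_Ex mV idV i (borel_cos ma) _).2; apply: intg_cos; exact: mVt.
Qed.

Let Exs i : Ex (fun t => sin (a (V i t))) = s.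
Proof.
by apply: (ident_intg_Ex mV idV i (borel_sin ma) _).2; apply: intg_sin; exact: mVt.
Qed.

Let sumS k t := \sum_(i < k) a (V i t).

Let mS k : measurable_fun setT (sumS k).
Proof. by apply: measurable_sum => i; exact: mVt. Qed.

(** The bounded factors at indices at least k are what makes the induction go through: the addition
    formulas split off the last summand, and its cosine or sine joins the product. *)
Lemma cos_sin_sum_aux k (r : seq nat) (psi : nat -> 'cV[R]_m -> R) :
  uniq r -> (forall j, j \in r -> (k <= j)%N) -> (forall j, borel_fun (psi j)) ->
  (forall j v, `|psi j v| <= 1) ->
  Ex (fun t => cos (sumS k t) * \prod_(j <- r) psi j (V j t)) =
    (cos_sin_rec c s k).1 * \prod_(j <- r) Ex (fun t => psi j (V j t)) /\
  Ex (fun t => sin (sumS k t) * \prod_(j <- r) psi j (V j t)) =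
    (cos_sin_rec c s k).2 * \prod_(j <- r) Ex (fun t => psi j (V j t)).
Proof.
elim: k r psi => [|k ih] r psi ur rk mpsi psi1.
  rewrite /= mul1r mul0r; split.
    rewrite -(indep_prod mV indV ur mpsi psi1).
    by apply: eq_Ex => t; rewrite /sumS big_ord0 cos0 mul1r.
  by rewrite -[RHS](Ex_cst Pr); apply: eq_Ex => t; rewrite /sumS big_ord0 sin0 mul0r.
have kr : k \notin r by apply/negP => /rk; rewrite ltnn.
have upd (f : 'cV[R]_m -> R) : borel_fun f -> (forall v, `|f v| <= 1) ->
    Ex (fun t => cos (sumS k t) * (f (V k t) * \prod_(j <- r) psi j (V j t))) =
    (cos_sin_rec c s k).1 * (Ex (fun t => f (V k t)) * \prod_(j <- r) Ex (fun t => psi j (V j t))) /\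
    Ex (fun t => sin (sumS k t) * (f (V k t) * \prod_(j <- r) psi j (V j t))) =
    (cos_sin_rec c s k).2 * (Ex (fun t => f (V k t)) * \prod_(j <- r) Ex (fun t => psi j (V j t))).
  move=> mf f1; pose psi' j := if j == k then f else psi j.
  have := ih (k :: r) psi' _ _ _ _; rewrite /= kr ur => /(_ isT).
  have H1 j : j \in k :: r -> (k <= j)%N.
    by rewrite inE => /predU1P[->//|/rk/ltnW].
  have H2 j : borel_fun (psi' j) by rewrite /psi'; case: ifP.
  have H3 j v : `|psi' j v| <= 1 by rewrite /psi'; case: ifP.
  have Er (G : nat -> ('cV[R]_m -> R) -> R) :
      \prod_(j <- k :: r) G j (psi' j) = G k f * \prod_(j <- r) G j (psi j).
    rewrite big_cons {1}/psi' eqxx; congr (_ * _); apply: eq_big_seq => j jr.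
    by rewrite /psi'; case: eqP => // jk; move: kr; rewrite -jk jr.
  move=> /(_ H1 H2 H3); rewrite (Er (fun j g => Ex (fun t => g (V j t)))).
  move=> [<- <-]; split; apply: eq_Ex => t; congr (_ * _);
  by rewrite (Er (fun j g => g (V j t))).
have [cc sc] := upd _ (borel_cos ma) (fun v => cos_max _).
have [cs ss] := upd _ (borel_sin ma) (fun v => sin_max _).
rewrite !Exc in cc sc; rewrite !Exs in cs ss.
have iX (g h : T -> R) : measurable_fun setT g -> (forall t, `|g t| <= 1) ->
    measurable_fun setT h -> (forall t, `|h t| <= 1) ->
    intg (fun t => g t * (h t * \prod_(j <- r) psi j (V j t))).
  move=> mg g1 mh h1; apply: (@bounded_intg _ _ _ _ _ 1).
    apply: measurable_funM => //; apply: measurable_funM => //.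
    by apply: measurable_prod => j _; exact: mVt.
  move=> t; rewrite normrM mulr_ile1// normrM mulr_ile1//.
  rewrite (le_trans (@norm_prod_le R (fun j => psi j (V j t)) 1 r _)) ?expr1n//.
have mcS := measurable_cosX (mS k); have msS := measurable_sinX (mS k).
have mca := measurable_cosX (mVt k ma); have msa := measurable_sinX (mVt k ma).
have i1 := iX _ _ mcS (fun t => cos_max _) mca (fun t => cos_max _).
have i2 := iX _ _ msS (fun t => sin_max _) msa (fun t => sin_max _).
have i3 := iX _ _ msS (fun t => sin_max _) mca (fun t => cos_max _).
have i4 := iX _ _ mcS (fun t => cos_max _) msa (fun t => sin_max _).
split=> /=.
- rewrite mulrBl -!mulrA -cc -ss -ExB//; apply: eq_Ex => t.
  by rewrite /sumS big_ord_recr/= cosD; ring.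
- rewrite mulrDl -!mulrA -sc -cs -ExD//; apply: eq_Ex => t.
  by rewrite /sumS big_ord_recr/= sinD; ring.
Qed.

Lemma cos_sin_sum k :
  Ex (fun t => cos (sumS k t)) = (cos_sin_rec c s k).1 /\
  Ex (fun t => sin (sumS k t)) = (cos_sin_rec c s k).2.
Proof.
have H (j : nat) : borel_fun (fun _ : 'cV[R]_m => 1 : R) by apply: continuous_borel; exact: cst_continuous.
have H1 (j : nat) (v : 'cV[R]_m) : `|1 : R| <= 1 by rewrite normr1.
have [] := @cos_sin_sum_aux k [::] (fun _ _ => 1) isT (fun _ => ltac:(by [])) H H1.
rewrite !big_nil !mulr1 => <- <-.
by split; apply: eq_Ex => t; rewrite mulr1.
Qed.

(** Read off from the probabilistic meaning: both numbers are expectations of a cosine or a sine. *)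
Lemma cos_sin_rec_bound k :
  `|(cos_sin_rec c s k).1| <= 1 /\ `|(cos_sin_rec c s k).2| <= 1.
Proof.
have [<- <-] := cos_sin_sum k; split.
- by apply: Ex_le_bound; [exact/intg_cos/mS|move=> t; exact: cos_max].
- by apply: Ex_le_bound; [exact/intg_sin/mS|move=> t; exact: sin_max].
Qed.

(** A telescoping comparison of (c + i s)^k with a real power rho^k; each of the k factors
    contributes at most |c - rho| + |s|. *)
Lemma cos_sin_rec_close (rho : R) k : `|rho| <= 1 ->
  `|(cos_sin_rec c s k).1 - rho ^+ k| <= k%:R * (`|c - rho| + `|s|) /\
  `|(cos_sin_rec c s k).2| <= k%:R * `|s|.
Proof.
move=> r1; have c1 : `|c| <= 1.
  by apply: Ex_le_bound; [exact: (intg_cos Pr (mVt 0%N ma))|move=> t; exact: cos_max].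
elim: k => [|k [ih1 ih2]]; first by rewrite /= expr0 subrr normr0 !mul0r.
have [b1 b2] := cos_sin_rec_bound k.
rewrite /= exprS -natr1 !mulrDl !mul1r; move: (cos_sin_rec c s k) b1 b2 ih1 ih2.
move=> [C S] /= b1 b2 ih1 ih2; split.
  rewrite (_ : _ - _ = (C - rho ^+ k) * rho + (C * (c - rho) - S * s)); last by ring.
  rewrite (le_trans (ler_normD _ _))// lerD//.
    by rewrite normrM (le_trans _ ih1)// ler_piMr.
  rewrite (le_trans (ler_normB _ _))// !normrM lerD// ler_piMl//.
by rewrite (le_trans (ler_normD _ _))// !normrM lerD// ?(le_trans _ ih2)// ?ler_piMr// ler_piMl.
Qed.

End one.

Variable phi : 'cV[R]_m -> R.
Hypothesis mphi : borel_fun phi.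
Hypothesis sphi : sqintg Pr (fun t => phi (V 0%N t)).
Hypothesis phi0 : Ex (fun t => phi (V 0%N t)) = 0.
Let s2 := Ex (fun t => phi (V 0%N t) ^+ 2).

Lemma clt_cos_sin :
  (fun n => Ex (fun t => cos ((\sum_(i < n) phi (V i t)) / Num.sqrt n%:R))) @ \oo -->
    expR (- (s2 / 2)) /\
  (fun n => Ex (fun t => sin ((\sum_(i < n) phi (V i t)) / Num.sqrt n%:R))) @ \oo --> 0.
Proof.
have s20 : 0 <= s2 by apply: Ex_ge0 => t; exact: sqr_ge0.
pose c n := Ex (fun t => cos (phi (V 0%N t) / Num.sqrt n%:R)).
pose s n := Ex (fun t => sin (phi (V 0%N t) / Num.sqrt n%:R)).
(* Chosen so that its n-th power is exactly the limit; the total error is then at most n |c_n -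
   rho_n| + n |s_n|, and both terms vanish by the expansions. *)
pose rho n := expR (- (s2 / 2) / n%:R).
have rho1 n : `|rho n| <= 1.
  by rewrite ger0_norm ?expR_ge0// -expR0 ler_expR mulNr oppr_le0 !divr_ge0.
have rhon n : n != 0%N -> rho n ^+ n = expR (- (s2 / 2)).
  by move=> n0; rewrite -expRM_natl mulrC divfK// pnatr_eq0.
have hs : (fun n : nat => n%:R * s n) @ \oo --> 0 := Ex_sin_expansion sphi phi0.
have hc : (fun n : nat => n%:R * (c n - rho n)) @ \oo --> 0.
  rewrite (_ : (fun n : nat => n%:R * (c n - rho n)) =
    (fun n : nat => n%:R * (c n - 1) - n%:R * (rho n - 1))); last first.
    by apply/funext => n; ring.
  rewrite -(subrr (- (s2 / 2))).
  exact: cvgB (Ex_cos_expansion sphi) (expR_expansion s20).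
have ma n : borel_fun (fun v => phi v / Num.sqrt n%:R).
  by apply: (@measurable_funM _ (borel_cV R m)) => //.
have Esum n t : (\sum_(i < n) phi (V i t)) / Num.sqrt n%:R =
    \sum_(i < n) (fun v => phi v / Num.sqrt n%:R) (V i t) by rewrite mulr_suml.
have hs' : (fun n : nat => `|n%:R * s n|) @ \oo --> 0.
  by rewrite -(normr0 R); exact: cvg_norm hs.
have hc' : (fun n : nat => `|n%:R * (c n - rho n)| + `|n%:R * s n|) @ \oo --> 0.
  rewrite -[X in _ --> X](addr0 0); apply: cvgD hs'.
  by rewrite -(normr0 R); exact: cvg_norm hc.
split.
  apply/cvgrPdist_le => e e0; have /cvgrPdist_le/(_ _ e0)[N _ HN] := hc'.
  exists N.+1 => // n /= Nn; have n0 : n != 0%N by case: n Nn.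
  have := HN n (ltnW Nn); rewrite /= sub0r normrN ger0_norm ?addr_ge0//.
  apply: le_trans; rewrite -(rhon n n0) distrC.
  rewrite (eq_Ex Pr (fun t => congr1 (@cos R) (Esum n t))).
  have [-> _] := cos_sin_sum (ma n) n.
  have [h _] := cos_sin_rec_close (ma n) n (rho1 n).
  by rewrite (le_trans h)// !normrM [`|n%:R|]ger0_norm// mulrDr.
apply: cvg_le0 hs' => n; rewrite subr0.
rewrite (eq_Ex Pr (fun t => congr1 (@sin R) (Esum n t))).
have [_ ->] := cos_sin_sum (ma n) n.
have [_ h] := cos_sin_rec_close (ma n) n (rho1 n).
by rewrite (le_trans h)// !normrM [`|n%:R|]ger0_norm.
Qed.

End clt.

(** * Gaussian laws *)

Section density.
Import HBSimple HBNNSimple.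
Local Open Scope ereal_scope.
Context d (T : measurableType d) (R : realType).
Variables (mu nu : {measure set T -> \bar R}) (p : T -> R).
Hypotheses (mp : measurable_fun setT p) (p0 : forall x, (0 <= p x)%R).
Hypothesis nuE : forall A, measurable A -> nu A = \int[mu]_(x in A) (p x)%:E.

(** The identity holds for simple functions by [nuE]; monotone convergence on both sides along the
    same approximating sequence carries it to f. *)
Lemma ge0_integral_density (f : T -> R) :
  measurable_fun setT f -> (forall x, (0 <= f x)%R) ->
  \int[nu]_x (f x)%:E = \int[mu]_x (f x * p x)%:E.
Proof.
move=> mf f0.
have mf' : measurable_fun setT (EFin \o f) by exact/measurable_EFinP.
have f0' x : setT x -> 0 <= (EFin \o f) x by rewrite lee_fin.
pose h := nnsfun_approx measurableT mf'.
have hcvg x : EFin \o h ^~ x @ \oo --> (f x)%:E.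
  exact: (cvg_nnsfun_approx measurableT mf' f0' I).
have hnd x : {homo (fun n => h n x) : a b / (a <= b)%N >-> (a <= b)%R}.
  by move=> a b ab; exact/lefP/nd_nnsfun_approx.
have c1 : (fun n => \int[nu]_x (h n x)%:E) @ \oo --> \int[nu]_x (f x)%:E.
  rewrite (_ : \int[nu]_x (f x)%:E = \int[nu]_x limn (EFin \o h ^~ x)); last first.
    by apply: eq_integral => x _; apply/esym/cvg_lim => //; exact: hcvg.
  apply: (@cvg_monotone_convergence _ _ _ nu setT measurableT (fun n x => (h n x)%:E)) => //.
  - by move=> n; apply/measurable_EFinP.
  - by move=> n x _; rewrite lee_fin.
  - by move=> x _ a b ab; rewrite lee_fin; exact: hnd.
have c2 : (fun n => \int[mu]_x (h n x * p x)%:E) @ \oo --> \int[mu]_x (f x * p x)%:E.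
  rewrite (_ : \int[mu]_x (f x * p x)%:E = \int[mu]_x limn (fun n => (h n x * p x)%:E)); last first.
    apply: eq_integral => x _; apply/esym/cvg_lim => //.
    apply: cvg_EFin; first exact: nearW.
    by apply: cvgMr_tmp; exact: (fine_cvg (hcvg x)).
  apply: (@cvg_monotone_convergence _ _ _ mu setT measurableT (fun n x => (h n x * p x)%:E)) => //.
  - by move=> n; apply/measurable_EFinP; apply: measurable_funM.
  - by move=> n x _; rewrite lee_fin mulr_ge0.
  - by move=> x _ a b ab; rewrite lee_fin ler_wpM2r// hnd.
suff E n : \int[nu]_x (h n x)%:E = \int[mu]_x (h n x * p x)%:E.
  by move: c1; rewrite (funext E) => c1; exact: (cvg_unique _ c1 c2).
transitivity (\int[nu]_x (\sum_(y \in range (h n)) (y * \1_(h n @^-1` [set y]) x)%:E)).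
  by apply: eq_integral => t _; rewrite fimfunE -fsumEFin.
have mi r : measurable_fun setT (fun x => (r * \1_(h n @^-1` [set r]) x)%:E).
  by apply/measurable_EFinP; apply: measurable_funM.
rewrite ge0_integral_fsum//; last by move=> y x _; exact: nnfun_muleindic_ge0.
transitivity (\int[mu]_x (\sum_(y \in range (h n)) (y * \1_(h n @^-1` [set y]) x * p x)%:E)); last first.
  apply: eq_integral => x _; rewrite [in RHS]fimfunE fsumEFin//; congr EFin.
  by rewrite !fsbig_finite//= mulr_suml.
rewrite ge0_integral_fsum//; last 2 first.
- move=> y; apply/measurable_EFinP; apply: measurable_funM => //.
  exact/measurable_EFinP/mi.
- by move=> y x _; rewrite EFinM mule_ge0 ?lee_fin//; exact: nnfun_muleindic_ge0.
apply: eq_fsbigr => r; rewrite inE => -[x _ <-].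
have hx0 : (0 <= h n x)%R by [].
set B := h n @^-1` [set h n x]; have mB : measurable B by exact: measurable_sfunP.
under eq_integral do rewrite EFinM.
rewrite ge0_integralZl_EFin//; last by apply/measurable_EFinP; exact: measurable_indic.
rewrite integral_indic// setIT nuE//.
under [RHS]eq_integral do rewrite -mulrA EFinM.
rewrite ge0_integralZl_EFin//; last 2 first.
- by move=> y _; rewrite lee_fin mulr_ge0.
- by apply/measurable_EFinP; apply: measurable_funM.
congr (_ * _); rewrite integral_mkcond; apply: eq_integral => y _.
rewrite patchE indicE; case: ifPn => _; by rewrite ?mul1r ?mul0r.
Qed.

End density.

(** * Affine substitution in Lebesgue integrals *)

Section affine.
Import HBSimple HBNNSimple.
Variable R : realType.
Local Notation lam := (@lebesgue_measure R).

Lemma measurable_affine (a c : R) : measurable_fun setT (fun y : R => a + c * y).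
Proof. by apply: measurable_funD => //; exact: measurable_funM. Qed.

Let aff (a c : R) : measurableTypeR R -> measurableTypeR R := fun y => a + c * y.

Let measurable_aff (a c : R) : measurable_fun setT (aff a c).
Proof. exact: measurable_affine. Qed.

(** The right side is a measure in A that agrees with Lebesgue measure on intervals ]p, q], so
    uniqueness applies. For negative c the preimage of such an interval is closed on the left
    instead, with the same length. *)
Lemma lebesgue_affine (a c : R) (A : set R) : c != 0 -> measurable A ->
  lam A = (`|c|%:E * lam [set y | A (a + c * y)%R])%E.
Proof.
move=> c0 mA.
pose push : {measure set (measurableTypeR R) -> \bar R} :=
  measure_function_pushforward__canonical__measure_function_Measure lam (measurable_aff a c).
have cn : 0 <= `|c| by [].
pose mu : {measure set (measurableTypeR R) -> \bar R} := mscale (NngNum cn) push.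
rewrite (@lebesgue_measure_unique R mu)// => X [[p q] /= _ <-].
rewrite /mu /mscale /= /pushforward lebesgue_measure_itv/=.
have [cp|cn'] := ltP 0 c.
- have -> : (fun y => a + c * y) @^-1` `]p, q] = `](p - a) / c, (q - a) / c]%classic.
    apply/seteqP; split => y /=; rewrite !in_itv/= ltr_pdivrMr// ler_pdivlMr// => /andP[h1 h2];
    by apply/andP; split; lra.
  rewrite lebesgue_measure_itv/= (gtr0_norm cp) !lte_fin ltr_pM2r ?invr_gt0// ltrD2r.
  case: ifPn => _; last by rewrite mule0.
  by rewrite -!EFinD -EFinM; congr EFin; field; rewrite gt_eqF.
- have {}cn' : c < 0 by rewrite lt_neqAle c0.
  have -> : (fun y => a + c * y) @^-1` `]p, q] = `[(q - a) / c, (p - a) / c[%classic.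
    apply/seteqP; split => y /=; rewrite !in_itv/= ler_ndivrMr// ltr_ndivlMr// => /andP[h1 h2];
    by apply/andP; split; lra.
  rewrite lebesgue_measure_itv/= (ltr0_norm cn') !lte_fin ltr_nM2r ?invr_lt0// ltrD2r.
  case: ifPn => _; last by rewrite mule0.
  by rewrite -!EFinD -EFinM; congr EFin; field; rewrite lt_eqF.
Qed.

Lemma ge0_integral_affine (a c : R) (f : R -> R) : c != 0 ->
  measurable_fun setT f -> (forall x, 0 <= f x) ->
  (\int[lam]_x (f x)%:E = `|c|%:E * \int[lam]_y (f (a + c * y)%R)%:E)%E.
Proof.
move=> c0 mf f0.
pose push : {measure set (measurableTypeR R) -> \bar R} :=
  measure_function_pushforward__canonical__measure_function_Measure lam (measurable_aff a c).
have cn : 0 <= `|c| by [].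
pose mu : {measure set (measurableTypeR R) -> \bar R} := mscale (NngNum cn) push.
transitivity (\int[mu]_x (f x)%:E)%E.
  apply: eq_measure_integral => A mA _.
  exact: lebesgue_affine.
have mf' : measurable_fun setT (EFin \o f) by exact/measurable_EFinP.
rewrite /mu ge0_integral_mscale//=; last by move=> x _; rewrite lee_fin.
congr (_ * _)%E.
have p0 : {in [set: R], forall y : R, (0 <= (EFin \o f) y)%E} by move=> y _; rewrite lee_fin.
exact: (ge0_integral_pushforward (measurable_aff a c) lam measurableT mf' p0).
Qed.

End affine.

(** * Stability of the standard normal law *)

Section gaussian.
Variable R : realType.
Local Notation lam := (@lebesgue_measure R).
Local Notation GR := (measurableTypeR R).

Definition stdnormal : probability (measurableTypeR R) R := normal_prob 0 1.
Local Notation N01 := stdnormal.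

Lemma ge0_integral_normal (m s : R) (f : R -> R) :
  measurable_fun setT f -> (forall x, 0 <= f x) ->
  (\int[normal_prob m s]_x (f x)%:E = \int[lam]_x (f x * normal_pdf m s x)%:E)%E.
Proof.
move=> mf f0; apply: ge0_integral_density => //.
- exact: measurable_normal_pdf.
- by move=> x; exact: normal_pdf_ge0.
Qed.

Lemma normal_peakM (s c : R) : normal_peak (c * s) = `|c|^-1 * normal_peak s.
Proof.
rewrite /normal_peak exprMn -mulrA -mulrnAr sqrtrM ?sqr_ge0// sqrtr_sqr invfM.
by rewrite mulrnAr.
Qed.

Lemma normal_pdf_affine (a c y : R) : c != 0 ->
  `|c| * normal_pdf a `|c| (a + c * y) = normal_pdf 0 1 y.
Proof.
move=> c0; have nc0 : `|c| != 0 by rewrite normr_eq0.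
rewrite !normal_pdfE ?oner_neq0// -[X in normal_peak X]mulr1 normal_peakM normr_id.
rewrite mulrA mulrA mulfV// mul1r; congr (_ * expR _).
by rewrite subr0 real_normK ?num_real//; field.
Qed.

Lemma normal_affine (a c : R) (A : set R) : c != 0 -> measurable A ->
  N01 [set y | A (a + c * y)] = normal_prob a `|c| A.
Proof.
move=> c0 mA; rewrite /= /normal_prob integral_mkcond [RHS]integral_mkcond.
pose f x := \1_A x * normal_pdf a `|c| x.
have mf : measurable_fun setT f.
  by apply: measurable_funM; [exact: measurable_indic|exact: measurable_normal_pdf].
have f0 x : 0 <= f x by rewrite mulr_ge0 ?normal_pdf_ge0.
transitivity (\int[lam]_x (f x)%:E)%E; last first.
  apply: eq_integral => x _; rewrite /f patchE indicE.
  by case: ifPn => _; rewrite ?mul1r ?mul0r.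
rewrite (ge0_integral_affine a c0 mf f0) -ge0_integralZl_EFin//; last 2 first.
- by move=> x _; rewrite lee_fin.
- apply/measurable_EFinP; apply: (@measurableT_comp _ _ _ _ _ _ f) => //.
  exact: measurable_affine.
apply: eq_integral => y _; rewrite patchE -EFinM /f indicE.
rewrite (_ : (y \in [set y0 | A (a + c * y0)]) = (a + c * y \in A)); last first.
  by apply/idP/idP; rewrite !inE.
case: ifPn => _; last by rewrite mul0r mulr0.
by rewrite mul1r normal_pdf_affine.
Qed.

(** Completing the square. For independent standard normal X and Y, both sides are the joint density
    of (X, aX + bY) at (x, w): on the left X first, on the right aX + bY first, with standard
    deviation tau, and then X given its value. *)
Lemma normal_pdf_square (a b x w : R) (tau := Num.sqrt (a ^+ 2 + b ^+ 2)) : b != 0 ->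
  normal_pdf 0 1 x * normal_pdf (a * x) `|b| w =
  normal_pdf 0 tau w * normal_pdf (a / tau ^+ 2 * w) (`|b| / tau) x.
Proof.
move=> b0; have nb0 : `|b| != 0 by rewrite normr_eq0.
have tE : tau ^+ 2 = a ^+ 2 + b ^+ 2 by rewrite sqr_sqrtr// addr_ge0 ?sqr_ge0.
have t0 : 0 < tau.
  by rewrite sqrtr_gt0 ltr_wpDl ?sqr_ge0// exprn_even_gt0.
have tn0 : tau != 0 by rewrite gt_eqF.
rewrite !normal_pdfE ?oner_neq0// ?mulf_neq0 ?invr_neq0//.
rewrite mulrACA [RHS]mulrACA; congr (_ * _).
  rewrite [in RHS]mulrC -[`|b| / tau]mulr1.
  rewrite [in RHS](_ : `|b| / tau * 1 = tau^-1 * `|b|); last by rewrite mulr1 mulrC.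
  rewrite normal_peakM -[X in _ = _ * normal_peak X]mulr1 normal_peakM.
  rewrite normfV invrK (gtr0_norm t0) [RHS]mulrACA mulfV// mul1r mulrC //.
rewrite /normal_fun -!expRD; congr expR.
rewrite expr_div_n !real_normK ?num_real// tE.
have b2 : b ^+ 2 != 0 by rewrite expf_neq0.
have ab2 : a ^+ 2 + b ^+ 2 != 0 by rewrite -tE expf_neq0.
by field; rewrite ab2 b0.
Qed.

Lemma stdnormal_abs (a : R) (A : set R) : measurable A ->
  N01 [set y | A (a * y)] = N01 [set y | A (`|a| * y)].
Proof.
move=> mA; have [->|a0] := eqVneq a 0; first by rewrite normr0.
have E c : [set y | A (c * y)] = [set y | A (0 + c * y)].
  by apply/seteqP; split => y /=; rewrite add0r.
have na0 : `|a| != 0 by rewrite normr_eq0.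
transitivity (N01 [set y | A (0 + a * y)]); first by rewrite -E.
transitivity (N01 [set y | A (0 + `|a| * y)]); last by rewrite -E.
by rewrite (normal_affine 0 a0 mA) (normal_affine 0 na0 mA) normr_id.
Qed.

Lemma measurable_normal_pdf2 (a b : R) : b != 0 ->
  measurable_fun setT (fun z : GR * GR => normal_pdf (a * z.1) b z.2).
Proof.
move=> b0; under eq_fun do rewrite normal_pdfE//.
apply: measurable_funM => //; apply: measurableT_comp => //.
apply: measurable_funM => //; apply: measurableT_comp => //.
apply: measurable_funX; apply: measurable_funB => //.
by apply: measurable_funM.
Qed.

Lemma integral_cst_normal_pdf (k m s : R) : 0 <= k ->
  (\int[lam]_x (k%:E * (normal_pdf m s x)%:E) = k%:E)%E.
Proof.
move=> k0; rewrite ge0_integralZl_EFin//; last 2 first.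
- by move=> x _; rewrite lee_fin normal_pdf_ge0.
- by apply/measurable_EFinP; exact: measurable_normal_pdf.
by rewrite integral_normal_pdf mule1.
Qed.

(** The law of aX + bY. The factorisation of the joint density and Tonelli's theorem allow x to be
    integrated out first; the conditional density of X has mass one. The case b != 0 is needed for
    that density to exist. *)
Lemma integral_stdnormal_indic (a b : R) (A : set R) : b != 0 -> measurable A ->
  (\int[N01]_x N01 [set y | A (a * x + b * y)%R] =
   N01 [set z | A (Num.sqrt (a ^+ 2 + b ^+ 2) * z)%R])%E.
Proof.
move=> b0 mA; have nb0 : `|b| != 0 by rewrite normr_eq0.
set tau := Num.sqrt _.
have t0 : 0 < tau.
  by rewrite sqrtr_gt0 ltr_wpDl ?sqr_ge0// exprn_even_gt0.
have tn0 : tau != 0 by rewrite gt_eqF.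
pose h (z : GR * GR) := \1_A z.2 * normal_pdf (a * z.1) `|b| z.2.
have mh : measurable_fun setT h.
  apply: measurable_funM; last exact: measurable_normal_pdf2.
  by apply: measurableT_comp => //; exact: measurable_indic.
have h0 z : 0 <= h z by rewrite mulr_ge0 ?normal_pdf_ge0.
have hE x : N01 [set y | A (a * x + b * y)] = (\int[lam]_w (h (x, w))%:E)%E.
  rewrite (normal_affine _ b0 mA) /normal_prob integral_mkcond; apply: eq_integral => w _.
  by rewrite patchE /h /= indicE; case: ifPn => _; rewrite ?mul1r ?mul0r.
pose f x := fine (\int[lam]_w (h (x, w))%:E).
have fE x : (f x)%:E = (\int[lam]_w (h (x, w))%:E)%E.
  by rewrite /f fineK// -hE (normal_affine _ b0 mA) fin_num_measure.
have mhE : measurable_fun setT (EFin \o h) by exact/measurable_EFinP.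
have h0E z : (0 <= (EFin \o h) z)%E by rewrite lee_fin.
have mf : measurable_fun setT f.
  apply/measurable_EFinP; rewrite (_ : EFin \o f = fubini_F lam (EFin \o h)).
    exact: measurable_fun_fubini_tonelli_F.
  by apply/funext => x; rewrite /= fE.
have f0 x : 0 <= f x by rewrite -lee_fin fE integral_ge0// => w _; rewrite lee_fin.
transitivity (\int[N01]_x (f x)%:E)%E.
  by apply: eq_integral => x _; rewrite fE -hE.
rewrite ge0_integral_normal//.
pose k (z : GR * GR) := normal_pdf 0 1 z.1 * h z.
have mk : measurable_fun setT (EFin \o k).
  apply/measurable_EFinP; apply: measurable_funM => //.
  by apply: measurableT_comp => //; exact: measurable_normal_pdf.
have k0 z : (0 <= (EFin \o k) z)%E by rewrite lee_fin mulr_ge0// normal_pdf_ge0.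
transitivity (\int[lam]_x \int[lam]_w (k (x, w))%:E)%E.
  apply: eq_integral => x _; rewrite mulrC EFinM fE -ge0_integralZl_EFin//.
  - by move=> w _; rewrite lee_fin.
  - apply/measurable_EFinP; apply: (measurableT_comp mh).
    exact: measurable_pair1.
  - exact: normal_pdf_ge0.
have FT := @fubini_tonelli _ _ GR GR R lam lam (EFin \o k) mk k0.
etransitivity; first exact: FT.
rewrite (_ : [set z | A (tau * z)] = [set z | A (0 + tau * z)]); last first.
  by apply/seteqP; split => y /=; rewrite add0r.
rewrite (normal_affine 0 tn0 mA) (gtr0_norm t0) /normal_prob [RHS]integral_mkcond.
apply: eq_integral => w _; rewrite patchE /=.
transitivity (\int[lam]_x ((\1_A w * normal_pdf 0 tau w)%:E *
    (normal_pdf (a / tau ^+ 2 * w) (`|b| / tau) x)%:E))%E.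
  apply: eq_integral => x _.
  by rewrite /k /h /= mulrCA (normal_pdf_square a x w b0) -/tau mulrA EFinM.
have c0 : 0 <= \1_A w * normal_pdf 0 tau w by rewrite mulr_ge0 ?normal_pdf_ge0.
etransitivity; first exact: (integral_cst_normal_pdf (a / tau ^+ 2 * w) (`|b| / tau) c0).
by rewrite indicE; case: ifPn => _; rewrite ?mul1r ?mul0r.
Qed.

Lemma stdnormal_stable (a b : R) (A : set R) : measurable A ->
  (\int[N01]_x N01 [set y | A (a * x + b * y)%R] =
   N01 [set z | A (Num.sqrt (a ^+ 2 + b ^+ 2) * z)%R])%E.
Proof.
(* For b = 0 the inner probability is the indicator that a x lies in A, and the claim reduces to the
   symmetry of the law. *)
move=> mA; have [->|b0] := eqVneq b 0; last exact: integral_stdnormal_indic.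
rewrite expr0n addr0 sqrtr_sqr -stdnormal_abs//.
have mB : measurable [set y | A (a * y)].
  rewrite -[X in measurable X]setTI.
  exact: (measurable_funM (measurable_cst a) (@measurable_id _ _ setT)).
rewrite -(setIT [set y | A (a * y)]) -(integral_indic N01)//.
apply: eq_integral => x _; rewrite indicE.
have [Ax|Ax] := pselect (A (a * x)).
  rewrite mem_set// (_ : [set y | _] = setT) ?probability_setT//.
  by apply/seteqP; split => y //= _; rewrite mul0r addr0.
rewrite memNset// (_ : [set y | _] = set0) ?measure0//.
by apply/seteqP; split => y //=; rewrite mul0r addr0.
Qed.

(** Gives the Dirac mass and the nondegenerate normal law one common form, the law of sqrt v times a
    standard normal, so later arguments need no case distinction. *)
Lemma centered_normalE (v : R) (A : set R) : 0 <= v -> measurable A ->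
  centered_normal v A = N01 [set z | A (Num.sqrt v * z)].
Proof.
move=> v0 mA; rewrite /centered_normal; case: ifPn => [/eqP ->|vn0].
  rewrite sqrtr0 diracE; have [A0|A0] := pselect (A 0).
    rewrite mem_set// (_ : [set y | _] = setT) ?probability_setT//.
    by apply/seteqP; split => y //= _; rewrite mul0r.
  rewrite memNset// (_ : [set y | _] = set0) ?measure0//.
  by apply/seteqP; split => y //=; rewrite mul0r.
have sv : 0 < Num.sqrt v by rewrite sqrtr_gt0 lt_neqAle eq_sym vn0.
rewrite (_ : [set z | A (Num.sqrt v * z)] = [set z | A (0 + Num.sqrt v * z)]); last first.
  by apply/seteqP; split => y /=; rewrite add0r.
by rewrite (normal_affine 0 (lt0r_neq0 sv) mA) (gtr0_norm sv).
Qed.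

End gaussian.

(** * The second moment of the standard normal law *)

Section stdnormal_moments.
Variable R : realType.
Local Notation lam := (@lebesgue_measure R).
Local Notation GR := (measurableTypeR R).
Local Notation N01 := (stdnormal R).
Local Notation Ex := (Ex N01).
Local Notation intg := (intg N01).

(** The integrand times the normal density is a multiple of the normal density of variance 1 / (1 +
    2h). This Laplace transform of Y^2 will give E Y^2 as its slope at h = 0. *)
Lemma stdnormal_expR (h : R) : 0 <= h ->
  Ex (fun y => expR (- h * y ^+ 2)) = (Num.sqrt (1 + 2 * h))^-1.
Proof.
move=> h0; set s := _^-1.
have q0 : 0 < 1 + 2 * h by rewrite ltr_wpDr// mulr_ge0.
have s0 : 0 < s by rewrite invr_gt0 sqrtr_gt0.
have s2 : s ^+ 2 = (1 + 2 * h)^-1 by rewrite exprVn sqr_sqrtr// ltW.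
have mf : measurable_fun setT (fun y : R => expR (- h * y ^+ 2)).
  by apply: measurableT_comp => //; apply: measurable_funM => //; exact: exprn_measurable.
have f0 (y : R) : 0 <= expR (- h * y ^+ 2) by exact: expR_ge0.
rewrite ExE (ge0_integral_normal 0 1 mf f0).
transitivity (fine (\int[lam]_y (s%:E * (normal_pdf 0 s y)%:E))%E); last first.
  by rewrite integral_cst_normal_pdf// ltW.
congr fine; apply: eq_integral.
  move=> y _; rewrite -EFinM !normal_pdfE ?oner_neq0 ?gt_eqF//.
  rewrite -[X in normal_peak X * normal_fun 0 s y]mulr1 normal_peakM (gtr0_norm s0).
  have sn0 : s != 0 by rewrite gt_eqF.
  rewrite [RHS](_ : _ = (normal_peak 1 * normal_fun 0 s y)%:E); last by congr EFin; field.
  rewrite mulrCA /normal_fun -expRD; congr (_ * expR _)%:E.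
  by rewrite !subr0 s2; field; rewrite gt_eqF.
Qed.

Lemma stdnormal_sqintg : sqintg N01 (fun y : GR => y).
Proof.
split; first exact: measurable_id.
have mf : measurable_fun setT (fun y : R => y ^+ 2) by exact: exprn_measurable.
apply/integrableP; split; first exact/measurable_EFinP.
have -> : (\int[N01]_y `|(EFin \o (fun t : GR => ((t : R) ^+ 2)%R)) y| =
    \int[N01]_y (((y : R) ^+ 2)%R)%:E)%E.
  by apply: eq_integral => y _; rewrite /= ger0_norm ?sqr_ge0.
rewrite (ge0_integral_normal 0 1 mf (@sqr_ge0 R)).
(* Since y^2 <= 4 exp(y^2 / 4), the integrand is at most 4 exp(- y^2 / 4) up to the peak, a multiple
   of the normal density of variance 2; comparing the peaks yields the factor s. *)
pose s : R := Num.sqrt 2.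
have s0 : 0 < s by rewrite sqrtr_gt0.
have s2 : s ^+ 2 = 2 by rewrite sqr_sqrtr.
apply: (@le_lt_trans _ _ (\int[lam]_y ((4 * s)%:E * (normal_pdf 0 s y)%:E))%E).
  apply: ge0_le_integral => //.
  - by move=> y _; rewrite lee_fin mulr_ge0 ?sqr_ge0// normal_pdf_ge0.
  - apply/measurable_EFinP; apply: measurable_funM => //; exact: measurable_normal_pdf.
  - apply/measurable_EFinP; apply: measurable_funM => //; exact: measurable_normal_pdf.
  move=> y _; rewrite -EFinM lee_fin !normal_pdfE ?oner_neq0 ?gt_eqF//.
  rewrite -[X in normal_peak X * normal_fun 0 s y]mulr1 normal_peakM (gtr0_norm s0).
  rewrite [leRHS](_ : _ = normal_peak 1 * (4 * normal_fun 0 s y)); last first.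
    by field; rewrite gt_eqF.
  rewrite mulrCA ler_wpM2l ?normal_peak_ge0//.
  rewrite (_ : normal_fun 0 1 y = expR (- (y ^+ 2 / 4)) * expR (- (y ^+ 2 / 4))); last first.
    by rewrite -expRD /normal_fun; congr expR; field.
  rewrite (_ : normal_fun 0 s y = expR (- (y ^+ 2 / 4))); last first.
    by rewrite /normal_fun s2; congr expR; field.
  rewrite mulrA ler_wpM2r ?expR_ge0//.
  have := expR_ge1Dx (y ^+ 2 / 4); have e0 := expR_gt0 (y ^+ 2 / 4).
  rewrite expRN ler_pdivrMr// => h; lra.
by rewrite integral_cst_normal_pdf ?ltry// mulr_ge0// ltW.
Qed.

(** The limit of n (1 - E exp(- Y^2 / n)) is computed twice: it is E Y^2 by dominated convergence,
    and 1 by the closed form with h = 1 / n. *)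
Lemma stdnormal_sqr : Ex (fun y => y ^+ 2) = 1.
Proof.
have mf : measurable_fun setT (fun y : GR => y ^+ 2) by exact: exprn_measurable.
have mg (n : nat) : measurable_fun setT (fun y : GR => expR (- (y ^+ 2 / n%:R))).
  apply: measurableT_comp => //; apply: measurableT_comp => //.
  exact: measurable_funM.
have gb n (y : R) : 0 <= expR (- (y ^+ 2 / n%:R)) <= 1.
  by rewrite expR_ge0 -expR0 ler_expR oppr_le0 divr_ge0 ?sqr_ge0.
have ig (n : nat) : intg (fun y : GR => expR (- (y ^+ 2 / n%:R))).
  apply: (@bounded_intg _ _ _ _ _ 1) => // y; have /andP[h1 h2] := gb n y.
  by rewrite ger0_norm.
have c1 : (fun n : nat => Ex (fun y => n%:R * (1 - expR (- (y ^+ 2 / n%:R))))) @ \oo -->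
    Ex (fun y => y ^+ 2).
  apply: (@intg_dominated_cvg _ _ _ N01
    (fun n (y : GR) => n%:R * (1 - expR (- ((y : R) ^+ 2 / n%:R))))
    (fun y : GR => (y : R) ^+ 2) (fun y : GR => (y : R) ^+ 2)) => //.
  - by move=> n; apply: measurable_funM => //; apply: measurable_funB.
  - move=> y; have s20 : 0 <= 2 * y ^+ 2 by rewrite mulr_ge0 ?sqr_ge0.
    rewrite (_ : (fun n : nat => n%:R * (1 - expR (- (y ^+ 2 / n%:R)))) =
        (fun n : nat => - (n%:R * (expR (- (2 * y ^+ 2 / 2) / n%:R) - 1)))); last first.
      apply/funext => n; rewrite (_ : 2 * y ^+ 2 / 2 = y ^+ 2); last by field.
      by rewrite mulNr; ring.
    rewrite [X in _ --> X](_ : _ = - - (2 * y ^+ 2 / 2)); last by field.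
    by apply: cvgN; exact: expR_expansion.
  - exact: stdnormal_sqintg.2.
  - move=> n y; have /andP[h1 h2] := gb n y.
    rewrite ger0_norm ?mulr_ge0 ?subr_ge0//.
    have [->|n0] := eqVneq n 0%N; first by rewrite mul0r sqr_ge0.
    have := expR_ge1Dx (- (y ^+ 2 / n%:R)) => h.
    rewrite mulrC -ler_pdivlMr ?ltr0n ?lt0n//; lra.
have c2 : (fun n : nat => Ex (fun y => n%:R * (1 - expR (- (y ^+ 2 / n%:R))))) @ \oo --> (1 : R).
  have E n : n != 0%N -> Ex (fun y => n%:R * (1 - expR (- (y ^+ 2 / n%:R)))) =
      n%:R * (1 - (Num.sqrt (1 + 2 * n%:R^-1))^-1).
    move=> n0; rewrite ExZ ?ExB ?Ex_cst//; last 2 first.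
    - exact: intg_cst.
    - by apply: intgB => //; exact: intg_cst.
    congr (_ * (_ - _)); rewrite -stdnormal_expR; last by rewrite invr_ge0.
    by apply: eq_Ex => y; congr expR; rewrite mulNr mulrC.
  apply/cvgrPdist_le => e e0.
  have /cvgrPdist_le/(_ (e / 2)) := @invn_cvg0 R.
  rewrite divr_gt0// => /(_ isT)[N _ HN]; exists N.+1 => // n /= Nn.
  have n0 : n != 0%N by case: n Nn.
  have nr0 : 0 < n%:R :> R by rewrite ltr0n lt0n.
  have := HN n (ltnW Nn); rewrite /= sub0r normrN ger0_norm// E//.
  have vE : n%:R * n%:R^-1 = 1 :> R by rewrite mulfV ?gt_eqF.
  have v0 : 0 < n%:R^-1 :> R by rewrite invr_gt0.
  set v := n%:R^-1 in vE v0 *; set k := n%:R in vE nr0 *.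
  move=> ve.
  have q1 : 1 <= 1 + 2 * v by lra.
  have r1 : 1 <= Num.sqrt (1 + 2 * v) by rewrite -[leLHS]sqrtr1 ler_wsqrtr.
  have r2 : Num.sqrt (1 + 2 * v) ^+ 2 = 1 + 2 * v by rewrite sqr_sqrtr; lra.
  set r := Num.sqrt _ in r1 r2 *.
  have rV : r * r^-1 = 1 by rewrite mulfV//; lra.
  (* With r = sqrt(1 + 2 / k) one has k = 2 / (r^2 - 1), which removes k and leaves an expression
     continuous at r = 1 with value 1. *)
  have kE : k * (1 - r^-1) = 2 / (r ^+ 2 + r).
    have r0 : r != 0 by lra.
    have rr : r ^+ 2 + r != 0 by nra.
    have kE : k = 2 / (r ^+ 2 - 1).
      by rewrite r2 addrAC subrr add0r invfM mulrA mulfV// mul1r -[k]invrK.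
    have r21 : r ^+ 2 - 1 != 0 by lra.
    by rewrite kE; field; rewrite r0 rr r21.
  have rr : 0 < r ^+ 2 + r by nra.
  rewrite kE ger0_norm.
    by rewrite lerBlDr -lerBlDl ler_pdivlMr//; nra.
  by rewrite subr_ge0 ler_pdivrMr//; nra.
exact: (cvg_unique _ c1 c2).
Qed.

End stdnormal_moments.

(** * The characteristic function of the standard normal law *)

Section stdnormal_charfun.
Variable R : realType.
Local Notation GR := (measurableTypeR R).
Local Notation N01 := (stdnormal R).
Local Notation Ex := (Ex N01).
Local Notation intg := (intg N01).

Lemma measurable_scale (c : R) : measurable_fun setT (fun y : GR => (c * y : GR)).
Proof. exact: measurable_funM. Qed.

Section stable_fun.
Variables (a b : R) (f : R -> R).
Hypotheses (mf : measurable_fun setT f) (f0 : forall x, 0 <= f x).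

Let phi (p : GR * GR) : GR := a * p.1 + b * p.2.

Let mphi : measurable_fun setT phi.
Proof. by apply: measurable_funD; apply: measurable_funM. Qed.

(** Stability says that the image of the product law under (x, y) -> a x + b y is the law of
    sqrt(a^2 + b^2) z; integrating f against the two equal measures extends it from sets to
    functions. *)
Lemma stdnormal_stable_fun :
  (\int[N01]_x \int[N01]_y (f (a * x + b * y)%R)%:E =
   \int[N01]_z (f (Num.sqrt (a ^+ 2 + b ^+ 2) * z)%R)%:E)%E.
Proof.
set tau := Num.sqrt _.
pose prod : {measure set (GR * GR) -> \bar R} := (N01 \x N01)%E.
pose m1 : {measure set GR -> \bar R} :=
  measure_function_pushforward__canonical__measure_function_Measure prod mphi.
pose m2 : {measure set GR -> \bar R} :=
  measure_function_pushforward__canonical__measure_function_Measure N01 (measurable_scale tau).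
have mfE : measurable_fun [set: GR] (EFin \o f) by exact/measurable_EFinP.
have fE0 : {in [set: GR], forall y : GR, (0 <= (EFin \o f) y)%E}.
  by move=> y _; rewrite lee_fin.
have E1 : (\int[m1]_x (f x)%:E = \int[prod]_p (f (phi p))%:E)%E.
  exact: (ge0_integral_pushforward mphi prod measurableT mfE fE0).
have E2 : (\int[m2]_x (f x)%:E = \int[N01]_z (f (tau * z)%R)%:E)%E.
  exact: (ge0_integral_pushforward (measurable_scale tau) N01 measurableT mfE fE0).
have mfphi : measurable_fun setT (fun p => (f (phi p))%:E).
  by apply/measurable_EFinP; exact: measurableT_comp mphi.
have E3 : (\int[prod]_p (f (phi p))%:E = \int[N01]_x \int[N01]_y (f (a * x + b * y)%R)%:E)%E.
  apply: (fubini_tonelli1 (fun p => (f (phi p))%:E) mfphi).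
  by move=> p; rewrite lee_fin.
rewrite -E3 -E1 -E2; apply: eq_measure_integral => A mA _.
transitivity (\int[N01]_x N01 [set y | A (a * x + b * y)%R])%E.
  apply: eq_integral => x _; congr (normal_prob 0 1 _).
  by apply/seteqP; split => y /=; rewrite /xsection /= inE.
exact: stdnormal_stable.
Qed.

End stable_fun.

Lemma measurable_sinM (c : R) : measurable_fun setT (fun y : GR => sin (c * y)).
Proof. by apply: measurable_sinX; exact: measurable_scale. Qed.

(** By the substitution y -> - y. Adding 1 makes the integrand nonnegative, as the substitution rule
    requires. *)
Lemma stdnormal_sin (c : R) : Ex (fun y => sin (c * y)) = 0.
Proof.
have ic : intg (fun y => sin (c * y)) by apply: intg_sin; exact: measurable_scale.
have iN : intg (fun y => sin (- c * y)) by apply: intg_sin; exact: measurable_scale.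
have mS (k : R) : measurable_fun setT (fun y : R => 1 + sin (k * y)).
  by apply: measurable_funD => //; exact: measurable_sinM.
have S0 (k y : R) : 0 <= 1 + sin (k * y) by have := sin_geN1 (k * y); lra.
have H (k : R) : Ex (fun y => 1 + sin (k * y)) =
    fine (\int[@lebesgue_measure R]_x ((1 + sin (k * x)) * normal_pdf 0 1 x)%:E)%E.
  by rewrite ExE (ge0_integral_normal 0 1 (mS k) (S0 k)).
have E : Ex (fun y => 1 + sin (c * y)) = Ex (fun y => 1 + sin (- c * y)).
  rewrite !H; congr fine.
  have n10 : (-1 : R) != 0 by rewrite oppr_eq0 oner_eq0.
  have mg : measurable_fun setT (fun x : R => (1 + sin (c * x)) * normal_pdf 0 1 x).
    by apply: measurable_funM; [exact: mS|exact: measurable_normal_pdf].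
  have g0 (x : R) : 0 <= (1 + sin (c * x)) * normal_pdf 0 1 x.
    by rewrite mulr_ge0 ?normal_pdf_ge0.
  rewrite (ge0_integral_affine 0 n10 mg g0) normrN1 mul1e.
  apply: eq_integral => x _; rewrite add0r mulN1r mulrN mulNr; congr (_ * _)%:E.
  have o0 : (1 : R) != 0 by rewrite oner_eq0.
  by rewrite !normal_pdfE// /normal_fun !subr0 sqrrN.
rewrite !ExD ?Ex_cst// in E; try exact: intg_cst.
have E' : Ex (fun y => sin (- c * y)) = - Ex (fun y => sin (c * y)).
  by rewrite -ExN//; apply: eq_Ex => y; rewrite mulNr sinN.
by move: E; rewrite E'; lra.
Qed.

(** Stability applied to the nonnegative function 1 + cos, followed by the addition formula; the
    sine terms integrate to zero. *)
Lemma stdnormal_cos_mul (a b : R) :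
  Ex (fun y => cos (Num.sqrt (a ^+ 2 + b ^+ 2) * y)) =
  Ex (fun y => cos (a * y)) * Ex (fun y => cos (b * y)).
Proof.
set tau := Num.sqrt _.
have ic (k : R) : intg (fun y => cos (k * y)) by apply: intg_cos; exact: measurable_scale.
have is_ (k : R) : intg (fun y => sin (k * y)) by apply: intg_sin; exact: measurable_scale.
have mf : measurable_fun setT (fun y : R => 1 + cos y).
  apply: measurable_funD => //; apply: continuous_measurable_fun; exact: continuous_cos.
have f0 (y : R) : 0 <= 1 + cos y by have := cos_geN1 y; lra.
have := stdnormal_stable_fun a b mf f0; rewrite -/tau.
have i1 (k : R) : intg (fun y => 1 + cos (k * y)) by apply: intgD => //; exact: intg_cst.
rewrite ExEE//.
have E x : (\int[N01]_y (1 + cos (a * x + b * y))%:E =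
    (1 + Ex (fun y => cos (b * y)) * cos (a * x))%:E)%E.
  have ix : intg (fun y => cos (a * x) * cos (b * y)) by exact: intgZ.
  have ix' : intg (fun y => sin (a * x) * sin (b * y)) by exact: intgZ.
  transitivity (\int[N01]_y (1 + (cos (a * x) * cos (b * y) - sin (a * x) * sin (b * y)))%:E)%E.
    by apply: eq_integral => y _; rewrite cosD.
  rewrite ExEE; last by apply: intgD; [exact: intg_cst|exact: intgB].
  rewrite ExD; [|exact: intg_cst|exact: intgB].
  by rewrite Ex_cst ExB// !ExZ// stdnormal_sin mulr0 subr0 mulrC.
under eq_integral do rewrite E.
have i2 : intg (fun x => 1 + Ex (fun y => cos (b * y)) * cos (a * x)).
  by apply: intgD; [exact: intg_cst|exact: intgZ].
rewrite ExEE// => -[]; rewrite !ExD//; try exact: intg_cst; last exact: intgZ.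
by rewrite !Ex_cst ExZ// => /addrI <-; rewrite mulrC.
Qed.

Lemma stdnormal_cos_pow (c : R) n : 0 <= c ->
  Ex (fun y => cos (Num.sqrt n%:R * c * y)) = Ex (fun y => cos (c * y)) ^+ n.
Proof.
move=> c0; elim: n => [|n ih].
  rewrite expr0 -[RHS](Ex_cst N01); apply: eq_Ex => y.
  by rewrite sqrtr0 !mul0r cos0.
rewrite exprS -ih -stdnormal_cos_mul; apply: eq_Ex => y; congr (cos (_ * _)).
rewrite exprMn sqr_sqrtr// -[X in X + _]mul1r -mulrDl nat1r sqrtrM//.
by rewrite sqrtr_sqr ger0_norm.
Qed.

(** No integral of a cosine against the density is evaluated. By stability the transform at c is the
    n-th power of the one at c / sqrt n, so the second-order expansion and a comparison of n-th
    powers, as in the limit theorem, force the value. *)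
Lemma stdnormal_cos (c : R) : 0 <= c ->
  Ex (fun y => cos (c * y)) = expR (- (c ^+ 2 / 2)).
Proof.
move=> c0.
have sZ : sqintg N01 (fun y : GR => c * y) by apply: sqintgZ; exact: stdnormal_sqintg.
have Z2 : Ex (fun y => (c * y) ^+ 2) = c ^+ 2.
  under eq_fun do rewrite exprMn.
  by rewrite ExZ ?stdnormal_sqr ?mulr1//; exact: (stdnormal_sqintg R).2.
pose k n := Ex (fun y => cos (c * y / Num.sqrt n%:R)).
pose rho (n : nat) := expR (- (c ^+ 2 / 2) / n%:R).
have c20 : 0 <= c ^+ 2 by exact: sqr_ge0.
have rho1 n : `|rho n| <= 1.
  by rewrite ger0_norm ?expR_ge0// -expR0 ler_expR mulNr oppr_le0 !divr_ge0.
have rhon n : n != 0%N -> rho n ^+ n = expR (- (c ^+ 2 / 2)).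
  by move=> n0; rewrite -expRM_natl mulrC divfK// pnatr_eq0.
have k1 n : `|k n| <= 1.
  apply: Ex_le_bound; last by move=> y; exact: cos_max.
  by apply: intg_cos; apply: measurable_funM => //; exact: measurable_scale.
have kn n : n != 0%N -> k n ^+ n = Ex (fun y => cos (c * y)).
  move=> n0; have sn0 : Num.sqrt n%:R != 0 :> R by rewrite gt_eqF// sqrtr_gt0 ltr0n lt0n.
  have cn0 : 0 <= c / Num.sqrt n%:R by rewrite divr_ge0// sqrtr_ge0.
  have := stdnormal_cos_pow n cn0; rewrite (_ : Ex (fun y => cos (c / Num.sqrt n%:R * y)) = k n); last first.
    by apply: eq_Ex => y; rewrite mulrAC.
  move=> <-; apply: eq_Ex => y; congr (cos (_ * _)); rewrite mulrC divfK//.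
have hc : (fun n : nat => `|n%:R * (k n - rho n)|) @ \oo --> (0 : R).
  rewrite -(normr0 R); apply: cvg_norm.
  rewrite (_ : (fun n : nat => n%:R * (k n - rho n)) =
    (fun n : nat => n%:R * (k n - 1) - n%:R * (rho n - 1))); last first.
    by apply/funext => n; ring.
  rewrite -(subrr (- (c ^+ 2 / 2))).
  have h1 := Ex_cos_expansion sZ; rewrite Z2 in h1.
  exact: cvgB h1 (expR_expansion c20).
apply/eqP; rewrite -subr_eq0 -normr_le0; apply/ler_addgt0Pr => e e0; rewrite add0r.
have /cvgrPdist_le/(_ _ e0)[N _ HN] := hc.
have := HN N.+1 (leqnSn N); rewrite sub0r normrN normr_id; apply: le_trans.
rewrite -(kn N.+1 isT) -(rhon N.+1 isT) normrM (ger0_norm (ler0n R N.+1)).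
exact: pow_close.
Qed.

End stdnormal_charfun.

(** * Weak convergence from characteristic functions *)

Section trig_approximation.
Variables (R : realType) (q : nat).
Implicit Types (f g : 'cV[R]_q -> R) (t v y : 'cV[R]_q).

Definition dotv t v : R := \sum_i t i 0 * v i 0.

Definition trig_poly (p : seq (R * 'cV[R]_q * R)) v : R :=
  \sum_(x <- p) x.1.1 * cos (dotv x.1.2 v + x.2).

(** Uniform approximation on the whole space, so that it survives expectation under any law. The
    class is stable under products, absolute values and minima. *)
Definition trig_approx f := forall e : R, 0 < e -> exists p, forall v,
  `|f v - trig_poly p v| <= e.

Lemma dotvDl t t' v : dotv (t + t') v = dotv t v + dotv t' v.
Proof.
by rewrite /dotv -big_split; apply: eq_bigr => i _; rewrite !mxE mulrDl.
Qed.

Lemma dotvNl t v : dotv (- t) v = - dotv t v.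
Proof.
by rewrite /dotv -sumrN; apply: eq_bigr => i _; rewrite !mxE mulNr.
Qed.

Lemma dotvDr t v v' : dotv t (v + v') = dotv t v + dotv t v'.
Proof.
by rewrite /dotv -big_split; apply: eq_bigr => i _; rewrite !mxE mulrDr.
Qed.

Lemma dotvZr (a : R) t v : dotv t (a *: v) = a * dotv t v.
Proof. by rewrite /dotv mulr_sumr; apply: eq_bigr => i _; rewrite mxE mulrCA. Qed.

Lemma dotv0r t : dotv t 0 = 0.
Proof. by rewrite /dotv big1// => i _; rewrite mxE mulr0. Qed.

Lemma trig_poly_bound p : exists2 C, 0 <= C & forall v, `|trig_poly p v| <= C.
Proof.
exists (\sum_(x <- p) `|x.1.1|); first exact: sumr_ge0.
move=> v; apply: (le_trans (ler_norm_sum _ _ _)); apply: ler_sum => x _.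
by rewrite normrM ler_piMr// cos_max.
Qed.

(** The product-to-sum formula for cosines, applied to each pair of terms. *)
Lemma trig_polyM p p' : exists p'', forall v,
  trig_poly p'' v = trig_poly p v * trig_poly p' v.
Proof.
exists (flatten [seq [:: (x.1.1 * x'.1.1 / 2, x.1.2 + x'.1.2, x.2 + x'.2);
   (x.1.1 * x'.1.1 / 2, x.1.2 - x'.1.2, x.2 - x'.2)] | x <- p, x' <- p']) => v.
rewrite /trig_poly big_flatten big_allpairs_dep big_distrlr /=.
apply: eq_bigr => x _; apply: eq_bigr => x' _.
rewrite big_cons big_seq1 /= !dotvDl dotvNl.
rewrite (_ : _ + _ + (_ + _) = (dotv x.1.2 v + x.2) + (dotv x'.1.2 v + x'.2)); last by ring.
rewrite (_ : _ - _ + (_ - _) = (dotv x.1.2 v + x.2) - (dotv x'.1.2 v + x'.2)); last by ring.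
by rewrite cosD cosB; field.
Qed.

Lemma trig_approx_cos (a c : R) t : trig_approx (fun v => a * cos (dotv t v + c)).
Proof.
move=> e e0; exists [:: (a, t, c)] => v.
by rewrite /trig_poly big_seq1 subrr normr0 ltW.
Qed.

Lemma trig_approx_cst (a : R) : trig_approx (fun=> a).
Proof.
move=> e e0; have [p pe] := trig_approx_cos a 0 0 e0; exists p => v.
move: (pe v); rewrite (_ : dotv 0 v = 0); first by rewrite addr0 cos0 mulr1.
by rewrite /dotv big1// => i _; rewrite mxE mul0r.
Qed.

Lemma trig_approxD f g : trig_approx f -> trig_approx g ->
  trig_approx (fun v => f v + g v).
Proof.
move=> af ag e e0; have e2 : 0 < e / 2 by rewrite divr_gt0.
have [p pe] := af _ e2; have [p' pe'] := ag _ e2; exists (p ++ p') => v.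
rewrite /trig_poly big_cat /= -/(trig_poly p v) -/(trig_poly p' v).
rewrite opprD addrACA (le_trans (ler_normD _ _))//.
have := pe v; have := pe' v; lra.
Qed.

Lemma trig_approx_bound f : trig_approx f -> exists2 C, 0 < C & forall v, `|f v| <= C.
Proof.
move=> /(_ 1 ltr01)[p pe]; have [C C0 Cp] := trig_poly_bound p.
exists (C + 1) => [|v]; first by rewrite ltr_wpDl.
rewrite -(subrK (trig_poly p v) (f v)) (le_trans (ler_normD _ _))// addrC.
exact: lerD.
Qed.

Lemma trig_approxM f g : trig_approx f -> trig_approx g ->
  trig_approx (fun v => f v * g v).
Proof.
move=> af ag e e0; have [C C0 fC] := trig_approx_bound af.
(* g is approximated first, so that the bound C' of its approximant is fixed before the accuracy
   required for f is chosen. *)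
have e2 : 0 < Num.min 1 (e / (2 * C)) by rewrite lt_min ltr01 divr_gt0// mulr_gt0.
have [p' pe'] := ag _ e2; have [C' C'0 pC'] := trig_poly_bound p'.
have e3 : 0 < e / (2 * (C' + 1)) by rewrite divr_gt0// mulr_gt0// ltr_wpDl.
have [p pe] := af _ e3; have [p'' E] := trig_polyM p p'; exists p'' => v; rewrite E.
rewrite (_ : _ - _ = f v * (g v - trig_poly p' v) + (f v - trig_poly p v) * trig_poly p' v); last by ring.
rewrite (le_trans (ler_normD _ _))// !normrM.
have h1 : `|f v| * `|g v - trig_poly p' v| <= C * (e / (2 * C)).
  by rewrite ler_pM// (le_trans (pe' v))// ge_min lexx orbT.
have h2 : `|f v - trig_poly p v| * `|trig_poly p' v| <= e / (2 * (C' + 1)) * (C' + 1).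
  by rewrite ler_pM// (le_trans (pC' v))// lerDl.
rewrite (_ : C * _ = e / 2) in h1; last by field; rewrite gt_eqF.
rewrite (_ : e / (2 * (C' + 1)) * (C' + 1) = e / 2) in h2; last by field; rewrite gt_eqF// ltr_wpDl.
by lra.
Qed.

Lemma trig_approxZ (a : R) f : trig_approx f -> trig_approx (fun v => a * f v).
Proof. by apply: trig_approxM; exact: trig_approx_cst. Qed.

Lemma trig_approx_lim f : (forall e, 0 < e -> exists2 g, trig_approx g &
  forall v, `|f v - g v| <= e) -> trig_approx f.
Proof.
move=> H e e0; have e2 : 0 < e / 2 by rewrite divr_gt0.
have [g ag fg] := H _ e2; have [p pe] := ag _ e2; exists p => v.
rewrite -(subrKA (g v)) (le_trans (ler_normD _ _))//.
have := pe v; have := fg v; lra.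
Qed.

(* Polynomials in x converging uniformly to |x| on [-1, 1]. *)
Fixpoint abs_iter (k : nat) (x : R) : R :=
  if k is k'.+1 then abs_iter k' x + (x ^+ 2 - abs_iter k' x ^+ 2) / 2 else 0.

(** The error e = |x| - r evolves by e -> e (1 - e/2) - e r <= e (1 - e/2). This last map is
    increasing on [0, 1], and it sends 2 / n to at most 2 / (n + 1). *)
Lemma abs_iter_bounds k (x : R) : `|x| <= 1 ->
  0 <= abs_iter k x <= `|x| /\ `|x| - abs_iter k x <= 2 / k.+2%:R.
Proof.
move=> x1; elim: k => [|k [/andP[h1 h2] h3]] /=.
  by rewrite lexx normr_ge0 subr0 divff.
rewrite -(real_normK (num_real x)); set r := abs_iter k x in h1 h2 h3 *.
have a0 := normr_ge0 x; set a := `|x| in a0 x1 h2 h3 *.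
split; first by apply/andP; split; nra.
set e := a - r in h3; have e0 : 0 <= e by rewrite subr_ge0.
have e1 : e <= 1 by rewrite /e; lra.
have k2 : 0 < k.+2%:R :> R by rewrite ltr0n.
rewrite (_ : a - _ = e * (1 - e / 2) - e * r); last by rewrite /e; field.
apply: (@le_trans _ _ (e * (1 - e / 2))).
  by rewrite lerBlDr lerDl mulr_ge0.
apply: (@le_trans _ _ (2 / k.+2%:R * (1 - (2 / k.+2%:R) / 2))).
  have b1 : 2 / k.+2%:R <= 1 :> R by rewrite ler_pdivrMr// mul1r ler_nat.
  by set b := 2 / _ in h3 b1 *; nra.
rewrite -(natr1 k.+2); set n := k.+2%:R in k2 *.
have n1 : 0 < n + 1 by lra.
rewrite ler_pdivlMr//.
rewrite (_ : _ * (n + 1) = 2 - 2 / n ^+ 2); last by field; rewrite gt_eqF.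
by rewrite lerBlDr lerDl divr_ge0// sqr_ge0.
Qed.

Lemma trig_approx_abs f : trig_approx f -> trig_approx (fun v => `|f v|).
Proof.
move=> af; have [C C0 fC] := trig_approx_bound af.
pose g v := C^-1 * f v.
have ag : trig_approx g by exact: trig_approxZ.
have g1 v : `|g v| <= 1.
  by rewrite normrM gtr0_norm ?invr_gt0// mulrC ler_pdivrMr// mul1r.
have ai k : trig_approx (fun v => abs_iter k (g v)).
  elim: k => [|k ih] /=; first exact: trig_approx_cst.
  apply: trig_approxD => //.
  under eq_fun do rewrite mulrC.
  apply: trig_approxZ; apply: trig_approxD; first exact: trig_approxM.
  under eq_fun do rewrite -mulN1r.
  by apply: trig_approxZ; exact: trig_approxM.
suff H : trig_approx (fun v => `|g v|).
  have := trig_approxZ C H; rewrite (_ : (fun v => C * `|g v|) = (fun v => `|f v|))//.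
  apply/funext => v; rewrite -[X in X * _](gtr0_norm C0) -normrM /g mulrA mulfV ?mul1r//.
  by rewrite gt_eqF.
apply: trig_approx_lim => e e0.
have e2 : 0 < e / 2 by rewrite divr_gt0.
have [N _ HN] := near_infty_natSinv_lt (PosNum e2).
exists (fun v => abs_iter N (g v)) => // v.
have [/andP[h1 h2] h3] := abs_iter_bounds N (g1 v).
rewrite ger0_norm ?subr_ge0// (le_trans h3)// mulrC -ler_pdivlMr//.
apply: le_trans (ltW (HN N (leqnn N))).
by rewrite lef_pV2 ?posrE// ler_nat.
Qed.

Lemma trig_approx_min f g : trig_approx f -> trig_approx g ->
  trig_approx (fun v => Num.min (f v) (g v)).
Proof.
move=> af ag.
have H : trig_approx (fun v => 2^-1 * (f v + g v + (-1) * `|f v + (-1) * g v|)).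
  apply: trig_approxZ; apply: trig_approxD; first exact: trig_approxD.
  apply: trig_approxZ; apply: trig_approx_abs; apply: trig_approxD => //.
  exact: trig_approxZ.
rewrite (_ : (fun v => Num.min _ _) = (fun v => 2^-1 * (f v + g v + (-1) * `|f v + (-1) * g v|)))//.
apply/funext => v; rewrite !mulN1r.
by case: (leP (f v) (g v)) => h; [rewrite ler0_norm|rewrite gtr0_norm]; lra.
Qed.

Lemma trig_approx_min_seq (I : Type) (s : seq I) (F : I -> 'cV[R]_q -> R) (B : R) :
  (forall i, trig_approx (F i)) ->
  trig_approx (fun v => foldr (fun i m => Num.min (F i v) m) B s).
Proof.
move=> aF; elim: s => [|i s ih] /=; first exact: trig_approx_cst.
exact: trig_approx_min.
Qed.

Lemma foldr_min_le (I : eqType) (s : seq I) (F : I -> R) (B : R) :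
  foldr (fun i m => Num.min (F i) m) B s <= B /\
  (forall i, i \in s -> foldr (fun i m => Num.min (F i) m) B s <= F i).
Proof.
elim: s => [|i s [ih1 ih2]] /=; first by [].
split=> [|j]; first by rewrite ge_min ih1 orbT.
rewrite inE ge_min => /predU1P[->|js]; first by rewrite lexx.
by rewrite ih2// orbT.
Qed.

Lemma le_foldr_min (I : eqType) (s : seq I) (F : I -> R) (B b : R) :
  b <= B -> (forall i, i \in s -> b <= F i) ->
  b <= foldr (fun i m => Num.min (F i) m) B s.
Proof.
move=> bB; elim: s => //= i s ih bF; rewrite le_min bF ?mem_head//= ih// => j js.
by rewrite bF// inE js orbT.
Qed.

(** A grid of step w = L / n < dlt; rounding each coordinate down moves it by less than w. *)
Lemma cube_net (L dlt : R) : 0 < L -> 0 < dlt -> exists2 s : seq 'cV[R]_q,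
  forall y, y \in s -> forall i, `|y i 0| <= L &
  forall v, (forall i, `|v i 0| <= L) ->
  exists2 y, y \in s & forall i, `|v i 0 - y i 0| < dlt.
Proof.
move=> L0 d0; have e0 : 0 < dlt / L by rewrite divr_gt0.
have [N _ HN] := near_infty_natSinv_lt (PosNum e0).
have {}HN := HN N (leqnn N); rewrite /= in HN.
pose n := N.+1; pose w : R := L / n%:R.
have n0 : 0 < n%:R :> R by rewrite ltr0n.
have w0 : 0 < w by rewrite divr_gt0.
have wd : w < dlt by rewrite /w mulrC -ltr_pdivlMr.
pose mk (F : {ffun 'I_q -> 'I_(n * 2).+1}) : 'cV[R]_q := \col_i (- L + w * (F i)%:R).
exists [seq mk F | F <- enum [set: {ffun 'I_q -> 'I_(n * 2).+1}]].
  move=> _ /mapP[G _ ->] i; rewrite mxE.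
  have : 0 <= w * (G i)%:R by rewrite mulr_ge0// ltW.
  have : w * (G i)%:R <= 2 * L.
    have : (G i)%:R <= (n * 2)%:R :> R by rewrite ler_nat -ltnS.
    move=> /(ler_wpM2l (ltW w0)) H; rewrite (le_trans H)// natrM /w.
    by rewrite mulrA divfK ?gt_eqF// mulrC.
  by rewrite ler_norml; lra.
move=> v vL.
pose k i := Num.truncn ((v i 0 + L) / w).
have vi0 i : 0 <= (v i 0 + L) / w.
  by rewrite divr_ge0 ?(ltW w0)//; have := vL i; rewrite ler_norml; lra.
have kle i : (k i < (n * 2).+1)%N.
  rewrite ltnS -(ler_nat R) (le_trans (y := (v i 0 + L) / w)) ?truncn_le//.
  rewrite natrM ler_pdivrMr// (_ : n%:R * 2 * w = 2 * L); last by rewrite /w; field; rewrite gt_eqF.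
  by have := vL i; rewrite ler_norml; lra.
exists (mk [ffun i => Ordinal (kle i)]).
  by apply/mapP; exists [ffun i => Ordinal (kle i)] => //; rewrite mem_enum inE.
have b i : w * (k i)%:R <= v i 0 + L < w * (k i).+1%:R.
  have := truncn_itv (vi0 i); rewrite -/(k i) ler_pdivlMr// ltr_pdivrMr//.
  by rewrite ![_ * w]mulrC.
move=> i; rewrite mxE ffunE /=; have /andP[] := b i; rewrite -natr1 mulrDr mulr1 => b1 b2.
by rewrite ltr_norml; lra.
Qed.

Lemma onem_cos_ge (s : R) : `|s| <= 2^-1 -> s ^+ 2 / 4 <= 1 - cos s.
Proof.
move=> s1; have := norm_cos_sub s; rewrite -(real_normK (num_real s)).
have a0 := normr_ge0 s; set a := `|s| in a0 s1 *.
rewrite ler_norml => /andP[_ h].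
have : a ^+ 4 <= a ^+ 2 / 4.
  rewrite (_ : a ^+ 4 = a ^+ 2 * a ^+ 2); last by ring.
  rewrite ler_wpM2l ?sqr_ge0// expr2.
  by have := ler_pM a0 a0 s1 s1; lra.
lra.
Qed.

(** g(v) is the minimum of B and of f(y) + C psi(v, y) over a finite net of points y, where psi, a
    sum of 1 - cos, is a periodic substitute for the squared distance. Near points y give values
    close to f(v), far ones are made irrelevant by the penalty. The formula keeps g between - B and
    B on the whole space, which controls the mass outside the cube. *)
Lemma trig_approx_cube f (B L e : R) : continuous f -> (forall v, `|f v| <= B) ->
  0 < L -> 0 < e -> exists g, [/\ trig_approx g, forall v, `|g v| <= B &
    forall v, (forall i, `|v i 0| <= L) -> `|f v - g v| <= e].
Proof.
move=> cf fB L0 e0.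
have B0 : 0 <= B by exact: le_trans (normr_ge0 _) (fB 0).
have e2 : 0 < e / 2 by rewrite divr_gt0.
have [h h0 fh] := compact_unif_continuous cf (@compact_cube R q L) e2.
(* For v and y in the cube, (v_i - y_i) / L' is at most 1/2 in absolute value, where 1 - cos s >=
   s^2 / 4. *)
pose L' := 4 * L; have L'0 : 0 < L' by rewrite mulr_gt0.
(* A lower bound of psi when some coordinates differ by at least h. The factor C below is then
   chosen so that C kappa = 2B: a far point costs more than the oscillation of f. *)
pose kappa := (h / L') ^+ 2 / 4.
have k0 : 0 < kappa by rewrite divr_gt0// exprn_gt0// divr_gt0.
pose C := 2 * B / kappa; have C0 : 0 <= C by rewrite divr_ge0 ?(ltW k0)// mulr_ge0.
pose den := (C * q%:R + 1).
have den0 : 0 < den by rewrite ltr_wpDl// mulr_ge0.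
(* The net is fine enough that the nearest y has f(y) within e / 2 of f(v), and penalty C psi(v, y)
   at most (C q / den) (e / 2) <= e / 2. *)
pose dlt := Num.min h (Num.min L' (L' * (e / den))).
have dlt0 : 0 < dlt by rewrite !lt_min h0 L'0 mulr_gt0// divr_gt0.
have [s sL sP] := cube_net L0 dlt0.
pose psi (v y : 'cV[R]_q) := \sum_i (1 - cos ((v i 0 - y i 0) / L')).
pose F (y v : 'cV[R]_q) := f y + C * psi v y.
have psi0 v y : 0 <= psi v y by apply: sumr_ge0 => i _; exact: onem_cos_ge0.
have aF y : trig_approx (F y).
  apply: trig_approxD; first exact: trig_approx_cst.
  apply: trig_approxZ; rewrite /psi.
  have : forall r : seq 'I_q, trig_approx (fun v => \sum_(i <- r) (1 - cos ((v i 0 - y i 0) / L'))).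
    elim=> [|i r ih].
      by under eq_fun do rewrite big_nil; exact: trig_approx_cst.
    under eq_fun do rewrite big_cons; apply: trig_approxD => //.
    apply: trig_approxD; first exact: trig_approx_cst.
    have := @trig_approx_cos (-1) (- (y i 0 / L')) (\col_k ((k == i)%:R / L')).
    rewrite (_ : (fun v => - 1 * cos _) = (fun v => - cos ((v i 0 - y i 0) / L')))//.
    apply/funext => v; rewrite mulN1r; congr (- cos _).
    rewrite /dotv (bigD1 i)//= big1 ?addr0 ?mxE ?eqxx; last first.
      by move=> k ki; rewrite mxE (negbTE ki) !mul0r.
    by rewrite mulr1n mul1r mulrBl mulrC.
  by apply.
exists (fun v => foldr (fun y m => Num.min (F y v) m) B s); split.
- exact: trig_approx_min_seq.
- move=> v; have [h1 _] := foldr_min_le s (F ^~ v) B; rewrite ler_norml h1 andbT.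
  apply: le_foldr_min; first by lra.
  move=> y _; have := fB y; rewrite ler_norml => /andP[h2 _].
  by rewrite (le_trans h2)// lerDl mulr_ge0.
- move=> v vL; have [y ys yv] := sP v vL.
  have [_ h1] := foldr_min_le s (F ^~ v) B; have {}h1 := h1 y ys.
  have fy : `|f v - f y| < e / 2.
    by apply: fh => // i; rewrite (lt_le_trans (yv i))// ge_min lexx.
  have cp : C * psi v y <= e / 2.
    have p1 : psi v y <= q%:R * (e / den / 2).
      rewrite -[X in X%:R](card_ord q) -sum1_card natr_sum mulr_suml ler_sum// => i _.
      rewrite mul1r (le_trans (onem_cos_le _))// ler_wpM2r//.
      have a1 : `|(v i 0 - y i 0) / L'| <= 1.
        rewrite normrM [`|L'^-1|]gtr0_norm ?invr_gt0// ler_pdivrMr// mul1r.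
        by rewrite ltW// (lt_le_trans (yv i))// !ge_min lexx !orbT.
      have a2 : `|(v i 0 - y i 0) / L'| <= e / den.
        rewrite normrM [`|L'^-1|]gtr0_norm ?invr_gt0// ler_pdivrMr// mulrC.
        by rewrite ltW// (lt_le_trans (yv i))// !ge_min lexx !orbT.
      rewrite -(real_normK (num_real (_ / L'))).
      by have a0 := normr_ge0 ((v i 0 - y i 0) / L'); nra.
    rewrite (le_trans (ler_wpM2l C0 p1))//.
    rewrite (_ : C * _ = (C * q%:R) / den * (e / 2)); last by field; rewrite gt_eqF.
    by rewrite ler_piMl ?(ltW e2)// ler_pdivrMr// mul1r /den lerDl.
  have h2 : f v - e <= foldr (fun y m => Num.min (F y v) m) B s.
    apply: le_foldr_min; first by have := fB v; rewrite ler_norml; lra.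
    move=> y' y's; rewrite /F.
    have [far|near_] := pselect (exists i, h <= `|v i 0 - y' i 0|); last first.
      have fy' : `|f v - f y'| < e / 2.
        by apply: fh => // i; rewrite ltNge; apply/negP => hi; apply: near_; exists i.
      by have := mulr_ge0 C0 (psi0 v y'); move: fy'; rewrite ltr_norml; lra.
    have [i hi] := far.
    have kp : kappa <= psi v y'.
      rewrite /psi (bigD1 i)//=.
      have r0 : 0 <= \sum_(k < q | k != i) (1 - cos ((v k 0 - y' k 0) / L')).
        by apply: sumr_ge0 => k _; exact: onem_cos_ge0.
      have s12 : `|(v i 0 - y' i 0) / L'| <= 2^-1.
        rewrite normrM [`|L'^-1|]gtr0_norm ?invr_gt0// ler_pdivrMr//.
        rewrite (le_trans (ler_normB _ _))// /L'.
        by have := vL i; have := sL y' y's i; lra.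
      have := onem_cos_ge s12; rewrite -(real_normK (num_real (_ / L'))).
      rewrite normrM [`|L'^-1|]gtr0_norm ?invr_gt0//.
      have : (h / L') ^+ 2 <= (`|v i 0 - y' i 0| / L') ^+ 2.
        rewrite lerXn2r ?nnegrE ?divr_ge0 ?(ltW L'0) ?(ltW h0)//.
        by rewrite ler_wpM2r// invr_ge0 ltW.
      by rewrite /kappa; lra.
    have CB : 2 * B <= C * psi v y'.
      apply: (@le_trans _ _ (C * kappa)); last by rewrite ler_wpM2l.
      by rewrite /C divfK// gt_eqF.
    by have := fB v; have := fB y'; rewrite !ler_norml; lra.
  by move: fy h1; rewrite /F ltr_norml ler_norml; lra.
Qed.

End trig_approximation.

(** * Weak convergence from tightness and convergence of characteristic functions *)

Section weak_convergence.
Context d (T : measurableType d) (R : realType) (Pr : probability T R) (q : nat).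
Variables (X : nat -> T -> 'cV[R]_q) (mu : probability (borel_cV R q) R).
Hypothesis mX : forall n, random_vector (X n).
Hypothesis cvg_cos : forall t : 'cV[R]_q,
  (fun n => Ex Pr (fun w => cos (dotv t (X n w)))) @ \oo --> Ex mu (fun v => cos (dotv t v)).
Hypothesis cvg_sin : forall t : 'cV[R]_q,
  (fun n => Ex Pr (fun w => sin (dotv t (X n w)))) @ \oo --> Ex mu (fun v => sin (dotv t v)).
Hypothesis tight : forall e : R, 0 < e -> exists L : R, \forall n \near \oo,
  exists A : set T, [/\ measurable A, (Pr A <= e%:E)%E &
    forall w, ~ A w -> forall i, `|X n w i 0| <= L].

Lemma borel_dotv (t : 'cV[R]_q) : borel_fun (dotv t).
Proof.
apply: (@measurable_sum _ (borel_cV R q)) => i.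
by apply: (@measurable_funM _ (borel_cV R q)) => //; exact: borel_coord.
Qed.

Lemma borel_trig_poly p : borel_fun (@trig_poly R q p).
Proof.
apply: (@measurable_sum _ (borel_cV R q)) => x.
apply: (@measurable_funM _ (borel_cV R q)) => //.
apply: borel_cos; apply: (@measurable_funD _ (borel_cV R q)) => //.
exact: borel_dotv.
Qed.

Lemma borel_trig_approx (g : 'cV[R]_q -> R) : trig_approx g -> borel_fun g.
Proof.
move=> ag.
pose p n := projT1 (cid (ag n.+1%:R^-1 (ltac:(by rewrite invr_gt0)))).
have pP n v : `|g v - trig_poly (p n) v| <= n.+1%:R^-1.
  by rewrite /p; case: cid => /=.
apply: (@measurable_fun_cvg _ (borel_cV R q) R setT (fun n => trig_poly (p n))).
  by move=> n; exact: borel_trig_poly.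
move=> v _; apply/cvgrPdist_le => e e0.
have := near_infty_natSinv_lt (PosNum e0); apply: filterS => n /= h.
exact: (le_trans (pP n v) (ltW h)).
Qed.

Let intgX (g : 'cV[R]_q -> R) C n : borel_fun g -> (forall v, `|g v| <= C) ->
  intg Pr (fun w => g (X n w)).
Proof.
by move=> mg gC; apply: (@bounded_intg _ _ _ _ _ C) => [|w]; [exact: borel_comp (mX n) mg|].
Qed.

Let intgmu (g : 'cV[R]_q -> R) C : borel_fun g -> (forall v, `|g v| <= C) -> intg mu g.
Proof. by move=> mg gC; exact: (@bounded_intg _ (borel_cV R q) _ _ _ C). Qed.

Lemma cvg_trig_poly p : (fun n => Ex Pr (fun w => trig_poly p (X n w))) @ \oo -->
  Ex mu (trig_poly p).
Proof.
have bc (x : R * 'cV[R]_q * R) : borel_fun (fun v => x.1.1 * cos (dotv x.1.2 v + x.2)).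
  have := borel_trig_poly [:: x]; rewrite (_ : trig_poly [:: x] = (fun v => x.1.1 * cos (dotv x.1.2 v + x.2)))//.
  by apply/funext => v; rewrite /trig_poly big_seq1.
have bb (x : R * 'cV[R]_q * R) v : `|x.1.1 * cos (dotv x.1.2 v + x.2)| <= `|x.1.1|.
  by rewrite normrM ler_piMr// cos_max.
have E n : Ex Pr (fun w => trig_poly p (X n w)) =
    \sum_(x <- p) Ex Pr (fun w => x.1.1 * cos (dotv x.1.2 (X n w) + x.2)).
  by rewrite Ex_sum// => x _; exact: (intgX n (bc x) (bb x)).
rewrite (funext E) (_ : Ex mu (trig_poly p) =
    \sum_(x <- p) Ex mu (fun v => x.1.1 * cos (dotv x.1.2 v + x.2))); last first.
  by rewrite Ex_sum// => x _; exact: (intgmu (bc x) (bb x)).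
apply: cvg_big => [|x _]; first exact: add_continuous.
move: x => [[a t] c] /=.
have ic n : intg Pr (fun w => cos (dotv t (X n w))).
  by apply: intg_cos; exact: (borel_comp (mX n) (borel_dotv t)).
have is_ n : intg Pr (fun w => sin (dotv t (X n w))).
  by apply: intg_sin; exact: (borel_comp (mX n) (borel_dotv t)).
have jc : intg mu (fun v => cos (dotv t v)) by apply: intg_cos; exact: borel_dotv.
have js : intg mu (fun v => sin (dotv t v)) by apply: intg_sin; exact: borel_dotv.
have e (d' : measure_display) (T' : measurableType d') (P' : probability T' R) (Z : T' -> 'cV[R]_q) :
    intg P' (fun w => cos (dotv t (Z w))) -> intg P' (fun w => sin (dotv t (Z w))) ->
    Ex P' (fun w => a * cos (dotv t (Z w) + c)) =
    a * cos c * Ex P' (fun w => cos (dotv t (Z w))) + (- a * sin c) * Ex P' (fun w => sin (dotv t (Z w))).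
  move=> i1 i2; rewrite -!ExZ// -ExD; [|exact: intgZ|exact: intgZ].
  by apply: eq_Ex => w; rewrite cosD; ring.
rewrite (e _ _ mu idfun jc js).
rewrite (_ : (fun n => _) = (fun n => a * cos c * Ex Pr (fun w => cos (dotv t (X n w))) +
  (- a * sin c) * Ex Pr (fun w => sin (dotv t (X n w))))); last first.
  by apply/funext => n; rewrite (e _ _ Pr (X n)).
by apply: cvgD; apply: cvgMl_tmp; [exact: cvg_cos|exact: cvg_sin].
Qed.

Lemma cvg_trig_approx (g : 'cV[R]_q -> R) : trig_approx g ->
  (fun n => Ex Pr (fun w => g (X n w))) @ \oo --> Ex mu g.
Proof.
move=> ag; apply/cvgrPdist_le => e e0; have e3 : 0 < e / 3 by rewrite divr_gt0.
have [p gp] := ag _ e3; have bg := borel_trig_approx ag.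
have [C C0 gC] := trig_approx_bound ag.
have [C' C'0 pC] := trig_poly_bound p.
have h1 : `|Ex mu g - Ex mu (trig_poly p)| <= e / 3.
  rewrite -ExB; [|exact: intgmu bg gC|exact: intgmu (borel_trig_poly p) pC].
  apply: Ex_le_bound => //; apply: intgB; [exact: intgmu bg gC|exact: intgmu (borel_trig_poly p) pC].
have /cvgrPdist_le/(_ _ e3) := @cvg_trig_poly p; apply: filterS => n h2.
have h3 : `|Ex Pr (fun w => g (X n w)) - Ex Pr (fun w => trig_poly p (X n w))| <= e / 3.
  rewrite -ExB; [|exact: intgX bg gC|exact: intgX (borel_trig_poly p) pC].
  by apply: Ex_le_bound => [|w //]; apply: intgB; [exact: intgX bg gC|exact: intgX (borel_trig_poly p) pC].
move: h1 h2 h3; rewrite !ler_norml; lra.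
Qed.

(** The sets where some coordinate exceeds k in absolute value decrease to the empty set, so their
    probability tends to zero. *)
Lemma probability_tight (e : R) : 0 < e -> exists L : R, exists A : set 'cV[R]_q,
  [/\ borel_set A, Ex mu (\1_A) <= e & forall v, ~ A v -> forall i, `|v i 0| <= L].
Proof.
move=> e0.
pose A (k : nat) : set 'cV[R]_q := [set v | exists i, k%:R < `|v i 0|].
have mA k : borel_set (A k).
  rewrite (_ : A k = \bigcup_(i in [set: 'I_q]) [set v | k%:R < `|v i 0|]); last first.
    by apply/seteqP; split => [v [i vi]|v [i _ vi]]; exists i.
  apply: (@fin_bigcup_measurable _ (borel_cV R q)) => // i _.
  have h : measurable_fun setT (fun v : borel_cV R q => k%:R < `|(v : 'cV[R]_q) i 0|).
    apply: measurable_fun_ltr => //; apply: measurableT_comp => //; exact: borel_coord.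
  by rewrite -[X in measurable X]setTI; exact: (h measurableT [set true]).
have c : (fun k => Ex mu (\1_(A k))) @ \oo --> Ex mu (fun=> 0).
  apply: (@intg_dominated_cvg _ (borel_cV R q) _ _ _ _ (fun=> 1)).
  - by move=> k; exact: (@measurable_indic _ (borel_cV R q) R setT (A k) (mA k)).
  - exact: measurable_cst.
  - move=> v; apply/cvgrPdist_le => e' e'0.
    exists (Num.truncn (\sum_i `|v i 0|)).+1 => // k /= Nk.
    rewrite sub0r normrN indicE memNset ?normr0 ?ltW// => -[i].
    rewrite ltNge => /negP; apply.
    apply: (@le_trans _ _ (\sum_i `|v i 0|)).
      by rewrite (bigD1 i)//= lerDl sumr_ge0.
    apply: ltW; apply: lt_le_trans (truncnS_gt _) _.
    by rewrite ler_nat.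
  - exact: intg_cst.
  - by move=> k v; exact: norm_indic_le1.
rewrite Ex_cst in c.
have /cvgrPdist_le/(_ _ e0)[N _ HN] := c.
exists N%:R, (A N); split=> //.
  by have := HN N (leqnn N); rewrite sub0r normrN; exact: le_trans (ler_norm _).
by move=> v Av i; rewrite leNgt; apply/negP => h; apply: Av; exists i.
Qed.

Lemma Ex_close_off_set d' (T' : measurableType d') (P' : probability T' R)
    (F G : T' -> R) (A : set T') (B e : R) : intg P' F -> intg P' G ->
  measurable A -> (forall w, `|F w| <= B) -> (forall w, `|G w| <= B) -> 0 <= e ->
  (forall w, ~ A w -> `|F w - G w| <= e) ->
  `|Ex P' F - Ex P' G| <= e + 2 * B * Ex P' (\1_A).
Proof.
move=> iF iG mA FB GB e0 FG.
have iA : intg P' (\1_A) by exact: intg_indic.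
rewrite -ExB// (le_trans (norm_Ex (intgB iF iG)))//.
rewrite -ExZ// -[e in leRHS](Ex_cst P') -ExD; [|exact: intg_cst|exact: intgZ].
apply: le_Ex; [exact/intg_norm/intgB|by apply: intgD; [exact: intg_cst|exact: intgZ]|].
move=> w; rewrite indicE; have [Aw|Aw] := pselect (A w).
  rewrite mem_set// mulr1 (le_trans (ler_normB _ _))//.
  by have := FB w; have := GB w; lra.
by rewrite memNset// mulr0 addr0; exact: FG.
Qed.

(** f is replaced by a uniform limit g of trigonometric polynomials that has the same bound B and is
    close to f on a cube carrying most of the mass of the limit law and of the law of each late
    X_n. *)
Theorem cvg_in_distribution_cos_sin : cvg_in_distribution Pr X mu.
Proof.
move=> f cf [B0 fB0].
pose B := `|B0| + 1; have B_gt0 : 0 < B by rewrite ltr_wpDl.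
have fB v : `|f v| <= B.
  by rewrite (le_trans (fB0 v))// (le_trans (ler_norm _))// lerDl.
have bf := continuous_borel cf.
have E n : 'E_Pr[f \o X n]%E = (Ex Pr (fun w => f (X n w)))%:E.
  by rewrite /Ex fineK// unlock; apply: intg_fin_num; exact: intgX bf fB.
rewrite (funext E) (ExEE (intgmu bf fB)).
apply: cvg_EFin; first exact: nearW.
apply/cvgrPdist_le => e e0.
(* Then 2 B e' = e / 5. Five errors of e / 5 occur: two for f against g on the cube, two for the
   mass outside it, one for the convergence of E g. *)
pose e' := e / (10 * B); have e'0 : 0 < e' by rewrite divr_gt0// mulr_gt0.
have [L1 HL1] := tight e'0.
have [L2 [A2 [mA2 PA2 HL2]]] := probability_tight e'0.
pose L := Num.max 1 (Num.max L1 L2); have L0 : 0 < L by rewrite lt_max ltr01.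
have e5 : 0 < e / 5 by rewrite divr_gt0.
have [g [ag gB fg]] := trig_approx_cube cf fB L0 e5.
have bg := borel_trig_approx ag.
have h1 : `|Ex mu f - Ex mu g| <= e / 5 + 2 * B * Ex mu (\1_A2).
  apply: (@Ex_close_off_set _ (borel_cV R q)) => //.
  - exact: intgmu bf fB.
  - exact: intgmu bg gB.
  - exact: ltW.
  - by move=> v Av; apply: fg => i; rewrite (le_trans (HL2 v Av i))// !le_max lexx !orbT.
have /cvgrPdist_le/(_ _ e5) := cvg_trig_approx ag.
move: HL1; apply: filterS2 => n [A [mA PA HA]] h2.
have h3 : `|Ex Pr (fun w => f (X n w)) - Ex Pr (fun w => g (X n w))| <= e / 5 + 2 * B * Ex Pr (\1_A).
  apply: Ex_close_off_set => //.
  - exact: intgX bf fB.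
  - exact: intgX bg gB.
  - exact: ltW.
  - by move=> w Aw; apply: fg => i; rewrite (le_trans (HA w Aw i))// !le_max lexx !orbT.
have PA' : Ex Pr (\1_A) <= e' by rewrite -lee_fin Ex_indic.
have k (y : R) : y <= e' -> 2 * B * y <= e / 5.
  move=> ye; rewrite (le_trans (y := 2 * B * e'))//.
    by rewrite ler_wpM2l// mulr_ge0// ltW.
  by rewrite /e' le_eqVlt; apply/orP; left; apply/eqP; field; rewrite gt_eqF.
have := k _ PA'; have := k _ PA2; rewrite /=.
move: h1 h2 h3; rewrite !ler_norml; lra.
Qed.

End weak_convergence.

(** * Multivariate normal laws: existence and characteristic function *)

Section push_probability.
Context d (T : measurableType d) (R : realType) (P : probability T R).
Context d' (T' : measurableType d').

Lemma push_probability (phi : T -> T') : measurable_fun setT phi ->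
  exists mu : probability T' R, forall A, mu A = P (phi @^-1` A).
Proof.
move=> mphi.
pose X : {mfun T >-> T'} := HB.pack phi (isMeasurableFun.Build _ _ _ _ phi mphi).
by exists (distribution P X).
Qed.

End push_probability.

Section same_law.
Context d (T : measurableType d) d' (T' : measurableType d') (R : realType).
Variables (P : probability T R) (P' : probability T' R).
Variables (X : T -> measurableTypeR R) (X' : T' -> measurableTypeR R).
Hypotheses (mX : measurable_fun setT X) (mX' : measurable_fun setT X').
Hypothesis lawE : forall A : set R, measurable A -> P (X @^-1` A) = P' (X' @^-1` A).

Lemma same_law_ge0 (f : R -> R) : measurable_fun setT f -> (forall x, 0 <= f x) ->
  (\int[P]_t (f (X t))%:E = \int[P']_t (f (X' t))%:E)%E.
Proof.
move=> mf f0.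
pose m1 : {measure set (measurableTypeR R) -> \bar R} :=
  measure_function_pushforward__canonical__measure_function_Measure P mX.
pose m2 : {measure set (measurableTypeR R) -> \bar R} :=
  measure_function_pushforward__canonical__measure_function_Measure P' mX'.
have mfE : measurable_fun [set: measurableTypeR R] (EFin \o f) by exact/measurable_EFinP.
have fE0 : {in [set: measurableTypeR R], forall y : measurableTypeR R, (0 <= (EFin \o f) y)%E}.
  by move=> y _; rewrite lee_fin.
have E1 : (\int[m1]_x (f x)%:E = \int[P]_t (f (X t))%:E)%E.
  exact: (ge0_integral_pushforward mX P measurableT mfE fE0).
have E2 : (\int[m2]_x (f x)%:E = \int[P']_t (f (X' t))%:E)%E.
  exact: (ge0_integral_pushforward mX' P' measurableT mfE fE0).
by rewrite -E1 -E2; apply: eq_measure_integral => A mA _; exact: lawE.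
Qed.

(** Adding the bound C makes the integrand nonnegative. *)
Lemma same_law_Ex (f : R -> R) (C : R) : measurable_fun setT f ->
  (forall x, `|f x| <= C) -> Ex P (fun t => f (X t)) = Ex P' (fun t => f (X' t)).
Proof.
move=> mf fC.
have mfX : measurable_fun setT (fun t => f (X t)) by exact: measurableT_comp mf mX.
have mfX' : measurable_fun setT (fun t => f (X' t)) by exact: measurableT_comp mf mX'.
have i1 : intg P (fun t => f (X t)) by exact: (@bounded_intg _ _ _ _ _ C).
have i2 : intg P' (fun t => f (X' t)) by exact: (@bounded_intg _ _ _ _ _ C).
apply: (addrI C).
have : Ex P (fun t => C + f (X t)) = Ex P' (fun t => C + f (X' t)).
  rewrite !ExE; congr fine; apply: (@same_law_ge0 (fun x => C + f x)).
    exact: measurable_funD.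
  by move=> x; have := fC x; rewrite ler_norml; lra.
by rewrite !ExD ?Ex_cst//; exact: intg_cst.
Qed.

End same_law.

Section mvnormal.
Variables (R : realType) (q : nat).
Local Notation N01 := (stdnormal R).
Local Notation GR := (measurableTypeR R).

Definition quad (ls : seq 'cV[R]_q) (t : 'cV[R]_q) : R :=
  \sum_(l <- ls) dotv t l ^+ 2.

Lemma quad_ge0 ls t : 0 <= quad ls t.
Proof. by apply: sumr_ge0 => l _; exact: sqr_ge0. Qed.

(** The law of the sum of Y_l l with independent standard normal Y_l, built one direction at a time
    on a product space. Stability identifies the law of each linear functional, and [quad] adds up
    the variances. *)
Lemma gaussian_exists (ls : seq 'cV[R]_q) :
  exists mu : probability (borel_cV R q) R, forall (t : 'cV[R]_q) (A : set R),
    measurable A ->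
    mu [set v | A (dotv t v)] = N01 [set z | A (Num.sqrt (quad ls t) * z)].
Proof.
elim: ls => [|l ls [mu ih]].
  exists (\d_(0 : borel_cV R q)) => t A mA.
  have d0 : dotv t 0 = 0 by rewrite /dotv big1// => i _; rewrite mxE mulr0.
  rewrite /quad big_nil sqrtr0 /= diracE.
  have [A0|A0] := pselect (A 0).
    rewrite mem_set/= ?d0// (_ : [set z | _] = setT) ?probability_setT//.
    by apply/seteqP; split => z //= _; rewrite mul0r.
  rewrite memNset/= ?d0// (_ : [set z | _] = set0) ?measure0//.
  by apply/seteqP; split => z //=; rewrite mul0r.
pose phi (p : borel_cV R q * GR) : borel_cV R q := (p.1 : 'cV[R]_q) + (p.2 : R) *: l.
have mphi : measurable_fun setT phi.
  apply: measurable_cV => i; rewrite /phi.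
  under eq_fun do rewrite !mxE.
  apply: measurable_funD; last by apply: measurable_funM.
  apply: (measurableT_comp (f := fun v : borel_cV R q => (v : 'cV[R]_q) i 0)) => //.
  exact: borel_coord.
have [mu' mu'E] := push_probability (mu \x N01)%E mphi.
exists mu' => t A mA; rewrite mu'E; set c := dotv t l.
pose h (p : GR * GR) := \1_A ((p.1 : R) + c * (p.2 : R)) : R.
have mh : measurable_fun setT (EFin \o h).
  have mS : measurable_fun setT (fun p : GR * GR => (p.1 : R) + c * (p.2 : R)).
    by apply: measurable_funD => //; apply: measurable_funM.
  apply/measurable_EFinP.
  exact: (measurableT_comp (@measurable_indic _ GR R setT A mA) mS).
have h0 p : (0 <= (EFin \o h) p)%E by rewrite lee_fin.
have hE (a : R) : (\int[N01]_y (h (a, y))%:E = N01 [set y | A (a + c * y)%R])%E.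
  have mB : measurable [set y : GR | A (a + c * y)].
    rewrite -[X in measurable X]setTI.
    exact: (@measurable_affine R a c measurableT A mA).
  transitivity (\int[N01]_y (\1_[set y : GR | A (a + c * y)%R] y)%:E)%E; last first.
    by rewrite integral_indic// setIT.
  apply: eq_integral => y _; rewrite /h !indicE.
  suff -> : (a + c * y \in A) = (y \in [set y : GR | A (a + c * y)]) by [].
  by apply/idP/idP; rewrite !inE.
(* The probability of the event given that the part already built has projection a. It depends on
   that part through the projection alone, whose law is known by induction. *)
pose g (a : R) := fine (N01 [set y | A (a + c * y)]).
have gE a : (g a)%:E = N01 [set y | A (a + c * y)].
  by rewrite /g fineK// fin_num_measure// -[X in measurable X]setTI;
     exact: (@measurable_affine R a c measurableT A mA).
have mg : measurable_fun setT g.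
  apply/measurable_EFinP; rewrite (_ : EFin \o g = fubini_F N01 (EFin \o h)).
    exact: (@measurable_fun_fubini_tonelli_F _ _ GR GR R N01 (EFin \o h) mh h0).
  by apply/funext => a; rewrite /= gE -hE.
have g0 a : 0 <= g a by rewrite fine_ge0.
have lawE (B : set R) : measurable B -> mu (dotv t @^-1` B) =
    N01 ((fun z : GR => Num.sqrt (quad ls t) * z) @^-1` B) by exact: ih.
have SL := same_law_ge0 (P := mu) (X := dotv t : borel_cV R q -> GR) (borel_dotv t)
  (measurable_scale (Num.sqrt (quad ls t))) lawE mg g0.
transitivity (\int[mu]_v (g (dotv t v))%:E)%E.
  apply: eq_integral => v _; rewrite gE /=; congr (normal_prob 0 1 _).
  have e y : dotv t (phi (v, y)) = dotv t v + c * y.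
    by rewrite /phi dotvDr dotvZr mulrC.
  by apply/seteqP; split => y /=; rewrite /xsection /= inE /= e.
rewrite SL.
transitivity (\int[N01]_x N01 [set y | A (Num.sqrt (quad ls t) * x + c * y)%R])%E.
  by apply: eq_integral => x _; rewrite gE.
rewrite stdnormal_stable// sqr_sqrtr ?quad_ge0//.
by rewrite /quad big_cons addrC.
Qed.

Lemma dotvE (t v : 'cV[R]_q) : dotv t v = (t^T *m v) 0 0.
Proof. by rewrite mxE; apply: eq_bigr => i _; rewrite mxE. Qed.

Lemma quadE (ls : seq 'cV[R]_q) t :
  quad ls t = (t^T *m (\sum_(l <- ls) l *m l^T) *m t) 0 0.
Proof.
rewrite mulmx_sumr mulmx_suml summxE; apply: eq_bigr => l _.
rewrite -!mulmxA mulmxA mxE big_ord1 -!dotvE expr2; congr (_ * _).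
by apply: eq_bigr => i _; rewrite mulrC.
Qed.

Lemma mvnormal_exists (ls : seq 'cV[R]_q) :
  exists mu : probability (borel_cV R q) R,
    is_mvnormal mu (\sum_(l <- ls) l *m l^T).
Proof.
have [mu muE] := gaussian_exists ls; exists mu; split; first split.
- rewrite linearN /=; congr (- _); rewrite linear_sum /=; apply: eq_bigr => l _.
  by rewrite trmx_mul trmxK.
- by move=> v; rewrite mulmxN mulNmx mxE -quadE oppr_le0 quad_ge0.
move=> t A mA; rewrite -quadE centered_normalE ?quad_ge0// -muE//.
by congr (mu _); apply/seteqP; split => v /=; rewrite dotvE.
Qed.

Lemma mvnormal_cos_sin (mu : probability (borel_cV R q) R) (S : 'M[R]_q) (t : 'cV[R]_q) :
  is_mvnormal mu S ->
  Ex mu (fun v => cos (dotv t v)) = expR (- ((t^T *m S *m t) 0 0 / 2)) /\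
  Ex mu (fun v => sin (dotv t v)) = 0.
Proof.
move=> [[_ Sneg] muE]; set Q := (t^T *m S *m t) 0 0.
have Q0 : 0 <= Q by have := Sneg t; rewrite mulmxN mulNmx mxE oppr_le0.
have lawE (B : set R) : measurable B -> mu (dotv t @^-1` B) =
    N01 ((fun z : GR => Num.sqrt Q * z) @^-1` B).
  move=> mB; rewrite -centered_normalE// -muE//.
  by congr (mu _); apply/seteqP; split => v /=; rewrite dotvE.
have SL f C := @same_law_Ex _ (borel_cV R q) _ GR R mu N01
  (dotv t) _ (borel_dotv t) (measurable_scale (Num.sqrt Q)) lawE f C.
have mc : measurable_fun setT (@cos R) by apply: continuous_measurable_fun; exact: continuous_cos.
have ms : measurable_fun setT (@sin R) by apply: continuous_measurable_fun; exact: continuous_sin.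
rewrite (SL _ 1 mc (@cos_max R)) (SL _ 1 ms (@sin_max R)).
by rewrite stdnormal_cos ?sqrtr_ge0// sqr_sqrtr// stdnormal_sin.
Qed.

End mvnormal.

(** * Least squares projections *)

Section inner_product.
Variable R : realType.

(** Lagrange's identity: the double sum of (f_i g_j - f_j g_i)^2 is twice the gap between the two
    sides. *)
Lemma cauchy_schwarz_sum (I : finType) (f g : I -> R) :
  (\sum_i f i * g i) ^+ 2 <= (\sum_i f i ^+ 2) * (\sum_i g i ^+ 2).
Proof.
have : 0 <= \sum_i \sum_j (f i * g j - f j * g i) ^+ 2.
  by apply: sumr_ge0 => i _; apply: sumr_ge0 => j _; exact: sqr_ge0.
have -> : \sum_i \sum_j (f i * g j - f j * g i) ^+ 2 =
    2 * ((\sum_i f i ^+ 2) * (\sum_i g i ^+ 2) - (\sum_i f i * g i) ^+ 2).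
  have E1 : \sum_i \sum_j (f i ^+ 2 * g j ^+ 2) = (\sum_i f i ^+ 2) * (\sum_i g i ^+ 2).
    by rewrite mulr_suml; apply: eq_bigr => i _; rewrite mulr_sumr.
  have E2 : \sum_i \sum_j (f j ^+ 2 * g i ^+ 2) = (\sum_i f i ^+ 2) * (\sum_i g i ^+ 2).
    by rewrite exchange_big.
  have E3 : \sum_i \sum_j ((f i * g i) * (f j * g j)) = (\sum_i f i * g i) ^+ 2.
    by rewrite expr2 mulr_suml; apply: eq_bigr => i _; rewrite mulr_sumr.
  transitivity (\sum_i \sum_j (f i ^+ 2 * g j ^+ 2) + \sum_i \sum_j (f j ^+ 2 * g i ^+ 2)
      - 2 * \sum_i \sum_j ((f i * g i) * (f j * g j))); last by rewrite E1 E2 E3; ring.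
  rewrite mulr_sumr -big_split -sumrB; apply: eq_bigr => i _.
  rewrite mulr_sumr -big_split -sumrB; apply: eq_bigr => j _ /=.
  by ring.
by rewrite pmulr_rge0// subr_ge0.
Qed.

Context {n : nat}.
Implicit Types a b c : 'cV[R]_n.

Definition nrm2 a : R := dotv a a.

Lemma nrm2_ge0 a : 0 <= nrm2 a.
Proof. by apply: sumr_ge0 => i _; rewrite -expr2 sqr_ge0. Qed.

Lemma dotvC a b : dotv a b = dotv b a.
Proof. by apply: eq_bigr => i _; rewrite mulrC. Qed.

Lemma nrm2E a : nrm2 a = \sum_i a i 0 ^+ 2.
Proof. by apply: eq_bigr => i _; rewrite expr2. Qed.

Lemma cauchy_schwarz a b : dotv a b ^+ 2 <= nrm2 a * nrm2 b.
Proof. by rewrite !nrm2E; exact: cauchy_schwarz_sum. Qed.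

Lemma nrm2_eq0 a : nrm2 a = 0 -> a = 0.
Proof.
rewrite nrm2E => /psumr_eq0P H; apply/colP => i; rewrite mxE.
by apply/eqP; rewrite -sqrf_eq0; apply/eqP; apply: H => // j _; exact: sqr_ge0.
Qed.

Lemma dotvZl (k : R) a b : dotv (k *: a) b = k * dotv a b.
Proof. by rewrite dotvC dotvZr dotvC. Qed.

Lemma dotvBr a b c : dotv a (b - c) = dotv a b - dotv a c.
Proof. by rewrite dotvDr [dotv a (- c)]dotvC dotvNl [dotv c a]dotvC. Qed.

Lemma dotvBl a b c : dotv (a - b) c = dotv a c - dotv b c.
Proof. by rewrite dotvDl dotvNl. Qed.

Lemma dotv_mulmx m (A : 'M[R]_(n, m)) a (b : 'cV[R]_m) :
  dotv a (A *m b) = dotv (A^T *m a) b.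
Proof. by rewrite !dotvE trmx_mul trmxK mulmxA. Qed.

End inner_product.

Section gram.
Variable R : realType.

Lemma gram_eq0 m n (X : 'M[R]_(m, n)) : X^T *m X = 0 -> X = 0.
Proof.
move=> XX; apply/matrixP => i j; rewrite [RHS]mxE.
have h : nrm2 (col j X) = 0.
  have := congr1 (fun A : 'M[R]_n => A j j) XX; rewrite !mxE => <-.
  by rewrite /nrm2 /dotv; apply: eq_bigr => k _; rewrite !mxE.
by have := nrm2_eq0 h => /colP/(_ i); rewrite !mxE.
Qed.

Variable ginv : forall m, 'M[R]_m -> 'M[R]_m.
Hypothesis ginvP : is_sym_ginv ginv.

Section projection.
Context {n K : nat}.
Variable P : 'M[R]_(n, K).
Let M := series_proj ginv P.
Let G := P^T *m P.

Let Gsym : G^T = G.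
Proof. by rewrite /G trmx_mul trmxK. Qed.

Lemma series_proj_sym : M^T = M.
Proof.
have [_ gs] := ginvP Gsym.
by rewrite /M /series_proj -/G !trmx_mul trmxK gs mulmxA.
Qed.

(** P'(MP - P) = 0 by the defining property of the generalized inverse. As MP - P is itself P times
    a matrix, its Gram matrix vanishes, and so does the matrix. *)
Lemma series_proj_id : M *m P = P.
Proof.
have [gg gs] := ginvP Gsym.
have MP : M *m P = P *m (ginv G *m G) by rewrite /M /series_proj -/G -!mulmxA.
have H : P^T *m (M *m P - P) = 0.
  rewrite mulmxBr (_ : P^T *m (M *m P) = G) ?subrr//.
  by rewrite MP -[RHS]gg -mulmxA (mulmxA P^T P).
have E : M *m P - P = P *m (ginv G *m G - 1%:M) by rewrite mulmxBr mulmx1 MP.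
apply/eqP; rewrite -subr_eq0; apply/eqP; apply: gram_eq0.
by rewrite [X in X^T]E trmx_mul -mulmxA H mulmx0.
Qed.

Lemma series_proj_idem : M *m M = M.
Proof.
have E : M = P *m (ginv G *m P^T) by rewrite /M /series_proj mulmxA.
by rewrite {2}E mulmxA series_proj_id -E.
Qed.

Lemma series_proj_range (v : 'cV[R]_n) : exists a : 'cV[R]_K, M *m v = P *m a.
Proof. by exists (ginv G *m P^T *m v); rewrite /M /series_proj -/G !mulmxA. Qed.

Lemma nrm2_proj (v : 'cV[R]_n) : nrm2 (M *m v) = dotv v (M *m v).
Proof.
by rewrite /nrm2 dotv_mulmx series_proj_sym mulmxA series_proj_idem dotvC.
Qed.

Lemma dotv_projC (v w : 'cV[R]_n) : dotv v (M *m w) = dotv (M *m v) w.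
Proof. by rewrite dotv_mulmx series_proj_sym. Qed.

Lemma dotv_proj (v w : 'cV[R]_n) : dotv v (M *m w) = dotv (M *m v) (M *m w).
Proof. by rewrite -{1}series_proj_idem -mulmxA dotv_projC. Qed.

Lemma nrm2_proj_le (v : 'cV[R]_n) : nrm2 (M *m v) <= nrm2 v.
Proof.
have := nrm2_ge0 (v - M *m v).
by rewrite /nrm2 dotvBr !dotvBl -(dotv_projC v v) -/(nrm2 (M *m v)) nrm2_proj; lra.
Qed.

(** M v lies in the range of P, which is also that of Pb, so M v = Pb a, and |M v|^2 = (Pb'v)'a. The
    Gram condition gives |Pb a|^2 >= (n/2) |a|^2, hence |M v|^4 <= |Pb'v|^2 |a|^2 <= |Pb'v|^2 (2/n)
    |M v|^2. The generalized inverse enters only through M being an orthogonal projection. *)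
Lemma nrm2_proj_gram (C : 'M[R]_K) (v : 'cV[R]_n) : C \in unitmx -> (0 < n)%N ->
  let Pb := P *m C in
  \sum_(p : 'I_K * 'I_K)
    ((Pb^T *m Pb) p.1 p.2 - n%:R * (p.1 == p.2)%:R) ^+ 2 <= (n%:R / 2) ^+ 2 ->
  nrm2 (M *m v) <= 2 / n%:R * nrm2 (Pb^T *m v).
Proof.
move=> uC n0 Pb; set D := fun p : 'I_K * 'I_K => _ => H.
have nr0 : 0 < n%:R :> R by rewrite ltr0n.
have [a0 Ma0] := series_proj_range v.
have [a Ma] : exists a : 'cV[R]_K, M *m v = Pb *m a.
  by exists (invmx C *m a0); rewrite Ma0 /Pb -mulmxA mulKVmx.
have E1 : nrm2 (Pb *m a) = \sum_(p : 'I_K * 'I_K) (a p.1 0 * a p.2 0) * (Pb^T *m Pb) p.1 p.2.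
  rewrite /nrm2 dotv_mulmx mulmxA dotvC /dotv.
  rewrite -(pair_bigA _ (fun i j => (a i 0 * a j 0) * (Pb^T *m Pb) i j))/=.
  apply: eq_bigr => i _; rewrite [in LHS]mxE mulr_sumr.
  by apply: eq_bigr => j _; ring.
have E2 : nrm2 a = \sum_(p : 'I_K * 'I_K) (a p.1 0 * a p.2 0) * (p.1 == p.2)%:R.
  rewrite -(pair_bigA _ (fun i j => (a i 0 * a j 0) * (i == j)%:R))/= nrm2E.
  apply: eq_bigr => i _; rewrite (bigD1 i)//= eqxx mulr1 big1 ?addr0 ?expr2// => j ji.
  by rewrite eq_sym (negbTE ji) mulr0.
have E3 : nrm2 a ^+ 2 = \sum_(p : 'I_K * 'I_K) (a p.1 0 * a p.2 0) ^+ 2.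
  rewrite -(pair_bigA _ (fun i j => (a i 0 * a j 0) ^+ 2))/= nrm2E expr2 mulr_suml.
  apply: eq_bigr => i _; rewrite mulr_sumr; apply: eq_bigr => j _.
  by rewrite exprMn.
(* Cauchy-Schwarz over pairs of indices: the Frobenius norm of a a' is |a|^2, and that of the Gram
   deviation is at most n / 2. *)
have E4 : (nrm2 (Pb *m a) - n%:R * nrm2 a) ^+ 2 <= (nrm2 a * (n%:R / 2)) ^+ 2.
  have -> : nrm2 (Pb *m a) - n%:R * nrm2 a = \sum_(p : 'I_K * 'I_K) (a p.1 0 * a p.2 0) *
      ((Pb^T *m Pb) p.1 p.2 - n%:R * (p.1 == p.2)%:R).
    by rewrite E1 E2 mulr_sumr -sumrB; apply: eq_bigr => p _; ring.
  by rewrite (le_trans (cauchy_schwarz_sum _ _))// -E3 exprMn ler_wpM2l ?sqr_ge0.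
have a20 := nrm2_ge0 a.
have E5 : n%:R / 2 * nrm2 a <= nrm2 (Pb *m a).
  have b0 : 0 <= nrm2 a * (n%:R / 2) by rewrite mulr_ge0// divr_ge0// ltW.
  move: E4; rewrite -[X in X <= _ -> _](real_normK (num_real _)).
  rewrite ler_pXn2r ?nnegrE// ler_norml => /andP[h _].
  set x := nrm2 (Pb *m a) in h *; lra.
have E6 : nrm2 (M *m v) = dotv (Pb^T *m v) a.
  by rewrite nrm2_proj Ma dotv_mulmx.
have E7 : nrm2 (M *m v) ^+ 2 <= nrm2 (Pb^T *m v) * nrm2 a.
  by rewrite {1}E6 cauchy_schwarz.
rewrite -Ma in E5.
have := nrm2_ge0 (M *m v); rewrite le_eqVlt => /predU1P[<-|m0].
  by rewrite mulr_ge0 ?nrm2_ge0// divr_ge0// ltW.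
rewrite -(ler_pM2r m0) -expr2 (le_trans E7)//.
rewrite [leRHS]mulrAC [leRHS]mulrC ler_wpM2l ?nrm2_ge0//.
have -> : nrm2 a = 2 / n%:R * (n%:R / 2 * nrm2 a) by field; rewrite gt_eqF.
by rewrite ler_wpM2l// divr_ge0// ltW.
Qed.

End projection.
End gram.

(** * Rayleigh quotients and Cholesky factors *)

Section positive_definite.
Variable R : realType.

Lemma continuous_sum_fun (T : topologicalType) (I : Type) (s : seq I) (F : I -> T -> R) :
  (forall i, continuous (F i)) -> continuous (fun v => \sum_(i <- s) F i v).
Proof.
move=> cF v; apply: cvg_big => [|i _]; first exact: add_continuous.
exact: cF.
Qed.

Lemma continuous_dotv_mul n (A : 'M[R]_n) : continuous (fun v : 'cV[R]_n => dotv v (A *m v)).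
Proof.
rewrite (_ : (fun v : 'cV[R]_n => dotv v (A *m v)) =
  (fun v : 'cV[R]_n => \sum_i \sum_j (v i 0 * (A i j * v j 0)))).
  apply: continuous_sum_fun => i; apply: continuous_sum_fun => j v.
  have c1 : {for v, continuous (fun v : 'cV[R]_n => v i 0)} by exact: continuous_coord.
  have c2 : {for v, continuous (fun v : 'cV[R]_n => v j 0)} by exact: continuous_coord.
  exact: (@cvgM _ _ (nbhs v) _ _ _ _ _ c1 (@cvgMl_tmp _ _ (nbhs v) _ _ (A i j) _ c2)).
apply/funext => v; rewrite /dotv; apply: eq_bigr => i _.
by rewrite mxE mulr_sumr.
Qed.

(** Turns a bound on eigenvalues into a bound on the quadratic form. The form attains its minimum
    lam on the unit sphere, and its first variation at the minimiser shows that the minimiser is an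
    eigenvector with eigenvalue lam. *)
Lemma rayleigh n (A : 'M[R]_n) (c : R) : A^T = A ->
  (forall a, eigenvalue A a -> c <= a) ->
  forall v, c * nrm2 v <= dotv v (A *m v).
Proof.
case: n A => [|n] A As eA v.
  by rewrite /nrm2 /dotv !big_ord0 mulr0.
pose f (v : 'cV[R]_n.+1) := dotv v (A *m v).
pose S := [set v : 'cV[R]_n.+1 | nrm2 v = 1].
have cf : continuous f by exact: continuous_dotv_mul.
have cn : continuous (@nrm2 R n.+1).
  rewrite (_ : @nrm2 R n.+1 = (fun v => dotv v (1%:M *m v))).
    exact: continuous_dotv_mul.
  by apply/funext => w; rewrite mul1mx.
have S0 : S !=set0.
  exists (delta_mx ord0 ord0); rewrite /S /= nrm2E (bigD1 ord0)//= big1 ?addr0.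
    by rewrite mxE !eqxx expr1n.
  by move=> i i0; rewrite mxE (negbTE i0) expr0n.
have cS : compact S.
  apply: (subclosed_compact _ (@compact_cube R n.+1 1)).
    rewrite (_ : S = @nrm2 R n.+1 @^-1` [set 1])//.
    by apply: closed_comp => [w _|]; [exact: cn|exact: closed_eq].
  move=> w; rewrite /S /= nrm2E => w1 i.
  rewrite -(ler_pXn2r (n := 2)) ?nnegrE// expr1n real_normK ?num_real// -w1.
  by rewrite (bigD1 i)//= lerDl sumr_ge0// => j _; exact: sqr_ge0.
have cfS : {within S, continuous f} by exact: continuous_subspaceT.
have [v0 /set_mem v0S min_] := compact_EVT_min S0 cS cfS.
set lam := f v0 in min_.
have homf w (k : R) : f (k *: w) = k ^+ 2 * f w.
  by rewrite /f -scalemxAr dotvZl dotvZr mulrA expr2.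
have homn w (k : R) : nrm2 (k *: w) = k ^+ 2 * nrm2 w.
  by rewrite /nrm2 dotvZl dotvZr mulrA expr2.
have low w : lam * nrm2 w <= f w.
  have [w0|w0] := eqVneq (nrm2 w) 0.
    by rewrite w0 mulr0 /f (nrm2_eq0 w0) /dotv big1// => i _; rewrite mxE mul0r.
  have wp : 0 < nrm2 w by rewrite lt_neqAle eq_sym w0 nrm2_ge0.
  have k2 : ((Num.sqrt (nrm2 w))^-1) ^+ 2 = (nrm2 w)^-1 by rewrite exprVn sqr_sqrtr// ltW.
  have wS : ((Num.sqrt (nrm2 w))^-1 *: w) \in S.
    by rewrite inE /S /= homn k2 mulVf.
  have := min_ _ wS; rewrite homf k2 mulrC ler_pdivlMr//.
have fB w s : f (v0 + s *: w) = f v0 + 2 * s * dotv w (A *m v0) + s ^+ 2 * f w.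
  rewrite /f mulmxDr -scalemxAr !dotvDl !dotvDr !dotvZl !dotvZr.
  rewrite (_ : dotv v0 (A *m w) = dotv w (A *m v0)); last by rewrite dotv_mulmx As dotvC.
  by ring.
have nB w s : nrm2 (v0 + s *: w) = nrm2 v0 + 2 * s * dotv w v0 + s ^+ 2 * nrm2 w.
  rewrite /nrm2 !dotvDl !dotvDr !dotvZl !dotvZr [dotv v0 w]dotvC.
  by ring.
have ort w : dotv w (A *m v0 - lam *: v0) = 0.
  rewrite dotvBr dotvZr; set x := _ - _.
  have H s : 0 <= 2 * s * x + s ^+ 2 * (f w - lam * nrm2 w).
    have := low (v0 + s *: w); rewrite fB nB v0S -/lam /x; nra.
  set y := f w - _ in H; have y0 : 0 <= y by rewrite subr_ge0 low.
  have y1 : 0 < y + 1 by rewrite ltr_wpDl.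
  (* Near the minimiser of 2 s x + s^2 y; using y + 1 instead of y keeps the denominator positive.
     The value is negative unless x = 0. *)
  have := H (- x / (y + 1)).
  rewrite (_ : _ + _ = - (x ^+ 2 * (y + 2) / (y + 1) ^+ 2)); last by field; rewrite gt_eqF.
  rewrite oppr_ge0 pmulr_lle0 ?invr_gt0 ?exprn_gt0// pmulr_lle0 ?ltr_wpDl//.
  by move=> x2; apply/eqP; rewrite -sqrf_eq0 eq_le x2 sqr_ge0.
have Av0 : A *m v0 = lam *: v0.
  by apply/eqP; rewrite -subr_eq0; apply/eqP/nrm2_eq0; rewrite /nrm2 ort.
(* [eigenvalue] refers to row vectors, so the eigenvector is transposed by means of the symmetry of
   A. *)
have el : eigenvalue A lam.
  apply/eigenvalueP; exists v0^T.
    by rewrite -[in LHS]As -trmx_mul Av0 linearZ.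
  rewrite trmx_eq0; apply/eqP => v00; move: v0S; rewrite v00 /S /= nrm2E big1 => [|i _].
    by move=> /eqP; rewrite eq_sym oner_eq0.
  by rewrite mxE expr0n.
rewrite (le_trans _ (low v))// ler_wpM2r ?nrm2_ge0//; exact: eA.
Qed.

Lemma posdef_dotv n (A : 'M[R]_n) v : posdef A -> v != 0 -> 0 < dotv v (A *m v).
Proof. by move=> [_ H] /H; rewrite dotvE mulmxA. Qed.

(** Induction on the size: the leading entry a is positive, the Schur complement D = C - b b' / a is
    again positive definite, and its factor is bordered by sqrt a and b / sqrt a. *)
Lemma cholesky n (A : 'M[R]_n) : posdef A ->
  exists2 L : 'M[R]_n, L \in unitmx & A = L *m L^T.
Proof.
elim: n A => [|n ih] A pA.
  exists 1%:M; first exact: unitmx1.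
  by apply/matrixP => -[].
rewrite -[n.+1]/(1 + n)%N in A pA *.
have [As pd] := pA.
pose a : R := A 0 0; pose b : 'cV[R]_n := dlsubmx A; pose C : 'M[R]_n := drsubmx A.
have Ab : ursubmx A = b^T by rewrite /b trmx_dlsub As.
have Aa : ulsubmx A = a%:M.
  by apply/matrixP => i j; rewrite !ord1 !mxE eqxx mulr1n; congr (A _ _); apply/val_inj.
have AE : A = block_mx a%:M b^T b C by rewrite -Aa -Ab submxK.
have Cs : C^T = C by rewrite /C trmx_drsub As.
have dcol (u u' : 'cV[R]_1) (v v' : 'cV[R]_n) :
    dotv (col_mx u v) (col_mx u' v') = u 0 0 * u' 0 0 + dotv v v'.
  rewrite /dotv big_split_ord /= big_ord1; congr (_ + _).
    by rewrite !col_mxEu.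
  by apply: eq_bigr => i _; rewrite !col_mxEd.
have form (x : R) (v : 'cV[R]_n) :
    dotv (col_mx x%:M v) (A *m col_mx x%:M v) = a * x ^+ 2 + 2 * x * dotv b v + dotv v (C *m v).
  rewrite AE mul_block_col dcol dotvDr !mul_mx_scalar dotvZr.
  rewrite !mxE eqxx !mulr1n.
  rewrite (_ : \sum_j b^T 0 j * v j 0 = dotv b v); last first.
    by apply: eq_bigr => j _; rewrite mxE.
  by rewrite [dotv v b]dotvC; ring.
have pos (x : R) (v : 'cV[R]_n) : (x != 0) || (v != 0) ->
    0 < a * x ^+ 2 + 2 * x * dotv b v + dotv v (C *m v).
  move=> xv; rewrite -form; apply: posdef_dotv => //.
  apply: contraTneq xv => /eqP; rewrite col_mx_eq0 => /andP[/eqP x0 /eqP ->].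
  have := congr1 (fun B : 'M[R]_1 => B 0 0) x0; rewrite !mxE eqxx mulr1n => ->.
  by rewrite !eqxx.
have a0 : 0 < a.
  have := pos 1 0; rewrite oner_eq0 => /(_ isT).
  by rewrite expr1n mulr1 mulmx0 !dotv0r mulr0 !addr0.
have an0 : a != 0 by rewrite gt_eqF.
pose D := C - a^-1 *: (b *m b^T).
have pD : posdef D.
  split; first by rewrite /D linearB linearZ /= trmx_mul trmxK Cs.
  move=> v v0; rewrite -mulmxA -dotvE.
  (* This first coordinate minimises the full form for given v; the minimum is v'D v. *)
  have := pos (- (dotv b v / a)) v; rewrite v0 orbT => /(_ isT).
  rewrite (_ : dotv v (D *m v) = dotv v (C *m v) - dotv b v ^+ 2 / a); last first.
    have bv : (b^T *m v) 0 0 = dotv b v by rewrite dotvE.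
    rewrite /D mulmxBl dotvBr -scalemxAl dotvZr -[b *m b^T *m v]mulmxA.
    rewrite [dotv v (b *m _)]dotv_mulmx (_ : dotv (b^T *m v) _ = dotv b v ^+ 2); last first.
      by rewrite [LHS]/dotv big_ord1 bv expr2.
    by rewrite mulrC.
  by congr (_ < _); field.
have [L uL DE] := ih _ pD.
pose s := Num.sqrt a; have s0 : 0 < s by rewrite sqrtr_gt0.
have s2 : s * s = a by rewrite -expr2 sqr_sqrtr// ltW.
exists (block_mx s%:M 0 (s^-1 *: b) L).
  rewrite unitmxE (det_lblock (s%:M : 'M[R]_1)) unitrM det_scalar1 -unitmxE uL andbT.
  by rewrite unitfE gt_eqF.
rewrite tr_block_mx mulmx_block !trmx0 !mulmx0 !mul0mx !addr0 tr_scalar_mx.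
rewrite AE; congr block_mx.
- by rewrite -scalar_mxM s2.
- by rewrite linearZ /= mul_scalar_mx scalerA mulfV ?scale1r// gt_eqF.
- by rewrite mul_mx_scalar scalerA mulfV ?scale1r// gt_eqF.
- rewrite -DE /D linearZ /= -scalemxAl -scalemxAr scalerA -invfM s2 addrC subrK//.
Qed.

End positive_definite.

(** * Stochastic order symbols *)

Section small_in_probability.
Context d (T : measurableType d) (R : realType) (Pr : probability T R).
Local Notation intg := (intg Pr).
Local Notation Ex := (Ex Pr).
Implicit Types (Q : nat -> T -> Prop) (X Y : nat -> T -> R).

(** The exceptional set is an explicit measurable set, so the events Q, often built from generalized
    inverses, may fail to be measurable. *)
Definition mostly (e : R) Q := \forall n \near \oo,
  exists A, [/\ measurable A, (Pr A <= e%:E)%E & forall t, ~ A t -> Q n t].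

Definition whp Q := forall e : R, 0 < e -> mostly e Q.

Lemma mostly_and e e' Q Q' : mostly e Q -> mostly e' Q' ->
  mostly (e + e') (fun n t => Q n t /\ Q' n t).
Proof.
move=> h h'; near=> n.
have [A [mA PA HA]] : exists A, [/\ measurable A, (Pr A <= e%:E)%E & forall t, ~ A t -> Q n t].
  by near: n; exact: h.
have [A' [mA' PA' HA']] : exists A, [/\ measurable A, (Pr A <= e'%:E)%E & forall t, ~ A t -> Q' n t].
  by near: n; exact: h'.
exists (A `|` A'); split; first exact: measurableU.
  rewrite (le_trans (measureU2 Pr mA mA'))// EFinD; exact: leeD.
by move=> t /not_orP[/HA ? /HA' ?].
Unshelve. all: by end_near. Qed.

Lemma mostly_mono e Q Q' : (\forall n \near \oo, forall t, Q n t -> Q' n t) ->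
  mostly e Q -> mostly e Q'.
Proof.
by apply: filterS2 => n QQ' [A [mA PA HA]]; exists A; split => // t /HA /QQ'.
Qed.

Lemma whp_and Q Q' : whp Q -> whp Q' -> whp (fun n t => Q n t /\ Q' n t).
Proof.
move=> h h' e e0; have e2 : 0 < e / 2 by rewrite divr_gt0.
by rewrite (splitr e); apply: mostly_and; [exact: h|exact: h'].
Qed.

Lemma whp_mono Q Q' : (\forall n \near \oo, forall t, Q n t -> Q' n t) -> whp Q -> whp Q'.
Proof. by move=> QQ' h e e0; exact: mostly_mono (h _ e0). Qed.

Lemma whp_all (I : finType) (Q : I -> nat -> T -> Prop) :
  (forall i, whp (Q i)) -> whp (fun n t => forall i, Q i n t).
Proof.
move=> h; suff : whp (fun n t => forall i, i \in enum I -> Q i n t).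
  by apply: whp_mono; near=> n => t H i; apply: H; rewrite mem_enum.
elim: (enum I) => [|i s ih].
  by move=> e e0; near=> n; exists set0; split => //; rewrite measure0 lee_fin ltW.
apply: whp_mono (whp_and (h i) ih); near=> n => t [Hi Hs] j.
by rewrite inE => /orP[/eqP ->//|]; exact: Hs.
Unshelve. all: by end_near. Qed.

Lemma whp_ae Q : (\forall n \near \oo, {ae Pr, forall t, Q n t}) -> whp Q.
Proof.
move=> H e e0; near=> n.
have [A [mA A0 HA]] : {ae Pr, forall t, Q n t} by near: n.
exists A; split => //; first by rewrite A0 lee_fin ltW.
by move=> t nA; apply: contrapT => nQ; apply: nA; exact: HA.
Unshelve. all: by end_near. Qed.

Definition op X := forall e : R, 0 < e -> whp (fun n t => `|X n t| <= e).

Definition Op X := forall e : R, 0 < e -> exists C : R, mostly e (fun n t => `|X n t| <= C).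

Lemma op_le_whp X Y : op Y -> whp (fun n t => `|X n t| <= `|Y n t|) -> op X.
Proof.
move=> oY h e e0; apply: whp_mono (whp_and (oY e e0) h); near=> n => t [H1 H2].
exact: le_trans H2 H1.
Unshelve. all: by end_near. Qed.

Lemma op_eq_whp X Y : op Y -> whp (fun n t => X n t = Y n t) -> op X.
Proof.
move=> oY h; apply: op_le_whp oY _; apply: whp_mono h.
by near=> n => t ->.
Unshelve. all: by end_near. Qed.

Lemma op_eq X Y : op Y -> (forall n t, X n t = Y n t) -> op X.
Proof.
move=> oY h e e0; apply: whp_mono (oY e e0); near=> n => t.
by rewrite h.
Unshelve. all: by end_near. Qed.

Lemma opD X Y : op X -> op Y -> op (fun n t => X n t + Y n t).
Proof.
move=> oX oY e e0; have e2 : 0 < e / 2 by rewrite divr_gt0.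
apply: whp_mono (whp_and (oX _ e2) (oY _ e2)); near=> n => t [H1 H2].
by rewrite (splitr e) (le_trans (ler_normD _ _))// lerD.
Unshelve. all: by end_near. Qed.

Lemma opZ (a : R) X : op X -> op (fun n t => a * X n t).
Proof.
move=> oX e e0; have a1 : 0 < `|a| + 1 by rewrite ltr_wpDl.
have ea : 0 < e / (`|a| + 1) by rewrite divr_gt0.
apply: whp_mono (oX _ ea); near=> n => t H; rewrite normrM.
have -> : e = (`|a| + 1) * (e / (`|a| + 1)) by rewrite mulrC divfK// gt_eqF.
by apply: ler_pM => //; rewrite lerDl.
Unshelve. all: by end_near. Qed.

Lemma opN X : op X -> op (fun n t => - X n t).
Proof. by move=> oX; apply: op_eq (opZ (-1) oX) _ => n t; rewrite mulN1r. Qed.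

Lemma opB X Y : op X -> op Y -> op (fun n t => X n t - Y n t).
Proof. by move=> oX oY; apply: opD oX (opN oY). Qed.

Lemma op_Op X : op X -> Op X.
Proof. by move=> oX e e0; exists 1; exact: (oX 1 ltr01). Qed.

Lemma Op_le_whp X Y : Op Y -> whp (fun n t => `|X n t| <= `|Y n t|) -> Op X.
Proof.
move=> oY h e e0; have e2 : 0 < e / 2 by rewrite divr_gt0.
have [C HC] := oY _ e2; exists C; rewrite (splitr e).
apply: mostly_mono (mostly_and HC (h _ e2)); near=> n => t [H1 H2].
exact: le_trans H2 H1.
Unshelve. all: by end_near. Qed.

Lemma OpD X Y : Op X -> Op Y -> Op (fun n t => X n t + Y n t).
Proof.
move=> oX oY e e0; have e2 : 0 < e / 2 by rewrite divr_gt0.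
have [C HC] := oX _ e2; have [C' HC'] := oY _ e2; exists (C + C'); rewrite (splitr e).
apply: mostly_mono (mostly_and HC HC'); near=> n => t [H1 H2].
by rewrite (le_trans (ler_normD _ _))// lerD.
Unshelve. all: by end_near. Qed.

Lemma Op_sum (I : Type) (s : seq I) (F : I -> nat -> T -> R) :
  (forall i, Op (F i)) -> Op (fun n t => \sum_(i <- s) F i n t).
Proof.
move=> oF; elim: s => [|i s ih].
  move=> e e0; exists 0; near=> n; exists set0; split => //; first by rewrite measure0 lee_fin ltW.
  by move=> t _; rewrite big_nil normr0.
move=> e e0; have [C HC] := OpD (oF i) ih e0; exists C.
by apply: mostly_mono HC; near=> n => t; rewrite big_cons.
Unshelve. all: by end_near. Qed.

Lemma opM X Y : op X -> Op Y -> op (fun n t => X n t * Y n t).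
Proof.
move=> oX oY e e0 b b0; have b2 : 0 < b / 2 by rewrite divr_gt0.
have [C HC] := oY _ b2; have C1 : 0 < `|C| + 1 by rewrite ltr_wpDl.
have eC : 0 < e / (`|C| + 1) by rewrite divr_gt0.
rewrite (splitr b); apply: mostly_mono (mostly_and (oX _ eC _ b2) HC).
near=> n => t [H1 H2]; rewrite normrM.
have H3 : `|Y n t| <= `|C| + 1.
  by rewrite (le_trans H2)// (le_trans (ler_norm C))// lerDl.
rewrite (le_trans (ler_pM (normr_ge0 _) (normr_ge0 _) H1 H3))//.
by rewrite divfK// gt_eqF.
Unshelve. all: by end_near. Qed.

Lemma op_cst (x : nat -> R) : x @ \oo --> (0 : R) -> op (fun n _ => x n).
Proof.
move=> /cvgrPdist_le x0 e e0; apply: whp_ae; have := x0 _ e0; apply: filterS => n.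
by rewrite sub0r normrN => H; apply: aeW.
Qed.

Lemma op_L1 X (x : nat -> R) : (forall n, intg (X n)) -> (forall n t, 0 <= X n t) ->
  (\forall n \near \oo, Ex (X n) <= x n) -> x @ \oo --> (0 : R) -> op X.
Proof.
move=> iX X0 Xx /cvgrPdist_le x0 e e0 b b0.
have eb : 0 < e * b by rewrite mulr_gt0.
near=> n; exists [set t | e <= X n t].
split; first exact: measurable_ge_set (intg_meas (iX n)).
  rewrite (le_trans (markov_Ex (iX n) (X0 n) e0))// lee_fin ler_pdivrMr// mulrC.
  have H : Ex (X n) <= x n by near: n.
  have : `|0 - x n| <= e * b by near: n; exact: x0.
  by rewrite sub0r normrN => /(le_trans (ler_norm _)); exact: le_trans.
by move=> t /= /negP; rewrite -ltNge => /ltW; rewrite ger0_norm.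
Unshelve. all: by end_near. Qed.

Lemma op_sqr X : op (fun n t => X n t ^+ 2) -> op X.
Proof.
move=> h e e0; have e2 : 0 < e ^+ 2 by rewrite exprn_gt0.
apply: whp_mono (h _ e2); near=> n => t.
by rewrite normrX ler_pXn2r// nnegrE// ltW.
Unshelve. all: by end_near. Qed.

Lemma op_L2 X (x : nat -> R) : (forall n, sqintg Pr (X n)) ->
  (\forall n \near \oo, Ex (fun t => X n t ^+ 2) <= x n) -> x @ \oo --> (0 : R) -> op X.
Proof.
move=> iX Xx x0; apply: op_sqr; apply: op_L1 Xx x0 => n; first exact: (iX n).2.
by move=> t; exact: sqr_ge0.
Qed.

Lemma Op_L2 X (C : R) : (forall n, sqintg Pr (X n)) ->
  (\forall n \near \oo, Ex (fun t => X n t ^+ 2) <= C) -> Op X.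
Proof.
move=> iX XC e e0.
have C1 : 0 < `|C| + 1 by rewrite ltr_wpDl.
have CC : C <= `|C| + 1 by rewrite (le_trans (ler_norm C))// lerDl.
(* Chebyshev's inequality: the probability that |X| >= L is at most C / L^2 <= e. *)
pose L := Num.sqrt ((`|C| + 1) / e).
have L0 : 0 < L by rewrite sqrtr_gt0 divr_gt0.
have L2 : L ^+ 2 = (`|C| + 1) / e by rewrite sqr_sqrtr// ltW// divr_gt0.
exists L; near=> n; exists [set t | L ^+ 2 <= X n t ^+ 2].
split; first by apply: measurable_ge_set (intg_meas (iX n).2).
  rewrite (le_trans (markov_Ex (iX n).2 _ _))//.
  - by move=> t; exact: sqr_ge0.
  - by rewrite exprn_gt0.
  rewrite lee_fin ler_pdivrMr ?exprn_gt0// L2 mulrC divfK ?gt_eqF//.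
  by apply: le_trans CC; near: n.
move=> t /= /negP; rewrite -ltNge => /ltW.
by rewrite -[X n t ^+ 2]real_normK ?num_real// ler_pXn2r// nnegrE// ltW.
Unshelve. all: by end_near. Qed.

End small_in_probability.

(** * Second moments of sample sums *)

Section second_moments.
Context d (T : measurableType d) (R : realType) (Pr : probability T R).
Local Notation intg := (intg Pr).
Local Notation Ex := (Ex Pr).
Context m (V : nat -> T -> 'cV[R]_m).
Hypothesis mV : forall i, random_vector (V i).
Hypothesis indV : mutually_independent Pr V.
Hypothesis idV : identically_distributed Pr V.

Let mfV i (f : 'cV[R]_m -> R) : borel_fun f -> measurable_fun setT (fun t => f (V i t)).
Proof. exact: borel_comp. Qed.

Lemma borelM (f g : 'cV[R]_m -> R) : borel_fun f -> borel_fun g -> borel_fun (fun v => f v * g v).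
Proof. exact: (@measurable_funM _ (borel_cV R m)). Qed.

Lemma borel_sqr (f : 'cV[R]_m -> R) : borel_fun f -> borel_fun (fun v => f v ^+ 2).
Proof. by move=> mf; under eq_fun do rewrite expr2; exact: borelM. Qed.

Lemma ident_sqintg i j (f : 'cV[R]_m -> R) : borel_fun f ->
  sqintg Pr (fun t => f (V i t)) -> sqintg Pr (fun t => f (V j t)).
Proof.
move=> mf [_ i2]; split; first exact: mfV.
exact: (ident_intg_Ex mV idV j (borel_sqr mf) i2).1.
Qed.

Lemma Ex_sum_sqr n (f : 'cV[R]_m -> R) : borel_fun f ->
  sqintg Pr (fun t => f (V 0%N t)) -> Ex (fun t => f (V 0%N t)) = 0 ->
  Ex (fun t => (\sum_(i < n) f (V i t)) ^+ 2) = n%:R * Ex (fun t => f (V 0%N t) ^+ 2).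
Proof.
move=> mf f2 f0.
have sq i : sqintg Pr (fun t => f (V i t)) by exact: ident_sqintg f2.
transitivity (Ex (fun t => \sum_(i < n) \sum_(j < n) f (V i t) * f (V j t))).
  by apply: eq_Ex => t; rewrite expr2 mulr_suml; apply: eq_bigr => i _; rewrite mulr_sumr.
rewrite Ex_sum; last first.
  by move=> i _; apply: intg_sum => j _; exact: sqintgM.
rewrite (eq_bigr (fun=> Ex (fun t => f (V 0%N t) ^+ 2))); last first.
  move=> i _; rewrite Ex_sum; last by move=> j _; exact: sqintgM.
  rewrite (bigD1 i)//= big1 ?addr0.
    rewrite -(ident_intg_Ex mV idV i (borel_sqr mf) f2.2).2.
    by apply: eq_Ex => t; rewrite expr2.
  move=> j ji; rewrite (indep_pair mV indV) //.
  - by rewrite (ident_intg_Ex mV idV i mf (sqintg_intg f2)).2 f0 mul0r.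
  - by apply: contra ji => /eqP ij; apply/eqP/val_inj.
  - exact: sqintg_intg.
  - exact: sqintg_intg.
  - exact: sqintgM.
by rewrite sumr_const card_ord mulr_natl.
Qed.

Definition samp n (f : 'cV[R]_m -> R) t : 'cV[R]_n := \col_(i < n) f (V i t).

Lemma dotv_samp n (f g : 'cV[R]_m -> R) t :
  dotv (samp n f t) (samp n g t) = \sum_(i < n) f (V i t) * g (V i t).
Proof. by apply: eq_bigr => i _; rewrite !mxE. Qed.

Lemma sqintg_sum_samp n (f : 'cV[R]_m -> R) : borel_fun f ->
  sqintg Pr (fun t => f (V 0%N t)) -> sqintg Pr (fun t => \sum_(i < n) f (V i t)).
Proof. by move=> mf f2; apply: sqintg_sum => i _; exact: ident_sqintg f2. Qed.

Lemma Op_sum_samp (f : 'cV[R]_m -> R) : borel_fun f ->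
  sqintg Pr (fun t => f (V 0%N t)) -> Ex (fun t => f (V 0%N t)) = 0 ->
  Op Pr (fun n t => (\sum_(i < n) f (V i t)) / Num.sqrt n%:R).
Proof.
move=> mf f2 f0.
apply: (@Op_L2 _ _ _ _ _ (Ex (fun t => f (V 0%N t) ^+ 2))).
  move=> n; have := sqintgZ (Num.sqrt n%:R)^-1 (sqintg_sum_samp n mf f2).
  by case=> H1 H2; split; [apply: eq_measurable_fun H1 => t _|apply: eq_intg H2 => t]; rewrite mulrC.
near=> n; have n0 : (0 < n)%N by near: n; exact: nbhs_infty_gt.
rewrite (eq_Ex Pr (Y := fun t => n%:R^-1 * (\sum_(i < n) f (V i t)) ^+ 2)); last first.
  by move=> t; rewrite exprMn exprVn sqr_sqrtr ?ler0n// mulrC.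
rewrite ExZ; last exact: (sqintg_sum_samp n mf f2).2.
by rewrite Ex_sum_sqr// mulKf// pnatr_eq0 -lt0n.
Unshelve. all: by end_near. Qed.

(** The summand may change with n, as approximation errors do; by independence and centring, the
    variance of the normalised sum is E f_n^2, which tends to zero. *)
Lemma op_sum_samp (f : nat -> 'cV[R]_m -> R) (x : nat -> R) : (forall n, borel_fun (f n)) ->
  (forall n, sqintg Pr (fun t => f n (V 0%N t))) ->
  (forall n, Ex (fun t => f n (V 0%N t)) = 0) ->
  (\forall n \near \oo, Ex (fun t => f n (V 0%N t) ^+ 2) <= x n) -> x @ \oo --> (0 : R) ->
  op Pr (fun n t => (\sum_(i < n) f n (V i t)) / Num.sqrt n%:R).
Proof.
move=> mf f2 f0 fx x0.
apply: (op_L2 _ _ x0).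
  move=> n; have := sqintgZ (Num.sqrt n%:R)^-1 (sqintg_sum_samp n (mf n) (f2 n)).
  by case=> H1 H2; split; [apply: eq_measurable_fun H1 => t _|apply: eq_intg H2 => t]; rewrite mulrC.
near=> n; have n0 : (0 < n)%N by near: n; exact: nbhs_infty_gt.
rewrite (eq_Ex Pr (Y := fun t => n%:R^-1 * (\sum_(i < n) f n (V i t)) ^+ 2)); last first.
  by move=> t; rewrite exprMn exprVn sqr_sqrtr ?ler0n// mulrC.
rewrite ExZ; last exact: (sqintg_sum_samp n (mf n) (f2 n)).2.
rewrite Ex_sum_sqr// mulKf; last by rewrite pnatr_eq0 -lt0n.
by near: n.
Unshelve. all: by end_near. Qed.

End second_moments.

(** * The partialled-out cross products *)

Section small_vectors.
Context d (T : measurableType d) (R : realType) (Pr : probability T R).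
Implicit Types a b : forall n, T -> 'cV[R]_n.

(** Squared length o_p(sqrt n): exactly what makes the inner product of two such vectors negligible
    against sqrt n. *)
Definition small a := op Pr (fun n t => nrm2 (a n t) / Num.sqrt n%:R).

Lemma nrm2D_le n (a b : 'cV[R]_n) : nrm2 (a + b) <= 2 * nrm2 a + 2 * nrm2 b.
Proof.
rewrite !nrm2E !mulr_sumr -big_split /= ler_sum// => i _; rewrite mxE.
by have := sqr_ge0 (a i 0 - b i 0); nra.
Qed.

Lemma dotv_amgm n (a b : 'cV[R]_n) : `|dotv a b| <= nrm2 a + nrm2 b.
Proof.
have H : dotv a b ^+ 2 <= nrm2 a * nrm2 b by exact: cauchy_schwarz.
have a0 := nrm2_ge0 a; have b0 := nrm2_ge0 b.
by rewrite -(ler_pXn2r (n := 2))// ?nnegrE ?addr_ge0// real_normK ?num_real//; nra.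
Qed.

Lemma smallD a b : small a -> small b -> small (fun n t => a n t + b n t).
Proof.
move=> sa sb; apply: op_le_whp (opD (opZ 2 sa) (opZ 2 sb)) _.
apply: whp_ae; near=> n; apply: aeW => t.
have s0 : 0 <= (Num.sqrt n%:R : R)^-1 by rewrite invr_ge0 sqrtr_ge0.
rewrite !mulrA -mulrDl !normrM (ger0_norm (nrm2_ge0 _)) (ger0_norm s0) ler_wpM2r//.
by rewrite (le_trans (nrm2D_le _ _))// ler_norm.
Unshelve. all: by end_near. Qed.

Lemma small_le_whp a b : small b -> whp Pr (fun n t => nrm2 (a n t) <= nrm2 (b n t)) -> small a.
Proof.
move=> sb h; apply: op_le_whp sb _; apply: whp_mono h; near=> n => t H.
have s0 : 0 <= (Num.sqrt n%:R : R)^-1 by rewrite invr_ge0 sqrtr_ge0.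
by rewrite !normrM !(ger0_norm (nrm2_ge0 _)) (ger0_norm s0) ler_wpM2r.
Unshelve. all: by end_near. Qed.

Lemma small_dot a b : small a -> small b ->
  op Pr (fun n t => dotv (a n t) (b n t) / Num.sqrt n%:R).
Proof.
move=> sa sb; apply: op_le_whp (opD sa sb) _.
apply: whp_ae; near=> n; apply: aeW => t.
have s0 : 0 <= (Num.sqrt n%:R : R)^-1 by rewrite invr_ge0 sqrtr_ge0.
rewrite -mulrDl !normrM (ger0_norm s0) ler_wpM2r//.
by rewrite (le_trans (dotv_amgm _ _))// ler_norm.
Unshelve. all: by end_near. Qed.

End small_vectors.

(** * Projections of noise and of approximation errors on the normalised series *)

Section core_estimates.
Context disp (T : measurableType disp) (R : realType) (Pr : probability T R).
Local Notation intg := (intg Pr).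
Local Notation Ex := (Ex Pr).
Local Notation op := (op Pr).
Local Notation whp := (whp Pr).
Local Notation small := (small Pr).
Context m (V : nat -> T -> 'cV[R]_m).
Hypothesis mV : forall i, random_vector (V i).
Hypothesis indV : mutually_independent Pr V.
Hypothesis idV : identically_distributed Pr V.
Local Notation samp := (samp V).

Variables (K : nat -> nat) (b : forall n, 'I_(K n) -> 'cV[R]_m -> R) (Z : nat -> R).
Arguments b : clear implicits.
Hypothesis mb : forall n k, borel_fun (b n k).
Hypothesis bZ : forall n v, \sum_k b n k v ^+ 2 <= Z n.
Hypothesis b1 : forall n j k, Ex (fun t => b n j (V 0%N t) * b n k (V 0%N t)) = (j == k)%:R.
Hypothesis KZ : (fun n => (K n)%:R * Z n / n%:R) @ \oo --> (0 : R).

Let mfV i (f : 'cV[R]_m -> R) : borel_fun f -> measurable_fun setT (fun t => f (V i t)).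
Proof. exact: borel_comp. Qed.

Let Z0 n : 0 <= Z n.
Proof. by apply: le_trans (bZ n 0); apply: sumr_ge0 => k _; exact: sqr_ge0. Qed.

Let b_le n k v : `|b n k v| <= Num.sqrt (Z n).
Proof.
rewrite -(ler_pXn2r (n := 2))// ?nnegrE ?sqrtr_ge0// sqr_sqrtr// real_normK ?num_real//.
apply: le_trans (bZ n v); rewrite (bigD1 k)//= lerDl; apply: sumr_ge0 => j _; exact: sqr_ge0.
Qed.

Let bb_le n j k v : `|b n j v * b n k v| <= Z n.
Proof.
by rewrite normrM -(sqr_sqrtr (Z0 n)) expr2 ler_pM.
Qed.

Let ibb n j k i : intg (fun t => b n j (V i t) * b n k (V i t)).
Proof. by apply: (@bounded_intg _ _ _ _ _ (Z n)); [exact: (mfV i (borelM (mb j) (mb k)))|by move=> t; exact: bb_le]. Qed.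

Let sqbb n j k i : sqintg Pr (fun t => b n j (V i t) * b n k (V i t)).
Proof. by apply: (@bounded_sqintg _ _ _ _ _ (Z n)); [exact: (mfV i (borelM (mb j) (mb k)))|by move=> t; exact: bb_le]. Qed.

(** The normalised functions have second moment one, so K is the mean of sum_k b_k^2, which is at
    most Z. Hence K Z / n -> 0 forces K^2 / n -> 0, and then K / sqrt n -> 0. *)
Let K_le n : (K n)%:R <= Z n.
Proof.
rewrite (_ : (K n)%:R = Ex (fun t => \sum_k b n k (V 0%N t) ^+ 2)).
  rewrite -[leRHS](Ex_cst Pr); apply: le_Ex => //; last exact: intg_cst.
  by apply: intg_sum => k _; under eq_fun do rewrite expr2.
rewrite Ex_sum; last by move=> k _; under eq_fun do rewrite expr2.
rewrite (eq_bigr (fun=> 1)); last first.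
  move=> k _; transitivity (Ex (fun t => b n k (V 0%N t) * b n k (V 0%N t))).
    by apply: eq_Ex => t; rewrite expr2.
  by rewrite b1 eqxx.
by rewrite sumr_const card_ord.
Qed.

Let K2 : (fun n => (K n)%:R ^+ 2 / n%:R) @ \oo --> (0 : R).
Proof.
apply: cvg_le0 KZ => n.
rewrite subr0 ger0_norm; last by rewrite divr_ge0 ?sqr_ge0 ?ler0n.
by rewrite ler_wpM2r ?invr_ge0// expr2 ler_wpM2l.
Qed.

Let Ksqrt : (fun n => (K n)%:R / Num.sqrt n%:R) @ \oo --> (0 : R).
Proof.
apply/cvgrPdist_le => a a0; have a2 : 0 < a ^+ 2 by rewrite exprn_gt0.
have /cvgrPdist_le/(_ _ a2) := K2; apply: filterS => n.
rewrite !sub0r !normrN => h; rewrite -(ler_pXn2r (n := 2))// ?nnegrE ?(ltW a0)// -normrX.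
by rewrite exprMn exprVn sqr_sqrtr// ler0n.
Qed.

Definition basis_mx n t : 'M[R]_(n, K n) := \matrix_(i < n, k < K n) b n k (V i t).

(** The entries of the deviation are sums of i.i.d. centred terms, so its expected squared Frobenius
    norm is at most n E(sum_k b_k^2)^2 <= n Z K, which is o(n^2). Markov's inequality concludes. *)
Lemma gram_close : whp (fun n t =>
  \sum_(p : 'I_(K n) * 'I_(K n))
    (((basis_mx n t)^T *m basis_mx n t) p.1 p.2 - n%:R * (p.1 == p.2)%:R) ^+ 2
      <= (n%:R / 2) ^+ 2).
Proof.
pose phi n (p : 'I_(K n) * 'I_(K n)) v := b n p.1 v * b n p.2 v - (p.1 == p.2)%:R.
have mphi n p : borel_fun (phi n p).
  apply: (@measurable_funB _ (borel_cV R m)); first exact: borelM.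
  exact: (@measurable_cst _ _ (borel_cV R m)).
have phi2 n p : sqintg Pr (fun t => phi n p (V 0%N t)).
  apply: (@bounded_sqintg _ _ _ _ _ (Z n + 1)); first exact: (mfV 0%N (mphi n p)).
  move=> t; rewrite (le_trans (ler_normB _ _))// lerD//.
  by case: (_ == _); rewrite ?normr1 ?normr0.
have phi0 n p : Ex (fun t => phi n p (V 0%N t)) = 0.
  by rewrite ExB ?b1 ?Ex_cst ?subrr//; exact: intg_cst.
have E n t p : ((basis_mx n t)^T *m basis_mx n t) p.1 p.2 - n%:R * (p.1 == p.2)%:R =
    \sum_(i < n) phi n p (V i t).
  rewrite sumrB sumr_const card_ord mulr_natl; congr (_ - _).
  by rewrite mxE; apply: eq_bigr => i _; rewrite !mxE.
pose X n t := n%:R ^- 2 * \sum_(p : 'I_(K n) * 'I_(K n)) (\sum_(i < n) phi n p (V i t)) ^+ 2.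
have iX n : intg (X n).
  apply: intgZ; apply: intg_sum => p _.
  exact: (sqintg_sum_samp mV idV n (mphi n p) (phi2 n p)).2.
have oX : op X.
  apply: (op_L1 iX _ _ KZ).
    move=> n t; apply: mulr_ge0; first by rewrite invr_ge0 exprn_ge0.
    by apply: sumr_ge0 => p _; exact: sqr_ge0.
  near=> n; have n0 : (0 < n)%N by near: n; exact: nbhs_infty_gt.
  rewrite ExZ; last first.
    by apply: intg_sum => p _; exact: (sqintg_sum_samp mV idV n (mphi n p) (phi2 n p)).2.
  rewrite Ex_sum; last first.
    by move=> p _; exact: (sqintg_sum_samp mV idV n (mphi n p) (phi2 n p)).2.
  rewrite (eq_bigr (fun p => n%:R * Ex (fun t => phi n p (V 0%N t) ^+ 2))); last first.
    by move=> p _; rewrite (Ex_sum_sqr mV indV idV).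
  rewrite -mulr_sumr.
  have nn : (n%:R : R) != 0 by rewrite pnatr_eq0 -lt0n.
  rewrite (_ : n%:R ^- 2 * (n%:R * _) = (\sum_p Ex (fun t => phi n p (V 0%N t) ^+ 2)) / n%:R); last first.
    by rewrite expr2 invfM -!mulrA mulKf// mulrC.
  rewrite ler_wpM2r ?invr_ge0//.
  (* The variance of b_j b_k is at most its second moment. *)
  have le1 p : Ex (fun t => phi n p (V 0%N t) ^+ 2) <=
      Ex (fun t => (b n p.1 (V 0%N t) * b n p.2 (V 0%N t)) ^+ 2).
    rewrite (eq_Ex Pr (Y := fun t => (b n p.1 (V 0%N t) * b n p.2 (V 0%N t)) ^+ 2 -
      ((2 * (p.1 == p.2)%:R) * (b n p.1 (V 0%N t) * b n p.2 (V 0%N t)) - (p.1 == p.2)%:R))); last first.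
      by move=> t; rewrite /phi; case: (p.1 == p.2) => /=; ring.
    rewrite ExB; [|exact: (sqbb _ _ _).2|by apply: intgB; [exact: intgZ|exact: intg_cst]].
    rewrite ExB; [|exact: intgZ|exact: intg_cst].
    rewrite ExZ// b1 Ex_cst; case: (p.1 == p.2) => /=; lra.
  apply: le_trans (ler_sum _ (fun p _ => le1 p)) _.
  rewrite -Ex_sum; last by move=> p _; exact: (sqbb _ _ _).2.
  rewrite (_ : (K n)%:R = Ex (fun t => \sum_k b n k (V 0%N t) * b n k (V 0%N t))); last first.
    rewrite Ex_sum; last by move=> k _.
    rewrite (eq_bigr (fun=> 1)); last by move=> k _; rewrite b1 eqxx.
    by rewrite sumr_const card_ord.
  rewrite mulrC -ExZ; last by apply: intg_sum => k _.
  apply: le_Ex.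
  - by apply: intg_sum => p _; exact: (sqbb _ _ _).2.
  - by apply: intgZ; apply: intg_sum => k _.
  move=> t; set c := fun k => b n k (V 0%N t).
  rewrite (_ : \sum_(p : 'I_(K n) * 'I_(K n)) _ = (\sum_k c k ^+ 2) * (\sum_k c k ^+ 2)); last first.
    rewrite mulr_suml -(pair_bigA _ (fun j k => (c j * c k) ^+ 2)) /=.
    by apply: eq_bigr => j _; rewrite mulr_sumr; apply: eq_bigr => k _; rewrite exprMn.
  rewrite [X in _ <= _ * X](_ : _ = \sum_k c k ^+ 2); last by apply: eq_bigr => k _; rewrite expr2.
  by apply: ler_wpM2r; [apply: sumr_ge0 => k _; exact: sqr_ge0|exact: bZ].
(* X is the squared deviation over n^2, so the level 1/4 corresponds to the distance n / 2. *)
have h4 : (0 : R) < 4^-1 by rewrite invr_gt0.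
apply: whp_mono (oX _ h4); near=> n => t.
have n0 : (0 < n)%N by near: n; exact: nbhs_infty_gt.
move=> /(le_trans (ler_norm _)); rewrite /X => H.
under eq_bigr do rewrite E.
rewrite mulrC ler_pdivrMr ?exprn_gt0 ?ltr0n// in H.
by apply: le_trans H _; rewrite exprMn exprVn mulrC (_ : 2 ^+ 2 = 4)// -natrX.
Unshelve. all: by end_near. Qed.

Variable ginv : forall m, 'M[R]_m -> 'M[R]_m.
Hypothesis ginvP : is_sym_ginv ginv.
Variables (P : forall n, T -> 'M[R]_(n, K n)) (C : forall n, 'M[R]_(K n)).
Arguments P : clear implicits.
Arguments C : clear implicits.
Hypothesis uC : forall n, C n \in unitmx.
Hypothesis PC : forall n, {ae Pr, forall t, P n t *m C n = basis_mx n t}.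
Local Notation M n t := (series_proj ginv (P n t)).

(** On the good Gram event |M f|^2 <= (2/n) |Pb'f|^2. The K coordinates of Pb'f are sums of n i.i.d.
    centred terms, so the right side has mean of order K, which is o(sqrt n). *)
Lemma small_proj (f : 'cV[R]_m -> R) (Cf : R) : borel_fun f ->
  (forall n k, sqintg Pr (fun t => b n k (V 0%N t) * f (V 0%N t))) ->
  (forall n k, Ex (fun t => b n k (V 0%N t) * f (V 0%N t)) = 0) ->
  (forall n k, Ex (fun t => (b n k (V 0%N t) * f (V 0%N t)) ^+ 2) <= Cf) ->
  small (fun n t => M n t *m samp n f t).
Proof.
move=> mf f2 f0 fC.
have mbf n k : borel_fun (fun v => b n k v * f v) by exact: borelM.
pose X n t := (n%:R * Num.sqrt n%:R)^-1 * nrm2 ((basis_mx n t)^T *m samp n f t).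
have XE n t : X n t = (n%:R * Num.sqrt n%:R)^-1 *
    \sum_(k < K n) (\sum_(i < n) b n k (V i t) * f (V i t)) ^+ 2.
  rewrite /X nrm2E; congr (_ * _); apply: eq_bigr => k _; congr (_ ^+ 2).
  by rewrite mxE; apply: eq_bigr => i _; rewrite !mxE.
have iS n : intg (fun t => \sum_(k < K n) (\sum_(i < n) b n k (V i t) * f (V i t)) ^+ 2).
  by apply: intg_sum => k _; exact: (sqintg_sum_samp mV idV n (mbf n k) (f2 n k)).2.
have iX n : intg (X n).
  apply: eq_intg (intgZ (n%:R * Num.sqrt n%:R)^-1 (iS n)) => t.
  by rewrite XE.
have oX : op X.
  apply: (@op_L1 _ _ _ _ _ (fun n => Cf * ((K n)%:R / Num.sqrt n%:R))) => //.
  - by move=> n t; rewrite mulr_ge0 ?nrm2_ge0// invr_ge0 mulr_ge0 ?sqrtr_ge0.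
  - near=> n; have n0 : (0 < n)%N by near: n; exact: nbhs_infty_gt.
    rewrite (eq_Ex Pr (XE n)) ExZ// Ex_sum; last first.
      by move=> k _; exact: (sqintg_sum_samp mV idV n (mbf n k) (f2 n k)).2.
    rewrite (eq_bigr (fun k => n%:R * Ex (fun t => (b n k (V 0%N t) * f (V 0%N t)) ^+ 2))); last first.
      by move=> k _; rewrite (Ex_sum_sqr mV indV idV _ (mbf n k)).
    rewrite -mulr_sumr invfM mulrCA -!mulrA mulVKf ?pnatr_eq0 -?lt0n//.
    rewrite mulrC mulrA ler_wpM2r ?invr_ge0 ?sqrtr_ge0//.
    apply: le_trans (ler_sum _ (fun k _ => fC n k)) _.
    by rewrite sumr_const card_ord mulr_natr.
  - by rewrite -(mulr0 Cf); apply: cvgMl_tmp; exact: Ksqrt.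
apply: op_le_whp (opZ 2 oX) _.
apply: whp_mono (whp_and gram_close (whp_ae (nearW _ PC))); near=> n => t [H HP].
have n0 : (0 < n)%N by near: n; exact: nbhs_infty_gt.
rewrite -HP in H.
have := nrm2_proj_gram ginvP (samp n f t) (uC n) n0 H; rewrite HP => H'.
have s0 : 0 <= (Num.sqrt n%:R : R)^-1 by rewrite invr_ge0 sqrtr_ge0.
rewrite [X in X <= _]ger0_norm ?mulr_ge0 ?nrm2_ge0//.
apply: le_trans (ler_norm _).
apply: le_trans (ler_wpM2r s0 H') _.
by rewrite /X invfM le_eqVlt; apply/orP; left; apply/eqP; ring.
Unshelve. all: by end_near. Qed.

Lemma small_proj_small a : small a -> small (fun n t => M n t *m a n t).
Proof.
move=> sa; apply: small_le_whp sa _; apply: whp_ae; near=> n; apply: aeW => t.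
exact: nrm2_proj_le.
Unshelve. all: by end_near. Qed.

Lemma small_samp (D : nat -> 'cV[R]_m -> R) (rho : nat -> R) :
  (\forall n \near \oo, forall v, D n v ^+ 2 <= rho n) ->
  (fun n => Num.sqrt n%:R * rho n) @ \oo --> (0 : R) -> small (fun n t => samp n (D n) t).
Proof.
move=> Drho rho0; apply: op_le_whp (op_cst _ rho0) _; apply: whp_ae; near=> n; apply: aeW => t.
have n0 : (0 < n)%N by near: n; exact: nbhs_infty_gt.
have s0 : 0 < (Num.sqrt n%:R : R) by rewrite sqrtr_gt0 ltr0n.
rewrite ger0_norm; last by rewrite divr_ge0 ?nrm2_ge0// ltW.
apply: le_trans (ler_norm _); rewrite ler_pdivrMr// mulrAC -expr2 sqr_sqrtr//.
have H : forall v, D n v ^+ 2 <= rho n by near: n.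
rewrite nrm2E; apply: le_trans (ler_sum _ (_ : forall i, true -> _ <= rho n)) _.
  by move=> i _; rewrite mxE.
by rewrite sumr_const card_ord mulr_natl.
Unshelve. all: by end_near. Qed.

Variables (I : Type) (e : I -> 'cV[R]_m -> R) (D : I -> nat -> 'cV[R]_m -> R).
Variables (Ce : R) (rho : nat -> R).
Hypothesis me : forall o, borel_fun (e o).
Hypothesis mD : forall o n, borel_fun (D o n).
Hypothesis be2 : forall o n k, sqintg Pr (fun t => b n k (V 0%N t) * e o (V 0%N t)).
Hypothesis be0 : forall o n k, Ex (fun t => b n k (V 0%N t) * e o (V 0%N t)) = 0.
Hypothesis beC : forall o n k, Ex (fun t => (b n k (V 0%N t) * e o (V 0%N t)) ^+ 2) <= Ce.
Hypothesis Drho : forall o, \forall n \near \oo, forall v, D o n v ^+ 2 <= rho n.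
Hypothesis rho0 : (fun n => Num.sqrt n%:R * rho n) @ \oo --> (0 : R).
Hypothesis De2 : forall o o' n, sqintg Pr (fun t => D o n (V 0%N t) * e o' (V 0%N t)).
Hypothesis De0 : forall o o' n, Ex (fun t => D o n (V 0%N t) * e o' (V 0%N t)) = 0.
Hypothesis DeC : forall o o', \forall n \near \oo,
  Ex (fun t => (D o n (V 0%N t) * e o' (V 0%N t)) ^+ 2) <= Ce * rho n.

Let aa o n t := samp n (D o n) t + samp n (e o) t.

Lemma dot_resid n t (a a' : 'cV[R]_n) :
  dotv (a - M n t *m a) (a' - M n t *m a') = dotv a a' - dotv (M n t *m a) (M n t *m a').
Proof.
rewrite dotvBl !dotvBr (dotv_proj ginvP (P n t) a a') [dotv (M n t *m a) a']dotvC (dotv_proj ginvP (P n t) a' a).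
by rewrite (dotvC (M n t *m a') (M n t *m a)); ring.
Qed.

Hypothesis rho1 : rho @ \oo --> (0 : R).

(** With a = D + e, the difference equals D'D~ - (M a)'(M a~) + D'e~ + D~'e, where the tilde marks
    the second index. The first two terms pair small vectors; the last two are centred sums with
    variance at most Ce rho per term, which tends to zero. *)
Lemma resid_dot o o' : op (fun n t =>
  (dotv (aa o n t - M n t *m aa o n t) (aa o' n t - M n t *m aa o' n t)
   - dotv (samp n (e o) t) (samp n (e o') t)) / Num.sqrt n%:R).
Proof.
have sD i : small (fun n t => samp n (D i n) t) by exact: small_samp rho0.
have sMe i : small (fun n t => M n t *m samp n (e i) t).
  by apply: (@small_proj _ Ce).
have sM i : small (fun n t => M n t *m aa i n t).
  apply: small_le_whp (smallD (small_proj_small (sD i)) (sMe i)) _.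
  by apply: whp_ae; apply: nearW => n; apply: aeW => t; rewrite mulmxDr.
have oDe i j : op (fun n t => dotv (samp n (D i n) t) (samp n (e j) t) / Num.sqrt n%:R).
  apply: (op_eq (Y := fun n t => (\sum_(k < n) D i n (V k t) * e j (V k t)) / Num.sqrt n%:R)).
    apply: (op_sum_samp mV indV idV (f := fun n v => D i n v * e j v) (x := fun n => Ce * rho n)) => //.
      by move=> n; exact: borelM.
    by rewrite -(mulr0 Ce); exact: cvgMl_tmp.
  by move=> n t; rewrite dotv_samp.
apply: op_eq (opD (opB (small_dot (sD o) (sD o')) (small_dot (sM o) (sM o'))) (opD (oDe o o') (oDe o' o))) _.
move=> n t; rewrite dot_resid -mulrBl -!mulrDl; congr (_ / _).
rewrite {1 2}/aa dotvDl !dotvDr (dotvC (samp n (e o) t) (samp n (D o' n) t)); ring.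
Qed.

End core_estimates.

(** * Asymptotic normality from the influence function *)

Section perturbation.
Variables (R : realType) (q : nat).
Implicit Types (A F : 'M[R]_q) (v g : 'cV[R]_q).

Lemma mulmx_norm_le A v : `|A *m v| <= q%:R * `|A| * `|v|.
Proof.
have h : 0 <= q%:R * `|A| * `|v| by rewrite !mulr_ge0.
apply: norm_mx_le => // i j; rewrite mxE (le_trans (ler_norm_sum _ _ _))//.
apply: le_trans (ler_sum _ (_ : forall k, true -> _ <= `|A| * `|v|)) _.
  by move=> k _; rewrite normrM; apply: ler_pM => //; exact: coord_norm_le.
by rewrite sumr_const card_ord -mulrA mulr_natl.
Qed.

(** A kernel vector v of A satisfies v = F^-1 (F - A) v, hence |v| <= |v| / 2. The factors q come
    from the entrywise maximum norm. *)
Lemma perturb_unit A F (dl : R) : F \in unitmx -> `|A - F| <= dl ->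
  (q%:R * `|invmx F|) * (q%:R * dl) <= 1 / 2 -> A \in unitmx.
Proof.
move=> uF Adl H; rewrite -unitmx_tr unitmxE unitfE; apply/negP => /det0P[v v0 vA].
have Av : A *m v^T = 0 by rewrite -[A]trmxK -trmx_mul vA trmx0.
have vE : v^T = invmx F *m ((F - A) *m v^T).
  by rewrite mulmxBl Av subr0 mulKmx.
have n0 : 0 <= `|v^T| := normr_ge0 _.
have : `|v^T| <= 1 / 2 * `|v^T|.
  rewrite {1}vE; apply: le_trans (mulmx_norm_le _ _) _.
  apply: le_trans (ler_wpM2r n0 H); rewrite -[leRHS]mulrA; apply: ler_wpM2l; first by rewrite mulr_ge0.
  apply: le_trans (mulmx_norm_le _ _) _; apply: ler_wpM2r => //.
  by rewrite ler_wpM2l// distrC.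
move=> h; have : `|v^T| <= 0 by lra.
rewrite normr_le0 => /eqP vT0; move/eqP: v0; apply.
by rewrite -[v]trmxK vT0 trmx0.
Qed.

(** From g - F^-1 X = F^-1 (b - X) - F^-1 (A - F) g; the part of |g| due to the difference itself is
    absorbed on the left, whence the factor 2. *)
Lemma perturb_solution A F (dl : R) g b X : F \in unitmx -> `|A - F| <= dl ->
  (q%:R * `|invmx F|) * (q%:R * dl) <= 1 / 2 -> A *m g = b ->
  `|g - invmx F *m X| <=
    2 * ((q%:R * `|invmx F|) * `|b - X| + (q%:R * `|invmx F|) * (q%:R * dl) * `|invmx F *m X|).
Proof.
move=> uF Adl H Ag.
set c := q%:R * `|invmx F|; have c0 : 0 <= c by rewrite mulr_ge0.
set y := invmx F *m X; set D := g - y.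
have dl0 : 0 <= dl by exact: le_trans (normr_ge0 _) Adl.
have DE : D = invmx F *m (b - X) - invmx F *m ((A - F) *m g).
  rewrite -mulmxBr (_ : b - X - _ = F *m g - X); first by rewrite mulmxBr mulKmx.
  by rewrite mulmxBl Ag opprB addrC addrA subrK.
have h1 : `|invmx F *m (b - X)| <= c * `|b - X| by exact: mulmx_norm_le.
have h2 : `|invmx F *m ((A - F) *m g)| <= c * (q%:R * dl) * `|g|.
  apply: le_trans (mulmx_norm_le _ _) _; rewrite -/c -[leRHS]mulrA ler_wpM2l//.
  apply: le_trans (mulmx_norm_le _ _) _; rewrite ler_wpM2r//.
  by rewrite ler_wpM2l.
have h3 : `|g| <= `|D| + `|y| by rewrite -{1}[g](subrK y) ler_normD.
have D0 := normr_ge0 D; have y0 := normr_ge0 y.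
have h4 : `|D| <= `|invmx F *m (b - X)| + `|invmx F *m ((A - F) *m g)|.
  by rewrite {1}DE ler_normB.
move: H h2; set k := c * (q%:R * dl) => H h2.
have k0 : 0 <= k by rewrite !mulr_ge0.
have h5 : k * `|g| <= k * `|D| + k * `|y| by rewrite -mulrDr ler_wpM2l.
have h6 : k * `|D| <= 1 / 2 * `|D| by rewrite ler_wpM2r.
lra.
Qed.

Lemma dotv_norm_le v g : `|dotv v g| <= q%:R * `|v| * `|g|.
Proof.
rewrite (le_trans (ler_norm_sum _ _ _))//.
apply: le_trans (ler_sum _ (_ : forall k, true -> _ <= `|v| * `|g|)) _.
  by move=> k _; rewrite normrM; apply: ler_pM => //; exact: coord_norm_le.
by rewrite sumr_const card_ord -mulrA mulr_natl.
Qed.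

Lemma col_sum_gram (B : 'M[R]_q) : \sum_(j < q) col j B *m (col j B)^T = B *m B^T.
Proof.
apply/matrixP => i k; rewrite summxE !mxE; apply: eq_bigr => j _.
by rewrite mxE big_ord1 !mxE.
Qed.

End perturbation.

Lemma norm_sinB (R : realType) (x y : R) : `|sin x - sin y| <= `|x - y|.
Proof. by rewrite -!cosBpihalf (le_trans (norm_cosB _ _))// opprB addrA subrK. Qed.

Lemma op_norm_mx d (T : measurableType d) (R : realType) (Pr : probability T R) m n
    (X : nat -> T -> 'M[R]_(m, n)) :
  (forall i j, op Pr (fun n t => X n t i j)) -> op Pr (fun n t => `|X n t|).
Proof.
move=> h e e0.
have := whp_all (fun p : 'I_m * 'I_n => h p.1 p.2 e e0).
apply: whp_mono; apply: nearW => k t H; rewrite normr_id.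
apply: norm_mx_le; first exact: ltW.
by move=> i j; exact: (H (i, j)).
Qed.

Lemma Op_norm_cV d (T : measurableType d) (R : realType) (Pr : probability T R) m
    (X : nat -> T -> 'cV[R]_m) :
  (forall i, Op Pr (fun n t => X n t i 0)) -> Op Pr (fun n t => `|X n t|).
Proof.
move=> h.
have h' i : Op Pr (fun n t => `|X n t i 0|).
  by apply: Op_le_whp (h i) _; apply: whp_ae; apply: nearW => n; apply: aeW => t; rewrite normr_id.
apply: Op_le_whp (Op_sum (index_enum 'I_m) h') _.
apply: whp_ae; apply: nearW => n; apply: aeW => t.
have s0 : 0 <= \sum_i `|X n t i 0| by apply: sumr_ge0.
rewrite normr_id ger0_norm//; apply: norm_mx_le => // i j.
by rewrite ord1 (bigD1 i)//= lerDl; apply: sumr_ge0.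
Qed.

(** Slutsky's argument for a bounded Lipschitz f, used with the cosine and the sine. *)
Lemma cvg_Ex_lipschitz d (T : measurableType d) (R : realType) (Pr : probability T R)
    (f : R -> R) (X Y : nat -> T -> R) (l : R) :
  (forall X : T -> R, measurable_fun setT X -> intg Pr (f \o X)) ->
  (forall x, `|f x| <= 1) -> (forall x y, `|f x - f y| <= `|x - y|) ->
  (forall n, measurable_fun setT (X n)) -> (forall n, measurable_fun setT (Y n)) ->
  op Pr (fun n t => X n t - Y n t) ->
  (fun n => Ex Pr (fun t => f (Y n t))) @ \oo --> l ->
  (fun n => Ex Pr (fun t => f (X n t))) @ \oo --> l.
Proof.
move=> fi f1 fL mX mY XY /cvgrPdist_le Yl; apply/cvgrPdist_le => e e0.
(* One quarter for the limit of E f(Y_n), one for |X - Y| off the exceptional set, and two for that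
   set, where f(X) and f(Y) differ by at most 2. *)
have e4 : 0 < e / 4 by rewrite divr_gt0.
move: (Yl _ e4) (XY _ e4 _ e4); apply: filterS2 => n h [A [mA PA HA]].
have := Ex_close_off_set (fi _ (mX n)) (fi _ (mY n)) mA (fun w => f1 _) (fun w => f1 _) (ltW e4)
  (fun w Aw => le_trans (fL _ _) (HA w Aw)).
have PA' : Ex Pr (\1_A) <= e / 4 by rewrite -lee_fin Ex_indic.
move: h PA'; rewrite /comp /= !ler_norml; lra.
Qed.

Section asymptotic_normality.
Context disp (T : measurableType disp) (R : realType) (Pr : probability T R).
Local Notation intg := (intg Pr).
Local Notation Ex := (Ex Pr).
Local Notation op := (op Pr).
Local Notation Op := (Op Pr).
Local Notation whp := (whp Pr).
Context m (V : nat -> T -> 'cV[R]_m).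
Hypothesis mV : forall i, random_vector (V i).
Hypothesis indV : mutually_independent Pr V.
Hypothesis idV : identically_distributed Pr V.
Local Notation samp := (samp V).

Variables (q : nat) (e : 'I_q -> 'cV[R]_m -> R) (ups : 'cV[R]_m -> R) (Ce : R).
Variables (Phi : 'M[R]_q) (s2 : R).
Hypothesis me : forall j, borel_fun (e j).
Hypothesis mu : borel_fun ups.
Hypothesis eC : forall j v, `|e j v| <= Ce.
Hypothesis ee : forall j k, Ex (fun t => e j (V 0%N t) * e k (V 0%N t)) = Phi j k.
Hypothesis u2 : sqintg Pr (fun t => ups (V 0%N t)).
Hypothesis eu : forall j, Ex (fun t => e j (V 0%N t) * ups (V 0%N t)) = 0.
Hypothesis eeuu : forall j k, Ex (fun t =>
  (e j (V 0%N t) * ups (V 0%N t)) * (e k (V 0%N t) * ups (V 0%N t))) = s2 * Phi j k.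
Hypothesis pPhi : posdef Phi.
Hypothesis s2_0 : 0 < s2.

Variables (r : 'I_q -> forall n, T -> 'cV[R]_n) (ru : forall n, T -> 'cV[R]_n).
Variable g : nat -> T -> 'cV[R]_q.
Hypothesis rr : forall j k, op (fun n t =>
  (dotv (r j n t) (r k n t) - dotv (samp n (e j) t) (samp n (e k) t)) / Num.sqrt n%:R).
Hypothesis rru : forall j, op (fun n t =>
  (dotv (r j n t) (ru n t) - dotv (samp n (e j) t) (samp n ups t)) / Num.sqrt n%:R).
Hypothesis mg : forall n, random_vector (g n).

Let A n t : 'M[R]_q := \matrix_(j, k) (dotv (r j n t) (r k n t) / n%:R).
Let b n t : 'cV[R]_q := \col_j (dotv (r j n t) (ru n t) / Num.sqrt n%:R).
Let X n t : 'cV[R]_q := \col_j (dotv (samp n (e j) t) (samp n ups t) / Num.sqrt n%:R).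
Hypothesis gP : whp (fun n t => A n t \in unitmx -> A n t *m g n t = b n t).

Let mfV i (f : 'cV[R]_m -> R) : borel_fun f -> measurable_fun setT (fun t => f (V i t)).
Proof. exact: borel_comp. Qed.

Let iPhi := invmx Phi.

Let uPhi : Phi \in unitmx.
Proof.
have [L uL ->] := cholesky pPhi.
by rewrite unitmx_mul unitmx_tr uL.
Qed.

Let A_Phi : op (fun n t => `|A n t - Phi|).
Proof.
apply: op_norm_mx => j k.
pose f v := e j v * e k v - Phi j k.
have mf : borel_fun f.
  apply: (@measurable_funB _ (borel_cV R m)); first exact: borelM.
  exact: (@measurable_cst _ _ (borel_cV R m)).
have iee : intg (fun t => e j (V 0%N t) * e k (V 0%N t)).
  apply: (@bounded_intg _ _ _ _ _ (Ce * Ce)); first exact: (mfV 0%N (borelM (me j) (me k))).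
  by move=> t; rewrite normrM ler_pM.
have f2 : sqintg Pr (fun t => f (V 0%N t)).
  apply: (@bounded_sqintg _ _ _ _ _ (Ce * Ce + `|Phi j k|)); first exact: (mfV 0%N mf).
  by move=> t; rewrite (le_trans (ler_normB _ _))// lerD// normrM ler_pM.
have f0 : Ex (fun t => f (V 0%N t)) = 0.
  by rewrite ExB ?ee ?Ex_cst ?subrr//; exact: intg_cst.
have o1 : op (fun n _ => (Num.sqrt (n%:R : R))^-1) by apply: op_cst; exact: invsqrtn_cvg0.
apply: op_eq_whp (opD (opM o1 (op_Op (rr j k))) (opM o1 (Op_sum_samp mV indV idV mf f2 f0))) _.
apply: whp_ae; near=> n; apply: aeW => t; have n0 : (0 < n)%N by near: n; exact: nbhs_infty_gt.
have nn : (n%:R : R) != 0 by rewrite pnatr_eq0 -lt0n.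
have ss : (Num.sqrt (n%:R : R))^-1 * (Num.sqrt (n%:R : R))^-1 = n%:R^-1.
  by rewrite -invfM -expr2 sqr_sqrtr.
rewrite !mxE -mulrDr -mulrDl [(_ + _) * _]mulrC mulrA ss.
rewrite sumrB sumr_const card_ord dotv_samp -[Phi j k *+ n]mulr_natl addrA subrK mulrBr mulKf//.
by rewrite mulrC.
Unshelve. all: by end_near. Qed.

Let b_X : op (fun n t => `|b n t - X n t|).
Proof.
apply: op_norm_mx => j k; apply: op_eq (rru j) _ => n t.
by rewrite !mxE -mulrBl.
Qed.

(** At Phi^-1 tau this is the influence function of the linear functional tau of the estimator. *)
Definition influence (tau : 'cV[R]_q) v : R := (\sum_j tau j 0 * e j v) * ups v.

Let borel_influence tau : borel_fun (influence tau).
Proof.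
apply: borelM => //; apply: (@measurable_sum _ (borel_cV R m)) => j.
by apply: borelM => //; exact: (@measurable_cst _ _ (borel_cV R m)).
Qed.

Let sq_eu j : sqintg Pr (fun t => e j (V 0%N t) * ups (V 0%N t)).
Proof. by apply: (@bounded_sqintgM _ _ _ _ _ _ Ce) => //; exact: mfV. Qed.

Let influenceE tau t : influence tau (V 0%N t) =
  \sum_j tau j 0 * (e j (V 0%N t) * ups (V 0%N t)).
Proof. by rewrite /influence mulr_suml; apply: eq_bigr => j _; rewrite mulrA. Qed.

Let sq_influence tau : sqintg Pr (fun t => influence tau (V 0%N t)).
Proof.
under eq_fun do rewrite influenceE.
by apply: sqintg_sum => j _; exact: sqintgZ.
Qed.

Let influence0 tau : Ex (fun t => influence tau (V 0%N t)) = 0.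
Proof.
rewrite (eq_Ex Pr (influenceE tau)) Ex_sum; last first.
  by move=> j _; apply: intgZ; exact/sqintg_intg.
by rewrite big1// => j _; rewrite ExZ ?eu ?mulr0//; exact/sqintg_intg.
Qed.

Let influence_var tau : Ex (fun t => influence tau (V 0%N t) ^+ 2) = s2 * (tau^T *m Phi *m tau) 0 0.
Proof.
have i4 j k : intg (fun t => (e j (V 0%N t) * ups (V 0%N t)) * (e k (V 0%N t) * ups (V 0%N t))).
  exact: sqintgM.
transitivity (Ex (fun t => \sum_j \sum_k (tau j 0 * tau k 0) *
   ((e j (V 0%N t) * ups (V 0%N t)) * (e k (V 0%N t) * ups (V 0%N t))))).
  apply: eq_Ex => t; rewrite influenceE expr2 mulr_suml; apply: eq_bigr => j _.
  by rewrite mulr_sumr; apply: eq_bigr => k _; rewrite mulrACA.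
rewrite Ex_sum; last by move=> j _; apply: intg_sum => k _; exact: intgZ.
rewrite mxE mulr_sumr.
under eq_bigr => j _.
  rewrite Ex_sum; last by move=> k _; exact: intgZ.
  under eq_bigr => k _ do rewrite ExZ// eeuu.
  over.
rewrite exchange_big /=; apply: eq_bigr => k _; rewrite mxE mulr_suml mulr_sumr.
by apply: eq_bigr => j _; rewrite mxE; ring.
Qed.

Let Y n t := iPhi *m X n t.

Let dotY tau n t : dotv tau (Y n t) =
  (\sum_(i < n) influence (iPhi *m tau) (V i t)) / Num.sqrt n%:R.
Proof.
have sPhi : iPhi^T = iPhi by rewrite /iPhi trmx_inv (proj1 pPhi).
rewrite dotv_mulmx sPhi mulr_suml /dotv.
under eq_bigr => j _ do rewrite [X n t j 0]mxE dotv_samp mulrA mulr_sumr mulr_suml.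
rewrite exchange_big /=; apply: eq_bigr => i _.
rewrite /influence !mulr_suml; apply: eq_bigr => j _; ring.
Qed.

Let OpY : Op (fun n t => `|Y n t|).
Proof.
apply: Op_norm_cV => i.
have H := Op_sum_samp mV indV idV (borel_influence (iPhi *m delta_mx i 0)) (sq_influence _) (influence0 _).
apply: Op_le_whp H _; apply: whp_ae; apply: nearW => n; apply: aeW => t.
rewrite -dotY /dotv (bigD1 i)//= big1; first by rewrite [delta_mx i 0 i 0]mxE !eqxx mul1r addr0.
by move=> j ji; rewrite [delta_mx i 0 j 0]mxE (negbTE ji) mul0r.
Qed.

Let g_Y : op (fun n t => `|g n t - Y n t|).
Proof.
set c := q%:R * `|iPhi|; have c0 : 0 <= c by rewrite mulr_ge0.
have oD : op (fun n t => 2 * (c * `|b n t - X n t| + (c * q%:R) * (`|A n t - Phi| * `|Y n t|))).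
  by apply: opZ; apply: opD; [exact: opZ|apply: opZ; exact: opM].
apply: op_le_whp oD _.
(* Below this level of |A - Phi| the perturbation bounds apply; adding 1 avoids a zero
   denominator. *)
have cq : 0 < 1 / (2 * (c * q%:R + 1)).
  by rewrite divr_gt0// mulr_gt0// ltr_wpDl// mulr_ge0.
apply: whp_mono (whp_and gP (A_Phi cq)); near=> n => t [HA HP].
have H : c * (q%:R * `|A n t - Phi|) <= 1 / 2.
  rewrite normr_id ler_pdivlMr in HP; last by rewrite mulr_gt0// ltr_wpDl// mulr_ge0.
  rewrite mulrA; move: HP; have := normr_ge0 (A n t - Phi); set y := `|_|; nra.
have uA := perturb_unit uPhi (lexx _) H.
have := perturb_solution (X n t) uPhi (lexx _) H (HA uA).
rewrite normr_id -/iPhi -/c => /le_trans; apply.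
by apply: le_trans (ler_norm _); rewrite !mulrA.
Unshelve. all: by end_near. Qed.

Let mtau tau n : measurable_fun setT (fun t => dotv tau (g n t)).
Proof. exact: (borel_comp (mg n) (borel_dotv tau)). Qed.

Let mtauY tau n : measurable_fun setT (fun t => dotv tau (Y n t)).
Proof.
under eq_fun do rewrite dotY.
have [h _] := sqintg_sum_samp mV idV n (borel_influence (iPhi *m tau)) (sq_influence _).
by apply: measurable_funM => //; exact: measurable_cst.
Qed.

Let op_tau tau : op (fun n t => dotv tau (g n t) - dotv tau (Y n t)).
Proof.
apply: op_le_whp (opZ (q%:R * `|tau|) g_Y) _; apply: whp_ae; apply: nearW => n; apply: aeW => t.
by rewrite -dotvBr; apply: le_trans (dotv_norm_le _ _) _; rewrite ler_norm.
Qed.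

Let limvar (tau : 'cV[R]_q) : s2 * ((iPhi *m tau)^T *m Phi *m (iPhi *m tau)) 0 0 =
  (tau^T *m (s2 *: iPhi) *m tau) 0 0.
Proof.
have sPhi : iPhi^T = iPhi by rewrite /iPhi trmx_inv (proj1 pPhi).
rewrite trmx_mul sPhi -!mulmxA [Phi *m _]mulmxA mulmxV// mul1mx.
by rewrite -scalemxAl -scalemxAr [RHS]mxE mulmxA.
Qed.

(** Each linear functional of g differs negligibly from a normalised i.i.d. sum, so its
    characteristic function converges to the Gaussian one. Tightness follows because Y is bounded in
    probability and g - Y is negligible. *)
Theorem asymptotically_normal_influence : asymptotically_normal Pr g (s2 *: iPhi).
Proof.
have [L uL PhiE] := cholesky pPhi.
(* With Phi = L L' this gives B B' = s2 Phi^-1, so the columns of B generate the normal law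
   required. *)
pose B : 'M[R]_q := Num.sqrt s2 *: (invmx L)^T.
have [nu nuP] := @mvnormal_exists R q (map (fun j : 'I_q => col j B) (index_enum 'I_q)).
rewrite big_map col_sum_gram in nuP.
have BB : B *m B^T = s2 *: iPhi.
  rewrite /B linearZ /= trmxK -scalemxAl -scalemxAr scalerA -expr2 sqr_sqrtr ?ltW//.
  congr (_ *: _); have E : (invmx L)^T *m invmx L *m Phi = 1%:M.
    by rewrite PhiE -!mulmxA (mulmxA (invmx L) L) mulVmx// mul1mx trmx_inv mulVmx// unitmx_tr.
  by rewrite -[LHS](mulmxK uPhi) E mul1mx.
rewrite BB in nuP; exists nu => //.
apply: cvg_in_distribution_cos_sin => //.
- move=> tau; rewrite (mvnormal_cos_sin tau nuP).1 -limvar -influence_var.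
  apply: (cvg_Ex_lipschitz (Y := fun n t => dotv tau (Y n t))) => //.
  + by move=> Z mZ; exact: intg_cos.
  + by move=> x; rewrite ler_norml cos_geN1 cos_le1.
  + exact: norm_cosB.
  rewrite (_ : (fun n => _) = (fun n => Ex (fun t =>
      cos ((\sum_(i < n) influence (iPhi *m tau) (V i t)) / Num.sqrt n%:R)))); last first.
    by apply/funext => n; apply: eq_Ex => t; rewrite dotY.
  exact: (clt_cos_sin mV indV idV (borel_influence _) (sq_influence _) (influence0 _)).1.
- move=> tau; rewrite (mvnormal_cos_sin tau nuP).2.
  apply: (cvg_Ex_lipschitz (Y := fun n t => dotv tau (Y n t))) => //.
  + by move=> Z mZ; exact: intg_sin.
  + by move=> x; rewrite ler_norml sin_geN1 sin_le1.
  + exact: norm_sinB.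
  rewrite (_ : (fun n => _) = (fun n => Ex (fun t =>
      sin ((\sum_(i < n) influence (iPhi *m tau) (V i t)) / Num.sqrt n%:R)))); last first.
    by apply/funext => n; apply: eq_Ex => t; rewrite dotY.
  exact: (clt_cos_sin mV indV idV (borel_influence _) (sq_influence _) (influence0 _)).2.
- have Og := OpD (op_Op g_Y) OpY.
  move=> a a0; have [C HC] := Og a a0; exists C.
  move: HC; apply: filterS => n [H [mH PH HH]]; exists H; split => // t /HH h i.
  rewrite (le_trans (coord_norm_le (g n t) i 0))// (le_trans _ h)// (le_trans _ (ler_norm _))//.
  by rewrite -{1}[g n t](subrK (Y n t)) ler_normD.
Qed.

End asymptotic_normality.

(** * Orthogonality to the varying coefficient class *)

Section open_approximation.
Variables (R : realType) (n : nat).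
Implicit Types (U : set 'cV[R]_n) (v y : 'cV[R]_n).

Lemma near_dist v (e : R) : 0 < e -> \forall y \near v, `|v - y| <= e.
Proof.
move=> e0; have F : Filter (nbhs v) by exact: nbhs_filter.
by case: (@cvgrPdist_le R 'cV[R]_n _ (nbhs v) F id v) => + _; apply.
Qed.

Lemma lipschitz_continuous (m : nat) (f : 'cV[R]_n -> 'cV[R]_m) :
  (forall v y, `|f v - f y| <= `|v - y|) -> continuous f.
Proof.
move=> fL v; have F : Filter (nbhs v) by exact: nbhs_filter.
case: (@cvgrPdist_le R 'cV[R]_m _ (nbhs v) F f (f v)) => _; apply => e e0.
by apply: (@filterS _ (nbhs v) _ _ _ _ (near_dist v e0)) => y; exact: le_trans.
Qed.

(** The functions min(1, k dist(v, complement of U)) are continuous and increase to the indicator of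
    U. *)
Lemma open_indic_approx U : open U -> exists h : nat -> 'cV[R]_n -> R,
  [/\ forall k, continuous (h k), forall k v, `|h k v| <= 1 &
      forall v, h ^~ v @ \oo --> (\1_U v : R)].
Proof.
(* If U is the whole space there is no distance to its complement, and the constant 1 serves. *)
move=> oU; have [[y0 Uy0]|nU] := pselect (exists y, ~ U y); last first.
  exists (fun _ _ => 1); split => [k v|k v|v]; [exact: (@cst_continuous 'cV[R]_n R 1)|by rewrite normr1|].
  rewrite indicE mem_set; first exact: cvg_cst.
  by apply: contrapT => ?; apply: nU; exists v.
pose D v := [set `|v - y| | y in ~` U]; pose dist v := inf (D v).
have D0 v : has_inf (D v).
  by split; [exists `|v - y0|, y0|exists 0 => _ [y _ <-]].
have dist_le v y : ~ U y -> dist v <= `|v - y|.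
  by move=> Uy; apply: ge_inf; [exact: (D0 v).2|exists y].
have le_dist v (a : R) : (forall y, ~ U y -> a <= `|v - y|) -> a <= dist v.
  by move=> H; apply: lb_le_inf; [exact: (D0 v).1|move=> _ [y Uy <-]; exact: H].
have dist_ge0 v : 0 <= dist v by apply: le_dist.
have distL v y : dist v <= dist y + `|v - y|.
  rewrite -lerBlDr; apply: le_dist => w Uw; rewrite lerBlDr (le_trans (dist_le v w Uw))//.
  by have := ler_normD (v - y) (y - w); rewrite addrA subrK [`|v - y| + _]addrC.
have cdist : continuous dist.
  move=> v; have F : Filter (nbhs v) by exact: nbhs_filter.
  case: (@cvgrPdist_le R R _ (nbhs v) F dist (dist v)) => _; apply => e e0.
  apply: (@filterS _ (nbhs v) _ _ _ _ (near_dist v e0)) => y h; rewrite ler_norml.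
  by have := distL v y; have := distL y v; move: h; rewrite [`|y - v|]distrC; set c := `|_|; lra.
exists (fun k v => Num.min 1 (k%:R * dist v)); split.
- move=> k v; apply: (@continuous_min R 'cV[R]_n (fun=> 1) (fun v => k%:R * dist v)).
    exact: cst_continuous.
  by apply: (@cvgMl_tmp _ _ (nbhs v)); exact: cdist.
- move=> k v; rewrite ger0_norm ?ge_min ?lexx//.
  by rewrite le_min ler01 mulr_ge0.
move=> v; rewrite indicE; have [Uv|Uv] := pselect (U v).
  rewrite mem_set//; have [e e0 eU] := open_cVP oU Uv.
  have ed : e <= dist v.
    apply: le_dist => y Uy; rewrite leNgt; apply/negP => h; apply: Uy; apply: eU => i.
    by apply: le_lt_trans h; rewrite (le_trans _ (coord_norm_le (v - y) i 0))// !mxE.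
  apply: cvg_near_cst; near=> k; apply/min_idPl.
  have ke : e^-1 <= k%:R by near: k; exact: nbhs_infty_ger.
  have en : e != 0 by rewrite gt_eqF.
  have ei : 0 <= e^-1 by rewrite invr_ge0 ltW.
  by have := ler_pM ei (ltW e0) ke ed; rewrite mulVf.
rewrite memNset// (_ : (fun k => _) = cst 0); first exact: cvg_cst.
have d0 : dist v = 0.
  by apply/eqP; rewrite eq_le dist_ge0 (le_trans (dist_le v v Uv))// subrr normr0.
by apply/funext => k /=; rewrite d0 mulr0 min_r.
Unshelve. all: by end_near. Qed.

End open_approximation.

Lemma indic_bigcup_ord (R : realType) (T : Type) (F : nat -> set T) k z :
  trivIset setT F -> \1_(\bigcup_(i < k) F i) z = \sum_(i < k) \1_(F i) z :> R.
Proof.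
move=> tF; rewrite indicE; have [[i ik Fi]|h] := pselect ((\bigcup_(i < k) F i) z).
  rewrite mem_set; last by exists i.
  rewrite (bigD1 (Ordinal ik))//= big1 ?addr0 ?indicE ?mem_set// => j ji.
  rewrite indicE memNset// => Fj; move/eqP: ji; apply; apply: val_inj => /=.
  by apply: (tF j i) => //; exists z.
rewrite memNset// big1// => i _; rewrite indicE memNset// => Fi; apply: h.
by exists i => //=.
Qed.

Section borel_orthogonality.
Context disp (T : measurableType disp) (R : realType) (Pr : probability T R).
Local Notation intg := (intg Pr).
Local Notation Ex := (Ex Pr).
Context n (Z : T -> 'cV[R]_n).
Hypothesis mZ : random_vector Z.
Variable eta : T -> R.
Hypothesis ieta : intg eta.
Hypothesis eta0 : forall h : 'cV[R]_n -> R, continuous h -> (forall v, `|h v| <= 1) ->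
  Ex (fun t => h (Z t) * eta t) = 0.

Let ind A : borel_set A -> intg (fun t => \1_A (Z t) * eta t).
Proof. by move=> mA; exact: intg_indic_comp. Qed.

Lemma borel_ortho_open U : open U -> Ex (fun t => \1_U (Z t) * eta t) = 0.
Proof.
move=> oU; have [h [ch h1 hU]] := open_indic_approx oU.
have mh k : measurable_fun setT (fun t => h k (Z t) * eta t).
  apply: measurable_funM; last exact: intg_meas ieta.
  exact: (borel_comp mZ (continuous_borel (ch k))).
have H : (fun k => Ex (fun t => h k (Z t) * eta t)) @ \oo --> Ex (fun t => \1_U (Z t) * eta t).
  apply: (intg_dominated_cvg mh (intg_meas (ind (open_borel oU))) _ (intg_norm ieta)).
    by move=> t; apply: cvgMr_tmp; exact: hU.
  by move=> k t; rewrite normrM ler_piMl.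
rewrite (_ : (fun k => _) = cst 0) in H; last by apply/funext => k; exact: eta0.
have F : ProperFilter (\oo : set_system nat) by exact: eventually_filter.
apply: (@cvg_unique R (@norm_hausdorff R R^o) (cst (0:R) @ \oo)); first exact: H.
exact: cvg_cst.
Qed.

(** Open sets are stable under intersection and generate the Borel sets, so Dynkin's theorem
    applies; disjoint unions are handled by dominated convergence of the partial unions. *)
Lemma borel_ortho A : borel_set A -> Ex (fun t => \1_A (Z t) * eta t) = 0.
Proof.
move: A; apply: (@dynkin_induction _ (borel_cV R n) (@open 'cV[R]_n)).
- by [].
- by move=> A B; exact: openI.
- by apply: borel_ortho_open; exact: openT.
- exact: borel_ortho_open.
- move=> A mA A0; transitivity (Ex (fun t => eta t - \1_A (Z t) * eta t)).
    apply: eq_Ex => t; rewrite !indicE in_setC; case: (_ \in _) => /=; ring.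
  rewrite ExB//; last exact: ind.
  rewrite A0 subr0 -(borel_ortho_open (@openT _)).
  by apply: eq_Ex => t; rewrite indicT mul1r.
move=> F mF tF F0.
pose f k t := \1_(\bigcup_(i < k) F i) (Z t) * eta t.
have mU : borel_set (\bigcup_k F k) by exact: (@bigcup_measurable _ (borel_cV R n)).
have mUk k : borel_set (\bigcup_(i < k) F i).
  by apply: (@bigcup_measurable _ (borel_cV R n)) => i _; exact: mF.
have f0 k : Ex (f k) = 0.
  transitivity (Ex (fun t => \sum_(i < k) \1_(F i) (Z t) * eta t)).
    apply: eq_Ex => t; rewrite /f -mulr_suml; congr (_ * _).
    by rewrite indic_bigcup_ord.
  rewrite Ex_sum; last by move=> i _; exact: (ind (mF i)).
  by rewrite big1// => i _; exact: F0.
have H : (fun k => Ex (f k)) @ \oo --> Ex (fun t => \1_(\bigcup_k F k) (Z t) * eta t).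
  apply: (intg_dominated_cvg _ (intg_meas (ind mU)) _ (intg_norm ieta)).
  - by move=> k; exact: intg_meas (ind (mUk k)).
  - move=> t; apply: cvgMr_tmp; apply: cvg_near_cst.
    have [[i _ Fi]|h] := pselect ((\bigcup_k F k) (Z t)).
      near=> k; rewrite !indicE !mem_set//; first by exists i.
      by exists i => //=; near: k; exact: nbhs_infty_gt.
    near=> k; rewrite !indicE !memNset// => -[i _ Fi]; apply: h; by exists i.
  - by move=> k t; rewrite normrM ler_piMl// norm_indic_le1.
rewrite (_ : (fun k => _) = cst 0) in H; last by apply/funext => k; exact: f0.
have PF : ProperFilter (\oo : set_system nat) by exact: eventually_filter.
apply: (@cvg_unique R (@norm_hausdorff R R^o) (cst (0:R) @ \oo)); first exact: H.
exact: cvg_cst.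
Unshelve. all: by end_near. Qed.
End borel_orthogonality.

(** * First-order conditions for the projection onto the varying coefficient class *)

Section projection_onto_G.
Context disp (T : measurableType disp) (R : realType) (Pr : probability T R).
Local Notation intg := (intg Pr).
Local Notation Ex := (Ex Pr).
Variables (d r : nat) (x : T -> 'cV[R]_d) (z : T -> 'cV[R]_r).
Hypothesis mxz : random_vector (fun t => col_mx (x t) (z t)).
Hypothesis xz_bounded : forall f : 'cV[R]_(d + r) -> R, continuous f ->
  exists C, {ae Pr, forall t, `|f (col_mx (x t) (z t))| <= C}.

Lemma continuous_dsubmx n1 n2 : continuous (fun v : 'cV[R]_(n1 + n2) => dsubmx v).
Proof.
apply: lipschitz_continuous => v y; apply: norm_mx_le => // i j.
by rewrite !mxE (le_trans _ (coord_norm_le (v - y) (rshift n1 i) j))// !mxE.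
Qed.

Let term (l : 'I_d) (h : 'cV[R]_r -> R) (v : 'cV[R]_(d + r)) : R :=
  v (lshift r l) 0 * h (dsubmx v).

Let termE l h t : term l h (col_mx (x t) (z t)) = x t l 0 * h (z t).
Proof. by rewrite /term col_mxEu col_mxKd. Qed.

Lemma continuous_term l h : continuous h -> continuous (term l h).
Proof.
move=> ch v; apply: (@cvgM _ _ (nbhs v) _ (fun v : 'cV[R]_(d + r) => v (lshift r l) 0)).
  exact: continuous_coord.
have := @continuous_comp _ _ _ (fun v : 'cV[R]_(d + r) => dsubmx v) h v.
by apply; [exact: continuous_dsubmx|exact: ch].
Qed.

Lemma sqintg_term l h : continuous h -> sqintg Pr (fun t => x t l 0 * h (z t)).
Proof.
move=> ch; have ct := continuous_term (l := l) ch.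
have [C HC] := xz_bounded ct.
have mt : measurable_fun setT (fun t => x t l 0 * h (z t)).
  by apply: eq_measurable_fun (borel_comp mxz (continuous_borel ct)) => t _; rewrite termE.
split => //; apply: (@ae_bounded_intg _ _ _ _ _ (C ^+ 2)).
  by under eq_fun do rewrite expr2; exact: measurable_funM.
apply: filterS HC => t; rewrite termE => h1.
by rewrite normrX ler_pXn2r// nnegrE// (le_trans _ h1).
Qed.

(** Continuous functions of the regressors are almost surely bounded, so the moment condition of
    [in_G] is automatic and m can be perturbed freely within the class. *)
Lemma in_G_continuous (g : 'cV[R]_d -> 'cV[R]_r -> R) (h : 'I_d -> 'cV[R]_r -> R) :
  (forall l, continuous (h l)) ->
  (forall xx zz, g xx zz = \sum_(l < d) xx l 0 * h l zz) -> in_G Pr x z g.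
Proof.
move=> ch gE; exists h; split => //.
rewrite (eq_bigr (fun l => (Ex (fun t => (x t l 0 * h l (z t)) ^+ 2))%:E)).
  by rewrite sumEFin ltry.
move=> l _; rewrite unlock -ExEE; last exact: (sqintg_term l (ch l)).2.
by apply: eq_integral => t _; rewrite exprMn.
Qed.

Lemma sqintg_in_G g : in_G Pr x z g -> sqintg Pr (fun t => g (x t) (z t)).
Proof.
move=> [h [ch gE _]]; under eq_fun do rewrite gE.
by apply: sqintg_sum => l _; exact: sqintg_term.
Qed.

Section orthogonality.
Variables (q : nat) (theta m : 'cV[R]_d -> 'cV[R]_r -> 'cV[R]_q).
Hypothesis sqtheta : forall j, sqintg Pr (fun t => theta (x t) (z t) j 0).
Hypothesis mP : is_G_projection Pr x z theta m.

Let A j t := theta (x t) (z t) j 0 - m (x t) (z t) j 0.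

Let sqA j : sqintg Pr (A j).
Proof.
have := sqintgD (sqtheta j) (sqintgZ (-1) (sqintg_in_G (mP.1 j))).
by case=> h1 h2; split; [apply: eq_measurable_fun h1 => t _|apply: eq_intg h2 => t]; rewrite mulN1r.
Qed.

Lemma quadratic_ge0_linear0 (b c : R) : 0 <= b -> (forall s, 0 <= b * s ^+ 2 - 2 * s * c) -> c = 0.
Proof.
move=> b0 H; have b1 : 0 < b + 1 by rewrite ltr_wpDl.
have := H (c / (b + 1)); rewrite (_ : _ - _ = - (b + 2) * (c / (b + 1)) ^+ 2); last first.
  by field; rewrite gt_eqF.
rewrite mulNr oppr_ge0 pmulr_rle0 ?ltr_wpDl// => h.
have : (c / (b + 1)) ^+ 2 == 0 by rewrite eq_le h sqr_ge0.
by rewrite sqrf_eq0 mulf_eq0 invr_eq0 (gt_eqF b1) orbF => /eqP.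
Qed.

(** The j-th component of m is perturbed by s x_l h(z). Minimality gives a quadratic polynomial in s
    that is nonnegative for all s and vanishes at 0, so its linear coefficient, the moment in
    question, is zero. *)
Lemma G_projection_ortho j l h : continuous h ->
  Ex (fun t => x t l 0 * h (z t) * A j t) = 0.
Proof.
move=> ch; set B := fun t => x t l 0 * h (z t).
have sqB : sqintg Pr B by exact: sqintg_term.
apply: (@quadratic_ge0_linear0 (Ex (fun t => B t ^+ 2))).
  by apply: Ex_ge0 => t; exact: sqr_ge0.
move=> s.
pose g xx zz : 'cV[R]_q := m xx zz + (s * (xx l 0 * h zz)) *: delta_mx j 0.
have Gg : in_Gq Pr x z g.
  move=> i; have [hm [chm mE _]] := mP.1 i.
  pose a := s * (i == j)%:R.
  apply: (@in_G_continuous _ (fun l' zz => hm l' zz + (a * (l' == l)%:R) * h zz)).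
    move=> l' v; apply: (@cvgD _ _ _ (nbhs v)); first exact: chm.
    by apply: (@cvgMl_tmp _ _ (nbhs v)); exact: ch.
  move=> xx zz; rewrite /g !mxE mE eqxx andbT.
  under [RHS]eq_bigr do rewrite mulrDr.
  rewrite big_split /=; congr (_ + _).
  rewrite (bigD1 l)//= eqxx big1 ?addr0; first by rewrite /a /=; ring.
  by move=> l' /negbTE ->; rewrite mulr0 mul0r mulr0.
(* Evaluating the Loewner inequality at a unit vector leaves the (j, j) entry only. *)
have [_ /(_ (delta_mx j 0))] := mP.2 g Gg.
rewrite -mulmxA -dotvE /dotv (bigD1 j)//= big1 ?addr0; last first.
  by move=> i ij; rewrite [delta_mx j 0 i 0]mxE (negbTE ij) mul0r.
rewrite [delta_mx j 0 j 0]mxE !eqxx mul1r mxE (bigD1 j)//= big1 ?addr0; last first.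
  by move=> i ij; rewrite [delta_mx j 0 i 0]mxE (negbTE ij) mulr0.
rewrite [delta_mx j 0 j 0]mxE !eqxx mulr1 !mxE subr_le0 => H.
have E1 : fine 'E_Pr[fun t => ((theta (x t) (z t) - m (x t) (z t)) *m
    (theta (x t) (z t) - m (x t) (z t))^T) j j]%E = Ex (fun t => A j t ^+ 2).
  by apply: eq_Ex => t; rewrite mxE big_ord1 !mxE expr2.
have E2 : fine 'E_Pr[fun t => ((theta (x t) (z t) - g (x t) (z t)) *m
    (theta (x t) (z t) - g (x t) (z t))^T) j j]%E = Ex (fun t => A j t ^+ 2 +
      (s ^+ 2 * B t ^+ 2 - (2 * s) * (B t * A j t))).
  by apply: eq_Ex => t; rewrite mxE big_ord1 /g !mxE !eqxx /= /A /B; ring.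
rewrite E1 E2 in H; move: H.
rewrite ExD; [|exact: (sqA j).2|]; last first.
  by apply: intgB; apply: intgZ; [exact: sqB.2|exact: sqintgM].
rewrite ExB; [|by apply: intgZ; exact: sqB.2|by apply: intgZ; exact: sqintgM].
rewrite !ExZ; [|exact: sqintgM|exact: sqB.2].
by rewrite lerDl [s ^+ 2 * _]mulrC.
Qed.

(** The series need not have continuous base functions. Bounded continuous h determine the moments
    over all Borel events of z, hence over all Borel psi. *)
Lemma G_projection_ortho_borel j l psi : borel_fun psi ->
  intg (fun t => psi (z t) * (x t l 0 * A j t)) ->
  Ex (fun t => psi (z t) * (x t l 0 * A j t)) = 0.
Proof.
have mz : random_vector z.
  apply: measurable_cV => i.
  by apply: eq_measurable_fun (random_vector_coord (rshift d i) mxz) => t _; rewrite col_mxEd.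
have sx : sqintg Pr (fun t => x t l 0).
  have [h1 h2] := @sqintg_term l (fun=> 1) (@cst_continuous 'cV[R]_r R 1).
  by split; [apply: eq_measurable_fun h1 => t _|apply: eq_intg h2 => t]; rewrite mulr1.
have iX : intg (fun t => x t l 0 * A j t) by exact: sqintgM.
move=> mpsi i0; apply: (@cond_ortho _ T R Pr _ (borel_cV R r)) => //.
apply: borel_ortho => // h ch h1; rewrite -[RHS](@G_projection_ortho j l h ch).
by apply: eq_Ex => t; ring.
Qed.

End orthogonality.
End projection_onto_G.

(** * Normalisation of the basis and algebra of the estimator *)

Section assembly_lemmas.
Variable R : realType.

Lemma random_vector_comp_dsubmx d (T : measurableType d) n1 n2 (X : T -> 'cV[R]_(n1 + n2)) :
  random_vector X -> random_vector (fun t => dsubmx (X t)).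
Proof.
move=> mX; apply: measurable_cV => i.
by apply: eq_measurable_fun (random_vector_coord (rshift n1 i) mX) => t _; rewrite mxE.
Qed.

Lemma random_vector_comp_usubmx d (T : measurableType d) n1 n2 (X : T -> 'cV[R]_(n1 + n2)) :
  random_vector X -> random_vector (fun t => usubmx (X t)).
Proof.
move=> mX; apply: measurable_cV => i.
by apply: eq_measurable_fun (random_vector_coord (lshift n2 i) mX) => t _; rewrite mxE.
Qed.

Lemma random_vector_id n : random_vector (T := borel_cV R n) (fun v => v).
Proof. by apply: (@measurable_cV _ _ (borel_cV R n)) => i; exact: borel_coord. Qed.

Lemma borel_dsubmx n1 n2 (f : 'cV[R]_n2 -> R) : borel_fun f ->
  borel_fun (fun v : 'cV[R]_(n1 + n2) => f (dsubmx v)).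
Proof.
move=> mf; apply: (@borel_comp _ (borel_cV R (n1 + n2)) _ _ (fun v => dsubmx v) f) => //.
by apply: (@random_vector_comp_dsubmx _ (borel_cV R (n1 + n2))); exact: random_vector_id.
Qed.

Lemma borel_usubmx n1 n2 (f : 'cV[R]_n1 -> R) : borel_fun f ->
  borel_fun (fun v : 'cV[R]_(n1 + n2) => f (usubmx v)).
Proof.
move=> mf; apply: (@borel_comp _ (borel_cV R (n1 + n2)) _ _ (fun v => usubmx v) f) => //.
by apply: (@random_vector_comp_usubmx _ (borel_cV R (n1 + n2))); exact: random_vector_id.
Qed.

Lemma borel_indic n (A : set 'cV[R]_n) : borel_set A -> borel_fun (\1_A : 'cV[R]_n -> R).
Proof. by move=> mA; exact: (@measurable_indic _ (borel_cV R n) R setT A mA). Qed.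

Lemma borelD n (f g : 'cV[R]_n -> R) : borel_fun f -> borel_fun g -> borel_fun (fun v => f v + g v).
Proof. exact: (@measurable_funD _ (borel_cV R n)). Qed.

Lemma borelB n (f g : 'cV[R]_n -> R) : borel_fun f -> borel_fun g -> borel_fun (fun v => f v - g v).
Proof. exact: (@measurable_funB _ (borel_cV R n)). Qed.

Lemma borel_cst n (a : R) : borel_fun (fun _ : 'cV[R]_n => a).
Proof. exact: (@measurable_cst _ _ (borel_cV R n)). Qed.

Lemma borel_sum n (I : Type) (s : seq I) (F : I -> 'cV[R]_n -> R) :
  (forall i, borel_fun (F i)) -> borel_fun (fun v => \sum_(i <- s) F i v).
Proof. by move=> mF; exact: (@measurable_sum _ (borel_cV R n)). Qed.

Lemma fnorm_cV n (a : 'cV[R]_n) : fnorm a ^+ 2 = nrm2 a.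
Proof.
rewrite /fnorm /mxtrace big_ord1 -dotvE sqr_sqrtr//; exact: nrm2_ge0.
Qed.

Lemma coord_le_fnorm n (a : 'cV[R]_n) i : `|a i 0| <= fnorm a.
Proof.
rewrite -(ler_pXn2r (n := 2))// ?nnegrE ?sqrtr_ge0// fnorm_cV nrm2E (bigD1 i)//=.
by rewrite real_normK ?num_real// lerDl sumr_ge0// => j _; exact: sqr_ge0.
Qed.

Section normalization.
Variables (n : nat) (Q L : 'M[R]_n) (c : R).
Hypotheses (c0 : 0 < c) (uL : L \in unitmx) (QE : Q = L *m L^T).
Hypothesis Qc : forall v : 'cV[R]_n, c * nrm2 v <= dotv v (Q *m v).

Lemma normalized_gram : invmx L *m Q *m (invmx L)^T = 1%:M.
Proof. by rewrite QE mulmxA mulVmx// mul1mx trmx_inv mulmxV// unitmx_tr. Qed.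

(** With y = Q^-1 v the left side is y'v. Since c |y|^2 <= y'v, the inequality (y'v)^2 <= |y|^2
    |v|^2 gives c y'v <= |v|^2. This keeps the bound [zeta0] under normalisation, up to the constant
    c. *)
Lemma normalized_bound (v : 'cV[R]_n) : nrm2 (invmx L *m v) <= nrm2 v / c.
Proof.
set y := (invmx L)^T *m (invmx L *m v).
have Qy : Q *m y = v.
  rewrite QE /y -!mulmxA (mulmxA L^T) trmx_inv mulmxV ?unitmx_tr// mul1mx.
  by rewrite mulmxA mulmxV// mul1mx.
have ay : nrm2 (invmx L *m v) = dotv y v.
  by rewrite /nrm2 dotv_mulmx.
have h1 := Qc y; rewrite Qy in h1.
have h2 : dotv y v ^+ 2 <= nrm2 y * nrm2 v by exact: cauchy_schwarz.
rewrite ler_pdivlMr// ay; have := nrm2_ge0 v; have := nrm2_ge0 y.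
have a0 : 0 <= dotv y v by rewrite -ay nrm2_ge0.
have [->|an0] := eqVneq (dotv y v) 0; first by rewrite mul0r.
have ap : 0 < dotv y v by rewrite lt_def an0.
move=> y0 v0; rewrite -(ler_pM2l ap) mulrA -expr2.
apply: le_trans (ler_wpM2r (ltW c0) h2) _.
rewrite (_ : _ * _ * c = (c * nrm2 y) * nrm2 v); last by ring.
by rewrite ler_wpM2r.
Qed.

End normalization.

Lemma series_basisE d r (p : 'I_d -> nat -> 'cV[R]_r -> R) (k : 'I_d -> nat)
    (i : 'I_(series_dim k)) : exists l j, forall xx zz,
  series_basis p k xx zz i 0 = xx l 0 * p l j zz.
Proof.
exists (tagnat.sig1 i), (tagnat.sig2 i) => xx' zz'.
by rewrite /series_basis !mxE.
Qed.

Lemma ginv_unit (ginv : forall m, 'M[R]_m -> 'M[R]_m) n (A : 'M[R]_n) :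
  is_sym_ginv ginv -> A^T = A -> A \in unitmx -> ginv n A = invmx A.
Proof.
move=> ginvP sA uA; have [A1 _] := ginvP n A sA.
by rewrite -[LHS](mulKmx uA) -[A *m _](mulmxK uA) A1 mulmxV// mulmx1.
Qed.

(** The residual maker 1 - M annihilates everything in the range of P, so only A and a survive.
    Invertibility of G turns the arbitrary generalized inverse into the true inverse. *)
Lemma partialled_ols_error (ginv : forall m, 'M[R]_m -> 'M[R]_m) n q K
    (Y : 'cV[R]_n) (W A : 'M[R]_(n, q)) (P : 'M[R]_(n, K)) (C : 'M[R]_(K, q))
    (c : 'cV[R]_K) (a : 'cV[R]_n) (gamma : 'cV[R]_q) : is_sym_ginv ginv ->
  W = P *m C + A -> Y = W *m gamma + P *m c + a ->
  let M := series_proj ginv P in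
  let G := (A - M *m A)^T *m (A - M *m A) in
  G \in unitmx ->
  G *m (partialled_ols ginv Y W P - gamma) = (A - M *m A)^T *m (a - M *m a).
Proof.
move=> ginvP WE YE M G uG.
have MP : M *m P = P by exact: series_proj_id.
have RW : W - M *m W = A - M *m A.
  by rewrite WE mulmxDr mulmxA MP opprD addrACA subrr add0r.
have RY : Y - M *m Y = (A - M *m A) *m gamma + (a - M *m a).
  rewrite YE !mulmxDr [M *m (P *m c)]mulmxA MP -RW mulmxBl -(mulmxA M W gamma).
  have zm (a1 a2 a3 a4 a5 : 'cV[R]_n) : a1 + a2 + a3 - (a4 + a2 + a5) = a1 - a4 + (a3 - a5).
    by rewrite opprD addrACA [- (a4 + a2)]opprD (addrACA a1) subrr addr0.
  exact: zm.
have Gs : G^T = G by rewrite /G trmx_mul trmxK.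
have gE := ginv_unit ginvP Gs uG.
rewrite /partialled_ols -/M RW RY -/G gE.
have ols (H : 'M[R]_(n, q)) (g : 'cV[R]_n) : H^T *m H \in unitmx ->
    H^T *m H *m (invmx (H^T *m H) *m H^T *m (H *m gamma + g) - gamma) = H^T *m g.
  move=> uH; rewrite mulmxBr -(mulmxA _ H^T) mulKVmx// mulmxDr mulmxA.
  by rewrite addrC addKr.
exact: ols.
Qed.

(** Cauchy-Schwarz links the two rates of the theorem: the square of the approximation rate, with
    exponents - delta_l, is bounded by the sum with exponents - 2 delta_l. *)
Lemma sum_powR_sqr_le d (k : 'I_d -> nat) (delta : 'I_d -> R) :
  (\sum_(l < d) (k l)%:R `^ (- delta l)) ^+ 2
    <= d%:R * \sum_(l < d) (k l)%:R `^ (- (2 * delta l)).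
Proof.
pose f l := (k l)%:R `^ (- delta l).
have := cauchy_schwarz_sum (fun=> 1) f.
rewrite (_ : \sum_(l < d) 1 ^+ 2 = d%:R); last first.
  rewrite (eq_bigr (fun=> 1)) => [|l _]; last by rewrite expr1n.
  by rewrite sumr_const card_ord.
rewrite (_ : \sum_(l < d) 1 * f l = \sum_(l < d) (k l)%:R `^ (- delta l)); last first.
  by apply: eq_bigr => l _; rewrite mul1r.
move=> /le_trans; apply; rewrite le_eqVlt; apply/orP; left; apply/eqP.
congr (_ * _); apply: eq_bigr => l _; rewrite /f -powR_mulrn ?powR_ge0// -powRrM.
by congr (_ `^ _); ring.
Qed.

End assembly_lemmas.

Section almost_sure_iid.
Context disp (T : measurableType disp) (R : realType) (Pr : probability T R).
Context m (V : nat -> T -> 'cV[R]_m).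
Hypothesis mV : forall i, random_vector (V i).
Hypothesis idV : identically_distributed Pr V.

Lemma ident_ae (A : set 'cV[R]_m) : borel_set A -> {ae Pr, forall t, A (V 0%N t)} ->
  {ae Pr, forall t, forall i, A (V i t)}.
Proof.
move=> mA A0; apply: (@ae_countable _ _ _ _ nat (fun i t => A (V i t))) => i.
have mA' : borel_set (~` A) by exact: (@measurableC _ (borel_cV R m)).
have E j : Pr (V j @^-1` (~` A)) = 0%E -> {ae Pr, forall t, A (V j t)}.
  move=> h; exists (V j @^-1` (~` A)); split => //; exact: random_vector_preimage.
apply: E; rewrite (idV i 0%N mA').
have [B [mB B0 HB]] := A0.
apply/eqP; rewrite eq_le measure_ge0 andbT -B0.
by apply: le_measure; rewrite ?inE//; exact: random_vector_preimage.
Qed.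

End almost_sure_iid.

(** * The regression model *)

Section regressors.
Context disp (T : measurableType disp) (R : realType) (Pr : probability T R).
Local Notation intg := (intg Pr).
Local Notation Ex := (Ex Pr).
Variables (q d r : nat) (w : T -> 'cV[R]_q) (x : T -> 'cV[R]_d) (z : T -> 'cV[R]_r).
Let xz t : 'cV[R]_(d + r) := col_mx (x t) (z t).
Let wxz t : 'cV[R]_(q + (d + r)) := col_mx (w t) (xz t).
Hypothesis mwxz : random_vector wxz.
Hypothesis cS : compact (support Pr wxz).
Variables (theta m : 'cV[R]_d -> 'cV[R]_r -> 'cV[R]_q).
Hypothesis ctheta : forall j, is_cond_exp Pr (fun t => w t j 0) xz
  (fun v => theta (usubmx v) (dsubmx v) j 0).
Hypothesis theta_bounded : exists C : R, forall ww xx zz,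
  support Pr wxz (col_mx ww (col_mx xx zz)) -> fnorm (theta xx zz) <= C.
Hypothesis mP : is_G_projection Pr x z theta m.

(** If |f| exceeded C at a support point, it would do so on a neighbourhood, which has positive
    probability. *)
Lemma support_bounded n (X : T -> 'cV[R]_n) (f : 'cV[R]_n -> R) (C : R) : random_vector X -> continuous f ->
  {ae Pr, forall t, `|f (X t)| <= C} -> forall v, support Pr X v -> `|f v| <= C.
Proof.
move=> mX cf [A [mA A0 HA]] v vS; rewrite leNgt; apply/negP => Cv.
have oU : open [set y : 'cV[R]_n | C < `|f y|].
  apply: (@open_comp _ _ (fun y : 'cV[R]_n => `|f y|) [set y : R | C < y]); last exact: open_gt.
  move=> y _; apply: (@continuous_comp _ _ _ f (fun y : R => `|y|)); first exact: cf.
  exact: norm_continuous.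
have := vS _ oU Cv; rewrite ltNge => /negP; apply; rewrite -A0.
apply: le_measure; rewrite ?inE//; first exact: random_vector_preimage (open_borel oU).
move=> t /= h; apply: HA => /=.
by apply/negP; rewrite -ltNge.
Qed.

Lemma xz_random : random_vector xz.
Proof.
by apply: eq_measurable_fun (random_vector_comp_dsubmx mwxz) => t _; rewrite col_mxKd.
Qed.

Lemma wxz_bounded (f : 'cV[R]_(q + (d + r)) -> R) : continuous f ->
  exists C, {ae Pr, forall t, `|f (wxz t)| <= C}.
Proof.
move=> cf; have [C HC] := compact_norm_bounded cf cS.
by exists C; apply: filterS (ae_support Pr mwxz) => t; exact: HC.
Qed.

Lemma xz_bounded (f : 'cV[R]_(d + r) -> R) : continuous f ->
  exists C, {ae Pr, forall t, `|f (xz t)| <= C}.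
Proof.
move=> cf; have cf' : continuous (fun v : 'cV[R]_(q + (d + r)) => f (dsubmx v)).
  move=> v; apply: (@continuous_comp _ _ _ (fun v : 'cV[R]_(q + (d + r)) => dsubmx v) f).
    exact: continuous_dsubmx.
  exact: cf.
have [C HC] := wxz_bounded cf'; exists C; apply: filterS HC => t.
by rewrite col_mxKd.
Qed.

Lemma sqintg_theta j : sqintg Pr (fun t => theta (x t) (z t) j 0).
Proof.
have [C HC] := theta_bounded; have [mth _ ith _] := ctheta j.
have mt : measurable_fun setT (fun t => theta (x t) (z t) j 0).
  by apply: eq_measurable_fun (intg_meas ith) => t _; rewrite /comp col_mxKu col_mxKd.
split => //; apply: (@ae_bounded_intg _ _ _ _ _ (C ^+ 2)).
  by under eq_fun do rewrite expr2; exact: measurable_funM.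
apply: filterS (ae_support Pr mwxz) => t h.
have h1 := le_trans (coord_le_fnorm _ j) (HC _ _ _ h).
by rewrite normrX ler_pXn2r// nnegrE// (le_trans _ h1).
Qed.

Definition resid_w j t := w t j 0 - m (x t) (z t) j 0.

Lemma meas_w j : measurable_fun setT (fun t => w t j 0).
Proof.
by apply: eq_measurable_fun (random_vector_coord (lshift (d + r) j) mwxz) => t _; rewrite col_mxEu.
Qed.

Lemma meas_resid_w j : measurable_fun setT (resid_w j).
Proof.
apply: measurable_funB; first exact: meas_w.
by have [] := sqintg_in_G xz_random xz_bounded (mP.1 j).
Qed.

Lemma m_bounded j : exists C, forall v, support Pr xz v -> `|m (usubmx v) (dsubmx v) j 0| <= C.
Proof.
have [h [ch mE _]] := mP.1 j.
have cf : continuous (fun v : 'cV[R]_(d + r) => \sum_(l < d) v (lshift r l) 0 * h l (dsubmx v)).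
  by apply: continuous_sum_fun => l; exact: continuous_term.
have [C HC] := xz_bounded cf; exists C => v vS; rewrite mE.
have := support_bounded xz_random cf HC vS; rewrite (eq_bigr (fun l => usubmx v l 0 * h l (dsubmx v)))//.
by move=> l _; rewrite mxE.
Qed.

Lemma w_bounded : exists C, forall v j, support Pr wxz v -> `|usubmx v j 0| <= C.
Proof.
have [C HC] := @compact_norm_bounded R _ (fun v : 'cV[R]_(q + (d + r)) => `|v|) _ (@norm_continuous _ _) cS.
exists C => v j vS; rewrite mxE (le_trans (coord_norm_le _ _ _))// (le_trans (ler_norm _))//.
exact: HC.
Qed.

Lemma resid_w_bounded : exists C, forall v j, support Pr wxz v -> support Pr xz (dsubmx v) ->
  `|usubmx v j 0 - m (usubmx (dsubmx v)) (dsubmx (dsubmx v)) j 0| <= C.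
Proof.
have [C HC] := w_bounded.
have [Cm HCm] : exists Cm : 'I_q -> R, forall j v, support Pr xz v ->
    `|m (usubmx v) (dsubmx v) j 0| <= Cm j.
  by have [Cm H] := choice m_bounded; exists Cm.
exists (C + \sum_j `|Cm j|) => v j vS vS'; rewrite (le_trans (ler_normB _ _))// lerD ?HC//.
apply: le_trans (HCm j _ vS') _; apply: le_trans (ler_norm _) _.
by rewrite (bigD1 j)//= lerDl sumr_ge0.
Qed.

Lemma resid_w_ae : exists C, forall j, {ae Pr, forall t, `|resid_w j t| <= C}.
Proof.
have [C HC] := resid_w_bounded; exists C => j.
move: (ae_support Pr mwxz) (ae_support Pr xz_random); apply: filterS2 => t h1 h2.
have := HC _ j h1; rewrite /wxz col_mxKd => /(_ h2).
by rewrite /xz !col_mxKu col_mxKd.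
Qed.

Lemma sqintg_resid_w j : sqintg Pr (resid_w j).
Proof.
have [C HC] := resid_w_ae; have mt := meas_resid_w j.
split => //; apply: (@ae_bounded_intg _ _ _ _ _ (C ^+ 2)).
  by under eq_fun do rewrite expr2; exact: measurable_funM.
apply: filterS (HC j) => t h1.
by rewrite normrX ler_pXn2r// nnegrE// (le_trans _ h1).
Qed.

(** w - m splits into w - theta, orthogonal to functions of (x, z) by conditional expectation, and
    theta - m, orthogonal to x_l psi(z) by the projection property. *)
Lemma resid_w_ortho_term j l psi : borel_fun psi ->
  (exists C, {ae Pr, forall t, `|x t l 0 * psi (z t)| <= C}) ->
  Ex (fun t => x t l 0 * psi (z t) * resid_w j t) = 0.
Proof.
move=> mpsi [C HC].
pose ph (v : 'cV[R]_(d + r)) := v (lshift r l) 0 * psi (dsubmx v).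
have mph : borel_fun ph by apply: borelM; [exact: borel_coord|exact: borel_dsubmx].
have phE t : ph (xz t) = x t l 0 * psi (z t) by rewrite /ph col_mxEu col_mxKd.
have mph' : measurable_fun setT (fun t => x t l 0 * psi (z t)).
  by apply: eq_measurable_fun (borel_comp xz_random mph) => t _; rewrite phE.
have sph : sqintg Pr (fun t => x t l 0 * psi (z t)).
  split => //; apply: (@ae_bounded_intg _ _ _ _ _ (C ^+ 2)).
    by under eq_fun do rewrite expr2; exact: measurable_funM.
  apply: filterS HC => t h1.
  by rewrite normrX ler_pXn2r// nnegrE// (le_trans _ h1).
have sth := sqintg_theta j.
have sm := sqintg_in_G xz_random xz_bounded (mP.1 j).
have sw : sqintg Pr (fun t => w t j 0).
  have := sqintgD (sqintg_resid_w j) sm.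
  by case=> h1 h2; split; [apply: eq_measurable_fun h1 => t _|apply: eq_intg h2 => t]; rewrite /resid_w subrK.
pose A t := theta (x t) (z t) j 0 - m (x t) (z t) j 0.
have sA : sqintg Pr A.
  have := sqintgD sth (sqintgZ (-1) sm).
  by case=> h1 h2; split; [apply: eq_measurable_fun h1 => t _|apply: eq_intg h2 => t]; rewrite /A mulN1r.
transitivity (Ex (fun t => (x t l 0 * psi (z t) * w t j 0 - x t l 0 * psi (z t) * theta (x t) (z t) j 0)
   + x t l 0 * psi (z t) * A t)).
  by apply: eq_Ex => t; rewrite /resid_w /A; ring.
rewrite ExD; [|by apply: intgB; exact: sqintgM|exact: sqintgM].
rewrite ExB; [|exact: sqintgM|exact: sqintgM].
have := cond_exp_pullout xz_random (ctheta j) mph.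
rewrite (eq_Ex Pr (Y := fun t => x t l 0 * psi (z t) * w t j 0)); last by move=> t; rewrite phE.
rewrite (eq_Ex Pr (X := fun t => ph (xz t) * _) (Y := fun t => x t l 0 * psi (z t) * theta (x t) (z t) j 0)); last first.
  by move=> t; rewrite phE col_mxKu col_mxKd.
move=> -> ; last 2 first.
- by apply: eq_intg (sqintgM sph sw) => t; rewrite phE.
- by apply: eq_intg (sqintgM sph sth) => t; rewrite phE col_mxKu col_mxKd.
rewrite subrr add0r.
have iA : intg (fun t => psi (z t) * (x t l 0 * A t)).
  by apply: eq_intg (sqintgM sph sA) => t; ring.
rewrite -[RHS](G_projection_ortho_borel xz_random xz_bounded sqintg_theta mP mpsi iA).
by apply: eq_Ex => t; rewrite /A; ring.
Qed.

Let S := support Pr xz.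

Lemma indic_S_ae : {ae Pr, forall t, \1_S (xz t) = 1 :> R}.
Proof.
by apply: filterS (ae_support Pr xz_random) => t h; rewrite indicE mem_set.
Qed.

(* The truncation to S makes x'beta(z), whose coefficients are arbitrary functions, Borel. *)
Definition admissible (F : 'cV[R]_(d + r) -> R) :=
  [/\ borel_fun (fun v => \1_S v * F v), exists C, forall v, S v -> `|F v| <= C &
      forall j, Ex (fun t => \1_S (xz t) * F (xz t) * resid_w j t) = 0].

Lemma trunc_bounded (F : 'cV[R]_(d + r) -> R) C : (forall v, S v -> `|F v| <= C) ->
  forall v, `|\1_S v * F v| <= `|C|.
Proof.
move=> H v; rewrite indicE; have [Sv|Sv] := pselect (S v).
  by rewrite mem_set// mul1r (le_trans (H v Sv))// ler_norm.
by rewrite memNset// mul0r normr0.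
Qed.

Lemma sqintg_admissible F : admissible F -> sqintg Pr (fun t => \1_S (xz t) * F (xz t)).
Proof.
move=> [mF [C HC] _]; apply: (@bounded_sqintg _ _ _ _ _ `|C|).
  exact: (borel_comp xz_random mF).
by move=> t; exact: trunc_bounded.
Qed.

Lemma intg_admissible F j : admissible F ->
  intg (fun t => \1_S (xz t) * F (xz t) * resid_w j t).
Proof. by move=> aF; apply: sqintgM; [exact: sqintg_admissible|exact: sqintg_resid_w]. Qed.

Lemma admissible_eq F G : admissible F -> (forall v, S v -> F v = G v) -> admissible G.
Proof.
move=> [mF [C HC] F0] FG.
have E v : \1_S v * F v = \1_S v * G v.
  rewrite indicE; have [Sv|Sv] := pselect (S v); first by rewrite FG.
  by rewrite memNset// !mul0r.
split; first by move: mF; rewrite (funext E).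
  by exists C => v Sv; rewrite -FG//; exact: HC.
by move=> j; rewrite -[RHS](F0 j); apply: eq_Ex => t; rewrite E.
Qed.

Lemma admissible0 : admissible (fun=> 0).
Proof.
split.
- by under eq_fun do rewrite mulr0; exact: borel_cst.
- by exists 0 => v _; rewrite normr0.
- move=> j; rewrite -[RHS](Ex_cst Pr 0); apply: eq_Ex => t.
  by rewrite mulr0 mul0r.
Qed.

Lemma admissibleD F G : admissible F -> admissible G -> admissible (fun v => F v + G v).
Proof.
move=> aF aG; have [mF [C HC] F0] := aF; have [mG [C' HC'] G0] := aG; split.
- by under eq_fun do rewrite mulrDr; exact: borelD.
- by exists (C + C') => v Sv; rewrite (le_trans (ler_normD _ _))// lerD// ?HC ?HC'.
- move=> j; have := ExD (intg_admissible j aF) (intg_admissible j aG).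
  rewrite F0 G0 addr0 => E; rewrite -[RHS]E.
  by apply: eq_Ex => t; ring.
Qed.

Lemma admissibleZ a F : admissible F -> admissible (fun v => a * F v).
Proof.
move=> aF; have [mF [C HC] F0] := aF; split.
- by under eq_fun do rewrite mulrCA; apply: borelM => //; exact: borel_cst.
- by exists (`|a| * C) => v Sv; rewrite normrM ler_wpM2l// HC.
- move=> j; have := ExZ a (intg_admissible j aF).
  rewrite F0 mulr0 => E; rewrite -[RHS]E.
  by apply: eq_Ex => t; ring.
Qed.

Lemma admissible_sum (I : Type) (s : seq I) (F : I -> 'cV[R]_(d + r) -> R) :
  (forall i, admissible (F i)) -> admissible (fun v => \sum_(i <- s) F i v).
Proof.
move=> aF; elim: s => [|i s ih].
  by apply: admissible_eq admissible0 _ => v _; rewrite big_nil.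
by apply: admissible_eq (admissibleD (aF i) ih) _ => v _; rewrite big_cons.
Qed.

Lemma admissible_term l psi : borel_fun psi ->
  (exists C, forall v, S v -> `|usubmx v l 0 * psi (dsubmx v)| <= C) ->
  admissible (fun v => usubmx v l 0 * psi (dsubmx v)).
Proof.
move=> mpsi [C HC].
have mF : borel_fun (fun v : 'cV[R]_(d + r) => usubmx v l 0 * psi (dsubmx v)).
  by apply: borelM; [exact: (borel_usubmx (f := fun v => v l 0) (borel_coord l))|exact: borel_dsubmx].
have mS : borel_fun (\1_S : 'cV[R]_(d + r) -> R) by apply: borel_indic; exact: borel_support.
split; [exact: borelM|by exists C|move=> j].
rewrite -[RHS](@resid_w_ortho_term j l psi mpsi); last first.
  exists C; apply: filterS (ae_support Pr xz_random) => t h.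
  by have := HC _ h; rewrite col_mxKu col_mxKd.
have me := meas_resid_w j.
have mF' : measurable_fun setT (fun t => x t l 0 * psi (z t)).
  by apply: eq_measurable_fun (borel_comp xz_random mF) => t _; rewrite col_mxKu col_mxKd.
apply: ae_eq_Ex.
- apply: measurable_funM => //; exact: (borel_comp xz_random (borelM mS mF)).
- exact: measurable_funM.
by apply: filterS indic_S_ae => t ->; rewrite mul1r col_mxKu col_mxKd.
Qed.

Lemma admissible_in_G g : in_G Pr x z g -> admissible (fun v => g (usubmx v) (dsubmx v)).
Proof.
move=> [h [ch gE _]].
suff : admissible (fun v => \sum_(l < d) usubmx v l 0 * h l (dsubmx v)).
  by move=> aF; apply: admissible_eq aF _ => v _; rewrite gE.
apply: admissible_sum => l; apply: admissible_term; first exact: continuous_borel.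
have cf := continuous_term (l := l) (ch l); have [C HC] := xz_bounded cf; exists C => v vS.
by have := support_bounded xz_random cf HC vS; rewrite mxE.
Qed.

(** The means by which x'beta(z) becomes tractable: a uniform limit on S of admissible functions
    inherits measurability, boundedness and orthogonality, with nothing assumed of F itself. *)
Lemma admissible_lim F (Fn : nat -> 'cV[R]_(d + r) -> R) (rho : nat -> R) :
  (forall n, admissible (Fn n)) ->
  (\forall n \near \oo, forall v, S v -> (F v - Fn n v) ^+ 2 <= rho n) ->
  rho @ \oo --> (0 : R) -> admissible F.
Proof.
move=> aFn FFn /cvgrPdist_le rho0.
have close (a : R) : 0 < a -> \forall n \near \oo, forall v, S v -> `|F v - Fn n v| <= a.
  move=> a0; have a2 : 0 < a ^+ 2 by rewrite exprn_gt0.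
  move: FFn (rho0 _ a2); apply: filterS2 => n h1 h2 v Sv.
  rewrite -(ler_pXn2r (n := 2))// ?nnegrE ?(ltW a0)// real_normK ?num_real//.
  apply: le_trans (h1 v Sv) _; move: h2; rewrite sub0r normrN; exact: le_trans (ler_norm _).
have mF : borel_fun (fun v => \1_S v * F v).
  apply: (@measurable_fun_cvg _ (borel_cV R (d + r)) R setT (fun n v => \1_S v * Fn n v)).
    by move=> n; have [] := aFn n.
  move=> v _; rewrite indicE; have [Sv|Sv] := pselect (S v).
    rewrite mem_set// mul1r; under eq_fun do rewrite mul1r.
    apply/cvgrPdist_le => a a0; move: (close a a0); apply: filterS => n; exact.
  by rewrite memNset// mul0r; under eq_fun do rewrite mul0r; exact: cvg_cst.
have bF : exists C, forall v, S v -> `|F v| <= C.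
  have [N _ /(_ N (leqnn N)) HN] := close 1 ltr01.
  have [_ [C HC] _] := aFn N; exists (1 + C) => v Sv.
  by rewrite -[F v](subrK (Fn N v)) (le_trans (ler_normD _ _))// lerD ?HN ?HC.
split => // j.
have sF : sqintg Pr (fun t => \1_S (xz t) * F (xz t)).
  have [C HC] := bF; apply: (@bounded_sqintg _ _ _ _ _ `|C|); first exact: (borel_comp xz_random mF).
  by move=> t; exact: trunc_bounded.
have iF := sqintgM sF (sqintg_resid_w j).
have iw := intg_norm (sqintg_intg (sqintg_resid_w j)).
set b := Ex (fun t => `|resid_w j t|).
have b0 : 0 <= b by apply: Ex_ge0.
have b1 : 0 < b + 1 by rewrite ltr_wpDl.
set c := Ex _.
(* Since [Fn N] is exactly orthogonal, the moment of F is at most the uniform distance a times E|w -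
   m|. *)
have H a : 0 < a -> `|c| <= a * b.
  move=> a0; have [N _ /(_ N (leqnn N)) HN] := close a a0.
  have [_ _ /(_ j) FN0] := aFn N.
  rewrite -[c]subr0 -FN0 /c -ExB//; last exact: intg_admissible.
  have iB := intgB iF (intg_admissible j (aFn N)).
  apply: le_trans (norm_Ex iB) _; rewrite /b -ExZ//; apply: le_Ex.
  - exact: intg_norm.
  - exact: intgZ.
  move=> t; rewrite -mulrBl -mulrBr !normrM ler_wpM2r//.
  rewrite indicE; have [Sv|Sv] := pselect (S (xz t)).
    by rewrite mem_set// normr1 mul1r HN.
  by rewrite memNset// normr0 mul0r ltW.
apply/eqP; rewrite -normr_le0; apply/ler_addgt0Pr => a a0; rewrite add0r.
have ab : 0 < a / (b + 1) by rewrite divr_gt0.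
apply: le_trans (H _ ab) _; rewrite mulrAC ler_pdivrMr// ler_wpM2l ?(ltW a0)//.
by rewrite lerDl.
Qed.

End regressors.

(** * The partially linear model and its series estimator *)

Section model.
Context (disp : measure_display) (T : measurableType disp) (R : realType) (Pr : probability T R).
Local Notation intg := (intg Pr).
Local Notation Ex := (Ex Pr).
Variables (q d r : nat) (Y u : nat -> T -> R) (w : nat -> T -> 'cV[R]_q)
  (x : nat -> T -> 'cV[R]_d) (z : nat -> T -> 'cV[R]_r)
  (gamma : 'cV[R]_q) (beta : 'I_d -> 'cV[R]_r -> R).
Variables (theta m : 'cV[R]_d -> 'cV[R]_r -> 'cV[R]_q) (sigma : R).
Let xz (i : nat) (t : T) : 'cV[R]_(d + r) := col_mx (x i t) (z i t).
Let wxz (i : nat) (t : T) : 'cV[R]_(q + (d + r)) := col_mx (w i t) (xz i t).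
Let V (i : nat) (t : T) : 'cV[R]_(1 + (q + (d + r))) :=
  col_mx ((Y i t)%:M : 'cV[R]_1) (wxz i t).
Let S : set 'cV[R]_(d + r) := support Pr (xz 0%N).
Let eps (t : T) : 'cV[R]_q := w 0%N t - m (x 0%N t) (z 0%N t).
Let Phi : 'M[R]_q := expectation_mx Pr (fun t => eps t *m (eps t)^T).
Let f0 (v : 'cV[R]_(d + r)) : R := \sum_(l < d) usubmx v l 0 * beta l (dsubmx v).

Hypothesis YE : forall i t, Y i t = ((w i t)^T *m gamma) 0 0
     + \sum_(l < d) x i t l 0 * beta l (z i t) + u i t.
Hypothesis cu : forall i, is_cond_exp Pr (u i) (wxz i) (fun=> 0).
Hypothesis mV : forall i, random_vector (V i).
Hypothesis indV : mutually_independent Pr V.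
Hypothesis idV : identically_distributed Pr V.
Hypothesis cS : compact (support Pr (wxz 0%N)).
Hypothesis ctheta : forall j, is_cond_exp Pr (fun t => w 0%N t j 0) (xz 0%N)
     (fun v => theta (usubmx v) (dsubmx v) j 0).
Hypothesis theta_bounded : exists C : R, forall ww xx zz,
     support Pr (wxz 0%N) (col_mx ww (col_mx xx zz)) -> fnorm (theta xx zz) <= C.
Hypothesis mP : is_G_projection Pr (x 0%N) (z 0%N) theta m.
Hypothesis cu2 : forall i, is_cond_exp Pr (fun t => u i t ^+ 2) (wxz i) (fun=> sigma ^+ 2).

Lemma wxz_random i : random_vector (wxz i).
Proof.
by apply: eq_measurable_fun (random_vector_comp_dsubmx (mV i)) => t _; rewrite col_mxKd.
Qed.

Local Notation adm := (admissible Pr (w 0%N) (x 0%N) (z 0%N) m).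
Local Notation resid := (resid_w (w 0%N) (x 0%N) (z 0%N) m).
Let mw0 : random_vector (wxz 0%N) := wxz_random 0%N.
Let mxz0 : random_vector (xz 0%N) := xz_random mw0.

(** The first set bounds w, the second bounds m, x'beta and the series. Almost surely all
    observations fall in both, so cutting off outside changes nothing but null events and makes the
    bounds global. *)
Definition regular_set : set 'cV[R]_(q + (d + r)) :=
  support Pr (wxz 0%N) `&` (fun v => dsubmx v) @^-1` S.
Local Notation S0 := regular_set.

Lemma borel_regular : borel_set S0.
Proof.
apply: (@measurableI _ (borel_cV R (q + (d + r)))); first exact: borel_support.
apply: (@random_vector_preimage _ (borel_cV R (q + (d + r))) _ _ (fun v => dsubmx v)).
  by apply: (@random_vector_comp_dsubmx _ _ (borel_cV R (q + (d + r)))); exact: random_vector_id.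
exact: borel_support.
Qed.

Lemma ae_regular : {ae Pr, forall t, forall i, S0 (wxz i t)}.
Proof.
have mA : borel_set ((fun v : 'cV[R]_(1 + (q + (d + r))) => dsubmx v) @^-1` S0).
  apply: (@random_vector_preimage _ (borel_cV R (1 + (q + (d + r)))) _ _ (fun v => dsubmx v)).
    by apply: (@random_vector_comp_dsubmx _ _ (borel_cV R _)); exact: random_vector_id.
  exact: borel_regular.
suff : {ae Pr, forall t, S0 (dsubmx (V 0%N t))}.
  move=> /(ident_ae mV idV mA); apply: filterS => t H i.
  by have := H i; rewrite /V /= col_mxKd.
move: (ae_support Pr mw0) (ae_support Pr mxz0); apply: filterS2 => t h1 h2.
by rewrite col_mxKd; split => //=; rewrite col_mxKd.
Qed.

Definition trunc (F : 'cV[R]_(d + r) -> R) (v : 'cV[R]_(q + (d + r))) : R :=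
  \1_S0 v * F (dsubmx v).

Lemma indic_regular v : S0 v -> \1_S0 v = 1 :> R.
Proof. by move=> h; rewrite indicE mem_set. Qed.

Lemma indic_nregular v : ~ S0 v -> \1_S0 v = 0 :> R.
Proof. by move=> h; rewrite indicE memNset. Qed.

Lemma trunc_ae F : {ae Pr, forall t, forall i, trunc F (wxz i t) = F (xz i t)}.
Proof.
apply: filterS ae_regular => t H i.
by rewrite /trunc indic_regular ?mul1r ?col_mxKd.
Qed.

Lemma borel_trunc F : adm F -> borel_fun (trunc F).
Proof.
move=> [mF _ _].
have E v : trunc F v = \1_S0 v * (\1_S (dsubmx v) * F (dsubmx v)).
  rewrite /trunc; have [h|h] := pselect (S0 v); last by rewrite indic_nregular ?mul0r.
  by rewrite indic_regular ?mul1r// [\1_S _]indicE mem_set ?mul1r//; case: h.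
rewrite (funext E); apply: borelM; first by apply: borel_indic; exact: borel_regular.
exact: (borel_dsubmx mF).
Qed.

Lemma trunc_sqr_le F (C : R) : 0 <= C -> (forall v, S v -> F v ^+ 2 <= C) ->
  forall v, trunc F v ^+ 2 <= C.
Proof.
move=> C0 H v; rewrite /trunc; have [h|h] := pselect (S0 v).
  by rewrite indic_regular ?mul1r//; apply: H; case: h.
by rewrite indic_nregular ?mul0r// expr0n.
Qed.

Lemma trunc_adm_bounded F : adm F -> exists C, forall v, `|trunc F v| <= C.
Proof.
move=> [_ [C HC] _]; exists `|C| => v; rewrite /trunc; have [h|h] := pselect (S0 v).
  by rewrite indic_regular ?mul1r// (le_trans (HC _ _)) ?ler_norm//; case: h.
by rewrite indic_nregular ?mul0r// normr0.
Qed.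

Let measV i (f : 'cV[R]_(q + (d + r)) -> R) : borel_fun f -> measurable_fun setT (fun t => f (wxz i t)).
Proof. by move=> mf; exact: (borel_comp (wxz_random i) mf). Qed.

Lemma sqintg_trunc F : adm F -> sqintg Pr (fun t => trunc F (wxz 0%N t)).
Proof.
move=> aF; have [C HC] := trunc_adm_bounded aF.
by apply: (@bounded_sqintg _ _ _ _ _ C) => //; apply: measV; exact: borel_trunc.
Qed.

Definition resid_fun (j : 'I_q) (v : 'cV[R]_(q + (d + r))) : R :=
  \1_S0 v * (usubmx v j 0 - m (usubmx (dsubmx v)) (dsubmx (dsubmx v)) j 0).

Lemma resid_fun_ae : {ae Pr, forall t, forall i j,
  resid_fun j (wxz i t) = w i t j 0 - m (x i t) (z i t) j 0}.
Proof.
apply: filterS ae_regular => t H i j.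
by rewrite /resid_fun indic_regular// mul1r /wxz /xz !col_mxKd !col_mxKu.
Qed.

Let adm_m j : adm (fun v => m (usubmx v) (dsubmx v) j 0).
Proof. exact: (admissible_in_G mw0 cS ctheta theta_bounded mP (mP.1 j)). Qed.

Lemma borel_resid_fun j : borel_fun (resid_fun j).
Proof.
have E v : resid_fun j v = \1_S0 v * usubmx v j 0 - trunc (fun v => m (usubmx v) (dsubmx v) j 0) v.
  by rewrite /resid_fun mulrBr.
rewrite (funext E); apply: borelB; last by apply: borel_trunc; exact: adm_m.
apply: borelM; first by apply: borel_indic; exact: borel_regular.
exact: (borel_usubmx (f := fun v => v j 0) (borel_coord j)).
Qed.

Lemma resid_fun_bounded : exists C, 0 <= C /\ forall j v, `|resid_fun j v| <= C.
Proof.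
have [C HC] := resid_w_bounded mw0 cS mP.
exists `|C|; split => // j v; rewrite /resid_fun; have [h|h] := pselect (S0 v).
  rewrite indic_regular ?mul1r// (le_trans (HC _ j _ _)) ?ler_norm//; by case: h.
by rewrite indic_nregular ?mul0r// normr0.
Qed.

Lemma trunc_ortho F j : adm F -> Ex (fun t => trunc F (wxz 0%N t) * resid_fun j (wxz 0%N t)) = 0.
Proof.
move=> aF; have [mF _ /(_ j) F0] := aF; rewrite -[RHS]F0; apply: ae_eq_Ex.
- by apply: measurable_funM; [apply: measV; exact: borel_trunc|apply: measV; exact: borel_resid_fun].
- by apply: intg_meas; exact: (intg_admissible mw0 cS mP j aF).
move: (trunc_ae F) resid_fun_ae (indic_S_ae Pr mw0); apply: filterS3 => t h1 h2 h3.
by rewrite h1 h2 h3 mul1r.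
Qed.

Lemma Phi_resid j k : Ex (fun t => resid_fun j (wxz 0%N t) * resid_fun k (wxz 0%N t)) = Phi j k.
Proof.
rewrite /Phi mxE; transitivity (Ex (fun t => resid j t * resid k t)); last first.
  by apply: eq_Ex => t; rewrite mxE big_ord1 /eps !mxE.
apply: ae_eq_Ex.
- by apply: measurable_funM; apply: measV; exact: borel_resid_fun.
- by apply: measurable_funM; exact: (meas_resid_w mw0 cS mP).
by apply: filterS resid_fun_ae => t h; rewrite !h.
Qed.

Lemma Ex_mul_u (psi : 'cV[R]_(q + (d + r)) -> R) C : borel_fun psi -> (forall v, `|psi v| <= C) ->
  Ex (fun t => psi (wxz 0%N t) * u 0%N t) = 0.
Proof.
move=> mpsi psiC; have [_ iu _ _] := cu 0%N.
have E := cond_exp_pullout mw0 (cu 0%N) mpsi.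
rewrite E; first by rewrite -[RHS](Ex_cst Pr 0); apply: eq_Ex => t; rewrite mulr0.
  by apply: (@bounded_intgM _ _ _ _ _ _ C) => //; exact: measV.
by apply: eq_intg (intg_cst Pr 0) => t; rewrite mulr0.
Qed.

Lemma Ex_mul_u2 (psi : 'cV[R]_(q + (d + r)) -> R) C : borel_fun psi -> (forall v, `|psi v| <= C) ->
  Ex (fun t => psi (wxz 0%N t) * u 0%N t ^+ 2) = sigma ^+ 2 * Ex (fun t => psi (wxz 0%N t)).
Proof.
move=> mpsi psiC; have [_ iu _ _] := cu2 0%N.
have ipsi : intg (fun t => psi (wxz 0%N t)) by apply: (@bounded_intg _ _ _ _ _ C) => //; exact: measV.
have E := cond_exp_pullout mw0 (cu2 0%N) mpsi.
rewrite E; first by rewrite -ExZ//; apply: eq_Ex => t; rewrite mulrC.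
  by apply: (@bounded_intgM _ _ _ _ _ _ C) => //; exact: measV.
by apply: eq_intg (intgZ (sigma ^+ 2) ipsi) => t; rewrite mulrC.
Qed.

Variables (p : 'I_d -> nat -> 'cV[R]_r -> R) (k : nat -> 'I_d -> nat)
  (ginv : forall m : nat, 'M[R]_m -> 'M[R]_m)
  (B : forall n : nat, 'M[R]_(series_dim (k n))) (zeta0 : nat -> R) (delta : 'I_d -> R) (c : R).
Local Notation K n := (series_dim (k n)).
Let PK (n : nat) (xx : 'cV[R]_d) (zz : 'cV[R]_r) : 'cV[R]_(K n) :=
  B n *m series_basis p (k n) xx zz.
Hypothesis mp : forall l j, borel_fun (p l j).
Hypothesis ginvP : is_sym_ginv ginv.
Hypothesis uB : forall n, B n \in unitmx.
Hypothesis c0 : 0 < c.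
Hypothesis eigB : forall n (a : R),
     eigenvalue (expectation_mx Pr (fun t =>
       PK n (x 0%N t) (z 0%N t) *m (PK n (x 0%N t) (z 0%N t))^T)) a -> c <= a.
Hypothesis PK_zeta : forall n xx zz, S (col_mx xx zz) -> fnorm (PK n xx zz) <= zeta0 (K n).
Hypothesis zetaK : (fun n => (zeta0 (K n)) ^+ 2 * (K n)%:R / n%:R : R) @ \oo --> (0 : R).

Let PKv n (i : 'I_(K n)) (v : 'cV[R]_(d + r)) : R := PK n (usubmx v) (dsubmx v) i 0.
Arguments PKv : clear implicits.

Lemma PK_fnorm n v : S v -> fnorm (PK n (usubmx v) (dsubmx v)) <= zeta0 (K n).
Proof. by move=> Sv; apply: PK_zeta; rewrite vsubmxK. Qed.

Lemma PKv_bounded n i v : S v -> `|PKv n i v| <= zeta0 (K n).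
Proof. by move=> Sv; apply: le_trans (coord_le_fnorm _ i) (PK_fnorm n Sv). Qed.

Lemma adm_basis n (i : 'I_(K n)) : adm (fun v => series_basis p (k n) (usubmx v) (dsubmx v) i 0).
Proof.
have [l [j E]] := series_basisE p i.
suff : adm (fun v => usubmx v l 0 * p l j (dsubmx v)).
  by move=> h; apply: admissible_eq h _ => v _; rewrite E.
apply: (admissible_term mw0 cS ctheta theta_bounded mP (mp l j)).
(* A bound is given only for [PK]; the original base functions are recovered from it through the
   inverse of B. *)
exists (\sum_(a < K n) `|invmx (B n) i a| * zeta0 (K n)) => v Sv.
rewrite -E -[series_basis _ _ _ _](mulKmx (uB n)) mxE.
apply: le_trans (ler_norm_sum _ _ _) _; apply: ler_sum => a _.
by rewrite normrM ler_wpM2l// PKv_bounded.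
Qed.

Lemma adm_PKv n (i : 'I_(K n)) : adm (PKv n i).
Proof.
have h : adm (fun v => \sum_a B n i a * series_basis p (k n) (usubmx v) (dsubmx v) a 0).
  apply: (admissible_sum mw0 cS mP) => a.
  by apply: (admissibleZ mw0 cS mP); exact: adm_basis.
by apply: admissible_eq h _ => v _; rewrite /PKv /PK mxE.
Qed.

Lemma adm_comb n (a : 'cV[R]_(K n)) : adm (fun v => ((PK n (usubmx v) (dsubmx v))^T *m a) 0 0).
Proof.
have h : adm (fun v => \sum_i a i 0 * PKv n i v).
  apply: (admissible_sum mw0 cS mP) => i.
  by apply: (admissibleZ mw0 cS mP); exact: adm_PKv.
apply: admissible_eq h _ => v _; rewrite mxE; apply: eq_bigr => i _.
by rewrite mxE mulrC.
Qed.

Let Q n : 'M[R]_(K n) := expectation_mx Pr (fun t =>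
       PK n (x 0%N t) (z 0%N t) *m (PK n (x 0%N t) (z 0%N t))^T).

Lemma QE n i j : Q n i j = Ex (fun t => trunc (PKv n i) (wxz 0%N t) * trunc (PKv n j) (wxz 0%N t)).
Proof.
rewrite /Q mxE; apply/esym; transitivity (Ex (fun t => PKv n i (xz 0%N t) * PKv n j (xz 0%N t))); last first.
  by apply: eq_Ex => t; rewrite [RHS]mxE big_ord1 [X in _ = _ * X]mxE /PKv col_mxKu col_mxKd.
have mPK a : measurable_fun setT (fun t => PKv n a (xz 0%N t)).
  apply: (borel_comp mxz0); rewrite (_ : PKv n a = fun v => \sum_b B n a b * series_basis p (k n) (usubmx v) (dsubmx v) b 0).
    apply: borel_sum => b; apply: borelM; first exact: borel_cst.
    have [l [j' E]] := series_basisE p b; under eq_fun do rewrite E.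
    apply: borelM; last exact: (borel_dsubmx (mp l j')).
    exact: (borel_usubmx (f := fun v => v l 0) (borel_coord l)).
  by apply/funext => v; rewrite /PKv /PK mxE.
apply: ae_eq_Ex.
- by apply: measurable_funM; apply: measV; apply: borel_trunc; exact: adm_PKv.
- exact: measurable_funM.
by move: (trunc_ae (PKv n i)) (trunc_ae (PKv n j)); apply: filterS2 => t h1 h2; rewrite h1 h2.
Qed.

Lemma Q_rayleigh n (v : 'cV[R]_(K n)) : c * nrm2 v <= dotv v (Q n *m v).
Proof.
apply: rayleigh; last exact: eigB.
by apply/matrixP => i j; rewrite mxE !QE; apply: eq_Ex => t; rewrite mulrC.
Qed.

Lemma Q_posdef n : posdef (Q n).
Proof.
split; first by apply/matrixP => i j; rewrite mxE !QE; apply: eq_Ex => t; rewrite mulrC.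
move=> v v0; rewrite -mulmxA -dotvE; apply: lt_le_trans (Q_rayleigh v).
rewrite mulr_gt0// lt_def nrm2_ge0 andbT; apply: contra v0 => /eqP h.
by apply/eqP; exact: nrm2_eq0.
Qed.

Definition chol n : 'M[R]_(K n) := s2val (cid2 (cholesky (Q_posdef n))).

Lemma chol_unit n : chol n \in unitmx.
Proof. exact: s2valP (cid2 (cholesky (Q_posdef n))). Qed.

Lemma cholE n : Q n = chol n *m (chol n)^T.
Proof. exact: s2valP' (cid2 (cholesky (Q_posdef n))). Qed.

(** The basis normalised to be orthonormal in L2. It spans the same space, so the projection M is
    unaffected, but its Gram matrix concentrates around n times the identity. *)
Definition nbasis n (i : 'I_(K n)) (v : 'cV[R]_(d + r)) : R :=
  (invmx (chol n) *m PK n (usubmx v) (dsubmx v)) i 0.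

Lemma adm_nbasis n i : adm (@nbasis n i).
Proof.
have h : adm (fun v => \sum_a invmx (chol n) i a * PKv n a v).
  apply: (admissible_sum mw0 cS mP) => a.
  by apply: (admissibleZ mw0 cS mP); exact: adm_PKv.
by apply: admissible_eq h _ => v _; rewrite /nbasis mxE.
Qed.

Lemma nbasis_bound n v : \sum_i trunc (@nbasis n i) v ^+ 2 <= zeta0 (K n) ^+ 2 / c.
Proof.
have z0 : 0 <= zeta0 (K n) ^+ 2 / c by rewrite divr_ge0 ?sqr_ge0// ltW.
rewrite /trunc; have [h|h] := pselect (S0 v); last first.
  by rewrite big1// => i _; rewrite indic_nregular ?mul0r ?expr0n.
rewrite (eq_bigr (fun i => nbasis i (dsubmx v) ^+ 2)); last first.
  by move=> i _; rewrite indic_regular ?mul1r.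
rewrite -nrm2E; apply: le_trans (normalized_bound c0 (chol_unit n) (cholE n) (@Q_rayleigh n) _) _.
rewrite ler_wpM2r ?invr_ge0 ?(ltW c0)// -fnorm_cV.
have hS : S (dsubmx v) by case: h.
have := PK_fnorm n hS; have : 0 <= fnorm (PK n (usubmx (dsubmx v)) (dsubmx (dsubmx v))) by exact: sqrtr_ge0.
by move=> a0 ab; rewrite ler_pXn2r ?nnegrE// (le_trans a0).
Qed.

Lemma nbasis_ortho n i j :
  Ex (fun t => trunc (@nbasis n i) (wxz 0%N t) * trunc (@nbasis n j) (wxz 0%N t)) = (i == j)%:R.
Proof.
have := congr1 (fun M : 'M[R]_(K n) => M i j) (normalized_gram (chol_unit n) (cholE n)).
rewrite [RHS]mxE => <-.
have tE a v : trunc (@nbasis n a) v = \sum_b invmx (chol n) a b * trunc (PKv n b) v.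
  rewrite /trunc /nbasis mxE mulr_sumr; apply: eq_bigr => b _; rewrite /PKv; ring.
have i2 a b : intg (fun t => trunc (PKv n a) (wxz 0%N t) * trunc (PKv n b) (wxz 0%N t)).
  by apply: sqintgM; apply: sqintg_trunc; exact: adm_PKv.
transitivity (Ex (fun t => \sum_b \sum_a (invmx (chol n) i a * invmx (chol n) j b) *
   (trunc (PKv n a) (wxz 0%N t) * trunc (PKv n b) (wxz 0%N t)))).
  apply: eq_Ex => t; rewrite !tE mulrC mulr_suml; apply: eq_bigr => b _.
  by rewrite mulr_sumr; apply: eq_bigr => a _; ring.
rewrite Ex_sum; last by move=> b _; apply: intg_sum => a _; exact: intgZ.
rewrite mxE; apply: eq_bigr => b _.
rewrite Ex_sum; last by move=> a _; exact: intgZ.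
rewrite mxE mulr_suml; apply: eq_bigr => a _.
by rewrite ExZ// -QE [(_^T) b j]mxE; ring.
Qed.

Let R0 n : R := \sum_(l < d) (k n l)%:R `^ (- (2 * delta l)).
Hypothesis rate0 : (fun n => Num.sqrt n%:R * R0 n) @ \oo --> (0 : R).

Lemma R0_ge0 n : 0 <= R0 n.
Proof. by apply: sumr_ge0 => l _; exact: powR_ge0. Qed.

Lemma R0_cvg : R0 @ \oo --> (0 : R).
Proof.
apply/cvgrPdist_le => a a0; have /cvgrPdist_le/(_ _ a0) := rate0.
move: (nbhs_infty_gt 0); apply: filterS2 => n n0.
have s1 : 1 <= Num.sqrt n%:R :> R by rewrite -[leLHS]sqrtr1 ler_sqrt ?ler1n// ler0n.
rewrite !sub0r !normrN normrM; apply: le_trans.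
by rewrite (ger0_norm (sqrtr_ge0 _)) ler_peMl.
Qed.

(** The functions that the series must approximate: m_j for the j-th column of W, x'beta for Y. *)
Definition target (o : option 'I_q) (v : 'cV[R]_(d + r)) : R :=
  if o is Some j then m (usubmx v) (dsubmx v) j 0 else f0 v.

Variables (alpha : option 'I_q -> forall n, 'cV[R]_(K n)) (Ca : option 'I_q -> R).
Hypothesis alphaP : forall o, \forall n \near \oo, forall xx zz, S (col_mx xx zz) ->
  `|target o (col_mx xx zz) - ((PK n xx zz)^T *m alpha o n) 0 0|
     <= Ca o * \sum_(l < d) (k n l)%:R `^ (- delta l).

(** The factor d comes from Cauchy-Schwarz over the coefficients; the sum over o gives a single
    constant for all targets. *)
Let CT : R := d%:R * \sum_o Ca o ^+ 2.
Let rho n : R := CT * R0 n.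

Lemma rho_cvg : rho @ \oo --> (0 : R).
Proof. by rewrite -(mulr0 CT); apply: cvgMl_tmp; exact: R0_cvg. Qed.

Lemma rho_rate : (fun n => Num.sqrt n%:R * rho n) @ \oo --> (0 : R).
Proof.
rewrite (_ : (fun n => _) = (fun n => CT * (Num.sqrt n%:R * R0 n))).
  by rewrite -(mulr0 CT); apply: cvgMl_tmp; exact: rate0.
by apply/funext => n; rewrite /rho mulrCA.
Qed.

Lemma CT_ge0 : 0 <= CT.
Proof. by rewrite mulr_ge0// sumr_ge0// => o _; exact: sqr_ge0. Qed.

Definition approx_error o n (v : 'cV[R]_(d + r)) : R :=
  target o v - ((PK n (usubmx v) (dsubmx v))^T *m alpha o n) 0 0.

Lemma approx_error_sqr o : \forall n \near \oo, forall v, S v -> approx_error o n v ^+ 2 <= rho n.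
Proof.
move: (alphaP o); apply: filterS => n H v Sv.
have := H (usubmx v) (dsubmx v); rewrite vsubmxK => /(_ Sv); rewrite -/(approx_error o n v).
set s := \sum_(l < d) _ => h; set a := approx_error o n v in h *.
have h0 : 0 <= Ca o * s by exact: le_trans h.
have h2 : a ^+ 2 <= (Ca o * s) ^+ 2.
  by rewrite -[a ^+ 2]real_normK ?num_real// ler_pXn2r// nnegrE.
apply: le_trans h2 _; rewrite exprMn /rho /CT.
apply: le_trans (_ : Ca o ^+ 2 * (d%:R * R0 n) <= _).
  by rewrite ler_wpM2l ?sqr_ge0//; exact: sum_powR_sqr_le.
rewrite (_ : d%:R * (\sum_o Ca o ^+ 2) * R0 n = (\sum_o Ca o ^+ 2) * (d%:R * R0 n)); last by ring.
apply: ler_wpM2r; first by rewrite mulr_ge0 ?R0_ge0.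
by rewrite (bigD1 o)//= lerDl sumr_ge0// => i _; exact: sqr_ge0.
Qed.

(** m_j lies in the class G; x'beta is reached as the uniform limit on S of its series
    approximations. *)
Lemma adm_target o : adm (target o).
Proof.
case: o => [j|]; first exact: adm_m.
apply: (admissible_lim mw0 cS mP (Fn := fun n v => ((PK n (usubmx v) (dsubmx v))^T *m alpha None n) 0 0)).
- by move=> n; exact: adm_comb.
- exact: approx_error_sqr.
- exact: rho_cvg.
Qed.

Lemma adm_approx_error o n : adm (approx_error o n).
Proof.
have h := admissibleD mw0 cS mP (adm_target o) (admissibleZ mw0 cS mP (-1) (adm_comb (alpha o n))).
by apply: admissible_eq h _ => v _; rewrite mulN1r.
Qed.

(** Y - w'gamma - x'beta, cut off to be Borel: it expresses u almost surely as a function of the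
    observation, through which the i.i.d. assumption reaches u. *)
Definition error_fun (v : 'cV[R]_(1 + (q + (d + r)))) : R :=
  \1_S0 (dsubmx v) * (v (lshift _ ord0) 0 - dotv gamma (usubmx (dsubmx v))) - trunc f0 (dsubmx v).

Definition noise (o : option 'I_q) (v : 'cV[R]_(1 + (q + (d + r)))) : R :=
  if o is Some j then resid_fun j (dsubmx v) else error_fun v.

Lemma dsubmxV i t : dsubmx (V i t) = wxz i t.
Proof. by rewrite /V col_mxKd. Qed.

Lemma error_fun_ae : {ae Pr, forall t, forall i, error_fun (V i t) = u i t}.
Proof.
apply: filterS ae_regular => t H i.
rewrite /error_fun /trunc dsubmxV indic_regular// !mul1r.
rewrite /V col_mxEu mxE eqxx mulr1n YE /wxz col_mxKu dotvC dotvE /f0 /xz !col_mxKd !col_mxKu.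
ring.
Qed.

Lemma borel_noise o : borel_fun (noise o).
Proof.
case: o => [j|]; first by apply: borel_dsubmx; exact: borel_resid_fun.
apply: borelB; last by apply: borel_dsubmx; apply: borel_trunc; exact: (adm_target None).
apply: borelM; first by apply: borel_dsubmx; apply: borel_indic; exact: borel_regular.
apply: borelB; first exact: borel_coord.
by apply: (borel_dsubmx (f := fun v => dotv gamma (usubmx v))); apply: borel_usubmx; exact: borel_dotv.
Qed.

Let measY i (f : 'cV[R]_(1 + (q + (d + r))) -> R) : borel_fun f ->
  measurable_fun setT (fun t => f (V i t)).
Proof. by move=> mf; exact: (borel_comp (mV i) mf). Qed.

Lemma sqintg_error : sqintg Pr (fun t => error_fun (V 0%N t)).
Proof.
have [_ iu2 _ _] := cu2 0%N.
have me := measY 0%N (borel_noise None); split => //.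
apply: (ae_eq_intg _ _ iu2); first by under eq_fun do rewrite expr2; exact: measurable_funM.
by apply: filterS error_fun_ae => t h; rewrite h.
Qed.

Lemma sqintg_noise o : sqintg Pr (fun t => noise o (V 0%N t)).
Proof.
case: o => [j|]; last exact: sqintg_error.
have [C [_ HC]] := resid_fun_bounded.
by apply: (@bounded_sqintg _ _ _ _ _ C); [exact: (measY 0%N (borel_noise (Some j)))|move=> t; exact: HC].
Qed.

Lemma sqintg_mul_noise o (G : 'cV[R]_(q + (d + r)) -> R) C : borel_fun G -> (forall v, `|G v| <= C) ->
  sqintg Pr (fun t => G (wxz 0%N t) * noise o (V 0%N t)).
Proof.
move=> mG GC; apply: (@bounded_sqintgM _ _ _ _ _ _ C) => //; first exact: measV.
exact: sqintg_noise.
Qed.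

Lemma mul_error_ae (G : 'cV[R]_(q + (d + r)) -> R) : borel_fun G ->
  Ex (fun t => G (wxz 0%N t) * error_fun (V 0%N t)) = Ex (fun t => G (wxz 0%N t) * u 0%N t).
Proof.
move=> mG; have [_ iu _ _] := cu 0%N.
apply: ae_eq_Ex.
- apply: measurable_funM; [exact: measV|exact: (measY 0%N (borel_noise None))].
- apply: measurable_funM; [exact: measV|exact: intg_meas iu].
by apply: filterS error_fun_ae => t ->.
Qed.

Lemma mul_error2_ae (G : 'cV[R]_(q + (d + r)) -> R) C : borel_fun G -> (forall v, `|G v| <= C) ->
  Ex (fun t => G (wxz 0%N t) * error_fun (V 0%N t) ^+ 2) = sigma ^+ 2 * Ex (fun t => G (wxz 0%N t)).
Proof.
move=> mG GC; have [_ iu _ _] := cu2 0%N; rewrite -(Ex_mul_u2 mG GC).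
have me := measY 0%N (borel_noise None).
apply: ae_eq_Ex.
- apply: measurable_funM; first exact: measV.
  by under eq_fun do rewrite expr2; exact: measurable_funM.
- apply: measurable_funM; [exact: measV|exact: intg_meas iu].
by apply: filterS error_fun_ae => t ->.
Qed.

Lemma Ex_trunc_noise o F : adm F -> Ex (fun t => trunc F (wxz 0%N t) * noise o (V 0%N t)) = 0.
Proof.
move=> aF; case: o => [j|].
  by rewrite -[RHS](trunc_ortho j aF); apply: eq_Ex => t; rewrite /noise dsubmxV.
have mF := borel_trunc aF; have [C HC] := trunc_adm_bounded aF.
by rewrite (mul_error_ae mF) (Ex_mul_u mF HC).
Qed.

(** One constant for both kinds of noise: w - m is bounded by Cr, and u, possibly unbounded, has
    conditional second moment sigma^2. *)
Lemma Ex_mul_noise_sqr : exists2 Ce, 0 <= Ce & forall o (G : 'cV[R]_(q + (d + r)) -> R) C,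
  borel_fun G -> (forall v, `|G v| <= C) ->
  Ex (fun t => (G (wxz 0%N t) * noise o (V 0%N t)) ^+ 2) <= Ce * Ex (fun t => G (wxz 0%N t) ^+ 2).
Proof.
have [Cr [Cr0 HCr]] := resid_fun_bounded; exists (Cr ^+ 2 + sigma ^+ 2) => [|o G C mG GC].
  by rewrite addr_ge0 ?sqr_ge0.
have sG : sqintg Pr (fun t => G (wxz 0%N t)) by apply: (@bounded_sqintg _ _ _ _ _ C) => //; exact: measV.
have G0 : 0 <= Ex (fun t => G (wxz 0%N t) ^+ 2) by apply: Ex_ge0 => t; exact: sqr_ge0.
rewrite mulrDl; case: o => [j|].
  apply: le_trans (_ : Cr ^+ 2 * Ex (fun t => G (wxz 0%N t) ^+ 2) <= _); last first.
    by rewrite lerDl mulr_ge0 ?sqr_ge0.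
  rewrite -ExZ; last exact: sG.2.
  apply: le_Ex.
  - exact: (sqintg_mul_noise (Some j) mG GC).2.
  - by apply: intgZ; exact: sG.2.
  move=> t; rewrite exprMn mulrC ler_wpM2r ?sqr_ge0// -[noise _ _ ^+ 2]real_normK ?num_real//.
  by rewrite ler_pXn2r ?nnegrE // HCr.
apply: le_trans (_ : sigma ^+ 2 * Ex (fun t => G (wxz 0%N t) ^+ 2) <= _); last first.
  by rewrite lerDr mulr_ge0 ?sqr_ge0.
have GC2 v : `|G v ^+ 2| <= C ^+ 2.
  by rewrite normrX ler_pXn2r// nnegrE// (le_trans _ (GC v)).
rewrite -(mul_error2_ae (borel_sqr mG) GC2) le_eqVlt; apply/orP; left; apply/eqP.
by apply: eq_Ex => t; rewrite exprMn.
Qed.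

Local Notation samp := (samp V).
Let P n t : 'M[R]_(n, K n) := \matrix_(i < n, j < K n) series_basis p (k n) (x i t) (z i t) j 0.
Let aa o n t : 'cV[R]_n := samp n (fun v => trunc (approx_error o n) (dsubmx v)) t + samp n (noise o) t.
Let rv o n t : 'cV[R]_n := aa o n t - series_proj ginv (P n t) *m aa o n t.

(** An almost sure identity only, since the normalised basis on the right is cut off outside the
    regular set. *)
Lemma basis_mx_ae n : {ae Pr, forall t, P n t *m (invmx (chol n) *m B n)^T =
  basis_mx V (fun n i v => trunc (@nbasis n i) (dsubmx v)) n t}.
Proof.
have h : {ae Pr, forall t, forall a : 'I_(K n), forall i, trunc (@nbasis n a) (wxz i t) = nbasis a (xz i t)}.
  by apply: (@ae_countable _ _ _ _ 'I_(K n)) => a; exact: trunc_ae.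
apply: filterS h => t h; apply/matrixP => i a.
rewrite [RHS]mxE dsubmxV h /nbasis /PK mulmxA /xz col_mxKu col_mxKd !mxE.
by apply: eq_bigr => j _; rewrite !mxE mulrC.
Qed.

Lemma resid_op o o' : op Pr (fun n t =>
  (dotv (rv o n t) (rv o' n t) - dotv (samp n (noise o) t) (samp n (noise o') t)) / Num.sqrt n%:R).
Proof.
have [Ce Ce0 HCe] := Ex_mul_noise_sqr.
apply: (@resid_dot _ T R Pr _ V mV indV idV (fun n => K n)
  (fun n i v => trunc (@nbasis n i) (dsubmx v)) (fun n => zeta0 (K n) ^+ 2 / c) _ _ _ _ ginv ginvP
  P (fun n => (invmx (chol n) *m B n)^T) _ _ _ noise (fun o n v => trunc (approx_error o n) (dsubmx v)) Ce rho).
- by move=> n i; apply: borel_dsubmx; apply: borel_trunc; exact: adm_nbasis.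
- by move=> n v; exact: nbasis_bound.
- by move=> n i j; rewrite -[RHS](nbasis_ortho i j); apply: eq_Ex => t; rewrite dsubmxV.
- rewrite (_ : (fun n => _) = (fun n => c^-1 * (zeta0 (K n) ^+ 2 * (K n)%:R / n%:R))).
    by rewrite -(mulr0 c^-1); apply: cvgMl_tmp; exact: zetaK.
  by apply/funext => n; ring.
- by move=> n; rewrite unitmx_tr unitmx_mul unitmx_inv chol_unit uB.
- exact: basis_mx_ae.
- exact: borel_noise.
- by move=> o1 n; apply: borel_dsubmx; apply: borel_trunc; exact: adm_approx_error.
- move=> o1 n i; under eq_fun do rewrite dsubmxV.
  have aF := adm_nbasis i; have [C HC] := trunc_adm_bounded aF.
  exact: (sqintg_mul_noise o1 (borel_trunc aF) HC).
- move=> o1 n i; rewrite -[RHS](Ex_trunc_noise o1 (adm_nbasis i)).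
  by apply: eq_Ex => t; rewrite dsubmxV.
- move=> o1 n i; have aF := adm_nbasis i; have [C HC] := trunc_adm_bounded aF.
  have := HCe o1 _ C (borel_trunc aF) HC.
  rewrite (_ : Ex (fun t => trunc _ _ ^+ 2) = 1); last first.
    transitivity (Ex (fun t => trunc (@nbasis n i) (wxz 0%N t) * trunc (@nbasis n i) (wxz 0%N t))).
      by apply: eq_Ex => t; rewrite expr2.
    by rewrite nbasis_ortho eqxx.
  rewrite mulr1; apply: le_trans; rewrite le_eqVlt; apply/orP; left; apply/eqP.
  by apply: eq_Ex => t; rewrite dsubmxV.
- move=> o1; move: (approx_error_sqr o1); apply: filterS => n H v.
  by apply: trunc_sqr_le => //; rewrite mulr_ge0 ?CT_ge0 ?R0_ge0.
- exact: rho_rate.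
- move=> o1 o2 n; under eq_fun do rewrite dsubmxV.
  have aF := adm_approx_error o1 n; have [C HC] := trunc_adm_bounded aF.
  exact: (sqintg_mul_noise o2 (borel_trunc aF) HC).
- move=> o1 o2 n; rewrite -[RHS](Ex_trunc_noise o2 (adm_approx_error o1 n)).
  by apply: eq_Ex => t; rewrite dsubmxV.
- move=> o1 o2; move: (approx_error_sqr o1); apply: filterS => n H.
  have aF := adm_approx_error o1 n; have [C HC] := trunc_adm_bounded aF.
  rewrite (eq_Ex Pr (Y := fun t => (trunc (approx_error o1 n) (wxz 0%N t) * noise o2 (V 0%N t)) ^+ 2)); last first.
    by move=> t; rewrite dsubmxV.
  apply: le_trans (HCe o2 _ C (borel_trunc aF) HC) _; rewrite ler_wpM2l//.
  rewrite -[leRHS](Ex_cst Pr); apply: le_Ex.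
  + exact: (sqintg_trunc aF).2.
  + exact: intg_cst.
  by move=> t; apply: trunc_sqr_le => //; rewrite mulr_ge0 ?CT_ge0 ?R0_ge0.
- exact: rho_cvg.
Qed.

Let ghat : nat -> T -> 'cV[R]_q := gamma_hat ginv Y w x z p k.
Hypothesis mghat : forall n, random_vector (ghat n).
Hypothesis pPhi : posdef Phi.
Hypothesis sigma0 : 0 < sigma ^+ 2.

Let A n t : 'M[R]_(n, q) := \matrix_(i, j) aa (Some j) n t i 0.
Let resid_A n t : 'M[R]_(n, q) := A n t - series_proj ginv (P n t) *m A n t.

Lemma resid_A_entry n t i j : resid_A n t i j = rv (Some j) n t i 0.
Proof.
rewrite /resid_A /rv [LHS]mxE [RHS]mxE; congr (_ + _); first by rewrite mxE.
rewrite [LHS]mxE [RHS]mxE; congr (- _); rewrite [LHS]mxE [RHS]mxE.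
by apply: eq_bigr => l _; congr (_ * _); rewrite mxE.
Qed.

Lemma comb_basis n (a : 'cV[R]_(K n)) i t :
  ((PK n (x i t) (z i t))^T *m a) 0 0 =
  \sum_l series_basis p (k n) (x i t) (z i t) l 0 * ((B n)^T *m a) l 0.
Proof.
rewrite /PK trmx_mul -mulmxA mxE; apply: eq_bigr => l _.
by rewrite [(series_basis _ _ _ _)^T _ _]mxE.
Qed.

(** Each target is its series combination plus the approximation error, so W = P C + A and Y = W
    gamma + P c + a, where A and a consist of approximation error plus noise; the algebra of
    partialled-out least squares then applies. *)
Lemma estimator_error n : {ae Pr, forall t, (resid_A n t)^T *m resid_A n t \in unitmx ->
  (resid_A n t)^T *m resid_A n t *m (ghat n t - gamma) = (resid_A n t)^T *m rv None n t}.
Proof.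
have h : {ae Pr, forall t, forall o : option 'I_q, forall i,
    trunc (approx_error o n) (wxz i t) = approx_error o n (xz i t)}.
  by apply: (@ae_countable _ _ _ _ (option 'I_q)) => o; exact: trunc_ae.
move: h resid_fun_ae error_fun_ae; apply: filterS3 => t h1 h2 h3.
have aaE o i : aa o n t i 0 = approx_error o n (xz i t) + noise o (V i t).
  by rewrite mxE mxE [samp n (noise o) t i 0]mxE dsubmxV h1.
have tE o (i : 'I_n) : target o (xz i t) = \sum_l P n t i l * ((B n)^T *m alpha o n) l 0 + approx_error o n (xz i t).
  have -> : \sum_l P n t i l * ((B n)^T *m alpha o n) l 0 =
      ((PK n (x i t) (z i t))^T *m alpha o n) 0 0.
    by rewrite comb_basis; apply: eq_bigr => l _; rewrite [P n t i l]mxE.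
  have xE : usubmx (xz i t) = x i t by exact: col_mxKu.
  have zE : dsubmx (xz i t) = z i t by exact: col_mxKd.
  rewrite /approx_error xE zE; set a := target _ _; set b := (_ *m _) 0 0.
  by rewrite addrC subrK.
apply: (partialled_ols_error (C := \matrix_(a, j) ((B n)^T *m alpha (Some j) n) a 0)
  (c := (B n)^T *m alpha None n) ginvP).
  apply/matrixP => i j; rewrite [LHS]mxE [RHS]mxE [A n t i j]mxE aaE addrA.
  rewrite [(_ *m _) i j]mxE (eq_bigr (fun l => P n t i l * ((B n)^T *m alpha (Some j) n) l 0)); last first.
    by move=> l _; rewrite [X in _ * X]mxE.
  by rewrite -tE /target /noise dsubmxV h2 /xz col_mxKu col_mxKd; ring.
apply/matrixP => i j; rewrite ord1 [LHS]mxE [RHS]mxE aaE [X in X + _]mxE addrA.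
rewrite -[X in X + noise _ _]addrA [(P n t *m _) i 0]mxE -tE /noise /= h3 YE.
congr (_ + _ + _).
  by rewrite [LHS]mxE [RHS]mxE; apply: eq_bigr => l _; rewrite !mxE.
by apply: eq_bigr => l _; rewrite /xz col_mxKu col_mxKd.
Qed.

Theorem series_estimator_normal :
  asymptotically_normal Pr (fun n t => Num.sqrt n%:R *: (ghat n t - gamma)) (sigma ^+ 2 *: invmx Phi).
Proof.
have [Cr [Cr0 HCr]] := resid_fun_bounded.
have [Ce Ce0 HCe] := Ex_mul_noise_sqr.
have be j := borel_resid_fun j.
apply: (@asymptotically_normal_influence _ T R Pr _ V mV indV idV q
  (fun j => noise (Some j)) (noise None) Cr Phi (sigma ^+ 2) _ _ _ _ _ _ _ _ _
  (fun j => rv (Some j)) (rv None)).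
- by move=> j; exact: borel_noise.
- exact: borel_noise.
- by move=> j v; exact: HCr.
- by move=> i j; rewrite -[RHS]Phi_resid; apply: eq_Ex => t; rewrite /noise dsubmxV.
- exact: sqintg_noise.
- move=> j; rewrite -[RHS](Ex_mul_u (be j) (HCr j)) -(mul_error_ae (be j)).
  by apply: eq_Ex => t; rewrite /noise dsubmxV.
- move=> i j.
  have HC v : `|resid_fun i v * resid_fun j v| <= Cr * Cr by rewrite normrM ler_pM.
  rewrite -Phi_resid -(mul_error2_ae (borelM (be i) (be j)) HC).
  by apply: eq_Ex => t; rewrite /noise dsubmxV; ring.
- exact: pPhi.
- exact: sigma0.
- by move=> i j; exact: resid_op.
- by move=> j; exact: resid_op.
- move=> n; apply: measurable_cV => i.
  have h := random_vector_coord i (mghat n).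
  apply: eq_measurable_fun (_ : measurable_fun setT (fun t => Num.sqrt n%:R * (ghat n t i 0 - gamma i 0))).
    by move=> t _; rewrite !mxE.
  apply: measurable_funM; first exact: measurable_cst.
  by apply: measurable_funB => //; exact: measurable_cst.
apply: whp_ae; near=> n; have n0 : (0 < n)%N by near: n; exact: nbhs_infty_gt.
have nn : (n%:R : R) != 0 by rewrite pnatr_eq0 -lt0n.
move: (estimator_error n); apply: filterS => t H.
set G := (resid_A n t)^T *m resid_A n t in H.
(* Dividing the normal equations by n and scaling the error by sqrt n leaves 1 / sqrt n on the right
   side. *)
rewrite (_ : \matrix_(j, l) _ = n%:R^-1 *: G); last first.
  apply/matrixP => j l; rewrite !mxE [RHS]mulrC; congr (_ / _); rewrite /dotv.
  by apply: eq_bigr => i _; rewrite [(resid_A n t)^T _ _]mxE !resid_A_entry.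
rewrite unitmxZ; last by rewrite unitfE invr_eq0.
move=> /H E; rewrite -scalemxAl -scalemxAr E scalerA.
apply/matrixP => j l; rewrite ord1 [LHS]mxE [RHS]mxE mulrC; congr (_ * _).
  rewrite mxE /dotv; apply: eq_bigr => i _.
  by rewrite [(resid_A n t)^T _ _]mxE resid_A_entry.
have s0 : Num.sqrt n%:R != 0 :> R by rewrite sqrtr_eq0 -ltNge ltr0n.
apply: (mulIf s0); rewrite mulVf// -mulrA -expr2 sqr_sqrtr// mulVf//.
Unshelve. all: by end_near. Qed.

End model.

(** * The efficiency bound *)

(** The conditional mean entering the definition of v is one version of E[X | V], hence almost
    surely 0, so v is a version of E[X^2 | V]; versions agree almost surely. *)
Lemma cond_var_ae disp (T : measurableType disp) (R : realType) (Pr : probability T R) n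
    (X : T -> R) (V : T -> 'cV[R]_n) (v : 'cV[R]_n -> R) (s2 : R) : random_vector V ->
  is_cond_exp Pr X V (fun=> 0) -> is_cond_exp Pr (fun t => X t ^+ 2) V (fun=> s2) ->
  is_cond_var Pr X V v -> {ae Pr, forall t, v (V t) = s2}.
Proof.
move=> mV cX cX2 [g cg [mv iv ivV Hv]].
have g0 := cond_exp_unique mV cg cX.
have [_ iX2 _ _] := cX2.
suff cv : is_cond_exp Pr (fun t => X t ^+ 2) V v by exact: cond_exp_unique cv cX2.
split => // A mA; rewrite -(Hv A mA).
have mVA := random_vector_preimage mV mA.
apply: ae_eq_integral => //.
- apply: measurable_funS (_ : measurable_fun setT _) => //.
  by apply/measurable_EFinP; exact: intg_meas iX2.
- apply: measurable_funS (_ : measurable_fun setT _) => //.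
  by apply/measurable_EFinP; exact: intg_meas iv.
by apply: filterS g0 => t h _; rewrite h subr0.
Qed.

(* x^-1 is the limit of the continuous functions x / (x^2 + 1/n), including the junk value 0^-1 = 0 *)
Lemma measurable_invX d (T : measurableType d) (R : realType) (X : T -> R) :
  measurable_fun setT X -> measurable_fun setT (fun t => (X t)^-1).
Proof.
move=> mX; pose f n (y : R) := y / (y ^+ 2 + n.+1%:R^-1).
have n0 n : 0 < n.+1%:R^-1 :> R by rewrite invr_gt0.
have den n y : y ^+ 2 + n.+1%:R^-1 != 0 :> R by rewrite gt_eqF// ltr_wpDl// sqr_ge0.
apply: (@measurable_fun_cvg _ _ _ _ (fun n t => f n (X t))) => [n|t _].
  apply: (@measurableT_comp _ _ _ _ _ _ (f n)) => //.
  apply: continuous_measurable_fun => y; apply: cvgM; first exact: cvg_id.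
  apply: cvgV; first exact: den.
  by apply: cvgD; [exact: exprn_continuous|exact: cvg_cst].
have [X0|X0] := eqVneq (X t) 0.
  rewrite X0 invr0 (_ : (fun n => _) = cst 0); first exact: cvg_cst.
  by apply/funext => n; rewrite /f mul0r.
rewrite (_ : (X t)^-1 = X t / (X t ^+ 2 + 0)); last by rewrite addr0 expr2 invfM mulVKf.
apply: cvgMl_tmp; apply: cvgV; first by rewrite addr0 expf_neq0.
by apply: cvgD; [exact: cvg_cst|exact: (@cvg_harmonic R)].
Qed.

Section efficiency_bound.
Context disp (T : measurableType disp) (R : realType) (Pr : probability T R).
Local Notation intg := (intg Pr).
Local Notation Ex := (Ex Pr).
Variables (q d r : nat) (w : T -> 'cV[R]_q) (x : T -> 'cV[R]_d) (z : T -> 'cV[R]_r).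
Let xz t : 'cV[R]_(d + r) := col_mx (x t) (z t).
Let wxz t : 'cV[R]_(q + (d + r)) := col_mx (w t) (xz t).
Hypothesis mwxz : random_vector wxz.
Hypothesis cS : compact (support Pr wxz).
Variables (theta m : 'cV[R]_d -> 'cV[R]_r -> 'cV[R]_q).
Hypothesis ctheta : forall j, is_cond_exp Pr (fun t => w t j 0) xz
  (fun v => theta (usubmx v) (dsubmx v) j 0).
Hypothesis theta_bounded : exists C : R, forall ww xx zz,
  support Pr wxz (col_mx ww (col_mx xx zz)) -> fnorm (theta xx zz) <= C.
Hypothesis mP : is_G_projection Pr x z theta m.
Variables (v : 'cV[R]_(q + (d + r)) -> R) (s2 : R).
Hypothesis mv : borel_fun v.
Hypothesis s2_0 : 0 < s2.
Hypothesis v_ae : {ae Pr, forall t, v (wxz t) = s2}.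

Let eps (t : T) : 'cV[R]_q := w t - m (x t) (z t).
Let Phi : 'M[R]_q := expectation_mx Pr (fun t => eps t *m (eps t)^T).
Local Notation resid := (resid_w w x z m).
Let mxz : random_vector xz := xz_random mwxz.
Let bxz := @xz_bounded _ _ _ _ q d r w x z mwxz cS.

Let sqG g : in_G Pr x z g -> sqintg Pr (fun t => g (x t) (z t)).
Proof. by move=> Gg; exact: (sqintg_in_G mxz bxz Gg). Qed.

Lemma resid_ortho_G g j : in_G Pr x z g -> Ex (fun t => g (x t) (z t) * resid j t) = 0.
Proof.
move=> Gg; have aG := admissible_in_G mwxz cS ctheta theta_bounded mP Gg.
have [_ _ /(_ j) <-] := aG.
apply: ae_eq_Ex.
- exact: (intg_meas (sqintgM (sqG Gg) (sqintg_resid_w mwxz cS mP j))).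
- exact: (intg_meas (intg_admissible mwxz cS mP j aG)).
apply: filterS (indic_S_ae Pr mwxz) => t ->.
by rewrite mul1r col_mxKu col_mxKd.
Qed.

Section one.
Variable g : 'cV[R]_d -> 'cV[R]_r -> 'cV[R]_q.
Hypothesis Gg : in_Gq Pr x z g.

Let D j t := m (x t) (z t) j 0 - g (x t) (z t) j 0.

Let sqD j : sqintg Pr (D j).
Proof.
have := sqintgD (sqG (mP.1 j)) (sqintgZ (-1) (sqG (Gg j))).
by case=> h1 h2; split; [apply: eq_measurable_fun h1 => t _|apply: eq_intg h2 => t]; rewrite /D mulN1r.
Qed.

Let sqr j : sqintg Pr (resid j) := sqintg_resid_w mwxz cS mP j.

Let orthoD i j : Ex (fun t => D i t * resid j t) = 0.
Proof.
transitivity (Ex (fun t => m (x t) (z t) i 0 * resid j t - g (x t) (z t) i 0 * resid j t)).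
  by apply: eq_Ex => t; rewrite /D mulrBl.
rewrite ExB; [|by apply: sqintgM => //; exact: sqG (mP.1 i)|by apply: sqintgM => //; exact: sqG (Gg i)].
by rewrite (resid_ortho_G j (mP.1 i)) (resid_ortho_G j (Gg i)) subrr.
Qed.

(** The weight is almost surely 1 / s2, and w - g = (w - m) + (m - g), where m - g belongs to the
    class, so that both cross moments vanish. *)
Lemma bound_entry i j : expectation_mx Pr (fun t => (v (wxz t))^-1 *:
      ((w t - g (x t) (z t)) *m (w t - g (x t) (z t))^T)) i j =
  s2^-1 * (Phi i j + Ex (fun t => D i t * D j t)).
Proof.
rewrite !mxE.
have E t : s2^-1 * (resid i t * resid j t + (D i t * resid j t + (D j t * resid i t + D i t * D j t))) =
    s2^-1 * ((w t - g (x t) (z t)) *m (w t - g (x t) (z t))^T) i j.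
  by rewrite mxE big_ord1 !mxE /resid_w /D; congr (_ * _); ring.
have i1 : intg (fun t => D j t * resid i t + D i t * D j t) by apply: intgD; exact: sqintgM.
have i2 : intg (fun t => D i t * resid j t + (D j t * resid i t + D i t * D j t)).
  by apply: intgD => //; exact: sqintgM.
have i3 : intg (fun t => resid i t * resid j t + (D i t * resid j t + (D j t * resid i t + D i t * D j t))).
  by apply: intgD => //; exact: sqintgM.
transitivity (Ex (fun t => s2^-1 * (resid i t * resid j t + (D i t * resid j t + (D j t * resid i t + D i t * D j t))))).
  have iE := eq_intg E (intgZ s2^-1 i3).
  rewrite (eq_Ex Pr E).
  apply: ae_eq_Ex.
  - under eq_fun do rewrite mxE.
    apply: measurable_funM; last first.
      have := intg_meas iE; move=> h.
      (* Measurability of the unweighted entry is recovered from the one weighted by 1 / s2 by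
         multiplying back. *)
      have h' := measurable_funM (@measurable_cst _ _ T R setT s2) h.
      apply: eq_measurable_fun h' => t _.
      by rewrite /= mulrA mulfV ?mul1r// gt_eqF.
    exact: measurable_invX (borel_comp mwxz mv).
  - exact: intg_meas iE.
  by apply: filterS v_ae => t h; rewrite mxE h.
rewrite ExZ// ExD//; last exact: sqintgM.
rewrite ExD//; last exact: sqintgM.
rewrite ExD; [|exact: sqintgM|exact: sqintgM].
rewrite !orthoD !add0r; congr (_ * (_ + _)).
by rewrite /Ex; congr fine; congr expectation; apply/funext => t; rewrite mxE big_ord1 !mxE.
Qed.

(** The difference is - 1 / s2 times the second moment matrix of m - g, whose quadratic form at a is
    E (a'(m - g))^2. *)
Lemma bound_le : loewner_le (s2^-1 *: Phi) (expectation_mx Pr (fun t => (v (wxz t))^-1 *: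
      ((w t - g (x t) (z t)) *m (w t - g (x t) (z t))^T))).
Proof.
set B := expectation_mx _ _.
have E i j : (s2^-1 *: Phi - B) i j = - (s2^-1 * Ex (fun t => D i t * D j t)).
  transitivity (s2^-1 * Phi i j - B i j); first by rewrite !mxE.
  by rewrite /B bound_entry; ring.
split.
  apply/matrixP => i j; rewrite mxE !E; congr (- (_ * _)).
  by apply: eq_Ex => t; rewrite mulrC.
move=> a; rewrite -mulmxA -dotvE.
have -> : dotv a ((s2^-1 *: Phi - B) *m a) = - (s2^-1 * Ex (fun t => (\sum_i a i 0 * D i t) ^+ 2)).
  transitivity (- (s2^-1 * \sum_i \sum_j (a i 0 * a j 0) * Ex (fun t => D i t * D j t))).
    rewrite /dotv mulr_sumr -sumrN; apply: eq_bigr => i _.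
    rewrite mxE mulr_sumr mulr_sumr -sumrN; apply: eq_bigr => j _.
    by rewrite E; ring.
  congr (- (_ * _)).
  transitivity (Ex (fun t => \sum_i \sum_j (a i 0 * a j 0) * (D i t * D j t))).
    rewrite Ex_sum; last by move=> i _; apply: intg_sum => j _; apply: intgZ; exact: sqintgM.
    apply: eq_bigr => i _; rewrite Ex_sum; last by move=> j _; apply: intgZ; exact: sqintgM.
    by apply: eq_bigr => j _; rewrite ExZ//; exact: sqintgM.
  apply: eq_Ex => t; rewrite expr2 mulr_suml; apply: eq_bigr => i _.
  by rewrite mulr_sumr; apply: eq_bigr => j _; ring.
rewrite oppr_le0 mulr_ge0 ?invr_ge0 ?(ltW s2_0)//.
by apply: Ex_ge0 => t; exact: sqr_ge0.
Qed.

End one.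

(** The matrix is a member of the set, at g = m, as well as a lower bound of it; any other lower
    bound therefore lies below it. *)
Theorem efficiency_bound_inf :
  is_loewner_inf (efficiency_bound_set Pr x z w v) (s2^-1 *: Phi).
Proof.
split => [A [g Gg ->]|L HL]; first exact: bound_le.
apply: HL; exists m; first exact: mP.1.
apply/matrixP => i j; rewrite (bound_entry mP.1) mxE; congr (_ * _).
rewrite (eq_Ex Pr (Y := fun=> 0)); first by rewrite Ex_cst addr0.
by move=> t; rewrite !subrr mul0r.
Qed.

End efficiency_bound.

Theorem mainTheorem2
  (disp : measure_display) (T : measurableType disp) (R : realType)
  (Pr : probability T R)
  (q d r : nat)
  (Y u : nat -> T -> R) (w : nat -> T -> 'cV[R]_q)
  (x : nat -> T -> 'cV[R]_d) (z : nat -> T -> 'cV[R]_r)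
  (gamma : 'cV[R]_q) (beta : 'I_d -> 'cV[R]_r -> R)
  (p : 'I_d -> nat -> 'cV[R]_r -> R) (k : nat -> 'I_d -> nat)
  (ginv : forall m : nat, 'M[R]_m -> 'M[R]_m)
  (B : forall n : nat, 'M[R]_(series_dim (k n)))
  (zeta0 : nat -> R) (delta : 'I_d -> R)
  (theta m : 'cV[R]_d -> 'cV[R]_r -> 'cV[R]_q)
  (varY varu : 'cV[R]_(q + (d + r)) -> R) (sigma : R) :
  let xz (i : nat) (t : T) : 'cV[R]_(d + r) := col_mx (x i t) (z i t) in
  let wxz (i : nat) (t : T) : 'cV[R]_(q + (d + r)) :=
    col_mx (w i t) (xz i t) in
  let Ywxz (i : nat) (t : T) : 'cV[R]_(1 + (q + (d + r))) :=
    col_mx ((Y i t)%:M : 'cV[R]_1) (wxz i t) in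
  let S : set 'cV[R]_(d + r) := support Pr (xz 0%N) in
  let PK (n : nat) (xx : 'cV[R]_d) (zz : 'cV[R]_r) :
      'cV[R]_(series_dim (k n)) := B n *m series_basis p (k n) xx zz in
  let eps (t : T) : 'cV[R]_q := w 0%N t - m (x 0%N t) (z 0%N t) in
  let Phi : 'M[R]_q := expectation_mx Pr (fun t => eps t *m (eps t)^T) in
  let ghat : nat -> T -> 'cV[R]_q := gamma_hat ginv Y w x z p k in
  (forall i t, Y i t = ((w i t)^T *m gamma) 0 0
     + \sum_(l < d) x i t l 0 * beta l (z i t) + u i t) ->
  (forall i, is_cond_exp Pr (u i) (wxz i) (fun=> 0)) ->
  (forall l j, borel_fun (p l j)) ->
  is_sym_ginv ginv ->
  (* not automatic: [ginv] is an arbitrary choice on singular matrices *)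
  (forall n, random_vector (ghat n)) ->
  (forall i, random_vector (Ywxz i)) ->
  mutually_independent Pr Ywxz ->
  identically_distributed Pr Ywxz ->
  compact (support Pr (wxz 0%N)) ->
  (forall j, is_cond_exp Pr (fun t => w 0%N t j 0) (xz 0%N)
     (fun v => theta (usubmx v) (dsubmx v) j 0)) ->
  (exists C : R, forall ww xx zz,
     support Pr (wxz 0%N) (col_mx ww (col_mx xx zz)) ->
     fnorm (theta xx zz) <= C) ->
  is_cond_var Pr (Y 0%N) (wxz 0%N) varY ->
  (exists C : R, forall v, support Pr (wxz 0%N) v -> `|varY v| <= C) ->
  (forall n, B n \in unitmx) ->
  (exists2 c : R, 0 < c & forall n (a : R),
     eigenvalue (expectation_mx Pr (fun t =>
       PK n (x 0%N t) (z 0%N t) *m (PK n (x 0%N t) (z 0%N t))^T)) a ->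
     c <= a) ->
  (forall n xx zz, S (col_mx xx zz) ->
     fnorm (PK n xx zz) <= zeta0 (series_dim (k n))) ->
  (fun n => (zeta0 (series_dim (k n))) ^+ 2 * (series_dim (k n))%:R / n%:R : R)
    @ \oo --> (0 : R) ->
  (forall l, 0 < delta l) ->
  is_G_projection Pr (x 0%N) (z 0%N) theta m ->
  series_approximable S PK delta
    (fun xx zz => \sum_(l < d) xx l 0 * beta l zz) ->
  (forall j, series_approximable S PK delta (fun xx zz => m xx zz j 0)) ->
  (forall N : nat, \forall n \near \oo, forall l, (N <= k n l)%N) ->
  (fun n => Num.sqrt n%:R * \sum_(l < d) (k n l)%:R `^ (- (2 * delta l)) : R)
    @ \oo --> (0 : R) ->
  posdef Phi ->
  0 < sigma ^+ 2 ->
  (forall i, ('E_Pr[fun t => (u i t ^+ 2)%R] = (sigma ^+ 2)%:E)%E) ->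
  (forall i, is_cond_exp Pr (fun t => u i t ^+ 2) (wxz i)
     (fun=> sigma ^+ 2)) ->
  is_cond_var Pr (u 0%N) (wxz 0%N) varu ->
  exists Sigma : 'M[R]_q,
    [/\ asymptotically_normal Pr
          (fun n t => Num.sqrt n%:R *: (ghat n t - gamma)) Sigma,
        Sigma = sigma ^+ 2 *: invmx Phi &
        is_loewner_inf
          (efficiency_bound_set Pr (x 0%N) (z 0%N) (w 0%N) varu)
          (invmx Sigma)].
Proof.
move=> xz wxz Ywxz S PK eps Phi ghat YE cu mp ginvP mghat mV indV idV cS ctheta theta_bounded.
move=> _ _ uB [c c0 eigB] zetaB zetaK _ mP appf appm _ rate0 pPhi s0 _ cu2 varuP.
(* The approximations of the m_j and of x'beta are gathered into one family over [option 'I_q], from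
   which coefficients and constants are then chosen. *)
have happ o : exists ac : (forall n, 'cV[R]_(series_dim (k n))) * R,
    \forall n \near \oo, forall xx zz, S (col_mx xx zz) ->
    `|target beta m o (col_mx xx zz) - ((PK n xx zz)^T *m ac.1 n) 0 0|
      <= ac.2 * \sum_(l < d) (k n l)%:R `^ (- delta l).
  case: o => [j|].
    have [al [C H]] := appm j; exists (al, C); apply: filterS H => n H xx zz Sxz.
    by rewrite /target col_mxKu col_mxKd; exact: H.
  have [al [C H]] := appf; exists (al, C); apply: filterS H => n H xx zz Sxz.
  by rewrite /target col_mxKu col_mxKd; exact: H.
have [ac acP] := choice happ.
have mwxz : random_vector (wxz 0%N) := wxz_random mV 0%N.
have uPhi : Phi \in unitmx.
  by have [L uL ->] := cholesky pPhi; rewrite unitmx_mul unitmx_tr uL.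
exists (sigma ^+ 2 *: invmx Phi); split => //.
  exact: (series_estimator_normal YE cu mV indV idV cS ctheta theta_bounded mP cu2 mp ginvP uB c0
    eigB zetaB zetaK rate0 acP mghat pPhi s0).
have us : sigma ^+ 2 *: invmx Phi \in unitmx.
  by rewrite unitmxZ ?unitmx_inv// unitfE gt_eqF.
rewrite invmxZ// invmxK.
have varu_ae := cond_var_ae mwxz (cu 0%N) (cu2 0%N) varuP.
have [g _ [mvaru _ _ _]] := varuP.
exact: (efficiency_bound_inf mwxz cS ctheta theta_bounded mP mvaru s0 varu_ae).
Qed.
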